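(* Let $T>0$, $Q_T=\mathbb{T}^3\times[0,T]$, $r\in L^\infty(Q_T)$, and suppose that $\nabla^2_{(\xi,\eta)}\hat e\ge c\,\mathbb{I}$ for some $c>0$, that $\hat\theta=\partial\hat e/\partial\eta\ge\delta>0$ for some $\delta$, and that for exponents $p\ge4$, $q\ge2$, $\rho>1$, $\ell>1$ and constants $c_1,c_2>0$, with $\xi=(F,\zeta,w)$ and $|\xi|_{p,q,\rho}:=|F|^p+|\zeta|^q+|w|^\rho$, $$c_1\big(|\xi|_{p,q,\rho}+|\eta|^\ell\big)-c_2\le\hat e(\xi,\eta)\le c_2\big(|\xi|_{p,q,\rho}+|\eta|^\ell\big)+c_2,$$ $$\lim_{|\xi|_{p,q,\rho}+|\eta|^\ell\to\infty}\frac{\hat\theta(\xi,\eta)}{|\xi|_{p,q,\rho}+|\eta|^\ell}=0,$$ $$|\partial_F\hat e|^{\frac{p}{p-1}}+|\partial_\zeta\hat e|^{\frac{p}{p-2}}+|\partial_w\hat e|^{\frac{p}{p-3}}\le c_2\big(|\xi|_{p,q,\rho}+|\eta|^\ell\big)+c_2 .$$ Let $\bar U=(\bar F,\bar v,\bar\eta)\in W^{1,\infty}(Q_T)$ be a Lipschitz solution, with initial data $\bar U^0$ and $\partial_\alpha\bar F_{i\beta}=\partial_\beta\bar F_{i\alpha}$, of $$\partial_t\Phi^B(\bar F)=\partial_\alpha\Big(\frac{\partial\Phi^B}{\partial F_{i\alpha}}(\bar F)\bar v_i\Big),\qquad \partial_t\bar\eta=\frac{r}{\hat\theta(\Phi(\bar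 F),\bar\eta)},\qquad \partial_t\bar v_i=\partial_\alpha\Big(\frac{\partial\hat e}{\partial\xi^B}(\Phi(\bar F),\bar\eta)\frac{\partial\Phi^B}{\partial F_{i\alpha}}(\bar F)\Big),$$ $$\partial_t\Big(\tfrac12|\bar v|^2+\hat e(\Phi(\bar F),\bar\eta)\Big)=\partial_\alpha\Big(\frac{\partial\hat e}{\partial\xi^B}(\Phi(\bar F),\bar\eta)\frac{\partial\Phi^B}{\partial F_{i\alpha}}(\bar F)\bar v_i\Big)+r,$$ taking values in $\Gamma_M=\{(\bar F,\bar v,\bar\eta):|\bar F|\le M,\ |\bar v|\le M,\ |\bar\eta|\le M\}$ for some $M>0$. Let $(\boldsymbol\nu,\boldsymbol\gamma,U)$, $U=(F,v,\eta)$, be a dissipative measure-valued solution (as defined in the context) with the same $r$ and with initial data $\boldsymbol\nu_{(x,0)}=\delta_{U_0(x)}$ for some $U_0$, with no initial concentration, $\boldsymbol\gamma_0=0$. If $U_0(x)=\bar U^0(x)$, then $\boldsymbol\nu=\delta_{\bar U}$ and $U=\bar U$ a.e. on $Q_T$.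
   Context: Repeated indices are summed. $\Phi(F)=(F,\operatorname{cof}F,\det F)\in\mathbb{R}^{19}$ for $F\in\mathbb{M}^{3\times3}$, with components $\Phi^B$, $B=1,\dots,19$; $\xi=(F,\zeta,w)\in\mathbb{M}^{3\times3}\times\mathbb{M}^{3\times3}\times\mathbb{R}\simeq\mathbb{R}^{19}$; $\hat e\in C^3(\mathbb{R}^{19}\times[0,\infty))$, and entropies take values in $[0,\infty)$. The internal energy is $e(F,\eta)=\hat e(\Phi(F),\eta)$, the stress is $\Sigma_{i\alpha}=\frac{\partial\hat e}{\partial\xi^B}(\Phi(F),\eta)\frac{\partial\Phi^B}{\partial F_{i\alpha}}(F)$ and the temperature is $\theta(F,\eta)=\hat\theta(\Phi(F),\eta)$ with $\hat\theta=\partial\hat e/\partial\eta$. A dissipative measure-valued solution $(\boldsymbol\nu,\boldsymbol\gamma,U)$ consists of a Young measure $\boldsymbol\nu=(\boldsymbol\nu_{(x,t)})_{(x,t)\in Q_T}$ of probability measures in the variables $\lambda_U=(\lambda_F,\lambda_v,\lambda_\eta)$, a nonnegative Radon measure $\boldsymbol\gamma\in\mathcal{M}^+(Q_T)$, and the averages $U=(F,v,\eta)$, $F=\langle\boldsymbol\nu,\lambda_F\rangle$, $v=\langle\boldsymbol\nu,\lambda_v\rangle$, $\eta=\langle\boldsymbol\nu,\lambda_\eta\rangle$, such that there is $y\in W^{1,\infty}(L^2(\mathbb{T}^3))\cap L^\infty(W^{1,p}(\mathbb{T}^3))$ with $F=\nabla y\in L^\infty(L^p)$, $v=\partial_ty\in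 L^\infty(L^2)$, $\eta\in L^\infty(L^\ell)$, $\Phi(F)=\langle\boldsymbol\nu,\Phi(\lambda_F)\rangle\in L^\infty(L^p)\times L^\infty(L^q)\times L^\infty(L^\rho)$; all averages below are integrable; the equations $$\partial_t\Phi^B(F)=\partial_\alpha\Big(\frac{\partial\Phi^B}{\partial F_{i\alpha}}(F)v_i\Big),\quad \partial_t\langle\boldsymbol\nu,\lambda_\eta\rangle=\Big\langle\boldsymbol\nu,\frac{r}{\hat\theta(\Phi(\lambda_F),\lambda_\eta)}\Big\rangle,\quad \partial_t\langle\boldsymbol\nu,\lambda_{v_i}\rangle=\partial_\alpha\Big\langle\boldsymbol\nu,\frac{\partial\hat e}{\partial\xi^B}(\Phi(\lambda_F),\lambda_\eta)\frac{\partial\Phi^B}{\partial F_{i\alpha}}(\lambda_F)\Big\rangle$$ hold in the sense of distributions, with the initial data attained weakly (i.e. tested against functions in $C_c^\infty(\mathbb{T}^3\times[0,T))$ with the corresponding initial terms given by $\boldsymbol\nu_{(x,0)}$); and for all $0\le\varphi\in C_c^\infty([0,T))$ $$-\int\varphi(0)\Big(\Big\langle\boldsymbol\nu,\tfrac12|\lambda_v|^2+\hat e(\Phi(\lambda_F),\lambda_\eta)\Big\rangle(x,0)\,dx+\boldsymbol\gamma_0(dx)\Big)-\int_0^T\!\!\int\varphi'(t)\Big(\Big\langle\boldsymbol\nu,\tfrac12|\lambda_v|^2+\hat e(\Phi(\lambda_F),\lambda_\eta)\Big\rangle\,dx\,dt+\boldsymbol\gamma(dx\,dt)\Big)\le\int_0^T\!\!\int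 r\,\varphi(t)\,dx\,dt,$$ where $\boldsymbol\gamma_0$ is the initial concentration measure. *)

(* Defs.v *)
From HB Require Import structures.
From mathcomp Require Import all_boot all_order all_algebra.
From mathcomp Require Import all_classical all_reals all_analysis.
Set Implicit Arguments.
Unset Strict Implicit.
Unset Printing Implicit Defensive.
Import Order.TTheory GRing.Theory Num.Theory.
Import numFieldNormedType.Exports.
Local Open Scope classical_set_scope.
Local Open Scope ring_scope.

(** The torus is T^3 = R^3/Z^3.  Functions that are differentiated (test
    functions) or required to be continuous are 1-periodic functions on R^3,
    which are the functions on T^3.  Integrals, measures and a.e. statements
    over T^3 are taken over the cell [0,1)^3, which is a Borel transversal of
    R^3/Z^3 carrying the Haar measure of T^3 to Lebesgue measure. *)

Notation xspace R := (R * R * R)%type.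
Notation stime R := (xspace R * R)%type.

Definition leb3 {R : realType} :=
  ((@lebesgue_measure R \x @lebesgue_measure R) \x @lebesgue_measure R)%E.
Definition leb4 {R : realType} := (@leb3 R \x @lebesgue_measure R)%E.

Definition cell {R : realType} : set (xspace R) :=
  [set x | [/\ 0 <= x.1.1 < 1, 0 <= x.1.2 < 1 & 0 <= x.2 < 1]].

Definition QT {R : realType} (T : R) : set (stime R) :=
  [set z | cell z.1 /\ 0 <= z.2 <= T].

Definition sbasis {R : realType} (a : 'I_3) : xspace R :=
  ((val a == 0%N)%:R, (val a == 1%N)%:R, (val a == 2%N)%:R).

Definition dt {R : realType} : stime R := (0, 1).
Definition dx {R : realType} (a : 'I_3) : stime R := (sbasis a, 0).

Definition periodic {R : realType} (V : Type) (f : stime R -> V) : Prop :=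
  forall z a, f (z + dx a) = f z.

(** C^infinity: all iterated directional derivatives exist and are
    continuous. *)
Definition smooth {R : realType} {V : normedModType R} (f : V -> R) : Prop :=
  forall s : seq V, let g := foldr (fun v h => 'D_v h) f s in
    continuous g /\ forall x v, derivable g x v.

(** C_c^infinity(T^3 x [0,T)), whose elements are the restrictions to t >= 0
    of the following functions. *)
Definition test_init {R : realType} (T : R) (psi : stime R -> R) : Prop :=
  [/\ smooth psi, periodic psi &
      exists2 T', T' < T & forall x t, T' <= t -> psi (x, t) = 0].

(** C_c^infinity(T^3 x (0,T)) *)
Definition test_int {R : realType} (T : R) (psi : stime R -> R) : Prop :=
  test_init T psi /\
  exists2 t0, 0 < t0 & forall x t, t <= t0 -> psi (x, t) = 0.

(** C_c^infinity([0,T)) *)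
Definition test_time {R : realType} (T : R) (phi : R -> R) : Prop :=
  smooth phi /\ exists2 T', T' < T & forall t, T' <= t -> phi t = 0.

(** g is the distributional derivative of f on T^3 x (0,T) along d. *)
Definition weak_deriv {R : realType} (T : R) (d : stime R)
    (f g : stime R -> R) : Prop :=
  forall psi, test_int T psi ->
    \int[leb4]_(z in QT T) (f z * 'D_d psi z) =
    - \int[leb4]_(z in QT T) (g z * psi z).

(** d_t f = d_a (g a) + s in the sense of distributions on T^3 x (0,T). *)
Definition balance_law {R : realType} (T : R)
    (f : stime R -> R) (g : 'I_3 -> stime R -> R) (s : stime R -> R) : Prop :=
  forall psi, test_int T psi ->
    \int[leb4]_(z in QT T)
      (f z * 'D_dt psi z - \sum_a g a z * 'D_(dx a) psi z + s z * psi z) = 0.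

Definition balance_law_init {R : realType} (T : R) (f0 : xspace R -> R)
    (f : stime R -> R) (g : 'I_3 -> stime R -> R) (s : stime R -> R) : Prop :=
  forall psi, test_init T psi ->
    \int[leb3]_(x in cell) (f0 x * psi (x, 0)) +
    \int[leb4]_(z in QT T)
      (f z * 'D_dt psi z - \sum_a g a z * 'D_(dx a) psi z + s z * psi z) = 0.

Definition Linf {R : realType} (T : R) (f : stime R -> R) : Prop :=
  measurable_fun (QT T) f /\
  exists C : R, {ae leb4, forall z, QT T z -> `|f z| <= C}.

(** L^infinity(0,T; L^p(T^3)) *)
Definition LinfLp {R : realType} (T p : R) (f : stime R -> R) : Prop :=
  measurable_fun (QT T) f /\
  exists C : R, {ae @lebesgue_measure R, forall t, 0 <= t <= T ->
    (\int[leb3]_(x in cell) (`|f (x, t)| `^ p)%:E <= C%:E)%E}.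

Definition W1inf {R : realType} (T : R) (f : stime R -> R) : Prop :=
  [/\ Linf T f,
      exists2 g, Linf T g & weak_deriv T dt f g &
      forall a, exists2 g, Linf T g & weak_deriv T (dx a) f g].

(** Derivatives and C^k regularity on a set D that need not be open: the
    difference quotient at x only uses increments that stay in D.  It is used
    with D a closed half-space, where this is the ordinary derivative, one-sided
    at boundary points in directions transversal to the boundary. *)
Definition dquot {R : realType} {V : normedModType R} (f : V -> R) (v x : V)
  (h : R) : R := h^-1 * (f (x + h *: v) - f x).

Definition derivable_in {R : realType} {V : normedModType R} (D : set V)
    (f : V -> R) (v x : V) : Prop :=
  cvg (dquot f v x @ within [set h | D (x + h *: v)] 0^').

Definition derive_in {R : realType} {V : normedModType R} (D : set V)
    (v : V) (f : V -> R) (x : V) : R :=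
  lim (dquot f v x @ within [set h | D (x + h *: v)] 0^').

Definition Ck_in {R : realType} {V : normedModType R} (D : set V) (k : nat)
    (f : V -> R) : Prop :=
  forall s : seq V, (size s <= k)%N -> let g := foldr (derive_in D) f s in
    {within D, continuous g} /\
    ((size s < k)%N -> forall v x, D x -> derivable_in D g v x).

(** xi = (F, zeta, w) in R^19, with its components indexed by xidx, and
    (xi, eta) in R^20, with its components indexed by option xidx. *)
Notation xi_space R := ('M[R]_3 * 'M[R]_3 * R)%type.
Notation xidx := (('I_3 * 'I_3) + ('I_3 * 'I_3) + unit)%type.

Definition xi_coord {R : realType} (B : xidx) (xi : xi_space R) : R :=
  match B with
  | inl (inl (i, a)) => xi.1.1 i a
  | inl (inr (i, a)) => xi.1.2 i a
  | inr tt => xi.2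
  end.

Definition xi_basis {R : realType} (B : xidx) : xi_space R :=
  match B with
  | inl (inl (i, a)) => (delta_mx i a, 0, 0)
  | inl (inr (i, a)) => (0, delta_mx i a, 0)
  | inr tt => (0, 0, 1)
  end.

Definition xe_basis {R : realType} (I : option xidx) : xi_space R * R :=
  if I is Some B then (xi_basis B, 0) else (0, 1).

Definition cof {R : realType} (F : 'M[R]_3) : 'M[R]_3 :=
  \matrix_(i, a) cofactor F i a.

Definition Phi {R : realType} (F : 'M[R]_3) : xi_space R := (F, cof F, \det F).

Definition PhiB {R : realType} (B : xidx) (F : 'M[R]_3) : R :=
  xi_coord B (Phi F).

(** d Phi^B / d F_{ia} *)
Definition dPhiB {R : realType} (B : xidx) (i a : 'I_3) (F : 'M[R]_3) : R :=
  'D_(delta_mx i a) (PhiB B) F.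

(** R^19 x [0,oo).  The energy \hat e is a function on R^19 x R of which only
    the values on this set are ever used. *)
Definition edom {R : realType} : set (xi_space R * R) := [set z | 0 <= z.2].

Definition de {R : realType} (e : xi_space R * R -> R) (I : option xidx) :
  xi_space R * R -> R := derive_in edom (xe_basis I) e.

Definition dxi {R : realType} (e : xi_space R * R -> R) (B : xidx) := de e (Some B).

Definition theta {R : realType} (e : xi_space R * R -> R) := de e None.

Definition hess {R : realType} (e : xi_space R * R -> R) (I J : option xidx) :
  xi_space R * R -> R := derive_in edom (xe_basis I) (de e J).

(** Sigma_{ia} *)
Definition stress {R : realType} (e : xi_space R * R -> R) (i a : 'I_3)
    (F : 'M[R]_3) (eta : R) : R :=
  \sum_(B : xidx) dxi e B (Phi F, eta) * dPhiB B i a F.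

Definition enorm {R : realType} {m n : nat} (A : 'M[R]_(m, n)) : R :=
  Num.sqrt (\sum_i \sum_j A i j ^+ 2).

(** |xi|_{p,q,rho} + |eta|^l *)
Definition growth {R : realType} (p q rho l : R) (z : xi_space R * R) : R :=
  enorm z.1.1.1 `^ p + enorm z.1.1.2 `^ q + `|z.1.2| `^ rho + `|z.2| `^ l.

Definition dF_e {R : realType} (e : xi_space R * R -> R) z : 'M[R]_3 :=
  \matrix_(i, a) dxi e (inl (inl (i, a))) z.
Definition dzeta_e {R : realType} (e : xi_space R * R -> R) z : 'M[R]_3 :=
  \matrix_(i, a) dxi e (inl (inr (i, a))) z.
Definition dw_e {R : realType} (e : xi_space R * R -> R) z : R :=
  dxi e (inr tt) z.

(** States (F, v, eta); borel_state is the same type with its Borel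
    sigma-algebra. *)
Notation state R := ('M[R]_3 * 'rV[R]_3 * R)%type.
Definition borel_state (R : realType) := g_sigma_algebraType (@open (state R)).

Definition sF {R : realType} (u : state R) : 'M[R]_3 := u.1.1.
Definition sv {R : realType} (u : state R) : 'rV[R]_3 := u.1.2.
Definition seta {R : realType} (u : state R) : R := u.2.

(** Entropies are nonnegative. *)
Definition sdom {R : realType} : set (state R) := [set u | 0 <= seta u].

Definition sPhi {R : realType} (u : state R) : xi_space R * R :=
  (Phi (sF u), seta u).

Definition energy {R : realType} (e : xi_space R * R -> R) (u : state R) : R :=
  2^-1 * enorm (sv u) ^+ 2 + e (sPhi u).

(** < m, f >, for m a probability measure concentrated on sdom *)
Definition avg {R : realType} (m : {measure set (borel_state R) -> \bar R})
    (f : state R -> R) : R :=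
  \int[m]_(u in (sdom : set (borel_state R))) f u.

(** The averages < nu_z, f z > exist and are integrable over Q_T. *)
Definition avg_integrable {R : realType} (T : R)
    (nu : R.-pker (stime R) ~> (borel_state R))
    (f : stime R -> state R -> R) : Prop :=
  {ae leb4, forall z, QT T z ->
     (nu z).-integrable (sdom : set (borel_state R)) (EFin \o f z)} /\
  leb4.-integrable (QT T) (EFin \o (fun z => avg (nu z) (f z))).

Definition avg_integrable0 {R : realType}
    (nu : R.-pker (stime R) ~> (borel_state R)) (f : state R -> R) : Prop :=
  {ae leb3, forall x, cell x ->
     (nu (x, 0)).-integrable (sdom : set (borel_state R)) (EFin \o f)} /\
  leb3.-integrable cell (EFin \o (fun x => avg (nu (x, 0)) f)).

Definition is_dirac {R : realType} (m : {measure set (borel_state R) -> \bar R})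
    (u : state R) : Prop :=
  forall A : set (borel_state R), measurable A -> m A = \d_(u : borel_state R) A.

Definition xexp {R : realType} (p q rho : R) (B : xidx) : R :=
  match B with inl (inl _) => p | inl (inr _) => q | inr _ => rho end.

(** Dissipative measure-valued solutions.  A Young measure is a measurable
    family of probability measures, i.e. a probability kernel; only its values
    on Q_T matter.  Likewise, since Q_T is compact, a nonnegative Radon measure
    on Q_T is a finite Borel measure, of which only the restriction to Q_T
    matters. *)
Record dmv_solution {R : realType} (e : xi_space R * R -> R) (p q rho l : R)
    (T : R) (r : stime R -> R)
    (nu : R.-pker (stime R) ~> (borel_state R))
    (gamma : {finite_measure set (stime R) -> \bar R})
    (gamma0 : {finite_measure set (xspace R) -> \bar R})
    (U : stime R -> state R) : Prop := DMVSolution {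
  dmv_sdom : {ae leb4, forall z, QT T z ->
    nu z (sdom : set (borel_state R)) = 1%E};
  dmv_sdom0 : {ae leb3, forall x, cell x ->
    nu (x, 0) (sdom : set (borel_state R)) = 1%E};
  dmv_int_Phi : forall B, avg_integrable T nu (fun _ u => PhiB B (sF u));
  dmv_int_v : forall i, avg_integrable T nu (fun _ u => sv u ord0 i);
  dmv_int_eta : avg_integrable T nu (fun _ u => seta u);
  dmv_int_source : avg_integrable T nu (fun z u => r z / theta e (sPhi u));
  dmv_int_stress : forall i a,
    avg_integrable T nu (fun _ u => stress e i a (sF u) (seta u));
  dmv_int_energy : avg_integrable T nu (fun _ u => energy e u);
  dmv_int0_Phi : forall B, avg_integrable0 nu (fun u => PhiB B (sF u));
  dmv_int0_v : forall i, avg_integrable0 nu (fun u => sv u ord0 i);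
  dmv_int0_eta : avg_integrable0 nu (fun u => seta u);
  dmv_int0_energy : avg_integrable0 nu (energy e);
  dmv_avg_F : {ae leb4, forall z, QT T z -> forall i a,
    sF (U z) i a = avg (nu z) (fun u => sF u i a)};
  dmv_avg_v : {ae leb4, forall z, QT T z -> forall i,
    sv (U z) ord0 i = avg (nu z) (fun u => sv u ord0 i)};
  dmv_avg_eta : {ae leb4, forall z, QT T z ->
    seta (U z) = avg (nu z) seta};
  dmv_avg_Phi : {ae leb4, forall z, QT T z -> forall B,
    PhiB B (sF (U z)) = avg (nu z) (fun u => PhiB B (sF u))};
  dmv_v_L2 : forall i, LinfLp T 2 (fun z => sv (U z) ord0 i);
  dmv_eta_Ll : LinfLp T l (fun z => seta (U z));
  dmv_Phi_Lpqr : forall B,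
    LinfLp T (xexp p q rho B) (fun z => PhiB B (sF (U z)));
  dmv_motion : exists y : stime R -> 'rV[R]_3, forall i,
    [/\ LinfLp T 2 (fun z => y z ord0 i),
        LinfLp T p (fun z => y z ord0 i),
        weak_deriv T dt (fun z => y z ord0 i) (fun z => sv (U z) ord0 i) &
        forall a, weak_deriv T (dx a) (fun z => y z ord0 i)
                                      (fun z => sF (U z) i a)];
  dmv_Phi_eq : forall B, balance_law_init T
    (fun x => avg (nu (x, 0)) (fun u => PhiB B (sF u)))
    (fun z => PhiB B (sF (U z)))
    (fun a z => \sum_i dPhiB B i a (sF (U z)) * sv (U z) ord0 i)
    (fun=> 0);
  dmv_entropy_eq : balance_law_init T
    (fun x => avg (nu (x, 0)) seta)
    (fun z => avg (nu z) seta)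
    (fun _ _ => 0)
    (fun z => avg (nu z) (fun u => r z / theta e (sPhi u)));
  dmv_momentum_eq : forall i, balance_law_init T
    (fun x => avg (nu (x, 0)) (fun u => sv u ord0 i))
    (fun z => avg (nu z) (fun u => sv u ord0 i))
    (fun a z => avg (nu z) (fun u => stress e i a (sF u) (seta u)))
    (fun=> 0);
  dmv_energy_ineq : forall phi : R -> R, test_time T phi ->
    (forall t, 0 <= t -> 0 <= phi t) ->
    - (\int[leb3]_(x in cell) (phi 0 * avg (nu (x, 0)) (energy e)) +
       \int[gamma0]_(x in cell) phi 0)
    - (\int[leb4]_(z in QT T) (derive1 phi z.2 * avg (nu z) (energy e)) +
       \int[gamma]_(z in QT T) derive1 phi z.2)
    <= \int[leb4]_(z in QT T) (r z * phi z.2)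
}.

(** Lipschitz solutions with initial data U0.  The equations hold in the sense
    of distributions on T^3 x (0,T); the initial value is a pointwise trace
    because U is continuous on T^3 x [0,T]. *)
Record lipschitz_solution {R : realType} (e : xi_space R * R -> R)
    (T : R) (r : stime R -> R) (U : stime R -> state R) (U0 : xspace R -> state R) :
    Prop := LipschitzSolution {
  lip_periodic : periodic U;
  lip_sdom : forall z, 0 <= z.2 <= T -> sdom (U z);
  lip_lipschitz : [lipschitz U z | z in [set z : stime R | 0 <= z.2 <= T]];
  lip_W_F : forall i a, W1inf T (fun z => sF (U z) i a);
  lip_W_v : forall i, W1inf T (fun z => sv (U z) ord0 i);
  lip_W_eta : W1inf T (fun z => seta (U z));
  lip_init : forall x, U (x, 0) = U0 x;
  lip_curl : forall i a b psi, test_int T psi ->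
    \int[leb4]_(z in QT T) (sF (U z) i b * 'D_(dx a) psi z) =
    \int[leb4]_(z in QT T) (sF (U z) i a * 'D_(dx b) psi z);
  lip_Phi_eq : forall B, balance_law T
    (fun z => PhiB B (sF (U z)))
    (fun a z => \sum_i dPhiB B i a (sF (U z)) * sv (U z) ord0 i)
    (fun=> 0);
  lip_entropy_eq : balance_law T
    (fun z => seta (U z)) (fun _ _ => 0)
    (fun z => r z / theta e (sPhi (U z)));
  lip_momentum_eq : forall i, balance_law T
    (fun z => sv (U z) ord0 i)
    (fun a z => stress e i a (sF (U z)) (seta (U z)))
    (fun=> 0);
  lip_energy_eq : balance_law T
    (fun z => energy e (U z))
    (fun a z => \sum_i stress e i a (sF (U z)) (seta (U z)) * sv (U z) ord0 i)
    r
}.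

(* Main.v *)
(** Relative entropy.  Write D_I for the derivatives of \hat e at
    (Phi(Fbar), etabar) and let H(x,t) be the average over nu_(x,t) of
      1/2 |lambda_v - vbar|^2 + \hat e(lambda) - \hat e(ubar) - sum_I D_I (lambda_I - ubar_I),
    where lambda stands for (Phi(lambda_F), lambda_eta).  Uniform convexity makes H dominate the
    averaged squared distance to Ubar.  Testing the energy inequality with phi(t), where
    phi >= 0 >= phi', and the evolution equations with phi(t) times vbar and D_I gives
      - int phi' H <= int phi Q,
    where gamma has been dropped since phi' <= 0, and all initial terms cancel.  The flux terms that
    are linear in nu vanish because D_B vbar_i can be tested against the null Lagrangian
    identity div dPhi^B/dF_i(F) = 0.  What is left in Q is quadratic: products of differences,
    controlled by Jensen's inequality, and the Taylor remainders of r / theta and of the stress,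
    controlled by convexity near Ubar and by the growth conditions far from it.  Hence Q <= K H, and
    phi(t) = exp(- k t) times a cutoff with k > K forces H = 0.

    The tests involve Lipschitz functions, whereas the weak formulations are stated for smooth ones:
    test functions are finite sums of products of smooth functions of one variable, which are dense
    in L^1 and approximate Lipschitz functions uniformly with bounded derivatives. *)

Require Import Defs.
From HB Require Import structures.
From mathcomp Require Import all_boot all_order all_algebra.
From mathcomp Require Import finmap.
From mathcomp Require Import all_classical all_reals all_analysis.
From mathcomp Require Import measurable_realfun ring lra.
Set Implicit Arguments.
Unset Strict Implicit.
Unset Printing Implicit Defensive.
Import Order.TTheory GRing.Theory Num.Theory.
Import numFieldNormedType.Exports.
Local Open Scope classical_set_scope.
Local Open Scope ring_scope.

(** * Smooth functions of one variable *)

Section OneVariable.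
Context {R : realType}.
Implicit Types (f g h : R -> R) (s t : R).

(** Neither solution is smooth enough for classical manipulations. Three devices replace them. Tests
    of product form reduce calculus to one variable: a derivative acts on one factor, mixed
    derivatives commute, a primitive in time is explicit, and Fubini integrates by parts along
    lines. Weak derivatives of Lipschitz functions are carried along as bounded functions. The chain
    rule, for $C^{1,1}$ functions on a box, pairs uniform convergence of smooth approximants with
    weak convergence of their derivatives. The approximants are convex combinations of values and so
    never leave the box; this matters because $\hat e$ lives on $\eta\ge0$ and has only one-sided
    $\eta$-derivatives at $\eta=0$. Weak derivatives are free on null sets, so those of $\bar U$ are
    chosen to make its equations pointwise identities. The remainder $Q$ is then computed by algebra
    at a fixed point. Structurally, the derivatives of the minors are affine in the minors, so
    averages over $\nu$ pass through them, and the coefficients have an antisymmetry that yields the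
    null Lagrangian identity. *)

Definition has_deriv f f' := forall t, is_derive t (1 : R) f (f' t).

(* Coinductive form: g lies in a class of functions stable under differentiation. *)
Definition smooth1 g := exists A : (R -> R) -> Prop, A g /\
  forall f, A f -> exists2 f', A f' & has_deriv f f'.

Lemma smooth1_deriv g : smooth1 g -> exists2 g', smooth1 g' & has_deriv g g'.
Proof.
move=> [A [Ag Ad]]; have [g' Ag' gg'] := Ad _ Ag.
by exists g' => //; exists A.
Qed.

Lemma has_deriv_continuous f f' : has_deriv f f' -> continuous f.
Proof.
move=> ff' t; apply/differentiable_continuous/derivable1_diffP.
by have [] := ff' t.
Qed.

Lemma smooth1_continuous g : smooth1 g -> continuous g.
Proof. by move=> /smooth1_deriv[g' _ /has_deriv_continuous]. Qed.

Lemma has_deriv_cst (c : R) : has_deriv (fun=> c) (fun=> 0).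
Proof. by move=> t; exact: is_derive_cst. Qed.

Lemma has_derivD f g f' g' : has_deriv f f' -> has_deriv g g' ->
  has_deriv (fun t => f t + g t) (fun t => f' t + g' t).
Proof. by move=> ff' gg' t; exact: is_deriveD. Qed.

Lemma has_derivM f g f' g' : has_deriv f f' -> has_deriv g g' ->
  has_deriv (fun t => f t * g t) (fun t => f t * g' t + g t * f' t).
Proof. by move=> ff' gg' t; exact: is_deriveM. Qed.

Lemma has_derivN f f' : has_deriv f f' -> has_deriv (fun t => - f t) (fun t => - f' t).
Proof. by move=> ff' t; exact: is_deriveN. Qed.

Lemma has_deriv_affine (a b : R) f f' : has_deriv f f' ->
  has_deriv (fun t => f (a * t + b)) (fun t => f' (a * t + b) * a).
Proof.
move=> ff' t; apply: (@is_derive1_comp _ f (fun t => a * t + b)) => //.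
rewrite -[X in is_derive _ _ _ X]addr0; apply: (@is_deriveD _ _ _ (fun t => a * t) (cst b)).
by have := @is_deriveZ R _ _ id a t 1 1 (is_derive_id _ _); rewrite /GRing.scale/= mulr1.
Qed.

Lemma smooth1_cst (c : R) : smooth1 (fun=> c).
Proof.
exists (fun f => exists c, f = fun=> c); split; first by exists c.
by move=> _ [d ->]; exists (fun=> 0); [exists 0 | exact: has_deriv_cst].
Qed.

(** The Leibniz rule turns one product into a sum of two, so the witness class for a product of
    smooth functions must be closed under sums. *)
Inductive product_class (A B : (R -> R) -> Prop) : (R -> R) -> Prop :=
| ProductM f g : A f -> B g -> product_class A B (fun t => f t * g t)
| ProductD f g : product_class A B f -> product_class A B g ->
    product_class A B (fun t => f t + g t).

Lemma smooth1M f g : smooth1 f -> smooth1 g -> smooth1 (fun t => f t * g t).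
Proof.
move=> [A [Af Ad]] [B [Bg Bd]]; exists (product_class A B); split.
  exact: ProductM.
move=> h; elim=> {h f g Af Bg} [f g Af Bg|f g _ [f' ? ff'] _ [g' ? gg']].
  have [f' Af' ff'] := Ad _ Af; have [g' Bg' gg'] := Bd _ Bg.
  exists (fun t => f t * g' t + f' t * g t).
    by apply: ProductD; exact: ProductM.
  by move=> t; apply: is_derive_eq (has_derivM ff' gg' t) _; rewrite [f' t * _]mulrC.
exists (fun t => f' t + g' t); first exact: ProductD.
exact: has_derivD.
Qed.

Lemma smooth1D f g : smooth1 f -> smooth1 g -> smooth1 (fun t => f t + g t).
Proof.
move=> [A [Af Ad]] [B [Bg Bd]].
exists (fun h => exists f g, [/\ A f, B g & h = fun t => f t + g t]); split.
  by exists f, g.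
move=> _ [h [k [Ah Bk ->]]].
have [h' Ah' hh'] := Ad _ Ah; have [k' Bk' kk'] := Bd _ Bk.
by exists (fun t => h' t + k' t); [exists h', k' | exact: has_derivD].
Qed.

Lemma smooth1N f : smooth1 f -> smooth1 (fun t => - f t).
Proof.
move=> sf; under eq_fun do rewrite -mulN1r.
by apply: smooth1M => //; exact: smooth1_cst.
Qed.

(** The factor [c] in the witness class absorbs the powers of [a] that repeated differentiation
    produces. *)
Lemma smooth1_affine (a b : R) f : smooth1 f -> smooth1 (fun t => f (a * t + b)).
Proof.
move=> [A [Af Ad]].
exists (fun h => exists c f, A f /\ h = fun t => f (a * t + b) * c); split.
  by exists 1, f; split=> //; apply/funext => t; rewrite mulr1.
move=> _ [c [g [Ag ->]]]; have [g' Ag' gg'] := Ad _ Ag.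
exists (fun t => g' (a * t + b) * (a * c)); first by exists (a * c), g'.
move=> t; apply: is_derive_eq (has_derivM (has_deriv_affine a b gg') (has_deriv_cst c) t) _.
by ring.
Qed.

Lemma smooth1_near f f' : smooth1 f' -> has_deriv f f' -> smooth1 f.
Proof.
move=> [A [Af' Ad]] ff'; exists (fun g => A g \/ g = f); split; first by right.
move=> g [Ag|->]; last by exists f' => //; left.
by have [g' Ag' gg'] := Ad _ Ag; exists g' => //; left.
Qed.

(** On the line, ['D_v] is the derivative multiplied by the number [v], so iterated directional
    derivatives stay in the class. *)
Lemma smooth1_smooth f : smooth1 f -> smooth f.
Proof.
move=> sf s; suff : smooth1 (foldr (fun v h => 'D_v h) f s).
  move=> /smooth1_deriv[g' _ gg'] /=; split; first exact: has_deriv_continuous gg'.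
  move=> x v; have [] := gg' x.
  by move=> /derivable1_diffP/diff_derivable.
elim: s => //= v s /smooth1_deriv[g' sg' gg'].
have -> : 'D_v (foldr (fun v h => 'D_v h) f s) = fun t => v * g' t.
  apply/funext => t; have [d e] := gg' t.
  rewrite deriveE; last exact/derivable1_diffP.
  rewrite -[v in LHS]mulr1 -[v * 1]/(v *: (1 : R)) linearZ/= -deriveE; last exact/derivable1_diffP.
  by rewrite e.
by apply: smooth1M => //; exact: smooth1_cst.
Qed.

Lemma is_derive1_unique f t (a b : R) :
  is_derive t (1 : R) f a -> is_derive t (1 : R) f b -> a = b.
Proof. by move=> [_ ea] [_ eb]; rewrite -ea -eb. Qed.

Lemma is_derive_near0 f t : (\forall u \near t, f u = 0) -> is_derive t (1 : R) f 0.
Proof.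
move=> H; have h : is_derive t (1 : R) (fun _ : R => 0 : R) 0 by exact: has_deriv_cst.
by apply: near_eq_is_derive h; apply: filterS H => x ->.
Qed.

(** The functions $p(1/s)e^{-1/s}$ for $s>0$, extended by zero: a family stable under
    differentiation that contains the standard flat function ($p=1$). *)
Definition flat (p : {poly R}) s : R :=
  if 0 < s then p.[s^-1] * expR (- s^-1) else 0.

(** Coefficient by coefficient, from $u^n/n!\le e^u$. *)
Lemma poly_le_exp (p : {poly R}) :
  exists2 C : R, 0 <= C & forall u : R, 0 <= u -> `|p.[u]| <= C * expR u.
Proof.
exists (\sum_(i < size p) `|p`_i| * (i`!)%:R).
  by apply: sumr_ge0 => i _; rewrite mulr_ge0.
move=> u u0; rewrite horner_coef mulr_suml (le_trans (ler_norm_sum _ _ _))//.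
apply: ler_sum => i _; rewrite normrM -mulrA ler_wpM2l// normrX (ger0_norm u0).
case: (nat_of_ord i) => [|n]; first by rewrite expr0 fact0 mul1r -expR0 ler_expR.
rewrite mulrC -ler_pdivrMr ?ltr0n ?fact_gt0//.
by rewrite (le_trans _ (expR_ge1Dxn n u0))// lerDr.
Qed.

(** The exponential bound is applied to $pX^2$ at $u=1/s$; the two extra powers of $u$ become the
    factor $s^2$, which settles the derivative at the junction $s=0$. *)
Lemma flat_small (p : {poly R}) :
  exists2 C : R, 0 <= C & forall s, `|flat p s| <= C * s ^+ 2.
Proof.
have [C C0 HC] := poly_le_exp (p * 'X^2); exists C => // s; rewrite /flat.
case: ifPn => [s0|_]; last by rewrite normr0 mulr_ge0// sqr_ge0.
have := HC s^-1; rewrite invr_ge0 (ltW s0) => /(_ isT).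
rewrite hornerM hornerXn normrM (@ger0_norm _ (s^-1 ^+ 2)) ?sqr_ge0// => H.
rewrite normrM expRN (@ger0_norm _ (expR _)^-1) ?invr_ge0 ?expR_ge0//.
rewrite ler_pdivrMr ?expR_gt0// -(@ler_pM2r _ (s^-1 ^+ 2)) ?exprn_gt0 ?invr_gt0//.
rewrite (le_trans H)// (_ : C * s ^+ 2 * _ * _ = C * expR s^-1)//; field.
by rewrite gt_eqF.
Qed.

(** For $s>0$ the derivative of $p(1/s)e^{-1/s}$ is $s^{-2}(p-p')(1/s)e^{-1/s}$, again of the same
    form; at $s=0$ the quadratic bound makes the difference quotient tend to 0. *)
Lemma flat_deriv (p : {poly R}) : has_deriv (flat p) (flat ('X^2 * (p - p^`()))).
Proof.
move=> s; have [s0|s0|->] := ltgtP s 0.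
- rewrite /flat (ltNge 0) (ltW s0)/=.
  apply: is_derive_near0.
  near=> u; rewrite ltNge (_ : u <= 0)//.
  by near: u; exact: lt_le_nbhsl.
- rewrite [in X in is_derive _ _ _ X]/flat s0.
  have dV : is_derive s (1 : R) (fun u => u^-1) (- s ^- 2).
    have s_neq0 : s != 0 by rewrite gt_eqF.
    apply: DeriveDef; first by apply: derivableV => //; exact: derivable_id.
    rewrite (@deriveV _ _ id)// ?derive_id; by rewrite /GRing.scale/= mulr1.
  have dp : is_derive s (1 : R) (fun u => p.[u^-1]) (p^`().[s^-1] * (- s ^- 2)).
    exact: (@is_derive1_comp _ (horner p) (fun u => u^-1)).
  have dN : is_derive s (1 : R) (fun u => - u^-1) (s ^- 2).
    by rewrite -[X in is_derive _ _ _ X]opprK; apply: is_deriveN.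
  have de : is_derive s (1 : R) (fun u => expR (- u^-1)) (expR (- s^-1) * s ^- 2).
    exact: (@is_derive1_comp _ expR (fun u => - u^-1)).
  have H : is_derive s (1 : R) (fun u => p.[u^-1] * expR (- u^-1))
      (('X^2 * (p - p^`())).[s^-1] * expR (- s^-1)).
    apply: is_derive_eq (is_deriveM dp de) _; rewrite /GRing.scale/=.
    rewrite hornerM hornerXn hornerD hornerN -exprVn.
    by ring.
  apply: near_eq_is_derive H; near=> u; rewrite /flat (_ : 0 < u)//.
  by near: u; exact: lt_nbhsr.
- have -> : flat ('X^2 * (p - p^`())) 0 = 0 by rewrite /flat ltxx.
  have [C C0 HC] := flat_small p.
  have lim0 : h^-1 *: ((flat p \o shift 0) (h *: (1 : R)) - flat p 0) @[h --> 0^'] --> (0 : R).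
    apply/cvgrPdist_le => e e0.
    have C1 : 0 < C + 1 by rewrite ltr_pwDr.
    have eC : 0 < e / (C + 1) by exact: divr_gt0.
    near=> h.
    rewrite /= addr0 [flat p 0]/flat ltxx subr0 sub0r normrN /GRing.scale/= mulr1.
    have h0 : h != 0 by near: h; exact: nbhs_dnbhs_neq.
    rewrite normrM normfV ler_pdivrMl ?normr_gt0// (le_trans (HC _))//.
    rewrite -[h ^+ 2]real_normK ?num_real// expr2 mulrCA ler_pM2l ?normr_gt0//.
    apply: (@le_trans _ _ ((C + 1) * `|h|)); first by rewrite ler_wpM2r// lerDl.
    rewrite mulrC -ler_pdivlMr//.
    by near: h; exact: dnbhs0_le eC.
  by apply: DeriveDef; [apply/cvg_ex; exists 0 | apply/cvg_lim].
Unshelve. all: by end_near. Qed.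

Lemma smooth1_flat p : smooth1 (flat p).
Proof.
exists (fun f => exists p, f = flat p); split; first by exists p.
move=> _ [q ->]; exists (flat ('X^2 * (q - q^`()))); last exact: flat_deriv.
by eexists.
Qed.

Lemma flat1_ge0 s : 0 <= flat 1 s.
Proof. by rewrite /flat; case: ifP => // _; rewrite hornerC mul1r expR_ge0. Qed.

Lemma flat1_gt0 s : 0 < s -> 0 < flat 1 s.
Proof. by move=> s0; rewrite /flat s0 hornerC mul1r expR_gt0. Qed.

Lemma flat1_eq0 s : s <= 0 -> flat 1 s = 0.
Proof. by rewrite /flat leNgt => /negbTE ->. Qed.

Lemma continuous_primitive f (a : R) : continuous f -> (forall t, t <= a -> f t = 0) ->
  exists2 F, has_deriv F f & forall t, t <= a -> F t = 0.
Proof.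
(* The base point lies strictly to the left of [a], in the zero set of [f]: the primitive is locally
   zero around every $t\le b$, and the fundamental theorem of calculus covers $t>b$. *)
move=> cf f0; pose b := a - 1.
pose F x := \int[lebesgue_measure]_(t in [set` Interval (BLeft b) (BRight x)]) f t.
have F0 t : t <= a -> F t = 0.
  move=> ta; rewrite /F (@eq_Rintegral _ _ _ _ _ (cst 0)) ?Rintegral_cst ?mul0r//.
  by move=> x; rewrite inE/= in_itv/= => /andP[_ xt]; rewrite f0// (le_trans xt).
exists F => // t; have [tb|bt] := leP t b.
  rewrite f0; last by rewrite (le_trans tb)// /b gerBl.
  apply: is_derive_near0.
  near=> x; rewrite F0//; near: x.
  by apply: lt_le_nbhsl; rewrite (le_lt_trans tb)// /b ltrBlDr ltrDl.
have tt1 : t < t + 1 by rewrite ltrDl.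
have fi : lebesgue_measure.-integrable `[b, t + 1] (EFin \o f).
  apply: continuous_compact_integrable; first exact: segment_compact.
  exact: continuous_subspaceT.
have bt' : (BLeft b < BRight t)%E by rewrite lte_fin.
have [dF eF] := continuous_FTC1 tt1 fi bt' (cf t).
have eF' : 'D_1 F t = f t by rewrite -derive1E.
exact: (DeriveDef dF eF').
Unshelve. all: by end_near. Qed.

Lemma has_deriv_ge0_le f f' : has_deriv f f' -> (forall t, 0 <= f' t) ->
  {homo f : s t / s <= t}.
Proof.
move=> ff' f'0 s t st.
have [||c _ e] := @MVT_segment R f f' s t st.
- by move=> x _; exact: ff'.
- by apply: continuous_subspaceT; exact: has_deriv_continuous ff'.
by rewrite -subr_ge0 e mulr_ge0// subr_ge0.
Qed.

(* The margins 1/3 make S locally constant near 0 and 1, so that it can be periodized. *)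
Lemma step_exists : exists S S' : R -> R, [/\ smooth1 S, has_deriv S S',
  (forall s, s <= 3^-1 -> S s = 0), (forall s, 2 / 3 <= s -> S s = 1) &
  [/\ forall s, 0 <= S s <= 1, forall s, 0 <= S' s,
      forall s, s <= 3^-1 -> S' s = 0, forall s, 2 / 3 <= s -> S' s = 0 &
      exists2 C, 0 < C & forall s, S' s <= C]].
Proof.
(* A smooth bump, positive exactly on the interval from 1/3 to 2/3; the step is its primitive
   divided by the total mass [P 1]. *)
pose B s := flat 1 (3 * s + (-1)) * flat 1 (-3 * s + 2).
have sB : smooth1 B by apply: smooth1M; apply: smooth1_affine; exact: smooth1_flat.
have B0 s : 0 <= B s by rewrite mulr_ge0// flat1_ge0.
have Bl s : s <= 3^-1 -> B s = 0.
  by move=> s3; rewrite /B flat1_eq0 ?mul0r//; lra.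
have Br s : 2 / 3 <= s -> B s = 0.
  by move=> s3; rewrite /B [X in _ * X]flat1_eq0 ?mulr0//; lra.
have B1 s : B s <= 1.
  have f1 u : flat 1 u <= 1.
    rewrite /flat; case: ifP => // u0; rewrite hornerC mul1r -expR0 ler_expR.
    by rewrite oppr_le0 invr_ge0 ltW.
  by rewrite /B mulr_ile1// flat1_ge0.
have [P dP P0] := continuous_primitive (smooth1_continuous sB) Bl.
have P_mono := has_deriv_ge0_le dP B0.
have P1 s : 2 / 3 <= s -> P s = P 1.
  have key u v : u <= v -> 2 / 3 <= u -> P u = P v.
    move=> uv u3.
    have [||c + e] := @MVT_segment R P B u v uv.
    - by move=> x _; exact: dP.
    - by apply: continuous_subspaceT; exact: has_deriv_continuous dP.
    rewrite in_itv/= => /andP[uc _]; move: e.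
    by rewrite Br ?mul0r; [move/eqP; rewrite subr_eq0 => /eqP -> | exact: le_trans uc].
  move=> s3; have [s1|s1] := leP s 1; first exact: key.
  by apply/esym/key; [exact: ltW | lra].
have c0 : 0 < P 1.
  (* The segment $[2/5,3/5]$ lies inside the support of [B], so the mean value theorem gives a
     strictly positive increment of [P] there. *)
  have [|||c + e] := @MVT_segment R P B (5^-1 * 2) (5^-1 * 3).
  - lra.
  - by move=> x _; exact: dP.
  - by apply: continuous_subspaceT; exact: has_deriv_continuous dP.
  rewrite in_itv/= => /andP[c1 c2].
  have Bc : 0 < B c by rewrite mulr_gt0// flat1_gt0//; lra.
  have : 0 <= P (5^-1 * 2) by rewrite -(P0 3^-1)//; apply: P_mono; lra.
  have : P (5^-1 * 3) <= P 1 by apply: P_mono; lra.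
  have : 0 < B c * (5^-1 * 3 - 5^-1 * 2) by rewrite mulr_gt0//; lra.
  rewrite -e; lra.
exists (fun s => (P 1)^-1 * P s), (fun s => (P 1)^-1 * B s).
have i0 : 0 < (P 1)^-1 by rewrite invr_gt0.
split.
- by apply: smooth1M; [exact: smooth1_cst | exact: smooth1_near sB dP].
- move=> t; apply: is_derive_eq (has_derivM (has_deriv_cst (P 1)^-1) dP t) _.
  by rewrite mulr0 addr0.
- by move=> s /P0 ->; rewrite mulr0.
- by move=> s /P1 ->; rewrite mulVf// gt_eqF.
split.
- move=> s; rewrite mulr_ge0 ?(ltW i0)//=; last first.
    have [s3|s3] := leP s 3^-1; first by rewrite P0.
    by rewrite -(P0 3^-1)// P_mono// ltW.
  rewrite mulrC ler_pdivrMr// mul1r.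
  have [s3|/ltW s3] := leP s 1; first exact: P_mono.
  by rewrite P1//; lra.
- by move=> s; rewrite mulr_ge0// ltW.
- by move=> s /Bl ->; rewrite mulr0.
- by move=> s /Br ->; rewrite mulr0.
by exists (P 1)^-1 => // s; rewrite -[leRHS]mulr1 ler_pM2l.
Qed.

Definition frac (s : R) : R := s - (Num.floor s)%:~R.

Lemma frac_itv s : 0 <= frac s < 1.
Proof.
rewrite /frac subr_ge0 floor_le /= ltrBlDl.
by have := floorD1_gt s; rewrite intrD.
Qed.

Lemma fracD1 s : frac (s + 1) = frac s.
Proof. by rewrite /frac floorDrz ?rpred1// intrD floor1; ring. Qed.

Lemma frac_id s : 0 <= s < 1 -> frac s = s.
Proof.
by move=> s01; rewrite /frac (@floor_def _ s 0) ?subr0// add0r.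
Qed.

Lemma frac_piece n s : n%:~R <= s < (n + 1)%:~R -> frac s = s - n%:~R.
Proof. by move=> /floor_def; rewrite /frac => ->. Qed.

(* The derivative of g o frac at a jump of frac exists because g is constant near 0 and 1. *)
Lemma has_deriv_frac g g' (c e : R) : 0 < e -> has_deriv g g' ->
  (forall s, s < e -> g s = c) -> (forall s, 1 - e < s -> g s = c) ->
  has_deriv (g \o frac) (g' \o frac).
Proof.
move=> e0 gg' gl gr s; have /andP[] := frac_itv s.
rewrite le_eqVlt => /orP[/eqP s0 _|s0 s1]; last first.
  have dg : is_derive s (1 : R) (fun u => g (1 * u - (Num.floor s)%:~R)) (g' (frac s)).
    by apply: is_derive_eq (has_deriv_affine 1 (- (Num.floor s)%:~R) gg' s) _; rewrite mul1r mulr1.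
  apply: near_eq_is_derive dg; near=> u; rewrite mul1r /= (@frac_piece (Num.floor s))//.
  apply/andP; split.
    by near: u; apply: lt_le_nbhsr; rewrite -subr_gt0.
  by near: u; apply: lt_nbhsl; rewrite intrD -ltrBlDl.
have g'0 : g' 0 = 0.
  have dc : is_derive 0 (1 : R) (fun _ : R => c) 0 by exact: has_deriv_cst.
  have : is_derive 0 (1 : R) g 0.
    apply: near_eq_is_derive dc; near=> u; rewrite gl//.
    by near: u; exact: lt_nbhsl.
  exact: is_derive1_unique (gg' 0).
rewrite /= -s0 g'0.
have dc : is_derive s (1 : R) (fun _ : R => c) 0 by exact: has_deriv_cst.
apply: near_eq_is_derive dc; near=> u => /=.
have sE : s = (Num.floor s)%:~R by apply/eqP; rewrite -subr_eq0 -/(frac s) -s0.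
have us : `|u - s| < Num.min e 1.
  rewrite distrC; near: u; apply: (@cvgr_dist_lt _ _ _ _ _ id); first exact: cvg_id.
  by rewrite lt_min e0 ltr01.
move: us; rewrite lt_min => /andP[]; rewrite !ltr_norml => /andP[u1 u2] /andP[u3 u4].
have [su|us] := leP s u.
  rewrite (@frac_piece (Num.floor s)) -?sE ?intrD -?sE ?su/=; last lra.
  by rewrite gl.
rewrite (@frac_piece (Num.floor s - 1)) ?intrB -?sE.
  by rewrite gr//; lra.
rewrite subrK -sE; apply/andP; split; lra.
Unshelve. all: by end_near. Qed.

(** Functions that take the same constant value near both ends of the period form a class stable
    under differentiation: the constant is 0 from the first derivative on. *)
Lemma smooth1_frac g (c e : R) : 0 < e -> smooth1 g ->
  (forall s, s < e -> g s = c) -> (forall s, 1 - e < s -> g s = c) ->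
  smooth1 (g \o frac).
Proof.
move=> e0 [A [Ag Ad]] gl gr.
exists (fun h => exists k d, [/\ A k, (forall s, s < e -> k s = d),
  (forall s, 1 - e < s -> k s = d) & h = k \o frac]); split; first by exists g, c.
move=> _ [k [d [Ak kl kr ->]]]; have [k' Ak' kk'] := Ad _ Ak.
exists (k' \o frac); last exact: has_deriv_frac e0 kk' kl kr.
have dd t : is_derive t (1 : R) (fun _ : R => d) 0 by exact: has_deriv_cst.
exists k', 0; split=> // s hs.
  have : is_derive s (1 : R) k 0.
    apply: near_eq_is_derive (dd s); near=> u; rewrite kl//.
    by near: u; exact: lt_nbhsl.
  exact: is_derive1_unique (kk' s).
have : is_derive s (1 : R) k 0.
  apply: near_eq_is_derive (dd s); near=> u; rewrite kr//.
  by near: u; exact: lt_nbhsr.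
exact: is_derive1_unique (kk' s).
Unshelve. all: by end_near. Qed.

End OneVariable.

(** * Test functions on the torus *)

Section SpaceTime.
Context {R : realType}.
Implicit Types (f g : stime R -> R) (z v : stime R).

Definition dir (k : option 'I_3) : stime R := if k is Some a then dx a else dt.

Lemma is_derive_line (V : normedModType R) (f : V -> R) (x v : V) (s d : R) :
  is_derive (s *: v + x) v f d -> is_derive s (1 : R) (fun h : R => f (h *: v + x)) d.
Proof.
have e : (fun h : R => h^-1 *: ((f \o shift (s *: v + x)) (h *: v) - f (s *: v + x))) =
    (fun h : R => h^-1 *: (((fun h : R => f (h *: v + x)) \o shift s) (h *: (1 : R)) - f (s *: v + x))).
  apply/funext => h /=; congr (_ *: (f _ - _)).
  by rewrite [h%:A]mulr1 scalerDl addrA.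
move=> [dd ee]; apply: DeriveDef; first by move: dd; rewrite /derivable e.
by move: ee; rewrite /derive e.
Qed.

Lemma is_derive_line0 (V : normedModType R) (f : V -> R) (x v : V) (d : R) :
  is_derive (0 : R) (1 : R) (fun h : R => f (h *: v + x)) d -> is_derive x v f d.
Proof.
have e : (fun h : R => h^-1 *: ((f \o shift x) (h *: v) - f x)) =
    (fun h : R => h^-1 *: (((fun h : R => f (h *: v + x)) \o shift 0) (h *: (1 : R)) - f (0 *: v + x))).
  by apply/funext => h /=; rewrite addr0 [h%:A]mulr1 scale0r add0r.
move=> [dd ee]; apply: DeriveDef; first by move: dd; rewrite /derivable e.
by move: ee; rewrite /derive e.
Qed.

Lemma is_derive_proj (V : normedModType R) (p : V -> R) (g g' : R -> R) (x v : V) :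
  (forall h : R, p (h *: v + x) = h * p v + p x) ->
  has_deriv g g' -> is_derive x v (g \o p) (g' (p x) * p v).
Proof.
move=> pE gg'.
have dg : is_derive 0 (1 : R) (fun h => g (p v * h + p x)) (g' (p x) * p v).
  by apply: is_derive_eq (has_deriv_affine (p v) (p x) gg' 0) _; rewrite mulr0 add0r.
have e : (fun h : R => h^-1 *: (((g \o p) \o shift x) (h *: v) - (g \o p) x)) =
   (fun h : R => h^-1 *: (((fun h => g (p v * h + p x)) \o shift 0) (h *: (1 : R)) - g (p v * 0 + p x))).
  apply/funext => h /=; by rewrite pE mulr0 add0r addr0 [h%:A]mulr1 [h * p v]mulrC.
case: dg => dd ee; apply: DeriveDef; first by move: dd; rewrite /derivable e.
by move: ee; rewrite /derive e.
Qed.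

Definition per1 (g : R -> R) := forall s, g (s + 1) = g s.

Lemma per1_deriv (g g' : R -> R) : per1 g -> has_deriv g g' -> per1 g'.
Proof.
move=> pg gg' s; have H := has_deriv_affine 1 1 gg' s.
apply: (@is_derive1_unique R g s) => //.
have gE : g = (fun t => g (1 * t + 1)) by apply/funext => t; rewrite mul1r pg.
by rewrite gE; apply: is_derive_eq H _; rewrite mul1r mulr1.
Qed.

Lemma per1_frac (g : R -> R) s : per1 g -> g (frac s) = g s.
Proof.
move=> pg; have pn (n : nat) : forall u, g (u + n%:R) = g u.
  by elim: n => [|n IH] u; rewrite ?addr0// -natr1 addrA pg.
rewrite /frac; case: (Num.floor s) => n; first by rewrite -[LHS](pn n) subrK.
by rewrite NegzE mulrNz opprK pn.
Qed.

(* The first three factors live on the torus. *)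
Inductive Sm : (stime R -> R) -> Prop :=
| SmT (g0 g1 g2 g3 : R -> R) : smooth1 g0 -> per1 g0 -> smooth1 g1 -> per1 g1 ->
    smooth1 g2 -> per1 g2 -> smooth1 g3 ->
    Sm (fun z => g0 z.1.1.1 * g1 z.1.1.2 * g2 z.1.2 * g3 z.2)
| SmD f g : Sm f -> Sm g -> Sm (fun z => f z + g z).

Lemma Sm_ext f g : Sm f -> f =1 g -> Sm g.
Proof. by move=> sf /funext <-. Qed.

Lemma Sm_cst (c : R) : Sm (fun=> c).
Proof.
apply: (@Sm_ext (fun z => (fun=> c) z.1.1.1 * (fun=> 1) z.1.1.2 * (fun=> 1) z.1.2 * (fun=> 1) z.2)).
  by apply: (@SmT (fun=> _) (fun=> _) (fun=> _) (fun=> _)) => //; exact: smooth1_cst.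
by move=> z /=; rewrite !mulr1.
Qed.

Lemma SmM f g : Sm f -> Sm g -> Sm (fun z => f z * g z).
Proof.
elim=> {f} [g0 g1 g2 g3 s0 p0 s1 p1 s2 p2 s3|f1 f2 _ IH1 _ IH2] sg; last first.
  apply: (@Sm_ext (fun z => f1 z * g z + f2 z * g z)); first exact: SmD (IH1 sg) (IH2 sg).
  by move=> z; rewrite mulrDl.
elim: sg => {g} [h0 h1 h2 h3 t0 q0 t1 q1 t2 q2 t3|f1 f2 _ IH1 _ IH2]; last first.
  apply: (Sm_ext (SmD IH1 IH2)) => z /=.
  by rewrite mulrDr.
apply: (@Sm_ext (fun z => (fun s => g0 s * h0 s) z.1.1.1 * (fun s => g1 s * h1 s) z.1.1.2 *
  (fun s => g2 s * h2 s) z.1.2 * (fun s => g3 s * h3 s) z.2)).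
  apply: (@SmT (fun s => g0 s * h0 s) (fun s => g1 s * h1 s) (fun s => g2 s * h2 s)
    (fun s => g3 s * h3 s)); try exact: smooth1M; move=> s.
  - by rewrite p0 q0.
  - by rewrite p1 q1.
  - by rewrite p2 q2.
by move=> z /=; ring.
Qed.

Lemma SmZ (c : R) f : Sm f -> Sm (fun z => c * f z).
Proof. by move=> sf; apply: SmM => //; exact: Sm_cst. Qed.

Lemma Sm_time (g : R -> R) : smooth1 g -> Sm (fun z => g z.2).
Proof.
move=> sg; apply: (@Sm_ext (fun z => (fun=> 1) z.1.1.1 * (fun=> 1) z.1.1.2 * (fun=> 1) z.1.2 * g z.2)).
  by apply: (@SmT (fun=> _) (fun=> _) (fun=> _)) => //; exact: smooth1_cst.
by move=> z /=; rewrite !mul1r.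
Qed.

Lemma Sm_sum (I : Type) (r : seq I) (P : pred I) (F : I -> stime R -> R) :
  (forall i, P i -> Sm (F i)) -> Sm (fun z => \sum_(i <- r | P i) F i z).
Proof.
move=> sF; elim: r => [|i r IH].
  by apply: (Sm_ext (Sm_cst 0)) => z; rewrite big_nil.
case Pi: (P i); last by apply: (Sm_ext IH) => z; rewrite big_cons Pi.
by apply: (Sm_ext (SmD (sF _ Pi) IH)) => z; rewrite big_cons Pi.
Qed.

Lemma Sm_derive f v : Sm f -> Sm ('D_v f) /\ forall z, is_derive z v f ('D_v f z).
Proof.
move=> sf; suff [f' sf' ff'] : exists2 f', Sm f' & forall z, is_derive z v f (f' z).
  suff -> : 'D_v f = f' by [].
  by apply/funext => z; have [_ ->] := ff' z.
elim: sf => {f} [g0 g1 g2 g3 s0 p0 s1 p1 s2 p2 s3|f1 f2 _ [h1 s1 d1] _ [h2 s2 d2]]; last first.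
  by exists (fun z => h1 z + h2 z); [exact: SmD|move=> z; exact: is_deriveD].
have [h0 t0 d0] := smooth1_deriv s0; have [h1 t1 d1] := smooth1_deriv s1.
have [h2 t2 d2] := smooth1_deriv s2; have [h3 t3 d3] := smooth1_deriv s3.
have q0 := per1_deriv p0 d0; have q1 := per1_deriv p1 d1; have q2 := per1_deriv p2 d2.
exists (fun z => (v.1.1.1 * (h0 z.1.1.1 * g1 z.1.1.2 * g2 z.1.2 * g3 z.2) +
   v.1.1.2 * (g0 z.1.1.1 * h1 z.1.1.2 * g2 z.1.2 * g3 z.2)) +
  (v.1.2 * (g0 z.1.1.1 * g1 z.1.1.2 * h2 z.1.2 * g3 z.2) +
   v.2 * (g0 z.1.1.1 * g1 z.1.1.2 * g2 z.1.2 * h3 z.2))).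
  by apply: SmD; apply: SmD; apply: SmZ; exact: SmT.
move=> z.
have e0 := @is_derive_proj (stime R) (fun z => z.1.1.1) g0 h0 z v (fun h => erefl) d0.
have e1 := @is_derive_proj (stime R) (fun z => z.1.1.2) g1 h1 z v (fun h => erefl) d1.
have e2 := @is_derive_proj (stime R) (fun z => z.1.2) g2 h2 z v (fun h => erefl) d2.
have e3 := @is_derive_proj (stime R) (fun z => z.2) g3 h3 z v (fun h => erefl) d3.
apply: is_derive_eq (is_deriveM (is_deriveM (is_deriveM e0 e1) e2) e3) _.
by rewrite /GRing.scale !fctE/=; ring.
Qed.

Lemma Sm_D f v : Sm f -> Sm ('D_v f). Proof. by case/(Sm_derive v). Qed.

Lemma Sm_is_derive f v z : Sm f -> is_derive z v f ('D_v f z).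
Proof. by case/(Sm_derive v). Qed.

Lemma Sm_periodic f : Sm f -> Defs.periodic f.
Proof.
elim=> {f} [g0 g1 g2 g3 s0 p0 s1 p1 s2 p2 s3|f1 f2 _ IH1 _ IH2] z a; last by rewrite IH1 IH2.
by case: a => -[|[|[|//]]] ? /=; rewrite ?addr0 ?p0 ?p1 ?p2.
Qed.

Lemma continuous_fst (A B C : topologicalType) (f : A -> C) :
  continuous f -> continuous (fun z : A * B => f z.1).
Proof. by move=> cf z; apply: (@continuous_comp _ _ _ fst f); [exact: cvg_fst|exact: cf]. Qed.

Lemma continuous_snd (A B C : topologicalType) (f : B -> C) :
  continuous f -> continuous (fun z : A * B => f z.2).
Proof. by move=> cf z; apply: (@continuous_comp _ _ _ snd f); [exact: cvg_snd|exact: cf]. Qed.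

Lemma continuousM4 (A : topologicalType) (a b c d : A -> R) :
  continuous a -> continuous b -> continuous c -> continuous d ->
  continuous (fun x : A => a x * b x * c x * d x).
Proof.
move=> ca cb cc cd z.
by apply: cvgM; [apply: cvgM; [apply: cvgM|]|]; [exact: ca|exact: cb|exact: cc|exact: cd].
Qed.

Lemma continuousD2 (A : topologicalType) (a b : A -> R) :
  continuous a -> continuous b -> continuous (fun x : A => a x + b x).
Proof. by move=> ca cb z; apply: cvgD; [exact: ca|exact: cb]. Qed.

Lemma Sm_continuous f : Sm f -> continuous f.
Proof.
elim=> {f} [g0 g1 g2 g3 s0 _ s1 _ s2 _ s3|f1 f2 _ IH1 _ IH2]; last exact: continuousD2.
apply: continuousM4.
- exact: (continuous_fst (continuous_fst (continuous_fst (smooth1_continuous s0)))).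
- exact: (continuous_fst (continuous_fst (continuous_snd (smooth1_continuous s1)))).
- exact: (continuous_fst (continuous_snd (smooth1_continuous s2))).
- exact: (continuous_snd (smooth1_continuous s3)).
Qed.

Lemma Sm_smooth f : Sm f -> smooth f.
Proof.
move=> sf s; suff sg : Sm (foldr (fun v h => 'D_v h) f s).
  split; first exact: Sm_continuous.
  by move=> z v; have [] := Sm_is_derive v z sg.
by elim: s => //= v s IH; exact: Sm_D.
Qed.

Lemma Sm_measurable f : Sm f -> measurable_fun setT f.
Proof.
elim=> {f} [g0 g1 g2 g3 s0 _ s1 _ s2 _ s3|f1 f2 _ IH1 _ IH2]; last exact: measurable_funD.
have m (g : R -> R) : smooth1 g -> measurable_fun setT g.
  by move=> sg; apply: continuous_measurable_fun; exact: smooth1_continuous.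
have m11 : measurable_fun setT (fun z : stime R => z.1.1).
  exact: (measurableT_comp measurable_fst measurable_fst).
apply: measurable_funM; [apply: measurable_funM; [apply: measurable_funM|]|].
- apply: (measurableT_comp (m _ s0)).
  exact: (measurableT_comp measurable_fst m11).
- apply: (measurableT_comp (m _ s1)).
  exact: (measurableT_comp measurable_snd m11).
- apply: (measurableT_comp (m _ s2)).
  exact: (measurableT_comp measurable_snd measurable_fst).
- by apply: (measurableT_comp (m _ s3)); exact: measurable_snd.
Qed.

(** The spatial factors are bounded by their maximum over one period; the time factor is bounded
    only on the compact interval, hence the restriction on [z.2]. *)
Lemma Sm_bounded f (T : R) : Sm f -> exists2 C, 0 <= C & forall z, 0 <= z.2 <= T -> `|f z| <= C.
Proof.
have bd (g : R -> R) (a b : R) : smooth1 g ->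
    exists2 C, 0 <= C & forall s, a <= s <= b -> `|g s| <= C.
  move=> sg; have [ab|ba] := leP a b; last first.
    by exists 0 => // s /andP[sa sb]; have := lt_le_trans ba (le_trans sa sb); rewrite ltxx.
  have cg : {within `[a, b], continuous (fun s => `|g s|)}.
    apply: continuous_subspaceT => s; apply: (@continuous_comp _ _ _ g (fun x => `|x|)).
      exact: smooth1_continuous.
    exact: norm_continuous.
  have [c _ cM] := EVT_max ab cg.
  by exists `|g c| => // s sab; apply: cM; rewrite in_itv.
have bp (g : R -> R) : smooth1 g -> per1 g -> exists2 C, 0 <= C & forall s, `|g s| <= C.
  move=> sg pg; have [C C0 HC] := bd g 0 1 sg; exists C => // s.
  have /andP[f0 /ltW f1] := frac_itv s.
  by rewrite -(per1_frac s pg); apply: HC; rewrite f0.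
elim=> {f} [g0 g1 g2 g3 s0 p0 s1 p1 s2 p2 s3|f1 f2 _ [C1 C10 H1] _ [C2 C20 H2]]; last first.
  exists (C1 + C2) => [|z zT]; first exact: addr_ge0.
  by rewrite (le_trans (ler_normD _ _))// lerD ?H1 ?H2.
have [C0 C00 H0] := bp _ s0 p0; have [C1 C10 H1] := bp _ s1 p1.
have [C2 C20 H2] := bp _ s2 p2; have [C3 C30 H3] := bd _ 0 T s3.
exists (C0 * C1 * C2 * C3) => [|z zT]; first by rewrite !mulr_ge0.
by rewrite !normrM !ler_pM ?mulr_ge0// H3.
Qed.

End SpaceTime.

(** * Sigma-finite products *)

Section ProductMeasure.
Context d1 d2 (X : measurableType d1) (Y : measurableType d2) (R : realType).
Variables (m1 : {sigma_finite_measure set X -> \bar R}) (m2 : {sigma_finite_measure set Y -> \bar R}).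

(** A named copy of the product, able to carry a sigma-finite structure: Fubini is applied to
    iterated products, whose left factor is itself a product. *)
Definition prod_measure : set (X * Y) -> \bar R := (m1 \x m2)%E.
HB.instance Definition _ := Measure.on prod_measure.

Lemma prod_measure_sigma_finite : sigma_finite setT prod_measure.
Proof.
have [F [FT Fnd Ffin]] := (sigma_finiteP _ _).1 (sigma_finiteT m1).
have [G [GT Gnd Gfin]] := (sigma_finiteP _ _).1 (sigma_finiteT m2).
exists (fun n => F n `*` G n).
  apply/seteqP; split=> // -[x y] _.
  have [i _ Fix] : (\bigcup_i F i) x by rewrite -FT.
  have [j _ Gjy] : (\bigcup_i G i) y by rewrite -GT.
  exists (maxn i j) => //; split=> /=.
    by move: x Fix; exact/subsetPset/Fnd/leq_maxl.
  by move: y Gjy; exact/subsetPset/Gnd/leq_maxr.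
move=> n; have [mF Fn] := Ffin n; have [mG Gn] := Gfin n.
split; first exact: measurableX.
by rewrite /prod_measure product_measure1E// lte_mul_pinfty// ge0_fin_numE.
Qed.

HB.instance Definition _ := Measure_isSigmaFinite.Build _ _ _ prod_measure prod_measure_sigma_finite.
End ProductMeasure.

(** * Fubini and integration of derivatives over the space-time cell *)

Section Integration.
Context {R : realType}.
Notation lam := (@lebesgue_measure R).

Definition leb2s : {sigma_finite_measure set _ -> \bar R} := prod_measure lam lam.
Definition leb3s : {sigma_finite_measure set _ -> \bar R} := prod_measure leb2s lam.

Lemma integrable_support d (X : measurableType d) (m : {measure set X -> \bar R})
    (f : X -> R) (C : R) (A : set X) :
  measurable_fun setT f -> (forall x, `|f x| <= C) -> measurable A -> (m A < +oo)%E ->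
  (forall x, ~ A x -> f x = 0) -> m.-integrable setT (EFin \o f).
Proof.
move=> mf fC mA Afin f0; have -> : EFin \o f = (EFin \o f) \_ A.
  apply/funext => x; rewrite patchE; case: ifPn => //; rewrite notin_setE => /f0 /= ->.
  by [].
apply/(integrable_mkcond _ mA).1; apply: measurable_bounded_integrable => //.
  exact: measurable_funS mf.
by exists C; split=> [|M CM x _ /=]; [exact: num_real|rewrite (le_trans (fC x))// ltW].
Qed.

Lemma prod_integral0_l d1 d2 (X : measurableType d1) (Y : measurableType d2)
    (m1 : {sigma_finite_measure set X -> \bar R})
    (m2 : {sigma_finite_measure set Y -> \bar R}) (f : X * Y -> R) :
  (m1 \x m2)%E.-integrable setT (EFin \o f) ->
  (forall y, \int[m1]_x (f (x, y))%:E = 0)%E -> (\int[m1 \x m2]_z (f z)%:E = 0)%E.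
Proof.
move=> fi f0; rewrite -integral21_prod_meas1//.
rewrite (eq_integral (fun=> 0%E)) ?integral0// => y _; exact: f0.
Qed.

Lemma prod_integral0_r d1 d2 (X : measurableType d1) (Y : measurableType d2)
    (m1 : {sigma_finite_measure set X -> \bar R})
    (m2 : {sigma_finite_measure set Y -> \bar R}) (f : X * Y -> R) :
  (m1 \x m2)%E.-integrable setT (EFin \o f) ->
  (forall x, \int[m2]_y (f (x, y))%:E = 0)%E -> (\int[m1 \x m2]_z (f z)%:E = 0)%E.
Proof.
move=> fi f0; rewrite -integral12_prod_meas1//.
rewrite (eq_integral (fun=> 0%E)) ?integral0// => y _; exact: f0.
Qed.

Lemma integral_deriv (g g' : R -> R) (a b : R) : a < b -> has_deriv g g' -> continuous g' ->
  (\int[lam]_(s in `[a, b]) (g' s)%:E = (g b - g a)%:E)%E.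
Proof.
move=> ab gg' cg'; rewrite EFinB; apply: continuous_FTC2 => //.
- exact: continuous_subspaceT.
- have cg := has_deriv_continuous gg'; split.
  + by move=> x _; have [] := gg' x.
  + by apply: cvg_at_right_filter; exact: cg.
  + by apply: cvg_at_left_filter; exact: cg.
- by move=> x _; rewrite derive1E; have [_ ->] := gg' x.
Qed.

Lemma integral_deriv_co (g g' : R -> R) (a b : R) : a < b -> has_deriv g g' -> continuous g' ->
  (\int[lam]_(s in `[a, b[) (g' s)%:E = (g b - g a)%:E)%E.
Proof.
move=> ab gg' cg'; rewrite integral_itv_bndo_bndc; first exact: integral_deriv.
by apply/measurable_EFinP/measurable_funTS; exact: continuous_measurable_fun.
Qed.

Lemma cellE : @cell R = (`[0, 1[%classic `*` `[0, 1[%classic) `*` `[0, 1[%classic.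
Proof.
by apply/seteqP; split=> x; rewrite /cell /= !in_itv/=; [case=> -> -> ->|case=> -[-> ->] ->].
Qed.

Lemma QTE (T : R) : @QT R T = cell `*` `[0, T]%classic.
Proof. by apply/seteqP; split=> x; rewrite /QT /= in_itv. Qed.

Lemma measurable_cell : measurable (@cell R).
Proof.
rewrite cellE; apply: measurableX; first apply: measurableX; exact: measurable_itv.
Qed.

Lemma measurable_QT (T : R) : measurable (@QT R T).
Proof.
by rewrite QTE; apply: measurableX; [exact: measurable_cell|exact: measurable_itv].
Qed.

Lemma lam_co01 : (lam `[0%R, 1%R[%classic < +oo)%E.
Proof. by rewrite lebesgue_measure_itv/= lte_fin ltr01 sube0 ltry. Qed.

Lemma lam_cc (T : R) : (lam `[0%R, T]%classic < +oo)%E.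
Proof. by rewrite lebesgue_measure_itv/=; case: ifPn => _; rewrite ?sube0 ?ltry. Qed.

Lemma leb2_sq : ((lam \x lam)%E (`[0%R, 1%R[%classic `*` `[0%R, 1%R[%classic) < +oo)%E.
Proof.
rewrite product_measure1E; [|exact: measurable_itv|exact: measurable_itv].
by apply: lte_mul_pinfty => //; [rewrite ge0_fin_numE//; exact: lam_co01|exact: lam_co01].
Qed.

Lemma leb3_cell : (@leb3 R cell < +oo)%E.
Proof.
rewrite /leb3 cellE product_measure1E; last 2 first.
- by apply: measurableX; exact: measurable_itv.
- exact: measurable_itv.
by apply: lte_mul_pinfty => //; [rewrite ge0_fin_numE//; exact: leb2_sq|exact: lam_co01].
Qed.

Lemma leb4_QT (T : R) : (@leb4 R (QT T) < +oo)%E.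
Proof.
rewrite /leb4 QTE product_measure1E; [|exact: measurable_cell|exact: measurable_itv].
by apply: lte_mul_pinfty => //; [rewrite ge0_fin_numE//; exact: leb3_cell|exact: lam_cc].
Qed.

Lemma smul_dx (a : 'I_3) (s : R) (x : stime R) :
  s *: dx a + x = (s * (val a == 0%N)%:R + x.1.1.1, s * (val a == 1%N)%:R + x.1.1.2,
     s * (val a == 2%N)%:R + x.1.2, x.2).
Proof.
case: x => [[[x0 x1] x2] t] /=; rewrite -[LHS]/(s * _ + x0, s * _ + x1, s * _ + x2, s * 0 + t).
by rewrite mulr0 add0r.
Qed.

Lemma smul_dt (s : R) (x : stime R) : s *: dt + x = (x.1, s + x.2).
Proof.
case: x => [[[x0 x1] x2] t] /=; rewrite -[LHS]/(s * 0 + x0, s * 0 + x1, s * 0 + x2, s * 1 + t).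
by rewrite mulr0 mulr1 !add0r.
Qed.

(** On each line in direction [a] the integral of [h'] over a period is a difference of two equal
    values. Extending [h'] by zero gives an integrable function on the whole space, to which Fubini
    applies; the three directions differ only in the order in which the variables are integrated
    out. *)
Lemma int_dx (T : R) (a : 'I_3) (h h' : stime R -> R) (C : R) :
  (forall z : stime R, is_derive z (dx a) h (h' z)) ->
  (forall z : stime R, continuous (fun s : R => h' (s *: dx a + z))) ->
  Defs.periodic h -> measurable_fun (QT T) h' -> (forall z : stime R, QT T z -> `|h' z| <= C) ->
  \int[leb4]_(z in QT T) h' z = 0.
Proof.
move=> dh ch ph mh hC.
have C0 : 0 <= `|C| by [].
have line (z : stime R) : (\int[lam]_(s in `[0%R, 1%R[) (h' (s *: dx a + z))%:E = 0)%E.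
  have dg : has_deriv (fun s => h (s *: dx a + z)) (fun s => h' (s *: dx a + z)).
    by move=> s; apply: is_derive_line.
  rewrite (@integral_deriv_co _ _ 0 1 ltr01 dg (ch z)).
  by rewrite !smul_dx !mul0r !add0r -!surjective_pairing -[X in h X - _](_ : z + dx a = _) ?ph ?subrr// addrC -[dx a]scale1r smul_dx.
pose f := h' \_ (QT T).
have mf : measurable_fun setT f by exact: (measurable_restrictT _ (measurable_QT T)).1 mh.
have fC z : `|f z| <= `|C|.
  rewrite /f patchE; case: ifPn => [|_]; last by rewrite normr0.
  by rewrite inE => /hC /le_trans; apply; exact: ler_norm.
have fE z : f z = if (0 <= z.1.1.1 < 1) && (0 <= z.1.1.2 < 1) && (0 <= z.1.2 < 1) && (0 <= z.2 <= T)
    then h' z else 0.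
  rewrite /f patchE; congr (if _ then _ else _); apply/idP/idP.
    by rewrite inE => -[[-> -> ->] ->].
  by move=> /andP[/andP[/andP[z0 z1] z2] zt]; rewrite inE.
have f0 z : ~ QT T z -> f z = 0 by move=> nz; rewrite /f patchE memNset.
have fi4 : leb4.-integrable setT (EFin \o f).
  by apply: (@integrable_support _ _ leb4 f `|C| (QT T)) => //; [exact: measurable_QT|exact: leb4_QT].
rewrite /Rintegral; suff -> : (\int[leb4]_(z in QT T) (h' z)%:E = 0)%E by [].
rewrite integral_mkcond restrict_EFin -/f.
refine (@prod_integral0_l _ _ _ _ leb3s lam f fi4 _) => t.
have mf3 := measurable_fun_pair1 t mf.
have fi3 : leb3.-integrable setT (EFin \o (fun x => f (x, t))).
  apply: (@integrable_support _ _ leb3 _ `|C| cell) => //;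
    [exact: measurable_cell|exact: leb3_cell|].
  by move=> x nx; apply: f0 => -[].
have int01 (P : bool) (F G : R -> R) : (forall s, F s = if (0 <= s < 1) && P then G s else 0) ->
   (\int[lam]_(s in `[0%R, 1%R[) (G s)%:E = 0)%E -> (\int[lam]_s (F s)%:E = 0)%E.
  move=> FE G0; have -> : (fun s => (F s)%:E) = if P then (EFin \o G) \_ `[0%R, 1%R[ else cst 0%E.
    apply/funext => s; rewrite /= FE; case: P {FE}; last by rewrite andbF.
    rewrite andbT patchE; case: ifPn => h01; first by rewrite mem_set//= in_itv.
    by rewrite memNset//= in_itv/=; apply/negP.
  by case: P {FE}; [rewrite -integral_mkcond|rewrite integral0].
case: a => -[|[|[|//]]] a3 in dh ch line *.
- refine (@prod_integral0_l _ _ _ _ leb2s lam _ fi3 _) => x2.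
  have mf2 := measurable_fun_pair1 x2 mf3.
  have fi2 : (lam \x lam)%E.-integrable setT (EFin \o (fun x => f (x, x2, t))).
    apply: (@integrable_support _ _ (lam \x lam)%E _ `|C| (`[0%R, 1%R[%classic `*` `[0%R, 1%R[%classic)) => //;
      [by apply: measurableX; exact: measurable_itv|exact: leb2_sq|].
    by move=> x nx; apply: f0 => -[[/= x0 x1 _] _]; apply: nx; rewrite /= !in_itv/=.
  refine (@prod_integral0_l _ _ _ _ lam lam _ fi2 _) => x1.
  apply: (int01 ((0 <= x1 < 1) && (0 <= x2 < 1) && (0 <= t <= T)) _ (fun s => h' (s, x1, x2, t))).
    by move=> s; rewrite fE/= !andbA.
  rewrite -[RHS](line (0, x1, x2, t)).
  by apply: eq_integral => s _; rewrite smul_dx/= mulr1 !mulr0 !add0r addr0.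
- refine (@prod_integral0_l _ _ _ _ leb2s lam _ fi3 _) => x2.
  have mf2 := measurable_fun_pair1 x2 mf3.
  have fi2 : (lam \x lam)%E.-integrable setT (EFin \o (fun x => f (x, x2, t))).
    apply: (@integrable_support _ _ (lam \x lam)%E _ `|C| (`[0%R, 1%R[%classic `*` `[0%R, 1%R[%classic)) => //;
      [by apply: measurableX; exact: measurable_itv|exact: leb2_sq|].
    by move=> x nx; apply: f0 => -[[/= x0 x1 _] _]; apply: nx; rewrite /= !in_itv/=.
  refine (@prod_integral0_r _ _ _ _ lam lam _ fi2 _) => x0.
  apply: (int01 ((0 <= x0 < 1) && (0 <= x2 < 1) && (0 <= t <= T)) _ (fun s => h' (x0, s, x2, t))).
    by move=> s; rewrite fE [(_, _).2]/=; case: (0 <= s < 1); rewrite ?andbT ?andbF.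
  rewrite -[RHS](line (x0, 0, x2, t)).
  by apply: eq_integral => s _; rewrite smul_dx/= mulr1 !mulr0 !add0r addr0.
- refine (@prod_integral0_r _ _ _ _ leb2s lam _ fi3 _) => x01.
  apply: (int01 ((0 <= x01.1 < 1) && (0 <= x01.2 < 1) && (0 <= t <= T)) _ (fun s => h' (x01, s, t))).
    by move=> s; rewrite fE [(_, _).2]/=; case: (0 <= s < 1); rewrite ?andbT ?andbF.
  rewrite -[RHS](line (x01, 0, t)).
  by apply: eq_integral => s _; rewrite smul_dx/= mulr1 !mulr0 !add0r addr0 -surjective_pairing.
Qed.

(** Fubini with the fundamental theorem of calculus on each time line. Time is not periodic, so both
    boundary values remain. *)
Lemma int_dt (T : R) (h h' : stime R -> R) (C : R) : 0 < T ->
  (forall z : stime R, is_derive z dt h (h' z)) ->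
  (forall z : stime R, continuous (fun s : R => h' (s *: dt + z))) ->
  measurable_fun (QT T) h' -> (forall z : stime R, QT T z -> `|h' z| <= C) ->
  \int[leb4]_(z in QT T) h' z = \int[leb3]_(x in cell) (h (x, T) - h (x, 0)).
Proof.
move=> T0 dh ch mh hC.
pose f := h' \_ (QT T).
have mf : measurable_fun setT f by exact: (measurable_restrictT _ (measurable_QT T)).1 mh.
have fC z : `|f z| <= `|C|.
  rewrite /f patchE; case: ifPn => [|_]; last by rewrite normr0.
  by rewrite inE => /hC /le_trans; apply; exact: ler_norm.
have f0 z : ~ QT T z -> f z = 0 by move=> nz; rewrite /f patchE memNset.
have fi4 : leb4.-integrable setT (EFin \o f).
  by apply: (@integrable_support _ _ leb4 f `|C| (QT T)) => //; [exact: measurable_QT|exact: leb4_QT].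
congr fine; rewrite integral_mkcond restrict_EFin -/f [RHS]integral_mkcond.
have e4 := @integral12_prod_meas1 _ _ _ _ _ leb3s lam _ fi4.
transitivity (\int[leb3s]_x fubini_F lam (EFin \o f) x)%E; first exact: esym e4.
apply: eq_integral => x _; rewrite /fubini_F patchE; case: ifPn => [|nx]; last first.
  rewrite (eq_integral (fun=> 0%E)) ?integral0// => t _ /=; rewrite f0// => -[cx _].
  by move: nx; rewrite mem_set.
rewrite inE => cx; have dg : has_deriv (fun s => h (s *: dt + (x, 0))) (fun s => h' (s *: dt + (x, 0))).
  by move=> s; apply: is_derive_line.
have := @integral_deriv _ _ 0 T T0 dg (ch (x, 0)).
rewrite !smul_dt/= add0r addr0 => <-; rewrite [RHS]integral_mkcond.
apply: eq_integral => t _; rewrite /= /f !patchE.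
have -> : (((x, t) : stime R) \in QT T) = (t \in `[0, T]%classic).
  by apply/idP/idP; rewrite !inE/= in_itv/=; [case | split].
by case: ifP => // _; rewrite smul_dt/= addr0.
Qed.

End Integration.

(** * Integrable and bounded functions *)

Lemma ae_imp d (X : measurableType d) (R : realType) (m : {measure set X -> \bar R})
    (P Q : X -> Prop) : {ae m, forall x, P x} -> (forall x, P x -> Q x) -> {ae m, forall x, Q x}.
Proof. by move=> aP PQ; apply: filterS aP. Qed.

Lemma ae_and d (X : measurableType d) (R : realType) (m : {measure set X -> \bar R})
    (P Q : X -> Prop) : {ae m, forall x, P x} -> {ae m, forall x, Q x} ->
  {ae m, forall x, P x /\ Q x}.
Proof. by move=> aP aQ; apply: filterS2 aP aQ. Qed.

Section Lebesgue.
Context d (X : measurableType d) (R : realType) (m : {measure set X -> \bar R}) (D : set X).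
Implicit Types (f g h : X -> R) (C k : R).

Definition L1 f := m.-integrable D (EFin \o f).

(** The bound holds everywhere on [D], not merely almost everywhere; essentially bounded data are
    replaced by such representatives before they are used. *)
Definition bnd f := measurable_fun D f /\ exists2 C, 0 <= C & forall x, D x -> `|f x| <= C.

Hypothesis mD : measurable D.

Lemma L1_measurable f : L1 f -> measurable_fun D f.
Proof. by move=> /measurable_int/measurable_EFinP. Qed.

Lemma measurable_ext f g : measurable_fun D f -> (forall x, D x -> f x = g x) ->
  measurable_fun D g.
Proof. by move=> mf fg; apply: eq_measurable_fun mf => x; rewrite inE => /fg. Qed.

Lemma L1_ext f g : L1 f -> (forall x, D x -> f x = g x) -> L1 g.
Proof. by move=> Lf fg; apply: eq_integrable Lf => // x; rewrite inE/= => /fg ->. Qed.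

Lemma L1D f g : L1 f -> L1 g -> L1 (fun x => f x + g x).
Proof. by move=> Lf Lg; have := integrableD mD Lf Lg. Qed.

Lemma L1Z k f : L1 f -> L1 (fun x => k * f x).
Proof. by move=> Lf; have := integrableZl mD k Lf. Qed.

Lemma L1N f : L1 f -> L1 (fun x => - f x).
Proof. by move=> Lf; apply: (L1_ext (L1Z (-1) Lf)) => x _; rewrite mulN1r. Qed.

Lemma L1B f g : L1 f -> L1 g -> L1 (fun x => f x - g x).
Proof. by move=> Lf Lg; apply: L1D => //; exact: L1N. Qed.

Lemma L1_0 : L1 (fun=> 0).
Proof. exact: integrable0. Qed.

Lemma L1_sum (I : Type) (r : seq I) (P : pred I) (F : I -> X -> R) :
  (forall i, P i -> L1 (F i)) -> L1 (fun x => \sum_(i <- r | P i) F i x).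
Proof.
move=> LF; elim: r => [|i r IH].
  by apply: (L1_ext L1_0) => x _; rewrite big_nil.
case Pi: (P i); last by apply: (L1_ext IH) => x _; rewrite big_cons Pi.
by apply: (L1_ext (L1D (LF _ Pi) IH)) => x _; rewrite big_cons Pi.
Qed.

Lemma L1_abs f : L1 f -> L1 (fun x => `|f x|).
Proof. by move=> /integrable_abse. Qed.

Lemma L1_le f g : measurable_fun D f -> L1 g -> (forall x, D x -> `|f x| <= g x) -> L1 f.
Proof.
move=> mf Lg fg; apply: le_integrable Lg => //; first exact/measurable_EFinP.
by move=> x Dx; rewrite /= lee_fin (le_trans (fg _ Dx))// ler_norm.
Qed.

Lemma L1_bndM f g : bnd f -> L1 g -> L1 (fun x => f x * g x).
Proof.
move=> [mf [C C0 fC]] Lg; apply: (@L1_le _ (fun x => C * `|g x|)).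
- by apply: measurable_funM => //; exact: L1_measurable.
- by apply: L1Z; exact: L1_abs.
- by move=> x Dx; rewrite normrM ler_wpM2r// fC.
Qed.

Lemma L1_Mbnd f g : L1 f -> bnd g -> L1 (fun x => f x * g x).
Proof. by move=> Lf bg; apply: (L1_ext (L1_bndM bg Lf)) => x _; rewrite mulrC. Qed.

Lemma L1_bnd f : (m D < +oo)%E -> bnd f -> L1 f.
Proof.
move=> mfin [mf [C C0 fC]]; apply: measurable_bounded_integrable => //.
by exists C; split=> [|M CM x /=]; [exact: num_real|move=> /fC /le_trans; apply; exact: ltW].
Qed.

Lemma bnd_ext f g : bnd f -> (forall x, D x -> f x = g x) -> bnd g.
Proof.
move=> [mf [C C0 fC]] fg; split; first exact: measurable_ext mf fg.
by exists C => // x Dx; rewrite -fg// fC.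
Qed.

Lemma bnd_cst k : bnd (fun=> k).
Proof. by split; [exact: measurable_cst|exists `|k|]. Qed.

Lemma bndD f g : bnd f -> bnd g -> bnd (fun x => f x + g x).
Proof.
move=> [mf [C C0 fC]] [mg [C' C'0 gC]]; split; first exact: measurable_funD.
exists (C + C') => [|x Dx]; first exact: addr_ge0.
by rewrite (le_trans (ler_normD _ _))// lerD ?fC ?gC.
Qed.

Lemma bndM f g : bnd f -> bnd g -> bnd (fun x => f x * g x).
Proof.
move=> [mf [C C0 fC]] [mg [C' C'0 gC]]; split; first exact: measurable_funM.
exists (C * C') => [|x Dx]; first exact: mulr_ge0.
by rewrite normrM ler_pM ?fC ?gC.
Qed.

Lemma bndZ k f : bnd f -> bnd (fun x => k * f x).
Proof. by move=> bf; apply: bndM => //; exact: bnd_cst. Qed.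

Lemma bndN f : bnd f -> bnd (fun x => - f x).
Proof. by move=> bf; apply: (bnd_ext (bndZ (-1) bf)) => x _; rewrite mulN1r. Qed.

Lemma bndB f g : bnd f -> bnd g -> bnd (fun x => f x - g x).
Proof. by move=> bf bg; apply: bndD => //; exact: bndN. Qed.

Lemma bnd_sum (I : Type) (r : seq I) (P : pred I) (F : I -> X -> R) :
  (forall i, P i -> bnd (F i)) -> bnd (fun x => \sum_(i <- r | P i) F i x).
Proof.
move=> LF; elim: r => [|i r IH].
  by apply: (bnd_ext (bnd_cst 0)) => x _; rewrite big_nil.
case Pi: (P i); last by apply: (bnd_ext IH) => x _; rewrite big_cons Pi.
by apply: (bnd_ext (bndD (LF _ Pi) IH)) => x _; rewrite big_cons Pi.
Qed.

Notation I := (fun f => \int[m]_(x in D) f x).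

Lemma int_ext f g : (forall x, D x -> f x = g x) -> I f = I g.
Proof. by move=> fg; apply: eq_Rintegral => x; rewrite inE => /fg. Qed.

Lemma intD f g : L1 f -> L1 g -> I (fun x => f x + g x) = I f + I g.
Proof. exact: RintegralD. Qed.

Lemma intZ k f : L1 f -> I (fun x => k * f x) = k * I f.
Proof. by move=> Lf; exact: RintegralZl. Qed.

Lemma intN f : L1 f -> I (fun x => - f x) = - I f.
Proof.
by move=> Lf; rewrite -mulN1r -intZ//; apply: int_ext => x _; rewrite mulN1r.
Qed.

Lemma intB f g : L1 f -> L1 g -> I (fun x => f x - g x) = I f - I g.
Proof. exact: RintegralB. Qed.

Lemma int0 : I (fun=> 0) = 0.
Proof. by rewrite -[LHS]/(\int[m]_(x in D) (0 : R)) Rintegral_cst// mul0r. Qed.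

Lemma int_sum (J : Type) (r : seq J) (P : pred J) (F : J -> X -> R) :
  (forall i, P i -> L1 (F i)) ->
  I (fun x => \sum_(i <- r | P i) F i x) = \sum_(i <- r | P i) I (F i).
Proof.
move=> LF; elim: r => [|i r IH].
  by rewrite big_nil -[RHS]int0; apply: int_ext => x _; rewrite big_nil.
rewrite big_cons -IH; case: ifPn => Pi; last first.
  by apply: int_ext => x _; rewrite big_cons (negbTE Pi).
rewrite -intD; [|exact: LF|exact: L1_sum].
by apply: int_ext => x _; rewrite big_cons Pi.
Qed.

Lemma int_le f g : L1 f -> L1 g -> (forall x, D x -> f x <= g x) -> I f <= I g.
Proof. exact: le_Rintegral. Qed.

Lemma int_ge0 f : (forall x, D x -> 0 <= f x) -> 0 <= I f.
Proof. exact: Rintegral_ge0. Qed.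

Lemma int_abs f : L1 f -> `|I f| <= I (fun x => `|f x|).
Proof. exact: le_normr_Rintegral. Qed.

Lemma int_ae f g : measurable_fun D f -> measurable_fun D g ->
  {ae m, forall x, D x -> f x = g x} -> I f = I g.
Proof.
move=> mf mg fg; congr fine; apply: ae_eq_integral => //; try exact/measurable_EFinP.
by apply: filterS fg => x /= H Dx; rewrite H.
Qed.

Lemma L1_ae f g : L1 f -> measurable_fun D g ->
  {ae m, forall x, D x -> f x = g x} -> L1 g.
Proof.
move=> Lf mg fg; apply/integrableP; split; first exact/measurable_EFinP.
have /integrableP[_] := Lf.
suff -> : (\int[m]_(x in D) `|(EFin \o f) x| = \int[m]_(x in D) `|(EFin \o g) x|)%E by [].
apply: ae_eq_integral => //.
- by apply/measurable_EFinP; apply: measurableT_comp => //; exact: L1_measurable.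
- by apply/measurable_EFinP; apply: measurableT_comp.
- by apply: filterS fg => x /= H Dx; rewrite H.
Qed.

(** Replacing [f] by the minimum of [f] and [g], equal to it almost everywhere, reduces the claim to
    a pointwise inequality. *)
Lemma int_ae_le f g : L1 f -> L1 g -> {ae m, forall x, D x -> f x <= g x} -> I f <= I g.
Proof.
move=> Lf Lg fg; have Lmin : L1 (fun x => Num.min (f x) (g x)).
  apply: (@L1_le _ (fun x => `|f x| + `|g x|)).
  - by apply: measurable_minr; exact: L1_measurable.
  - by apply: L1D; exact: L1_abs.
  - by move=> x _; rewrite minEle; case: ifP => _; rewrite ?lerDl ?lerDr.
rewrite (@int_ae f (fun x => Num.min (f x) (g x))).
- by apply: int_le => // x _; rewrite ge_min lexx orbT.
- exact: L1_measurable.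
- exact: L1_measurable.
- by apply: filterS fg => x /= H Dx; rewrite min_l// H.
Qed.

Lemma int_ge0_eq0 f : L1 f -> (forall x, D x -> 0 <= f x) -> I f <= 0 ->
  {ae m, forall x, D x -> f x = 0}.
Proof.
move=> Lf f0 If; have mf := L1_measurable Lf.
have : (\int[m]_(x in D) `|(EFin \o f) x| = 0)%E.
  rewrite (eq_integral (EFin \o f)); last first.
    by move=> x; rewrite inE => Dx; rewrite /= ger0_norm// f0.
  have : I f = 0 by apply/eqP; rewrite eq_le If int_ge0.
  rewrite /Rintegral => /eqP; rewrite fine_eq0; first by move/eqP.
  exact: integrable_fin_num.
move=> /(ae_eq_integral_abs _ mD) H.
have {}H := H ((measurable_EFinP _ _).2 mf).
by apply: filterS H => x /= H Dx; have [] := H Dx.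
Qed.

Lemma int_bndM_le f g C : bnd f -> L1 g -> (forall x, D x -> `|f x| <= C) ->
  `|I (fun x => f x * g x)| <= C * I (fun x => `|g x|).
Proof.
move=> bf Lg fC; rewrite (le_trans (int_abs (L1_bndM bf Lg)))// -intZ; last exact: L1_abs.
apply: int_le; first by apply: L1_abs; exact: L1_bndM.
  by apply: L1Z; exact: L1_abs.
by move=> x Dx; rewrite normrM ler_wpM2r// fC.
Qed.

End Lebesgue.

(** * Density of test functions *)

Section Density.
Context d (X : measurableType d) (R : realType) (m : {measure set X -> \bar R}) (D : set X).
Hypothesis mD : measurable D.
Hypothesis mDfin : (m D < +oo)%E.
Variable C : (X -> R) -> Prop.
Hypothesis C0 : C (fun=> 0).
Hypothesis CD : forall f g, C f -> C g -> C (fun x => f x + g x).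
Hypothesis CZ : forall k f, C f -> C (fun x => k * f x).
Hypothesis CL : forall f, C f -> L1 m D f.

(** Membership in the $L^1(D)$ closure of the linear class [C]. *)
Definition dense_at (f : X -> R) := L1 m D f /\
  forall e, 0 < e -> exists2 g, C g & \int[m]_(x in D) `|f x - g x| <= e.

Lemma dense_at_ext f g : dense_at f -> (forall x, D x -> f x = g x) -> dense_at g.
Proof.
move=> [Lf fC] fg; split; first exact: L1_ext Lf fg.
move=> e /fC[h Ch hf]; exists h => //; apply: le_trans hf.
by rewrite le_eqVlt; apply/orP; left; apply/eqP/esym/int_ext => x Dx; rewrite fg.
Qed.

Lemma dense_at_class f : C f -> dense_at f.
Proof.
move=> Cf; split; first exact: CL.
move=> e e0; exists f => //; rewrite (@int_ext _ _ _ m D _ (fun=> 0)) ?int0 ?ltW//.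
by move=> x _; rewrite subrr normr0.
Qed.

Lemma dense_atZ k f : dense_at f -> dense_at (fun x => k * f x).
Proof.
move=> [Lf fC]; split; first exact: L1Z.
move=> e e0; have k1 : 0 < `|k| + 1 by rewrite ltr_pwDr.
have [|g Cg gf] := fC (e / (`|k| + 1)); first exact: divr_gt0.
exists (fun x => k * g x); first exact: CZ.
rewrite (@int_ext _ _ _ m D _ (fun x => `|k| * `|f x - g x|)); last first.
  by move=> x _; rewrite -normrM mulrBr.
rewrite intZ//; last by apply: L1_abs; apply: L1B => //; exact: CL.
rewrite (le_trans (ler_wpM2l (normr_ge0 _) gf))// mulrCA ger_pMr//.
by rewrite ler_pdivrMr// mul1r lerDl.
Qed.

Lemma dense_atD f g : dense_at f -> dense_at g -> dense_at (fun x => f x + g x).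
Proof.
move=> [Lf fC] [Lg gC]; split; first exact: L1D.
move=> e e0; have e2 : 0 < e / 2 by exact: divr_gt0.
have [f' Cf ff] := fC _ e2; have [g' Cg gg] := gC _ e2.
exists (fun x => f' x + g' x); first exact: CD.
have L1' : L1 m D (fun x => `|f x - f' x|) by apply: L1_abs; apply: L1B => //; exact: CL.
have L2' : L1 m D (fun x => `|g x - g' x|) by apply: L1_abs; apply: L1B => //; exact: CL.
rewrite [e]splitr (le_trans _ (lerD ff gg))// -intD//; apply: int_le => //.
- exact: (L1_abs (L1B mD (L1D mD Lf Lg) (L1D mD (CL Cf) (CL Cg)))).
- exact: L1D.
- by move=> x _; rewrite opprD addrACA ler_normD.
Qed.

Lemma dense_atB f g : dense_at f -> dense_at g -> dense_at (fun x => f x - g x).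
Proof.
move=> df dg; apply: (dense_at_ext (dense_atD df (dense_atZ (-1) dg))) => x _.
by rewrite mulN1r.
Qed.

Lemma dense_at_sum (I : Type) (r : seq I) (P : pred I) (F : I -> X -> R) :
  (forall i, P i -> dense_at (F i)) -> dense_at (fun x => \sum_(i <- r | P i) F i x).
Proof.
move=> LF; elim: r => [|i r IH].
  by apply: (dense_at_ext (dense_at_class C0)) => x _; rewrite big_nil.
case Pi: (P i); last by apply: (dense_at_ext IH) => x _; rewrite big_cons Pi.
by apply: (dense_at_ext (dense_atD (LF _ Pi) IH)) => x _; rewrite big_cons Pi.
Qed.

Lemma dense_at_closed f : L1 m D f ->
  (forall e, 0 < e -> exists2 g, dense_at g & \int[m]_(x in D) `|f x - g x| <= e) -> dense_at f.
Proof.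
move=> Lf fC; split=> // e e0; have e2 : 0 < e / 2 by exact: divr_gt0.
have [g [Lg gC] fg] := fC _ e2; have [h Ch gh] := gC _ e2; exists h => //.
have L1' : L1 m D (fun x => `|f x - g x|) by apply: L1_abs; exact: L1B.
have L2' : L1 m D (fun x => `|g x - h x|) by apply: L1_abs; apply: L1B => //; exact: CL.
rewrite [e]splitr (le_trans _ (lerD fg gh))// -intD//; apply: int_le => //.
- by apply: L1_abs; apply: L1B => //; exact: CL.
- exact: L1D.
- by move=> x _; rewrite -[f x - h x](subrKA (g x)) ler_normD.
Qed.

(** On a set of finite measure the constant [k] is an integrable majorant, so bounded pointwise
    limits are $L^1$ limits. *)
Lemma dense_at_dominated (f : X -> R) (F : nat -> X -> R) (k : R) :
  measurable_fun D f -> (forall n, dense_at (F n)) ->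
  (forall n x, D x -> `|F n x| <= k) ->
  {ae m, forall x, D x -> F n x @[n --> \oo] --> f x} -> dense_at f.
Proof.
move=> mf dF Fk Ff.
have mF n : measurable_fun D (EFin \o F n).
  by have [LF _] := dF n; apply/measurable_EFinP; exact: L1_measurable LF.
have mf' : measurable_fun D (EFin \o f) by exact/measurable_EFinP.
have Ff' : {ae m, forall x, D x -> (EFin \o F n) x @[n --> \oo] --> (EFin \o f) x}.
  by apply: filterS Ff => x H /H /= {}H; apply: cvg_EFin => //; near=> n.
have Ik : m.-integrable D (EFin \o (fun=> k)) by exact: (L1_bnd mD mDfin (bnd_cst D k)).
have Fk' : {ae m, forall x n, D x -> (`|(EFin \o F n) x| <= (EFin \o (fun=> k)) x)%E}.
  by apply: aeW => x n Dx; rewrite lee_fin Fk.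
have [Lf I0 _] := dominated_convergence mD mF mf' Ff' Ik Fk'.
apply: dense_at_closed => // e e0.
have /fine_cvgP[_ /cvgrPdist_lt/(_ _ e0)[N _ HN]] := I0.
exists (F N); first exact: dF.
have := HN N (leqnn N); rewrite /= sub0r normrN.
set u := fine _ => ue; rewrite (le_trans _ (ltW (le_lt_trans (ler_norm _) ue)))//.
rewrite /u le_eqVlt; apply/orP; left; apply/eqP; congr fine.
by apply: eq_integral => x _ /=; rewrite distrC.
Unshelve. all: by end_near. Qed.

(** Monotone class argument in one coordinate [p], the constraints on the other coordinates being
    frozen in [B]: the sets whose indicator lies in the closure form a Dynkin system, by linearity
    and bounded convergence. *)
Lemma dense_at_dynkin d' (Y : measurableType d') (p : X -> Y) (B : set X) (G : set (set Y)) :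
  measurable_fun setT p -> measurable B -> @measurable _ Y = <<s G >> -> setI_closed G ->
  dense_at \1_B -> (forall A, G A -> dense_at \1_(p @^-1` A `&` B)) ->
  forall A, measurable A -> dense_at \1_(p @^-1` A `&` B).
Proof.
move=> mp mB mE GI dB dG A; rewrite mE => GA.
pose P (A : set Y) := dense_at \1_(p @^-1` A `&` B).
have mpA S : measurable S -> measurable (p @^-1` S `&` B).
  by move=> mS; apply: measurableI => //; rewrite -[p @^-1` S]setTI; exact: mp.
have indB S : \1_(p @^-1` (~` S) `&` B) = (fun x => \1_B x - \1_(p @^-1` S `&` B) x) :> (X -> R).
  apply/funext => x; rewrite !indicE.
  have [Bx|Bx] := pselect (B x); have [Sx|Sx] := pselect (S (p x)).
  - by rewrite memNset ?(mem_set Bx) ?mem_set ?subrr// => -[].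
  - have -> : (x \in p @^-1` (~` S) `&` B) = true by exact: mem_set.
    have -> : (x \in p @^-1` S `&` B) = false by apply: memNset => -[].
    by rewrite (mem_set Bx) subr0.
  - by rewrite !memNset ?subr0// => -[].
  - by rewrite !memNset ?subr0// => -[].
apply: (@dynkin_induction _ Y G P mE GI) GA.
- by rewrite /P preimage_setT setTI.
- exact: dG.
- by move=> S mS PS; rewrite /P indB; exact: dense_atB.
move=> F mF tF PF; rewrite /P.
apply: (@dense_at_dominated _ (fun n x => \sum_(i < n) \1_(p @^-1` F i `&` B) x) 1).
- apply: measurable_funTS; apply: measurable_indic; apply: mpA; exact: bigcup_measurable.
- by move=> n; apply: dense_at_sum => i _; exact: PF.
- move=> n x _; have [[i Fi]|nF] := pselect (exists i : 'I_n, F i (p x)).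
    rewrite (bigD1 i)//= big1 ?addr0 => [|j ji].
      by rewrite indicE; case: (_ \in _); rewrite ?normr1 ?normr0.
    rewrite indicE memNset// => -[/= Fj _]; move: ji; apply/negP; rewrite negbK.
    apply/eqP/val_inj; apply: tF => //.
    by exists (p x).
  rewrite big1 ?normr0// => i _; rewrite indicE memNset// => -[Fi _].
  by apply: nF; exists i.
- apply: aeW => x _; rewrite indicE.
  have [[[i _ Fi] Bx]|nF] := pselect ((p @^-1` (\bigcup_k F k) `&` B) x).
    rewrite mem_set//; last by split => //; exists i.
    apply: (@cvg_trans _ ((fun=> 1 : R) @ \oo)); last exact: cvg_cst.
    apply: near_eq_cvg; near=> n.
    have ni : (i < n)%N by near: n; exact: nbhs_infty_gt.
    rewrite (bigD1 (Ordinal ni))//= big1 ?addr0 => [|j ji]; first by rewrite indicE mem_set.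
    rewrite indicE memNset// => -[/= Fj _]; move: ji; apply/negP; rewrite negbK.
    apply/eqP/val_inj; apply: tF => //.
    by exists (p x).
  rewrite memNset//; apply: (@cvg_trans _ ((fun=> 0 : R) @ \oo)); last exact: cvg_cst.
  apply: near_eq_cvg; near=> n; rewrite big1// => i _; rewrite indicE memNset// => -[Fi Bx].
  by apply: nF; split => //; exists i.
Unshelve. all: by end_near. Qed.

Import HBSimple.

Lemma dense_at_L1 f : (forall A, measurable A -> dense_at \1_A) -> L1 m D f -> dense_at f.
Proof.
move=> dA Lf; apply: dense_at_closed => // e e0.
have [g_ [Lg _ g0]] := approximation_sfun_integrable mD Lf.
have /fine_cvgP[_ /cvgrPdist_lt/(_ _ e0)[N _ HN]] := g0.
exists (g_ N).
  have : dense_at (fun x => \sum_(y <- fset_set (range (g_ N))) y * \1_(g_ N @^-1` [set y]) x).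
    apply: dense_at_sum => y _; apply: dense_atZ; apply: dA.
    exact: measurable_sfunP.
  by move/dense_at_ext; apply => x _; rewrite fimfunE fsbig_finite.
have := HN N (leqnn N); rewrite /= sub0r normrN.
set u := fine _ => ue; rewrite (le_trans _ (ltW (le_lt_trans (ler_norm _) ue)))//.
Qed.

End Density.

(** * Density of product test functions in space-time *)

Section SpaceTimeDensity.
Context {R : realType}.
Notation lebT := (measurableTypeR R).
Notation lebT4 := (lebT * lebT * lebT * lebT)%type.

Definition L1Q (T : R) (f : stime R -> R) := L1 leb4 (QT T) f.
Definition bndQ (T : R) (f : stime R -> R) := bnd (QT T : set lebT4) f.

Lemma bndQP (T : R) (f : stime R -> R) (C : R) :
  measurable_fun (QT T) f -> (forall z, QT T z -> `|f z| <= C) -> bndQ T f.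
Proof.
move=> mf fC; split; first exact: mf.
by exists `|C| => // z Qz; rewrite (le_trans (fC z Qz))// ler_norm.
Qed.

Lemma Sm_bndQ (T : R) (f : stime R -> R) : Sm f -> bndQ T f.
Proof.
move=> sf; have [C C0 fC] := Sm_bounded T sf.
apply: (@bndQP _ _ C); last by move=> z [_ zT]; exact: fC.
by apply: measurable_funS (Sm_measurable sf) => //; exact: measurableT.
Qed.

Lemma bndQ_L1Q (T : R) (f : stime R -> R) : bndQ T f -> L1Q T f.
Proof.
move=> bf; have := @L1_bnd _ _ _ leb4 (QT T) (measurable_QT T) f (leb4_QT T) bf.
exact.
Qed.

Lemma Sm_L1Q (T : R) (f : stime R -> R) : Sm f -> L1Q T f.
Proof. by move=> sf; apply: bndQ_L1Q; exact: Sm_bndQ. Qed.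

Definition time_supported (T : R) (f : stime R -> R) :=
  (exists2 t0, 0 < t0 & forall z, z.2 <= t0 -> f z = 0) /\
  (exists2 T', T' < T & forall z, T' <= z.2 -> f z = 0).

Definition SmT_int (T : R) (f : stime R -> R) := Sm f /\ time_supported T f.

Lemma time_supportedD T f g : time_supported T f -> time_supported T g ->
  time_supported T (fun z => f z + g z).
Proof.
move=> [[a a0 fa] [b bT fb]] [[a' a'0 ga] [b' b'T gb]]; split.
  exists (Num.min a a') => [|z]; first by rewrite lt_min a0.
  by rewrite le_min => /andP[? ?]; rewrite fa// ga// addr0.
exists (Num.max b b') => [|z]; first by rewrite gt_max bT.
by rewrite ge_max => /andP[? ?]; rewrite fb// gb// addr0.
Qed.

Lemma time_supportedM T f g : time_supported T f -> time_supported T (fun z => f z * g z).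
Proof.
move=> [[a a0 fa] [b bT fb]]; split.
  by exists a => // z /fa ->; rewrite mul0r.
by exists b => // z /fb ->; rewrite mul0r.
Qed.

Lemma SmT_int_test T f : SmT_int T f -> test_int T f.
Proof.
move=> [sf [[a a0 fa] [b bT fb]]]; split; last by exists a => // x t; exact: (fa (x, t)).
split; [exact: Sm_smooth|exact: Sm_periodic|].
by exists b => // x t; exact: (fb (x, t)).
Qed.

(** The second factor of [h], $S(n(1-s))$, switches the approximation off near 1: the function then
    vanishes near both ends of the cell and can be periodized, while in the limit only $s=1$,
    outside the cell, is affected. For $a<0$ the ray contains the cell and the constant 1 serves. *)
Lemma ray_approx (a : R) : exists g : nat -> R -> R, [/\ forall n, smooth1 (g n),
  forall n, per1 (g n), forall n s, `|g n s| <= 1 &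
  forall s, 0 <= s < 1 -> g n s @[n --> \oo] --> (\1_(`]a, +oo[%classic) s : R)].
Proof.
have [S [S' [sS dS S0 S1 [S01 _ _ _ _]]]] := @step_exists R.
have S_norm s : `|S s| <= 1 by have /andP[? ?] := S01 s; rewrite ger0_norm.
have [a0|a0] := ltP a 0.
  exists (fun _ _ => 1); split => //.
  - by move=> n; exact: smooth1_cst.
  - by move=> n s; rewrite normr1.
  - move=> s /andP[s0 _]; rewrite indicE mem_set; first exact: cvg_cst.
    by rewrite /= in_itv/= andbT (lt_le_trans a0).
pose h (n : nat) s := S (n%:R * s + (- (n%:R * a))) * S ((- n%:R) * s + n%:R).
have hs n : smooth1 (h n) by apply: smooth1M; exact: smooth1_affine.
(* Below this threshold $n s\le 1/3$, the range on which [S] vanishes; the estimate near 1 uses the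
   same margin for $n(1-s)$. *)
have h0 n s : s < (n.+1%:R)^-1 / 3 -> h n s = 0.
  move=> sn; rewrite /h S0 ?mul0r//.
  have [->|n0] := eqVneq n 0%N; first by rewrite !mul0r oppr0 addr0.
  have n1 : 0 < n%:R :> R by rewrite ltr0n lt0n.
  have [s0|s0] := ltP s 0.
    by rewrite (le_trans _ (_ : 0 <= 3^-1))//; nra.
  have : n%:R * s <= 3^-1.
    rewrite (le_trans (ler_wpM2l (ltW n1) (ltW sn)))// mulrA ler_pdivrMr// mulVf//.
    by rewrite ler_pdivrMr ?ltr0n// mul1r ler_nat.
  by nra.
have h1 n s : 1 - (n.+1%:R)^-1 / 3 < s -> h n s = 0.
  move=> sn; rewrite /h [X in _ * X]S0 ?mulr0//.
  have : n%:R * (1 - s) <= 3^-1.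
    have [s1|s1] := leP s 1; last by apply: (@le_trans _ _ 0) => //; rewrite mulr_ge0_le0// subr_le0 ltW.
    have sn' : 1 - s <= n.+1%:R^-1 / 3 by rewrite lerBlDr -lerBlDl ltW.
    rewrite (le_trans (ler_wpM2l (ler0n _ _) sn'))//.
    rewrite mulrA ler_pdivrMr// mulVf//.
    by rewrite ler_pdivrMr ?ltr0n// mul1r ler_nat.
  by nra.
exists (fun n => h n \o frac); split.
- move=> n; apply: (@smooth1_frac _ _ 0 (n.+1%:R^-1 / 3)); rewrite ?divr_gt0//.
    exact: h0.
  exact: h1.
- by move=> n s; rewrite /= fracD1.
- by move=> n s; rewrite /= normrM mulr_ile1.
move=> s s01; rewrite /= frac_id//; have /andP[s0 s1] := s01.
rewrite indicE; have [sa|sa] := ltP a s; last first.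
  rewrite memNset; last by rewrite /= in_itv/= andbT; apply/negP; rewrite -leNgt.
  apply: (@cvg_trans _ ((fun=> 0 : R) @ \oo)); last exact: cvg_cst.
  apply: near_eq_cvg; near=> n; rewrite /h S0 ?mul0r// (le_trans _ (_ : 0 <= 3^-1))//.
  by rewrite -mulrBr mulr_ge0_le0// subr_le0.
rewrite mem_set; last by rewrite /= in_itv/= andbT.
apply: (@cvg_trans _ ((fun=> 1 : R) @ \oo)); last exact: cvg_cst.
have sa0 : 0 < s - a by rewrite subr_gt0.
have s10 : 0 < 1 - s by rewrite subr_gt0.
apply: near_eq_cvg; near=> n; rewrite /h !S1 ?mulr1//.
  rewrite mulNr addrC -[X in _ <= X - _]mulr1 -mulrBr -ler_pdivrMr//; near: n.
  exact: nbhs_infty_ger.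
rewrite -mulrBr -ler_pdivrMr//; near: n.
exact: nbhs_infty_ger.
Unshelve. all: by end_near. Qed.

(** The approximants must be supported inside the open time interval, so the ray is started at
    $\max(a,0)$ and cut off before [T]. Convergence may fail at the two end times, which are null
    slices. *)
Lemma ray_approx_time (T a : R) : 0 < T -> exists g : nat -> R -> R,
  [/\ forall n, smooth1 (g n), forall n, time_supported T (fun z => g n z.2),
   forall n s, `|g n s| <= 1 &
  forall s, 0 < s < T -> g n s @[n --> \oo] --> (\1_(`]a, +oo[%classic) s : R)].
Proof.
move=> T0.
have [S [S' [sS dS S0 S1 [S01 _ _ _ _]]]] := @step_exists R.
have S_norm s : `|S s| <= 1 by have /andP[? ?] := S01 s; rewrite ger0_norm.
pose b := Num.max a 0.
have b0 : 0 <= b by rewrite le_max lexx orbT.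
pose h (n : nat) s := S (n.+1%:R * s + (- (n.+1%:R * b))) * S ((- n.+1%:R) * s + n.+1%:R * T).
exists h; split.
- by move=> n; apply: smooth1M; exact: smooth1_affine.
- move=> n; have n0 : 0 < n.+1%:R :> R by rewrite ltr0n.
  have i0 : 0 < (n.+1%:R^-1 / 3 : R) by rewrite divr_gt0.
  have nV : n.+1%:R * (n.+1%:R^-1 / 3) = 3^-1 :> R by rewrite mulrA mulfV ?mul1r// gt_eqF.
  split.
    exists (n.+1%:R^-1 / 3) => // z zs; rewrite /h S0 ?mul0r//.
    by have := ler_wpM2l (ltW n0) zs; rewrite nV; nra.
  exists (T - n.+1%:R^-1 / 3) => [|z zs]; first by rewrite ltrBlDr ltrDl.
  rewrite /h [X in _ * X]S0 ?mulr0//.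
  have : T - z.2 <= n.+1%:R^-1 / 3 by rewrite lerBlDr -lerBlDl.
  by move=> /(ler_wpM2l (ltW n0)); rewrite nV; nra.
- by move=> n s; rewrite /h normrM mulr_ile1.
move=> s /andP[s0 sT].
rewrite indicE; have [sa|sa] := ltP b s; last first.
  have as_ : s <= a by move: sa; rewrite le_max leNgt orbC leNgt s0/= -leNgt.
  rewrite memNset; last by rewrite /= in_itv/= andbT; apply/negP; rewrite -leNgt.
  apply: (@cvg_trans _ ((fun=> 0 : R) @ \oo)); last exact: cvg_cst.
  apply: near_eq_cvg; near=> n; rewrite /h S0 ?mul0r// (le_trans _ (_ : 0 <= 3^-1))//.
  by rewrite -mulrBr mulr_ge0_le0// subr_le0.
rewrite mem_set; last by rewrite /= in_itv/= andbT; move: sa; rewrite gt_max => /andP[].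
apply: (@cvg_trans _ ((fun=> 1 : R) @ \oo)); last exact: cvg_cst.
have sa0 : 0 < s - b by rewrite subr_gt0.
have s10 : 0 < T - s by rewrite subr_gt0.
apply: near_eq_cvg; near=> n; rewrite /h !S1 ?mulr1//.
  rewrite mulNr addrC -mulrBr -ler_pdivrMr//.
  apply: (@le_trans _ _ n%:R); last by rewrite ler_nat.
  by near: n; exact: nbhs_infty_ger.
rewrite -mulrBr -ler_pdivrMr//.
apply: (@le_trans _ _ n%:R); last by rewrite ler_nat.
by near: n; exact: nbhs_infty_ger.
Unshelve. all: by end_near. Qed.

Lemma ae_open_time (T : R) : {ae leb4, forall z, QT T z -> 0 < z.2 < T}.
Proof.
have slice (s : R) : leb4 ((cell : set (xspace R)) `*` [set s]) = 0%E.
  rewrite /leb4 product_measure1E; [|exact: measurable_cell|exact: measurable_set1].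
  have e := @lebesgue_measure_set1 R s.
  by rewrite [X in (_ * X)%E]e mule0.
have neg (s : R) : leb4.-negligible ((cell : set (xspace R)) `*` [set s]).
  exists ((cell : set (xspace R)) `*` [set s]); split; [|exact: slice|by []].
  by apply: measurableX; [exact: measurable_cell|exact: measurable_set1].
apply: (negligibleS _ (negligibleU (neg 0) (neg T))).
move=> z /= /not_implyP[[cz /andP[z0 zT]] nz].
move: nz; rewrite !lt_neqAle z0 zT !andbT => /negP; rewrite negb_and !negbK.
by move=> /orP[/eqP e|/eqP e]; [left|right]; split => //=.
Qed.

Lemma dense_at_box (T a0 a1 a2 a3 : R) : 0 < T ->
  dense_at leb4 (QT T) (SmT_int T) (\1_[set z : lebT4 |
    [/\ z.1.1.1 \in `]a0, +oo[%classic, z.1.1.2 \in `]a1, +oo[%classic,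
       z.1.2 \in `]a2, +oo[%classic & z.2 \in `]a3, +oo[%classic]]).
Proof.
move=> T0; have [g0 [s0 p0 b0 l0]] := ray_approx a0; have [g1 [s1 p1 b1 l1]] := ray_approx a1.
have [g2 [s2 p2 b2 l2]] := ray_approx a2; have [g3 [s3 u3 b3 l3]] := ray_approx_time a3 T0.
have Ssup f : SmT_int T f -> L1 leb4 (QT T) f by move=> [sf _]; exact: Sm_L1Q.
pose F n (z : stime R) := g0 n z.1.1.1 * g1 n z.1.1.2 * g2 n z.1.2 * g3 n z.2.
have SF n : SmT_int T (F n).
  split; first exact: SmT.
  have [[c c0 hc] [d dT hd]] := u3 n; split.
    by exists c => // z zc; rewrite /F hc ?mulr0.
  by exists d => // z zc; rewrite /F hd ?mulr0.
have -> : \1_[set z : lebT4 |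
    [/\ z.1.1.1 \in `]a0, +oo[%classic, z.1.1.2 \in `]a1, +oo[%classic,
       z.1.2 \in `]a2, +oo[%classic & z.2 \in `]a3, +oo[%classic]] =
    (fun z : lebT4 => \1_(`]a0, +oo[%classic) z.1.1.1 * \1_(`]a1, +oo[%classic) z.1.1.2 *
       \1_(`]a2, +oo[%classic) z.1.2 * \1_(`]a3, +oo[%classic) z.2) :> (lebT4 -> R).
  apply/funext => z; rewrite !indicE -!natrM !mulnb; congr (_ %:R); congr nat_of_bool.
  by apply/idP/idP; rewrite inE/=; [case=> -> -> -> ->|move=> /andP[/andP[/andP[]]]].
have mray (a : R) : measurable_fun setT (\1_(`]a, +oo[%classic) : lebT -> R).
  by apply: measurable_indic; exact: measurable_itv.
apply: (@dense_at_dominated _ _ _ leb4 (QT T) (measurable_QT T) (leb4_QT T) (SmT_int T) Ssup _ F 1).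
- apply: measurable_funTS; apply: measurable_funM; [apply: measurable_funM; [apply: measurable_funM|]|].
  + exact: (measurableT_comp (mray a0) (measurableT_comp measurable_fst (measurableT_comp measurable_fst measurable_fst))).
  + exact: (measurableT_comp (mray a1) (measurableT_comp measurable_snd (measurableT_comp measurable_fst measurable_fst))).
  + exact: (measurableT_comp (mray a2) (measurableT_comp measurable_snd measurable_fst)).
  + exact: (measurableT_comp (mray a3) measurable_snd).
- by move=> n; apply: dense_at_class => //; exact: measurable_QT.
- by move=> n z _; rewrite /F !normrM !mulr_ile1// !mulr_ge0.
- apply: (ae_imp (ae_open_time T)) => z H Qz; have zT := H Qz; have [[z0 z1 z2] _] := Qz.
  by apply: cvgM; [apply: cvgM; [apply: cvgM|]|]; [exact: l0|exact: l1|exact: l2|exact: l3].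
Qed.

Lemma measurableT_ray : @measurable _ lebT = <<s @RGenOInfty.G R >>.
Proof. exact: RGenOInfty.measurableE. Qed.

Lemma ray_setI : setI_closed (@RGenOInfty.G R).
Proof.
move=> _ _ [a ->] [b ->]; exists (Num.max a b); apply/seteqP; split=> x /=;
  rewrite !in_itv/= !andbT gt_max; first by case=> -> ->.
by case/andP.
Qed.

Lemma prod_setI d1 d2 (X : measurableType d1) (Y : measurableType d2) :
  setI_closed [set A `*` B | A in @measurable _ X & B in @measurable _ Y].
Proof.
move=> _ _ [A mA [B mB <-]] [A' mA' [B' mB' <-]]; rewrite -setXI.
by exists (A `&` A'); [exact: measurableI|exists (B `&` B') => //; exact: measurableI].
Qed.

(** Monotone classes one factor at a time: boxes of rays are approximated explicitly, then a ray is
    replaced by a Borel set in each coordinate, and rectangles by Borel sets of the products of the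
    coordinates already treated. Indicators of Borel sets give all integrable functions through
    simple functions. *)
Lemma L1Q_dense (T : R) (f : stime R -> R) : 0 < T -> L1Q T f ->
  forall e, 0 < e -> exists2 g, SmT_int T g & \int[leb4]_(z in QT T) `|f z - g z| <= e.
Proof.
move=> T0 Lf; pose Dn (A : set lebT4) := dense_at leb4 (QT T) (SmT_int T) \1_A.
have Ssup g : SmT_int T g -> L1 leb4 (QT T) g by move=> [sg _]; exact: Sm_L1Q.
have C0 : SmT_int T (fun=> 0).
  by split; [exact: Sm_cst|split; [exists 1|exists (T - 1) => //; rewrite ltrBlDr ltrDl]].
have CD g h : SmT_int T g -> SmT_int T h -> SmT_int T (fun z => g z + h z).
  by move=> [? ?] [? ?]; split; [exact: SmD|exact: time_supportedD].
have CZ k g : SmT_int T g -> SmT_int T (fun z => k * g z).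
  move=> [sg tg]; split; first exact: SmZ.
  by under eq_fun do rewrite mulrC; exact: time_supportedM.
have mQ : measurable (QT T : set lebT4) by exact: measurable_QT.
have fQ := leb4_QT T.
have ext (A B : set lebT4) : Dn A -> (forall z, QT T z -> A z <-> B z) -> Dn B.
  move=> dA AB; apply: (dense_at_ext mQ dA) => z Qz; rewrite !indicE; congr (nat_of_bool _)%:R.
  by apply/idP/idP; rewrite !inE => /(AB _ Qz).
have dyn d' (Y : measurableType d') (p : lebT4 -> Y) (B : set lebT4) (G : set (set Y)) :
    measurable_fun setT p -> measurable B -> @measurable _ Y = <<s G>> -> setI_closed G ->
    Dn B -> (forall A, G A -> Dn (p @^-1` A `&` B)) ->
    forall A, measurable A -> Dn (p @^-1` A `&` B).
  exact: (dense_at_dynkin mQ fQ C0 CD CZ Ssup).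
have mf1 : measurable_fun setT (fun z : lebT4 => z.1) by exact: measurable_fst.
have mf11 : measurable_fun setT (fun z : lebT4 => z.1.1).
  exact: (measurableT_comp measurable_fst measurable_fst).
have mf111 : measurable_fun setT (fun z : lebT4 => z.1.1.1).
  exact: (measurableT_comp measurable_fst mf11).
have mf112 : measurable_fun setT (fun z : lebT4 => z.1.1.2).
  exact: (measurableT_comp measurable_snd mf11).
have mf12 : measurable_fun setT (fun z : lebT4 => z.1.2).
  exact: (measurableT_comp measurable_snd measurable_fst).
have mf2 : measurable_fun setT (fun z : lebT4 => z.2) by exact: measurable_snd.
have mR (a : R) : measurable (`]a, +oo[%classic : set lebT) by exact: measurable_itv.
have pm d' (Y : measurableType d') (p : lebT4 -> Y) A : measurable_fun setT p -> measurable A ->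
  measurable (p @^-1` A) by move=> mp mA; rewrite -[_ @^-1` _]setTI; exact: mp.
pose ray (a : R) : set lebT := `]a, +oo[%classic.
have x0 (a1 a2 a3 : R) (A : set lebT) : measurable A ->
    Dn ((fun z => z.1.1.1) @^-1` A `&` [set z | [/\ ray a1 z.1.1.2, ray a2 z.1.2 & ray a3 z.2]]).
  have key a0 : Dn ((fun z => z.1.1.1) @^-1` ray a0 `&`
       [set z | [/\ ray a1 z.1.1.2, ray a2 z.1.2 & ray a3 z.2]]).
    apply: (ext _ _ (dense_at_box a0 a1 a2 a3 T0)) => z _.
    by rewrite /= !inE; split; [case=> ? ? ? ?|case=> ? [? ? ?]].
  apply: (dyn _ _ _ _ _ mf111 _ measurableT_ray ray_setI) => //.
  - rewrite (_ : [set _ | _] = (fun z => z.1.1.2) @^-1` ray a1 `&` ((fun z => z.1.2) @^-1` ray a2 `&`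
      (fun z => z.2) @^-1` ray a3)).
      exact: (measurableI _ _ (pm _ _ _ _ mf112 (mR a1)) (measurableI _ _ (pm _ _ _ _ mf12 (mR a2)) (pm _ _ _ _ mf2 (mR a3)))).
    by apply/seteqP; split=> z /=; [case|case=> ? []].
  (* The coordinate is nonnegative on the cell, so the ray from -1 imposes no constraint there and
     stands for the whole line. *)
  - apply: (ext _ _ (key (-1))) => z [[/andP[z0 _] _ _] _]; split; first by case.
    by move=> h; split => //; rewrite /ray /= in_itv/= andbT (lt_le_trans _ z0).
  - by move=> _ [a ->]; exact: key.
have x1 (a2 a3 : R) (A0 A1 : set lebT) : measurable A0 -> measurable A1 ->
    Dn ((fun z => z.1.1.2) @^-1` A1 `&` [set z | [/\ A0 z.1.1.1, ray a2 z.1.2 & ray a3 z.2]]).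
  move=> mA0; move: A1.
  have key a1 : Dn ((fun z => z.1.1.2) @^-1` ray a1 `&`
       [set z | [/\ A0 z.1.1.1, ray a2 z.1.2 & ray a3 z.2]]).
    apply: (ext _ _ (x0 a1 a2 a3 A0 mA0)) => z _.
    by split => /=; [case=> ? [? ? ?]|case=> ? [? ? ?]].
  apply: (dyn _ _ _ _ _ mf112 _ measurableT_ray ray_setI) => //.
  - rewrite (_ : [set _ | _] = (fun z => z.1.1.1) @^-1` A0 `&` ((fun z => z.1.2) @^-1` ray a2 `&`
      (fun z => z.2) @^-1` ray a3)).
      exact: (measurableI _ _ (pm _ _ _ _ mf111 mA0) (measurableI _ _ (pm _ _ _ _ mf12 (mR a2)) (pm _ _ _ _ mf2 (mR a3)))).
    by apply/seteqP; split=> z /=; [case|case=> ? []].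
  - apply: (ext _ _ (key (-1))) => z [[_ /andP[z0 _] _] _]; split; first by case.
    by move=> h; split => //; rewrite /ray /= in_itv/= andbT (lt_le_trans _ z0).
  - by move=> _ [a ->]; exact: key.
have x01 (a2 a3 : R) (A : set (lebT * lebT)%type) : measurable A ->
    Dn ((fun z => z.1.1) @^-1` A `&` [set z | ray a2 z.1.2 /\ ray a3 z.2]).
  move: A; apply: (dyn _ _ _ _ _ mf11 _ (measurable_prod_measurableType lebT lebT) (@prod_setI _ _ lebT lebT)) => //.
  - by apply: (measurableI _ _ (pm _ _ _ _ mf12 (mR a2)) (pm _ _ _ _ mf2 (mR a3))).
  - apply: (ext _ _ (x1 a2 a3 setT setT measurableT measurableT)) => z _.
    by split => /=; [case=> ? []|case].
  - move=> _ [A0 mA0 [A1 mA1 <-]]; apply: (ext _ _ (x1 a2 a3 A0 A1 mA0 mA1)) => z _.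
    by split => /=; [case=> ? []|case=> -[? ?] []].
have x2 (a3 : R) (A : set (lebT * lebT)%type) (A2 : set lebT) : measurable A -> measurable A2 ->
    Dn ((fun z => z.1.2) @^-1` A2 `&` [set z | A z.1.1 /\ ray a3 z.2]).
  move=> mA; move: A2.
  have key a2 : Dn ((fun z => z.1.2) @^-1` ray a2 `&` [set z | A z.1.1 /\ ray a3 z.2]).
    by apply: (ext _ _ (x01 a2 a3 A mA)) => z _; split => /=; [case=> ? []|case=> ? []].
  apply: (dyn _ _ _ _ _ mf12 _ measurableT_ray ray_setI) => //.
  - by apply: (measurableI _ _ (pm _ _ _ _ mf11 mA) (pm _ _ _ _ mf2 (mR a3))).
  - apply: (ext _ _ (key (-1))) => z [[_ _ /andP[z0 _]] _]; split; first by case.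
    by move=> h; split => //; rewrite /ray /= in_itv/= andbT (lt_le_trans _ z0).
  - by move=> _ [a ->]; exact: key.
have x012 (a3 : R) (A : set (lebT * lebT * lebT)%type) : measurable A ->
    Dn ((fun z => z.1) @^-1` A `&` (fun z => z.2) @^-1` ray a3).
  move: A; apply: (dyn _ _ _ _ _ mf1 _ (measurable_prod_measurableType (lebT * lebT)%type lebT)
     (@prod_setI _ _ (lebT * lebT)%type lebT)) => //.
  - exact: pm mf2 (mR a3).
  - apply: (ext _ _ (x2 a3 setT setT measurableT measurableT)) => z _.
    by split => /=; [case=> ? []|].
  - move=> _ [A0 mA0 [A1 mA1 <-]]; apply: (ext _ _ (x2 a3 A0 A1 mA0 mA1)) => z _.
    by split => /=; [case=> ? []|case=> -[? ?]].
have x3 (A : set (lebT * lebT * lebT)%type) (A3 : set lebT) : measurable A -> measurable A3 ->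
    Dn ((fun z => z.2) @^-1` A3 `&` (fun z => z.1) @^-1` A).
  move=> mA; move: A3.
  have key a3 : Dn ((fun z => z.2) @^-1` ray a3 `&` (fun z => z.1) @^-1` A).
    by apply: (ext _ _ (x012 a3 A mA)) => z _; split => /=; case.
  apply: (dyn _ _ _ _ _ mf2 _ measurableT_ray ray_setI) => //.
  - exact: pm mf1 mA.
  - apply: (ext _ _ (key (-1))) => z [_ /andP[z0 _]]; split; first by case.
    by move=> h; split => //; rewrite /ray /= in_itv/= andbT (lt_le_trans _ z0).
  - by move=> _ [a ->]; exact: key.
have xall (A : set lebT4) : measurable A -> Dn A.
  move=> mA; apply: (ext (id @^-1` A `&` setT)); last by move=> z _; split; [case|].
  move: A mA; apply: (dyn _ _ _ _ _ (@measurable_id _ _ _) _ (measurable_prod_measurableType (lebT * lebT * lebT)%type lebT)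
     (@prod_setI _ _ (lebT * lebT * lebT)%type lebT)) => //.
  - by apply: (ext _ _ (x3 setT setT measurableT measurableT)) => z _; split.
  - move=> _ [A0 mA0 [A1 mA1 <-]]; apply: (ext _ _ (x3 A0 A1 mA0 mA1)) => z _.
    by split => /=; [case|case=> -[? ?]].
have [_ df] := dense_at_L1 mQ C0 CD CZ Ssup xall Lf.
exact: df.
Qed.

End SpaceTimeDensity.

(** * Approximation of Lipschitz functions *)

Section Approximation.
Context {R : realType}.

Section Convex.
Context {I : finType} (K : I -> R).
Hypothesis K0 : forall k, 0 <= K k.
Hypothesis K1 : \sum_k K k = 1.

Lemma convex_le (u : I -> R) (b : R) : (forall k, u k <= b) -> \sum_k u k * K k <= b.
Proof.
move=> ub; rewrite -[b]mulr1 -K1 mulr_sumr; apply: ler_sum => k _.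
by rewrite ler_wpM2r.
Qed.

Lemma convex_ge (u : I -> R) (b : R) : (forall k, b <= u k) -> b <= \sum_k u k * K k.
Proof.
move=> ub; rewrite -[b in b <= _]mulr1 -K1 mulr_sumr; apply: ler_sum => k _.
by rewrite ler_wpM2r.
Qed.

Lemma convex_abs (u : I -> R) (b : R) : (forall k, `|u k| <= b) -> `|\sum_k u k * K k| <= b.
Proof.
move=> ub; rewrite ler_norml; apply/andP; split.
  by apply: convex_ge => k; have := ub k; rewrite ler_norml => /andP[].
by apply: convex_le => k; have := ub k; rewrite ler_norml => /andP[].
Qed.

Lemma convex_dist (u v : I -> R) (b : R) : (forall k, `|u k - v k| <= b) ->
  `|\sum_k u k * K k - \sum_k v k * K k| <= b.
Proof.
move=> uv; rewrite -sumrB.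
under eq_bigr do rewrite -mulrBl.
exact: convex_abs.
Qed.

End Convex.

Lemma has_deriv_sum (I : finType) (F F' : I -> R -> R) :
  (forall i, has_deriv (F i) (F' i)) ->
  has_deriv (fun s => \sum_i F i s) (fun s => \sum_i F' i s).
Proof.
move=> FF'; elim: (index_enum I) => [|i r IH].
  have -> : (fun s => \sum_(i <- [::]) F i s) = (fun=> 0) by apply/funext => s; rewrite big_nil.
  by move=> s; rewrite big_nil; exact: has_deriv_cst.
have -> : (fun s => \sum_(j <- i :: r) F j s) = (fun s => F i s + \sum_(j <- r) F j s).
  by apply/funext => s; rewrite big_cons.
by move=> s; rewrite big_cons; exact: (has_derivD (FF' i) IH).
Qed.

(** Summation by parts. It moves the difference from the kernels to the nodal values, where the
    Lipschitz constant controls it. *)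
Lemma abel_sum (n : nat) (a t : nat -> R) :
  \sum_(k < n.+1) a k * (t k - t k.+1) =
  a 0%N * t 0%N - a n * t n.+1 + \sum_(k < n) (a k.+1 - a k) * t k.+1.
Proof.
elim: n => [|n IH]; first by rewrite big_ord1 big_ord0 addr0 mulrBr.
by rewrite big_ord_recr IH [in RHS]big_ord_recr/=; ring.
Qed.

(* A smooth partition of unity with nodes k / (n + 1). *)
Lemma unit_kernel : exists2 C : R, 0 <= C & forall n : nat, exists H H' : nat -> R -> R,
  [/\ (forall k, smooth1 (H k)), (forall k, has_deriv (H k) (H' k)),
      (forall k s, 0 <= H k s), (forall s, \sum_(k < n.+2) H k s = 1) &
   [/\ (forall (k : nat) s, 0 <= s <= 1 -> H k s != 0 -> `|k%:R / n.+1%:R - s| <= n.+1%:R^-1),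
      (forall a (M : R) s, (forall k, (k < n.+1)%N -> `|a k.+1 - a k| <= M) ->
         `|\sum_(k < n.+2) a k * H' k s| <= C * n.+1%:R * M) &
      (forall (k : nat) s, (k <= n.+1)%N -> s < n.+1%:R^-1 / 3 -> H k s = (k == 0%N)%:R) /\
      (forall (k : nat) s, (k <= n.+1)%N -> 1 - n.+1%:R^-1 / 3 < s -> H k s = (k == n.+1)%:R)]].
Proof.
have [S [S' [sS dS S0 S1 [S01 S'0 S'l S'r [C C0 S'C]]]]] := @step_exists R.
exists C => [|n]; first exact: ltW.
have n0 : 0 < n.+1%:R :> R by rewrite ltr0n.
have nn0 : n.+1%:R != 0 :> R by rewrite gt_eqF.
(* A decreasing family from [t 0 = 1] to [t n.+2 = 0]; in between, [t k'.+1] climbs from 0 to 1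
   within the [k']-th grid interval. The kernels are consecutive differences, so they are
   nonnegative and telescope to 1. *)
pose t (k : nat) (s : R) : R := if k is k'.+1 then if (k' < n.+1)%N then S (n.+1%:R * s + - k'%:R) else 0 else 1.
pose t' (k : nat) (s : R) : R := if k is k'.+1 then if (k' < n.+1)%N then S' (n.+1%:R * s + - k'%:R) * n.+1%:R else 0 else 0.
have st k : smooth1 (t k).
  case: k => [|k]; first exact: smooth1_cst.
  by rewrite /t; case: (k < n.+1)%N; [exact: smooth1_affine|exact: smooth1_cst].
have dt_ k : has_deriv (t k) (t' k).
  case: k => [|k]; first exact: has_deriv_cst.
  by rewrite /t /t'; case: (k < n.+1)%N; [exact: has_deriv_affine|exact: has_deriv_cst].
have t01 k s : 0 <= t k s <= 1.
  by case: k => [|k] /=; [rewrite ler01 lexx|case: ifP => _; rewrite ?lexx ?ler01].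
have t_decr k s : t k.+1 s <= t k s.
  case: k => [|k]; first by have /andP[] := t01 1%N s.
  rewrite /t; case: ifP => kn; last by have /andP[] := t01 k.+1 s.
  rewrite (ltnW kn); apply: (has_deriv_ge0_le dS S'0).
  by rewrite lerD2l lerN2 ler_nat.
have tr (k : nat) s : (k.+1 <= n.+1)%N -> n.+1%:R * s <= k%:R + 3^-1 -> t k.+1 s = 0.
  by move=> kn ks; rewrite /t kn S0// lerBlDr addrC.
have tl (k : nat) s : (k.+1 <= n.+1)%N -> k%:R + 2 / 3 <= n.+1%:R * s -> t k.+1 s = 1.
  by move=> kn ks; rewrite /t kn S1// lerBrDr addrC.
exists (fun k s => t k s - t k.+1 s), (fun k s => t' k s - t' k.+1 s); split.
- by move=> k; apply: smooth1D => //; exact: smooth1N.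
- by move=> k; apply: has_derivD => //; exact: has_derivN.
- by move=> k s; rewrite subr_ge0.
- move=> s; have := abel_sum n.+1 (fun=> 1) (fun k => t k s).
  under eq_bigr do rewrite mul1r.
  move=> ->; rewrite big1 => [|k _]; last by rewrite subrr mul0r.
  by rewrite /= ltnn !mulr1 mulr0 subr0 addr0.
split.
- move=> k s /andP[s0 s1] Hk.
  have ns1 : n.+1%:R * s <= n.+1%:R by rewrite ger_pMr.
  have ns0 : 0 <= n.+1%:R * s by rewrite mulr_ge0// ltW.
  suff : `|k%:R - n.+1%:R * s| <= 1.
    move=> H; rewrite -(ler_pM2l n0) mulfV// -[X in X * _]gtr0_norm// -normrM mulrBr.
    by rewrite mulrCA mulfV// mulr1.
  have [kn|kn] := ltnP k n.+2; last first.
    move: Hk; case: k kn => [//|k] kn; rewrite /t.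
    have -> : (k < n.+1)%N = false by apply/negbTE; rewrite -leqNgt -ltnS.
    have -> : (k.+1 < n.+1)%N = false by apply/negbTE; rewrite -leqNgt ltnW.
    by rewrite subrr eqxx.
  rewrite ler_norml; apply/andP; split.
    have [kn'|kn'] := leqP k.+1 n.+1; last first.
      have -> : k = n.+1 by apply/eqP; rewrite eqn_leq -ltnS kn.
      by lra.
    rewrite leNgt; apply/negP => Hlt; move: Hk.
    have e1 : t k.+1 s = 1 by apply: tl => //; lra.
    have /andP[_ e2] := t01 k s; have e3 := t_decr k s.
    by rewrite e1 in e3 *; rewrite subr_eq0 eq_le e2 e3.
  case: k kn Hk => [|k] kn Hk; first by lra.
  rewrite leNgt; apply/negP => Hlt; move: Hk.
  have e1 : t k.+1 s = 0 by apply: tr => //; move: Hlt; rewrite -natr1; lra.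
  have /andP[e2 _] := t01 k.+2 s; have e3 := t_decr k.+1 s.
  by rewrite e1 in e3 *; rewrite subr_eq0 eq_le e2 e3.
(* After summation by parts each term carries the derivative of one step. These derivatives have
   disjoint supports, so at most one term is nonzero and the bound does not grow with the number of
   nodes. *)
- move=> a M s aM; rewrite (abel_sum n.+1 a (fun k => t' k s))/= ltnn !mulr0 subr0 add0r.
  have M0 : 0 <= M by rewrite (le_trans _ (aM 0%N _)).
  rewrite (le_trans (ler_norm_sum _ _ _))//.
  apply: (@le_trans _ _ (\sum_(i < n.+1) M * (S' (n.+1%:R * s + - i%:R) * n.+1%:R))).
    apply: ler_sum => i _; rewrite ltn_ord normrM.
    rewrite [X in _ * X]ger0_norm; last by rewrite mulr_ge0// ltW.
    by rewrite ler_wpM2r ?aM// mulr_ge0// ltW.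
  rewrite -mulr_sumr -mulr_suml mulrC ler_wpM2r// (ler_wpM2r (ltW n0))//.
  have [[i Hi]|noi] := pselect (exists i : 'I_n.+1, S' (n.+1%:R * s + - i%:R) != 0); last first.
    rewrite big1 ?ltW// => i _; apply/eqP; apply: contrapT => /negP Hi; apply: noi.
    by exists i.
  have bnd_i (j : 'I_n.+1) : S' (n.+1%:R * s + - j%:R) != 0 -> 3^-1 < n.+1%:R * s - j%:R < 2 / 3.
    move=> Hj; rewrite !ltNge -negb_or; apply/negP => /orP[/S'l|/S'r] E;
    by move: Hj; rewrite E eqxx.
  rewrite (bigD1 i)//= big1 ?addr0// => j ji; apply/eqP; apply: contraNT ji => Hj.
  have /andP[i1 i2] := bnd_i i Hi; have /andP[j1 j2] := bnd_i j Hj.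
  apply/eqP/val_inj/eqP; rewrite eqn_leq.
  by apply/andP; split; rewrite -ltnS -(ltr_nat R) -natr1; lra.
- split=> k s kn sn.
    have ns : n.+1%:R * s < 3^-1.
      by rewrite -(ltr_pM2l n0) mulrA mulfV// mul1r in sn.
    have tz j : (j < n.+1)%N -> t j.+1 s = 0.
      by move=> jn; apply: tr => //; rewrite (le_trans (ltW ns))// lerDr.
    case: k kn => [|k] kn; first by rewrite tz// subr0.
    rewrite tz// /t; case: ifP => kn'; last by rewrite subrr.
    by have := tz _ kn'; rewrite /t kn' => ->; rewrite subrr.
  have ns : n.+1%:R - 3^-1 < n.+1%:R * s.
    by rewrite -(ltr_pM2l n0) mulrBr mulr1 mulrA mulfV// mul1r in sn.
  have tz j : (j <= n.+1)%N -> t j s = 1.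
    case: j => [//|j] jn; apply: tl => //; have : j.+1%:R <= n.+1%:R :> R by rewrite ler_nat.
    by rewrite -natr1; lra.
  rewrite tz//; have [->|kn'] := eqVneq k n.+1; first by rewrite /t ltnn subr0.
  by rewrite tz ?subrr// ltn_neqAle kn' kn.
Qed.

(** The nodes 0 and 1 are the same point of the circle, so the kernel of the last node is added to
    that of node 0. Near both ends of the period this kernel is 1 and the others are 0, so all of
    them can be periodized. In the derivative bound the factor $n+1$ cancels the node spacing, which
    leaves a constant independent of [n]. *)
Lemma x_kernel : exists2 C : R, 0 <= C & forall n : nat, exists K K' : 'I_n.+1 -> R -> R,
  [/\ (forall k, smooth1 (K k) /\ per1 (K k)), (forall k, has_deriv (K k) (K' k)),
      (forall k s, 0 <= K k s), (forall s, \sum_k K k s = 1) &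
   forall (a : R -> R) (L : R), per1 a -> (forall s t, `|a s - a t| <= L * `|s - t|) -> forall s,
      `|\sum_(k < n.+1) a (k%:R / n.+1%:R) * K' k s| <= C * L /\
      `|\sum_(k < n.+1) a (k%:R / n.+1%:R) * K k s - a s| <= L * n.+1%:R^-1].
Proof.
have [C C0 HC] := unit_kernel; exists C => // n.
have [H [H' [sH dH H0 H1 [Hloc Hbd [Hl Hr]]]]] := HC n.
have n0 : 0 < n.+1%:R :> R by rewrite ltr0n.
have nn0 : n.+1%:R != 0 :> R by rewrite gt_eqF.
pose G (k : 'I_n.+1) s := H k s + (k == ord0)%:R * H n.+1 s.
pose G' (k : 'I_n.+1) s := H' k s + (k == ord0)%:R * H' n.+1 s.
have sG k : smooth1 (G k) by apply: smooth1D => //; apply: smooth1M => //; exact: smooth1_cst.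
have dG k : has_deriv (G k) (G' k).
  move=> s; apply: is_derive_eq (has_derivD (dH k) (has_derivM (has_deriv_cst _) (dH n.+1)) s) _.
  by rewrite mulr0 addr0.
have e0 : 0 < n.+1%:R^-1 / 3 :> R by rewrite divr_gt0// invr_gt0.
have Gl (k : 'I_n.+1) s : s < n.+1%:R^-1 / 3 -> G k s = (k == ord0)%:R.
  move=> se; rewrite /G (Hl k)//; last by rewrite ltnW// ltn_ord.
  by rewrite (Hl n.+1)// mulr0 addr0; congr (_ %:R); rewrite -val_eqE.
have Gr (k : 'I_n.+1) s : 1 - n.+1%:R^-1 / 3 < s -> G k s = (k == ord0)%:R.
  move=> se; rewrite /G (Hr k)//; last by rewrite ltnW// ltn_ord.
  by rewrite (Hr n.+1)// eqxx mulr1 ltn_eqF ?ltn_ord// add0r.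
have sumG (F : nat -> R -> R) (b : nat -> R) s : b n.+1 = b 0%N ->
    \sum_(k < n.+1) b k * (F k s + (k == ord0)%:R * F n.+1 s) = \sum_(k < n.+2) b k * F k s.
  move=> bn; rewrite [RHS]big_ord_recr/= bn.
  under eq_bigr do rewrite mulrDr; rewrite big_split/=; congr (_ + _).
  rewrite (bigD1 ord0)//= big1 ?addr0 ?mul1r// => k /negbTE ->.
  by rewrite mul0r mulr0.
exists (fun k => G k \o frac), (fun k => G' k \o frac); split.
- move=> k; split; last by move=> s; rewrite /= fracD1.
  by apply: (smooth1_frac e0 (sG k)) => s; [exact: Gl|exact: Gr].
- by move=> k; apply: (has_deriv_frac e0 (dG k)) => s; [exact: Gl|exact: Gr].
- by move=> k s; rewrite /= /G addr_ge0// mulr_ge0.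
- move=> s; rewrite -(H1 (frac s)) /= /G.
  have /= e1 := sumG H (fun=> 1) (frac s) erefl.
  transitivity (\sum_(k < n.+1) 1 * (H k (frac s) + (k == ord0)%:R * H n.+1 (frac s))).
    by apply: eq_bigr => k _; rewrite mul1r.
  by rewrite e1; apply: eq_bigr => k _; rewrite mul1r.
move=> a L pa La s; have L0 : 0 <= L by have := La 1 0; rewrite subr0 normr1 mulr1; exact: le_trans.
pose b (k : nat) : R := a (k%:R / n.+1%:R).
have bn : b n.+1 = b 0%N by rewrite /b mul0r mulfV// -[1]add0r pa.
have /andP[f0 f1] := frac_itv s.
split.
  rewrite (sumG H' b)// (le_trans (Hbd b (L / n.+1%:R) _ _))//.
    move=> k _; rewrite /b (le_trans (La _ _))// ler_wpM2l// -mulrBl -natr1 addrAC subrr add0r.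
    by rewrite mul1r ger0_norm// invr_ge0 ltW.
  by rewrite -[leLHS]mulrA [n.+1%:R * _]mulrC divfK.
rewrite (sumG H b)// -(per1_frac s pa).
have -> : a (frac s) = \sum_(k < n.+2) a (frac s) * H k (frac s) by rewrite -mulr_sumr H1 mulr1.
rewrite -sumrB.
under eq_bigr do rewrite -mulrBl.
rewrite (le_trans (ler_norm_sum _ _ _))//.
have -> : L / n.+1%:R = \sum_(k < n.+2) L / n.+1%:R * H k (frac s) by rewrite -mulr_sumr H1 mulr1.
apply: ler_sum => k _.
rewrite normrM (ger0_norm (H0 _ _)).
have [->|Hk] := eqVneq (H k (frac s)) 0; first by rewrite !mulr0.
rewrite ler_wpM2r// (le_trans (La _ _))// ler_wpM2l// Hloc// f0 ltW//.
Qed.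

(** The unit kernel rescaled to $[0,T]$, without identification of the end points: the factor $T$ of
    the node spacing cancels the $T^{-1}$ of the derivative. *)
Lemma t_kernel (T : R) : 0 < T -> exists2 C : R, 0 <= C & forall n : nat, exists K K' : 'I_n.+2 -> R -> R,
  [/\ (forall k, smooth1 (K k)), (forall k, has_deriv (K k) (K' k)),
      (forall k s, 0 <= K k s), (forall s, \sum_k K k s = 1) &
   forall (a : R -> R) (L : R), (forall s t, 0 <= s <= T -> 0 <= t <= T -> `|a s - a t| <= L * `|s - t|) ->
      (forall s, `|\sum_(k < n.+2) a (T * (k%:R / n.+1%:R)) * K' k s| <= C * L) /\
      (forall s, 0 <= s <= T ->
         `|\sum_(k < n.+2) a (T * (k%:R / n.+1%:R)) * K k s - a s| <= L * T * n.+1%:R^-1)].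
Proof.
move=> T0; have [C C0 HC] := unit_kernel; exists C => // n.
have [H [H' [sH dH H0 H1 [Hloc Hbd _]]]] := HC n.
have n0 : 0 < n.+1%:R :> R by rewrite ltr0n.
have nn0 : n.+1%:R != 0 :> R by rewrite gt_eqF.
have Tn0 : T != 0 by rewrite gt_eqF.
exists (fun k s => H k (T^-1 * s + 0)), (fun k s => H' k (T^-1 * s + 0) * T^-1); split.
- by move=> k; exact: smooth1_affine.
- by move=> k; exact: has_deriv_affine.
- by [].
- by move=> s; exact: H1.
move=> a L La; have L0 : 0 <= L.
  have := La T 0; rewrite !lexx (ltW T0) subr0 (gtr0_norm T0) => /(_ isT isT) H2.
  by rewrite -(pmulr_lge0 _ T0); exact: le_trans H2.
have node (k : nat) : (k <= n.+1)%N -> 0 <= T * (k%:R / n.+1%:R) <= T.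
  move=> kn; rewrite mulr_ge0 ?divr_ge0// ?(ltW T0)//= ger_pMr// ler_pdivrMr// mul1r.
  by rewrite ler_nat.
pose b (k : nat) : R := a (T * (k%:R / n.+1%:R)).
split=> s.
  under eq_bigr do rewrite mulrA.
  rewrite -mulr_suml normrM [X in _ * X]gtr0_norm ?invr_gt0// ler_pdivrMr//.
  rewrite (le_trans (Hbd b (L * T / n.+1%:R) _ _))//.
    move=> k kn; rewrite /b (le_trans (La _ _ (node _ kn) (node _ (ltnW kn))))//.
    rewrite -mulrBr normrM (gtr0_norm T0) -mulrBl -natr1 addrAC subrr add0r mul1r.
    by rewrite ger0_norm ?mulrA// invr_ge0 ltW.
  by rewrite -[leLHS]mulrA [n.+1%:R * _]mulrC divfK// mulrA.
move=> /andP[s0 sT].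
have u01 : 0 <= T^-1 * s + 0 <= 1.
  by rewrite addr0 mulr_ge0 ?invr_ge0 ?(ltW T0)//= mulrC ler_pdivrMr// mul1r.
have -> : a s = \sum_(k < n.+2) a s * H k (T^-1 * s + 0) by rewrite -mulr_sumr H1 mulr1.
rewrite -sumrB.
under eq_bigr do rewrite -mulrBl.
rewrite (le_trans (ler_norm_sum _ _ _))//.
have -> : L * T / n.+1%:R = \sum_(k < n.+2) L * T / n.+1%:R * H k (T^-1 * s + 0).
  by rewrite -mulr_sumr H1 mulr1.
apply: ler_sum => k _.
rewrite normrM (ger0_norm (H0 _ _)).
have [->|Hk] := eqVneq (H k (T^-1 * s + 0)) 0; first by rewrite !mulr0.
have kn : (k <= n.+1)%N by rewrite -ltnS ltn_ord.
have s0T : 0 <= s <= T by rewrite s0.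
rewrite ler_wpM2r// (le_trans (La _ _ (node k kn) s0T))//.
rewrite -mulrA ler_wpM2l//.
have -> : T * (k%:R / n.+1%:R) - s = T * (k%:R / n.+1%:R - (T^-1 * s + 0)).
  by rewrite addr0 mulrBr mulVKf.
by rewrite normrM (gtr0_norm T0) ler_pM2l// Hloc.
Qed.

End Approximation.

(** * Tensor-product approximation in space-time *)

Section LipschitzApproximation.
Context {R : realType}.
Implicit Types (T : R).

(** The $\ell^1$ distance, which splits a Lipschitz estimate coordinate by coordinate. *)
Definition dist4 (z w : stime R) : R := `|z.1.1.1 - w.1.1.1| + `|z.1.1.2 - w.1.1.2| + `|z.1.2 - w.1.2| + `|z.2 - w.2|.

(** The bound is required on the full strip over $\mathbb{R}^3$, so it also holds across the faces
    of the cell. *)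
Definition lipQ T (f : stime R -> R) := Defs.periodic f /\
  exists2 L, 0 <= L & forall z w : stime R, 0 <= z.2 <= T -> 0 <= w.2 <= T -> `|f z - f w| <= L * dist4 z w.

Lemma Sm_derive_line (g : stime R -> R) (v z : stime R) (G G' : R -> R) : Sm g ->
  (forall s : R, g (s *: v + z) = G s) -> has_deriv G G' -> 'D_v g z = G' 0.
Proof.
move=> sg gG dG; apply: (@is_derive1_unique R G 0) => //.
have <- : (fun s : R => g (s *: v + z)) = G by apply/funext.
apply: is_derive_line; rewrite scale0r add0r; exact: Sm_is_derive.
Qed.

Lemma periodic_x0 (V : Type) (f : stime R -> V) (x0 x1 x2 t : R) :
  Defs.periodic f -> f (x0 + 1, x1, x2, t) = f (x0, x1, x2, t).
Proof. by move=> pf; rewrite -(pf (x0, x1, x2, t) ord0); congr f; congr (_, _, _, _) => /=; rewrite addr0. Qed.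

Lemma periodic_x1 (V : Type) (f : stime R -> V) (x0 x1 x2 t : R) :
  Defs.periodic f -> f (x0, x1 + 1, x2, t) = f (x0, x1, x2, t).
Proof.
move=> pf; rewrite -(pf (x0, x1, x2, t) (Ordinal (isT : 1 < 3)%N)).
by congr f; congr (_, _, _, _) => /=; rewrite addr0.
Qed.

Lemma periodic_x2 (V : Type) (f : stime R -> V) (x0 x1 x2 t : R) :
  Defs.periodic f -> f (x0, x1, x2 + 1, t) = f (x0, x1, x2, t).
Proof.
move=> pf; rewrite -(pf (x0, x1, x2, t) (Ordinal (isT : 2 < 3)%N)).
by congr f; congr (_, _, _, _) => /=; rewrite addr0.
Qed.

(** Interpolation of nodal values by the tensor product of the partitions of unity. A derivative in
    one coordinate only sees differences of nodal values in that coordinate, hence a bound [C]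
    independent of the accuracy [e]. Being a convex combination of values taken in the strip, [g]
    inherits pointwise bounds [lo] and [hi] everywhere, even at times outside the strip. *)
Lemma approx_exists T (f : stime R -> R) : 0 < T -> lipQ T f ->
  exists2 C, 0 <= C & forall e, 0 < e -> exists g, [/\ Sm g,
    forall z : stime R, 0 <= z.2 <= T -> `|g z - f z| <= e,
    forall k (z : stime R), `|'D_(dir k) g z| <= C &
    forall lo hi, (forall z : stime R, 0 <= z.2 <= T -> lo <= f z <= hi) -> forall z : stime R, lo <= g z <= hi].
Proof.
move=> T0 [pf [L L0 fL]].
have [Cx Cx0 HX] := @x_kernel R; have [Ct Ct0 HT] := t_kernel T0.
exists ((Cx + Ct) * L) => [|e e0]; first by rewrite mulr_ge0// addr_ge0.
have [n Hn] : exists n : nat, (L * T + L + L + L) * n.+1%:R^-1 <= e.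
  have B0 : 0 <= L * T + L + L + L by rewrite !addr_ge0// mulr_ge0// ltW.
  exists (Num.truncn ((L * T + L + L + L) / e)); rewrite ler_pdivrMr ?ltr0n// [e * _]mulrC.
  by rewrite -ler_pdivrMr//; apply: ltW; exact: truncnS_gt.
have [K [K' [sK dK K0 K1 HK]]] := HX n; have [Q [Q' [sQ dQ Q0 Q1 HQ]]] := HT n.
pose xn (k : nat) : R := k%:R / n.+1%:R; pose tn (k : nat) : R := T * (k%:R / n.+1%:R).
have tn01 (k : 'I_n.+2) : 0 <= tn k <= T.
  rewrite /tn mulr_ge0 ?divr_ge0// ?(ltW T0)//= ger_pMr// ler_pdivrMr ?ltr0n// mul1r.
  by rewrite ler_nat -ltnS ltn_ord.
have f0 s s' x1 x2 t : 0 <= t <= T -> `|f (s, x1, x2, t) - f (s', x1, x2, t)| <= L * `|s - s'|.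
  by move=> t0; have := fL (s, x1, x2, t) (s', x1, x2, t) t0 t0; rewrite /dist4/= !subrr normr0 !addr0.
have f1 x0 s s' x2 t : 0 <= t <= T -> `|f (x0, s, x2, t) - f (x0, s', x2, t)| <= L * `|s - s'|.
  by move=> t0; have := fL (x0, s, x2, t) (x0, s', x2, t) t0 t0; rewrite /dist4/= !subrr normr0 !addr0 add0r.
have f2 x0 x1 s s' t : 0 <= t <= T -> `|f (x0, x1, s, t) - f (x0, x1, s', t)| <= L * `|s - s'|.
  by move=> t0; have := fL (x0, x1, s, t) (x0, x1, s', t) t0 t0; rewrite /dist4/= !subrr normr0 !addr0 !add0r.
have f3 x0 x1 x2 s s' : 0 <= s <= T -> 0 <= s' <= T -> `|f (x0, x1, x2, s) - f (x0, x1, x2, s')| <= L * `|s - s'|.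
  by move=> s0 s0'; have := fL (x0, x1, x2, s) (x0, x1, x2, s') s0 s0'; rewrite /dist4/= !subrr normr0 !add0r.
(* Partial interpolants: [N3] in time only, then one more spatial variable at each stage. Each keeps
   the Lipschitz constant and the periodicity in the variables not yet interpolated. *)
pose N3 x0 x1 x2 t := \sum_(k < n.+2) f (x0, x1, x2, tn k) * Q k t.
pose N2 x0 x1 z2 t := \sum_(k < n.+1) N3 x0 x1 (xn k) t * K k z2.
pose N1 x0 z1 z2 t := \sum_(k < n.+1) N2 x0 (xn k) z2 t * K k z1.
pose N0 z0 z1 z2 t := \sum_(k < n.+1) N1 (xn k) z1 z2 t * K k z0.
pose g (z : stime R) := N0 z.1.1.1 z.1.1.2 z.1.2 z.2.
have L3_0 s s' x1 x2 t : `|N3 s x1 x2 t - N3 s' x1 x2 t| <= L * `|s - s'|.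
  by apply: convex_dist => // k; exact: f0.
have L3_1 x0 s s' x2 t : `|N3 x0 s x2 t - N3 x0 s' x2 t| <= L * `|s - s'|.
  by apply: convex_dist => // k; exact: f1.
have L3_2 x0 x1 s s' t : `|N3 x0 x1 s t - N3 x0 x1 s' t| <= L * `|s - s'|.
  by apply: convex_dist => // k; exact: f2.
have L2_0 s s' x1 z2 t : `|N2 s x1 z2 t - N2 s' x1 z2 t| <= L * `|s - s'|.
  by apply: convex_dist => // k.
have L2_1 x0 s s' z2 t : `|N2 x0 s z2 t - N2 x0 s' z2 t| <= L * `|s - s'|.
  by apply: convex_dist => // k.
have L1_0 s s' z1 z2 t : `|N1 s z1 z2 t - N1 s' z1 z2 t| <= L * `|s - s'|.
  by apply: convex_dist => // k.
have P3 x0 x1 t : per1 (fun s => N3 x0 x1 s t).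
  by move=> s; apply: eq_bigr => k _; rewrite periodic_x2.
have P2 x0 z2 t : per1 (fun s => N2 x0 s z2 t).
  by move=> s; apply: eq_bigr => k _; congr (_ * _); apply: eq_bigr => j _; rewrite periodic_x1.
have P1 z1 z2 t : per1 (fun s => N1 s z1 z2 t).
  move=> s; apply: eq_bigr => k _; congr (_ * _); apply: eq_bigr => j _; congr (_ * _).
  by apply: eq_bigr => i _; rewrite periodic_x0.
have sg : Sm g.
  pose F (p : 'I_n.+1 * 'I_n.+1 * 'I_n.+1 * 'I_n.+2) (z : stime R) :=
    f (xn p.1.1.1, xn p.1.1.2, xn p.1.2, tn p.2) * (K p.1.1.1 z.1.1.1 * K p.1.1.2 z.1.1.2 * K p.1.2 z.1.2 * Q p.2 z.2).
  apply: (@Sm_ext _ (fun z => \sum_p F p z)).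
    apply: Sm_sum => p _; apply: SmZ.
    by apply: SmT; [case: (sK p.1.1.1)|case: (sK p.1.1.1)|case: (sK p.1.1.2)|case: (sK p.1.1.2)|
      case: (sK p.1.2)|case: (sK p.1.2)|exact: sQ].
  move=> z; rewrite /g /N0 -(pair_bigA_idem _ (fun p k3 => F (p, k3) z))//=; last exact: addr0.
  rewrite -(pair_bigA_idem _ (fun p k2 => \sum_k3 F (p, k2, k3) z))//=; last exact: addr0.
  rewrite -(pair_bigA_idem _ (fun k0 k1 => \sum_k2 \sum_k3 F (k0, k1, k2, k3) z))//=; last exact: addr0.
  apply: eq_bigr => k0 _; rewrite mulr_suml; apply: eq_bigr => k1 _.
  rewrite !mulr_suml; apply: eq_bigr => k2 _; rewrite !mulr_suml; apply: eq_bigr => k3 _.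
  by rewrite /F/=; ring.
exists g; split => //.
- move=> z zT; have nV : 0 <= n.+1%:R^-1 :> R by rewrite invr_ge0.
  have E3 x0 x1 x2 : `|N3 x0 x1 x2 z.2 - f (x0, x1, x2, z.2)| <= L * T * n.+1%:R^-1.
    have [//|_ H] := HQ (fun s => f (x0, x1, x2, s)) L.
      by move=> s t s0 t0; exact: f3.
    exact: H.
  have E2 x0 x1 : `|N2 x0 x1 z.1.2 z.2 - f (x0, x1, z.1.2, z.2)| <= (L * T + L) * n.+1%:R^-1.
    have [||_ H] := HK (fun s => f (x0, x1, s, z.2)) L _ _ z.1.2.
    + by move=> s; rewrite periodic_x2.
    + by move=> s t; exact: f2.
    have := @convex_dist _ _ (K^~ z.1.2) (K0^~ z.1.2) (K1 z.1.2) (fun k => N3 x0 x1 (xn k) z.2)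
      (fun k => f (x0, x1, xn k, z.2)) _ (fun k => E3 x0 x1 (xn k)).
    rewrite -/(N2 x0 x1 z.1.2 z.2) => H2; rewrite mulrDl (le_trans _ (lerD H2 H))//.
    by rewrite (le_trans _ (ler_normD _ _))// addrA subrK.
  have E1 x0 : `|N1 x0 z.1.1.2 z.1.2 z.2 - f (x0, z.1.1.2, z.1.2, z.2)| <= (L * T + L + L) * n.+1%:R^-1.
    have [||_ H] := HK (fun s => f (x0, s, z.1.2, z.2)) L _ _ z.1.1.2.
    + by move=> s; rewrite periodic_x1.
    + by move=> s t; exact: f1.
    have := @convex_dist _ _ (K^~ z.1.1.2) (K0^~ z.1.1.2) (K1 z.1.1.2) (fun k => N2 x0 (xn k) z.1.2 z.2)
      (fun k => f (x0, xn k, z.1.2, z.2)) _ (fun k => E2 x0 (xn k)).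
    rewrite -/(N1 x0 z.1.1.2 z.1.2 z.2) => H2; rewrite mulrDl (le_trans _ (lerD H2 H))//.
    by rewrite (le_trans _ (ler_normD _ _))// addrA subrK.
  have [||_ H] := HK (fun s => f (s, z.1.1.2, z.1.2, z.2)) L _ _ z.1.1.1.
  + by move=> s; rewrite periodic_x0.
  + by move=> s t; exact: f0.
  have := @convex_dist _ _ (K^~ z.1.1.1) (K0^~ z.1.1.1) (K1 z.1.1.1) (fun k => N1 (xn k) z.1.1.2 z.1.2 z.2)
    (fun k => f (xn k, z.1.1.2, z.1.2, z.2)) _ (fun k => E1 (xn k)).
  rewrite -/(N0 z.1.1.1 z.1.1.2 z.1.2 z.2) -/(g z) -!surjective_pairing in H * => H2.
  rewrite (le_trans _ Hn)// mulrDl (le_trans _ (lerD H2 H))//.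
  by rewrite (le_trans _ (ler_normD _ _))// addrA subrK.
- have CxL : Cx * L <= (Cx + Ct) * L by rewrite ler_wpM2r// lerDl.
  have CtL : Ct * L <= (Cx + Ct) * L by rewrite ler_wpM2r// lerDr.
  have shift_deriv (I : finType) (c : I -> R) (F F' : I -> R -> R) (b : R) :
      (forall k, has_deriv (F k) (F' k)) ->
      has_deriv (fun s => \sum_k c k * F k (1 * s + b)) (fun s => \sum_k c k * F' k (1 * s + b)).
    move=> dF; apply: has_deriv_sum => k s.
    apply: is_derive_eq (has_derivM (has_deriv_cst (c k)) (has_deriv_affine 1 b (dF k)) s) _.
    by rewrite mulr0 addr0 mulr1.
  have mulK_deriv (I : finType) (c : I -> R) (F F' : I -> R -> R) :
      (forall k, has_deriv (F k) (F' k)) ->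
      has_deriv (fun s => \sum_k F k s * c k) (fun s => \sum_k F' k s * c k).
    move=> dF; apply: has_deriv_sum => k s.
    apply: is_derive_eq (has_derivM (dF k) (has_deriv_cst (c k)) s) _.
    by rewrite mulr0 add0r mulrC.
  move=> k z; case: k => [[[|[|[|//]]] a3]|].
  + rewrite (@Sm_derive_line g _ z _ _ sg _ (shift_deriv _ (fun k : 'I_n.+1 => N1 (xn k) z.1.1.2 z.1.2 z.2) K K' z.1.1.1 dK)); last first.
      by move=> s; rewrite smul_dx/= mulr1 !mulr0 !add0r /g/= mul1r.
    rewrite mulr0 add0r (le_trans _ CxL)//.
    by have [] := HK (fun s => N1 s z.1.1.2 z.1.2 z.2) L (P1 _ _ _) (fun s s' => L1_0 s s' _ _ _) z.1.1.1.
  + have d1 k0 := shift_deriv _ (fun k : 'I_n.+1 => N2 (xn k0) (xn k) z.1.2 z.2) K K' z.1.1.2 dK.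
    rewrite (@Sm_derive_line g _ z _ _ sg _ (mulK_deriv _ (fun k : 'I_n.+1 => K k z.1.1.1) _ _ d1)); last first.
      by move=> s; rewrite smul_dx/= mulr1 !mulr0 !add0r /g/= /N0 /N1 mul1r.
    rewrite mulr0 add0r (le_trans _ CxL)//; apply: convex_abs => // k0.
    by have [] := HK (fun s => N2 (xn k0) s z.1.2 z.2) L (P2 _ _ _) (fun s s' => L2_1 _ s s' _ _) z.1.1.2.
  + have d2 k0 k1 := shift_deriv _ (fun k : 'I_n.+1 => N3 (xn k0) (xn k1) (xn k) z.2) K K' z.1.2 dK.
    have d1 k0 := mulK_deriv _ (fun k : 'I_n.+1 => K k z.1.1.2) _ _ (d2 k0).
    rewrite (@Sm_derive_line g _ z _ _ sg _ (mulK_deriv _ (fun k : 'I_n.+1 => K k z.1.1.1) _ _ d1)); last first.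
      by move=> s; rewrite smul_dx/= mulr1 !mulr0 !add0r /g/= /N0 /N1 /N2 mul1r.
    rewrite mulr0 add0r (le_trans _ CxL)//; apply: convex_abs => // k0; apply: convex_abs => // k1.
    by have [] := HK (fun s => N3 (xn k0) (xn k1) s z.2) L (P3 _ _ _) (fun s s' => L3_2 _ _ s s' _) z.1.2.
  + have d3 k0 k1 k2 := shift_deriv _ (fun k : 'I_n.+2 => f (xn k0, xn k1, xn k2, tn k)) Q Q' z.2 dQ.
    have d2 k0 k1 := mulK_deriv _ (fun k : 'I_n.+1 => K k z.1.2) _ _ (d3 k0 k1).
    have d1 k0 := mulK_deriv _ (fun k : 'I_n.+1 => K k z.1.1.2) _ _ (d2 k0).
    rewrite (@Sm_derive_line g _ z _ _ sg _ (mulK_deriv _ (fun k : 'I_n.+1 => K k z.1.1.1) _ _ d1)); last first.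
      by move=> s; rewrite smul_dt/= /g/= /N0 /N1 /N2 /N3 mul1r.
    rewrite mulr0 add0r (le_trans _ CtL)//; apply: convex_abs => // k0; apply: convex_abs => // k1.
    apply: convex_abs => // k2.
    have [//|H _] := HQ (fun s => f (xn k0, xn k1, xn k2, s)) L.
      by move=> s t s0 t0; exact: f3.
    exact: H.
- move=> lo hi fb z; apply/andP; split.
    apply: convex_ge => // i; apply: convex_ge => // j; apply: convex_ge => // h; apply: convex_ge => // k.
    by have /andP[] := fb (xn i, xn j, xn h, tn k) (tn01 k).
  apply: convex_le => // i; apply: convex_le => // j; apply: convex_le => // h; apply: convex_le => // k.
  by have /andP[] := fb (xn i, xn j, xn h, tn k) (tn01 k).
Qed.

End LipschitzApproximation.

(** * Weak derivatives of Lipschitz functions *)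

Section TorusCalculus.
Context {R : realType}.
Implicit Types (T : R) (f g h : stime R -> R).
Notation lebT := (measurableTypeR R).

Definition intQ T f : R := \int[leb4]_(z in QT T) f z.
Definition intC (f : xspace R -> R) : R := \int[leb3]_(x in cell) f x.
Definition L1C (f : xspace R -> R) := L1 leb3 cell f.
Definition bndC (f : xspace R -> R) := bnd (cell : set (lebT * lebT * lebT)%type) f.

Let mQT T : measurable (QT T : set (lebT * lebT * lebT * lebT)%type).
Proof. exact: measurable_QT. Qed.

Let mcell : measurable (cell : set (lebT * lebT * lebT)%type).
Proof. exact: measurable_cell. Qed.

Lemma L1Q_ext T f g : L1Q T f -> (forall z, QT T z -> f z = g z) -> L1Q T g.
Proof. exact: (L1_ext (mQT T)). Qed.
Lemma L1QD T f g : L1Q T f -> L1Q T g -> L1Q T (fun z => f z + g z).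
Proof. exact: (L1D (mQT T)). Qed.
Lemma L1QB T f g : L1Q T f -> L1Q T g -> L1Q T (fun z => f z - g z).
Proof. exact: (L1B (mQT T)). Qed.
Lemma L1QN T f : L1Q T f -> L1Q T (fun z => - f z).
Proof. exact: (L1N (mQT T)). Qed.
Lemma L1QZ T (k : R) f : L1Q T f -> L1Q T (fun z => k * f z).
Proof. exact: (L1Z (mQT T) k). Qed.
Lemma L1Q_sum T (I : Type) (r : seq I) (P : pred I) (F : I -> stime R -> R) :
  (forall i, P i -> L1Q T (F i)) -> L1Q T (fun z => \sum_(i <- r | P i) F i z).
Proof. exact: (L1_sum (mQT T)). Qed.
Lemma L1Q_bndM T f g : bndQ T f -> L1Q T g -> L1Q T (fun z => f z * g z).
Proof. exact: (L1_bndM (mQT T)). Qed.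
Lemma L1Q_Mbnd T f g : L1Q T f -> bndQ T g -> L1Q T (fun z => f z * g z).
Proof. exact: (L1_Mbnd (mQT T)). Qed.
Lemma L1Q_abs T f : L1Q T f -> L1Q T (fun z => `|f z|).
Proof. exact: L1_abs. Qed.

Lemma bndQ_ext T f g : bndQ T f -> (forall z, QT T z -> f z = g z) -> bndQ T g.
Proof. exact: bnd_ext. Qed.
Lemma bndQ_cst T (k : R) : bndQ T (fun=> k).
Proof. exact: bnd_cst. Qed.
Lemma bndQD T f g : bndQ T f -> bndQ T g -> bndQ T (fun z => f z + g z).
Proof. exact: bndD. Qed.
Lemma bndQB T f g : bndQ T f -> bndQ T g -> bndQ T (fun z => f z - g z).
Proof. exact: bndB. Qed.
Lemma bndQM T f g : bndQ T f -> bndQ T g -> bndQ T (fun z => f z * g z).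
Proof. exact: bndM. Qed.
Lemma bndQZ T (k : R) f : bndQ T f -> bndQ T (fun z => k * f z).
Proof. exact: bndZ. Qed.
Lemma bndQ_sum T (I : Type) (r : seq I) (P : pred I) (F : I -> stime R -> R) :
  (forall i, P i -> bndQ T (F i)) -> bndQ T (fun z => \sum_(i <- r | P i) F i z).
Proof. exact: bnd_sum. Qed.

Lemma intQ_ext T f g : (forall z, QT T z -> f z = g z) -> intQ T f = intQ T g.
Proof. by move=> fg; apply: eq_Rintegral => z; rewrite inE => /fg. Qed.
Lemma intQD T f g : L1Q T f -> L1Q T g -> intQ T (fun z => f z + g z) = intQ T f + intQ T g.
Proof. exact: (intD (mQT T)). Qed.
Lemma intQB T f g : L1Q T f -> L1Q T g -> intQ T (fun z => f z - g z) = intQ T f - intQ T g.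
Proof. exact: (intB (mQT T)). Qed.
Lemma intQN T f : L1Q T f -> intQ T (fun z => - f z) = - intQ T f.
Proof. exact: (intN (mQT T)). Qed.
Lemma intQZ T (k : R) f : L1Q T f -> intQ T (fun z => k * f z) = k * intQ T f.
Proof. exact: (intZ (mQT T) k). Qed.
Lemma intQ_sum T (I : Type) (r : seq I) (P : pred I) (F : I -> stime R -> R) :
  (forall i, P i -> L1Q T (F i)) ->
  intQ T (fun z => \sum_(i <- r | P i) F i z) = \sum_(i <- r | P i) intQ T (F i).
Proof. exact: (int_sum (mQT T)). Qed.
Lemma intQ_bndM_le T f g (C : R) : bndQ T f -> L1Q T g -> (forall z, QT T z -> `|f z| <= C) ->
  `|intQ T (fun z => f z * g z)| <= C * intQ T (fun z => `|g z|).
Proof. exact: (int_bndM_le (mQT T)). Qed.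
Lemma intQ_ge0 T f : (forall z, QT T z -> 0 <= f z) -> 0 <= intQ T f.
Proof. by move=> f0; apply: Rintegral_ge0 => z; exact: f0. Qed.

Lemma bndC_L1C (f : xspace R -> R) : bndC f -> L1C f.
Proof. exact: (@L1_bnd _ _ _ leb3 cell mcell f leb3_cell). Qed.

Definition hrate (n : nat) : R := n.+1%:R^-1.

Lemma hrate_gt0 n : 0 < hrate n. Proof. by rewrite invr_gt0. Qed.

Lemma cvg_hrate (u : nat -> R) (l C : R) : (forall n, `|u n - l| <= C * hrate n) ->
  u n @[n --> \oo] --> l.
Proof.
move=> ul; apply/cvgrPdist_le => e e0.
have : C * hrate n @[n --> \oo] --> (0 : R).
  by rewrite -[0](mulr0 C); apply: cvgM; [exact: cvg_cst|exact: cvg_harmonic].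
move=> /cvgrPdist_le/(_ e e0); apply: filterS => n.
by rewrite sub0r normrN distrC => H; rewrite (le_trans (ul n))// (le_trans (ler_norm _)).
Qed.

Lemma intQ_cvg_unif T (F : nat -> stime R -> R) f h (C : R) :
  (forall n, bndQ T (F n)) -> bndQ T f -> L1Q T h ->
  (forall n z, QT T z -> `|F n z - f z| <= C * hrate n) ->
  intQ T (fun z => F n z * h z) @[n --> \oo] --> intQ T (fun z => f z * h z).
Proof.
move=> bF bf Lh Ff; apply: (@cvg_hrate _ _ (C * intQ T (fun z => `|h z|))) => n.
rewrite -intQB; [|exact: L1Q_bndM|exact: L1Q_bndM].
rewrite (intQ_ext (g := fun z => (F n z - f z) * h z)); last by move=> z _; rewrite mulrBl.
by rewrite mulrAC; apply: intQ_bndM_le => //; [exact: bndQB|exact: Ff].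
Qed.

Lemma Sm_deriveM (v z : stime R) f g : Sm f -> Sm g ->
  'D_v (fun z => f z * g z) z = f z * 'D_v g z + g z * 'D_v f z.
Proof. by move=> sf sg; have [_ ->] := is_deriveM (Sm_is_derive v z sf) (Sm_is_derive v z sg). Qed.

Lemma Sm_line_continuous (v z : stime R) f : Sm f -> continuous (fun s : R => f (s *: v + z)).
Proof.
move=> sf; apply: (@has_deriv_continuous _ _ (fun s => 'D_v f (s *: v + z))) => s.
by apply: is_derive_line; exact: Sm_is_derive.
Qed.

Lemma Sm_ibp_x T (a : 'I_3) f g : Sm f -> Sm g ->
  intQ T (fun z => f z * 'D_(dx a) g z) = - intQ T (fun z => 'D_(dx a) f z * g z).
Proof.
move=> sf sg; have sfg := SmM sf sg; have sD := Sm_D (dx a) sfg.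
have [_ [C C0 HC]] := Sm_bndQ T sD.
have : intQ T ('D_(dx a) (fun z => f z * g z)) = 0.
  apply: (@int_dx _ T a (fun z => f z * g z) _ C) => //.
  - by move=> z; exact: Sm_is_derive.
  - by move=> z; exact: (@Sm_line_continuous (dx a) z _ sD).
  - exact: Sm_periodic.
  - by have [] := Sm_bndQ T sD.
rewrite (intQ_ext (g := fun z => f z * 'D_(dx a) g z + 'D_(dx a) f z * g z)).
  rewrite intQD; [move/eqP; rewrite addr_eq0 => /eqP //| |].
    by apply: Sm_L1Q; apply: SmM => //; exact: Sm_D.
  by apply: Sm_L1Q; apply: SmM => //; exact: Sm_D.
by move=> z _; rewrite Sm_deriveM// [X in _ + X]mulrC.
Qed.

Definition Sm_init T f := Sm f /\ exists2 T', T' < T & forall z, T' <= z.2 -> f z = 0.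

Lemma Sm_init_test T f : Sm_init T f -> test_init T f.
Proof.
move=> [sf [T' T'T f0]]; split; [exact: Sm_smooth|exact: Sm_periodic|].
by exists T' => // x t; exact: (f0 (x, t)).
Qed.

Lemma SmT_int_init T f : SmT_int T f -> Sm_init T f.
Proof. by move=> [sf [_ H]]. Qed.

Lemma Sm_ibp_t T f g : 0 < T -> Sm f -> Sm_init T g ->
  intQ T (fun z => f z * 'D_dt g z) =
  - intC (fun x => f (x, 0) * g (x, 0)) - intQ T (fun z => 'D_dt f z * g z).
Proof.
move=> T0 sf [sg [T' T'T g0]]; have sfg := SmM sf sg; have sD := Sm_D dt sfg.
have [_ [C C0 HC]] := Sm_bndQ T sD.
have : intQ T ('D_dt (fun z => f z * g z)) = intC (fun x => - (f (x, 0) * g (x, 0))).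
  have d1 z : is_derive z dt (fun z => f z * g z) ('D_dt (fun z => f z * g z) z) by exact: Sm_is_derive.
  have m1 : measurable_fun (QT T) ('D_dt (fun z => f z * g z)) by have [] := Sm_bndQ T sD.
  rewrite /intQ (int_dt T0 d1 (fun z => @Sm_line_continuous dt z _ sD) m1 HC).
  by apply: eq_Rintegral => x _; rewrite g0 ?mulr0 ?sub0r//; exact: ltW.
have -> : intC (fun x => - (f (x, 0) * g (x, 0))) = - intC (fun x => f (x, 0) * g (x, 0)).
  have := @intN _ _ _ leb3 cell mcell (fun x => f (x, 0) * g (x, 0)).
  apply; apply: bndC_L1C; split.
    have m0 : measurable_fun setT (fun x : (lebT * lebT * lebT)%type => (x, 0 : lebT)).
      exact: pair2_measurable.
    have := measurableT_comp (Sm_measurable sfg) m0.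
    exact: measurable_funTS.
  have [C' C'0 HC'] := Sm_bounded T sfg; exists C' => // x cx.
  by apply: (HC' (x, 0)); rewrite /= lexx ltW.
rewrite (intQ_ext (g := fun z => f z * 'D_dt g z + 'D_dt f z * g z)).
  rewrite intQD; [move=> <-; rewrite addrK //| |].
    by apply: Sm_L1Q; apply: SmM => //; exact: Sm_D.
  by apply: Sm_L1Q; apply: SmM => //; exact: Sm_D.
by move=> z _; rewrite Sm_deriveM// [X in _ + X]mulrC.
Qed.

Lemma Sm_ibp T (k : option 'I_3) f g : 0 < T -> Sm f -> SmT_int T g ->
  intQ T (fun z => f z * 'D_(dir k) g z) = - intQ T (fun z => 'D_(dir k) f z * g z).
Proof.
move=> T0 sf tg; have [sg [[t0 t00 gt0] _]] := tg; case: k => [a|]; first exact: Sm_ibp_x.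
rewrite (Sm_ibp_t T0 sf (SmT_int_init tg)).
rewrite (_ : intC _ = 0) ?oppr0 ?add0r//.
rewrite -[RHS](@int0 _ _ _ leb3 cell mcell); apply: eq_Rintegral => x _.
by rewrite gt0 ?mulr0//= ltW.
Qed.

Lemma lipQ_bounded T f : lipQ T f -> 0 < T -> exists2 C, 0 <= C & forall z, QT T z -> `|f z| <= C.
Proof.
move=> [_ [L L0 fL]] T0; exists (`|f (0, 0, 0, 0)| + L * (1 + 1 + 1 + T)).
  by rewrite addr_ge0// mulr_ge0// !addr_ge0// ltW.
move=> z [[/andP[a0 a1] /andP[b0 b1] /andP[c0 c1]] /andP[t0 t1]].
rewrite -[f z](subrK (f (0, 0, 0, 0))) addrC (le_trans (ler_normD _ _))// lerD2l.
rewrite (le_trans (fL _ _ _ _))//=; [by rewrite t0|by rewrite lexx ltW|].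
rewrite ler_wpM2l// /dist4/= !subr0 !ger0_norm// !lerD//; exact: ltW.
Qed.

Lemma lipQ_measurable T f : 0 < T -> lipQ T f -> measurable_fun (QT T) f.
Proof.
move=> T0 lf; have [C C0 HC] := approx_exists T0 lf.
have /choice[g Hg] n := HC _ (hrate_gt0 n).
apply: (@measurable_fun_cvg _ _ _ _ g) => [n|z [_ zT]].
- by have [sg _ _ _] := Hg n; exact: measurable_funS (Sm_measurable sg).
by apply: (@cvg_hrate _ _ 1) => n; rewrite mul1r; have [_ H _ _] := Hg n; exact: H.
Qed.

Lemma lipQ_bndQ T f : 0 < T -> lipQ T f -> bndQ T f.
Proof.
move=> T0 lf; have [C C0 HC] := lipQ_bounded lf T0.
by apply: (bndQP _ HC); exact: lipQ_measurable.
Qed.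

(* A Lipschitz function f with bounded weak derivatives df None in time and df (Some a) in x_a. *)
Definition Lw T f (df : option 'I_3 -> stime R -> R) := [/\ lipQ T f, forall k, bndQ T (df k) &
  forall k psi, SmT_int T psi ->
    intQ T (fun z => f z * 'D_(dir k) psi z) = - intQ T (fun z => df k z * psi z)].

(** The approximants converge uniformly and their derivatives are bounded uniformly. Integration by
    parts gives convergence of the derivatives against test functions; density of these in $L^1$ and
    the uniform bound extend it to every integrable [h]. *)
Lemma Lw_approx T f df : 0 < T -> Lw T f df -> exists (g : nat -> stime R -> R) (C : R),
  [/\ 0 <= C, forall n, Sm (g n),
    forall n z, 0 <= z.2 <= T -> `|g n z - f z| <= hrate n,
    forall n k z, `|'D_(dir k) (g n) z| <= C &
    (forall n lo hi, (forall z, 0 <= z.2 <= T -> lo <= f z <= hi) -> forall z, lo <= g n z <= hi) /\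
    (forall k h, L1Q T h -> intQ T (fun z => 'D_(dir k) (g n) z * h z) @[n --> \oo] -->
      intQ T (fun z => df k z * h z))].
Proof.
move=> T0 [lf bdf wf]; have [C C0 HC] := approx_exists T0 lf.
have /choice[g Hg] n := HC _ (hrate_gt0 n).
have sg n : Sm (g n) by case: (Hg n).
have gf n z : 0 <= z.2 <= T -> `|g n z - f z| <= hrate n by case: (Hg n) => _ + _ _; apply.
have Dg n k z : `|'D_(dir k) (g n) z| <= C by case: (Hg n).
exists g, C; split => //; split=> [n|k h Lh]; first by case: (Hg n).
have [_ [C' C'0 dfC]] := bdf k.
apply/cvgrPdist_le => e e0.
(* [psi] is fixed before [n]: the error [h - psi] is paired with both [df k], bounded by [C'], and
   the derivative of [g n], bounded by [C]. *)
have [psi tpsi hpsi] : exists2 psi, SmT_int T psi & (C + C') * intQ T (fun z => `|h z - psi z|) <= e / 2.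
  have B0 : 0 < C + C' + 1 by rewrite ltr_pwDr// addr_ge0.
  have [psi tpsi H] := L1Q_dense T0 Lh (divr_gt0 (divr_gt0 e0 (ltr0n R 2)) B0).
  exists psi => //; have I0 : 0 <= intQ T (fun z => `|h z - psi z|) by exact: intQ_ge0.
  apply: (@le_trans _ _ ((C + C' + 1) * intQ T (fun z => `|h z - psi z|))).
    by rewrite ler_wpM2r// lerDl.
  by rewrite mulrC -ler_pdivlMr.
have spsi : Sm psi by case: tpsi.
have Lpsi := Sm_L1Q T spsi; have LDpsi := Sm_L1Q T (Sm_D (dir k) spsi).
have bDg n : bndQ T ('D_(dir k) (g n)) by apply: Sm_bndQ; exact: Sm_D.
have bf := lipQ_bndQ T0 lf.
have lim1 : intQ T (fun z => g n z * 'D_(dir k) psi z) @[n --> \oo] --> intQ T (fun z => f z * 'D_(dir k) psi z).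
  apply: (@intQ_cvg_unif _ _ _ _ 1) => // [n|n z [_ zT]]; first exact: Sm_bndQ.
  by rewrite mul1r gf.
have e2 : 0 < e / 2 by exact: divr_gt0.
have /cvgrPdist_le/(_ _ e2) := lim1; apply: filterS => n Hn.
have Lhp : L1Q T (fun z => h z - psi z) by exact: L1QB.
have -> : intQ T (fun z => df k z * h z) - intQ T (fun z => 'D_(dir k) (g n) z * h z) =
    intQ T (fun z => df k z * (h z - psi z)) - intQ T (fun z => 'D_(dir k) (g n) z * (h z - psi z)) -
    (intQ T (fun z => f z * 'D_(dir k) psi z) - intQ T (fun z => g n z * 'D_(dir k) psi z)).
  rewrite (wf k psi tpsi) (Sm_ibp _ T0 (sg n) tpsi).
  have spl F : bndQ T F -> intQ T (fun z => F z * h z) = intQ T (fun z => F z * (h z - psi z)) + intQ T (fun z => F z * psi z).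
    move=> bF; rewrite -intQD; [|exact: L1Q_bndM|exact: L1Q_bndM].
    by apply: intQ_ext => z _; rewrite -mulrDr subrK.
  by rewrite !spl//; ring.
rewrite (le_trans (ler_normB _ _))// [leRHS]splitr lerD//.
rewrite (le_trans (ler_normB _ _))// (le_trans _ hpsi)// mulrDl addrC lerD//.
  by apply: intQ_bndM_le.
by apply: intQ_bndM_le => // z _; exact: Dg.
Qed.

End TorusCalculus.

(** * Chain rule for Lipschitz functions *)

Section ChainRule.
Context {R : realType}.
Implicit Types (T : R) (f g h : stime R -> R).

Lemma cvg_sumr (J : Type) (U : Type) (F : set_system U) (r : seq J) (f : J -> U -> R) (a : J -> R) :
  Filter F -> (forall j, f j x @[x --> F] --> a j) ->
  \sum_(j <- r) f j x @[x --> F] --> \sum_(j <- r) a j.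
Proof. by move=> FF fa; apply: cvg_big => // -[x y]; exact: add_continuous. Qed.

Lemma mean_value_lip (G G' : R -> R) (C s t : R) : has_deriv G G' ->
  (forall r, Num.min s t <= r <= Num.max s t -> `|G' r| <= C) -> `|G s - G t| <= C * `|s - t|.
Proof.
move=> dG; wlog st : s t / s <= t.
  move=> H GC; have [st|/ltW ts] := leP s t; first exact: H.
  rewrite distrC (distrC s t); apply: H => // r.
  by rewrite minC maxC; exact: GC.
rewrite min_l// max_r// => GC.
have cG : {within `[s, t], continuous G} by apply: continuous_subspaceT; exact: has_deriv_continuous dG.
have [c + e] := MVT_segment st (fun x _ => dG x) cG.
rewrite in_itv/= => cst_; rewrite distrC e normrM (distrC s t).
by rewrite ler_wpM2r// GC.
Qed.

Lemma Sm_lip T f : 0 < T -> Sm f -> lipQ T f.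
Proof.
move=> T0 sf; split; first exact: Sm_periodic.
have HD k : exists2 C, 0 <= C & forall z, 0 <= z.2 <= T -> `|'D_(dir k) f z| <= C.
  by apply: Sm_bounded; exact: Sm_D.
have /choice[C HC] k : exists C, 0 <= C /\ forall z, 0 <= z.2 <= T -> `|'D_(dir k) f z| <= C.
  by have [C C0 H] := HD k; exists C.
have line k (z : stime R) : has_deriv (fun s => f (s *: dir k + z)) (fun s => 'D_(dir k) f (s *: dir k + z)).
  by move=> s; apply: is_derive_line; exact: Sm_is_derive.
pose k1 : 'I_3 := Ordinal (isT : (1 < 3)%N); pose k2 : 'I_3 := Ordinal (isT : (2 < 3)%N).
pose M := C (Some ord0) + C (Some k1) + C (Some k2) + C None.
have C0 k : 0 <= C k by case: (HC k).
have M0 : 0 <= M by rewrite /M !addr_ge0.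
have CM k : C k <= M.
  have h0 := C0 (Some ord0); have h1 := C0 (Some k1); have h2 := C0 (Some k2); have h3 := C0 None.
  have : [\/ k = Some ord0, k = Some k1, k = Some k2 | k = None].
    case: k => [[[|[|[|//]]] a3]|]; last by constructor 4.
    - by constructor 1; congr Some; exact: val_inj.
    - by constructor 2; congr Some; exact: val_inj.
    - by constructor 3; congr Some; exact: val_inj.
  by rewrite /M; case=> ->; lra.
have step k (z : stime R) s t : (forall r, Num.min s t <= r <= Num.max s t -> 0 <= (r *: dir k + z).2 <= T) ->
    `|f (s *: dir k + z) - f (t *: dir k + z)| <= M * `|s - t|.
  move=> H; apply: (mean_value_lip (line k z)) => r /H rT.
  by rewrite (le_trans _ (CM k))//; have [_ ->] := HC k.
exists M => // -[[[z0 z1] z2] t] [[[w0 w1] w2] s] /= tT sT; rewrite /dist4/=.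
have e0 (a b c u : R) : a *: dir (Some ord0) + (0, b, c, u) = (a, b, c, u).
  by rewrite smul_dx/= mulr1 !mulr0 !add0r addr0.
have e1 (a b c u : R) : b *: dir (Some k1) + (a, 0, c, u) = (a, b, c, u).
  by rewrite smul_dx/= mulr1 !mulr0 !add0r addr0.
have e2 (a b c u : R) : c *: dir (Some k2) + (a, b, 0, u) = (a, b, c, u).
  by rewrite smul_dx/= mulr1 !mulr0 !add0r addr0.
have e3 (a b c u : R) : u *: dir None + (a, b, c, 0) = (a, b, c, u) by rewrite smul_dt/= addr0.
have h0 : `|f (z0, z1, z2, t) - f (w0, z1, z2, t)| <= M * `|z0 - w0|.
  have := step (Some ord0) (0, z1, z2, t) z0 w0; rewrite !e0; apply => r _; by rewrite smul_dx.
have h1 : `|f (w0, z1, z2, t) - f (w0, w1, z2, t)| <= M * `|z1 - w1|.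
  have := step (Some k1) (w0, 0, z2, t) z1 w1; rewrite !e1; apply => r _; by rewrite smul_dx.
have h2 : `|f (w0, w1, z2, t) - f (w0, w1, w2, t)| <= M * `|z2 - w2|.
  have := step (Some k2) (w0, w1, 0, t) z2 w2; rewrite !e2; apply => r _; by rewrite smul_dx.
have h3 : `|f (w0, w1, w2, t) - f (w0, w1, w2, s)| <= M * `|t - s|.
  have := step None (w0, w1, w2, 0) t s; rewrite !e3; apply => r; rewrite smul_dt/= addr0 => /andP[r1 r2].
  move: tT sT => /andP[t0 tT] /andP[s0 sT]; apply/andP; split.
    by rewrite (le_trans _ r1)// le_min t0.
  by rewrite (le_trans r2)// ge_max tT.
rewrite !mulrDr.
have -> : f (z0, z1, z2, t) - f (w0, w1, w2, s) =
   (f (z0, z1, z2, t) - f (w0, z1, z2, t)) + (f (w0, z1, z2, t) - f (w0, w1, z2, t)) +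
   (f (w0, w1, z2, t) - f (w0, w1, w2, t)) + (f (w0, w1, w2, t) - f (w0, w1, w2, s)) by ring.
by do 3 (rewrite (le_trans (ler_normD _ _))// lerD//).
Qed.

(** The difference quotient of [B] at [s] is dominated by that of [q], which tends to 0. With [q] a
    sum of squared increments this differentiates a Taylor remainder. *)
Lemma is_derive_squeeze (B q : R -> R) (C s : R) : 0 <= C -> is_derive s (1 : R) q 0 -> q s = 0 ->
  (forall t, `|B t| <= C * q t) -> is_derive s (1 : R) B 0.
Proof.
move=> C0 [dq eq] qs Bq.
have Bs : B s = 0 by apply/eqP; rewrite -normr_le0; have := Bq s; rewrite qs mulr0.
have lim0 : h^-1 *: ((B \o shift s) (h *: (1 : R)) - B s) @[h --> 0^'] --> (0 : R).
  apply/cvgrPdist_le => e e0.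
  have C1 : 0 < C + 1 by rewrite ltr_pwDr.
  have eC : 0 < e / (C + 1) by exact: divr_gt0.
  have qlim : h^-1 *: ((q \o shift s) (h *: (1 : R)) - q s) @[h --> 0^'] --> (0 : R).
    by have H : h^-1 *: ((q \o shift s) (h *: (1 : R)) - q s) @[h --> 0^'] --> ('D_1 q s : R) := dq; rewrite eq in H.
  move/cvgrPdist_le : qlim => /(_ _ eC); apply: filterS => h.
  rewrite !sub0r !normrN qs Bs !subr0 /GRing.scale/= !normrM => H.
  rewrite (le_trans (ler_wpM2l (normr_ge0 _) (Bq _)))// mulrCA.
  rewrite (le_trans (ler_wpM2l C0 (ler_wpM2l (normr_ge0 _) (ler_norm _))))//.
  rewrite (le_trans (ler_wpM2l C0 H))// mulrCA ger_pMr// ler_pdivrMr// mul1r.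
  by rewrite lerDl.
by apply: DeriveDef; [apply/cvg_ex; exists 0 | apply/cvg_lim].
Qed.

Lemma intQ_dir_eq0 T (k : option 'I_3) h h' : 0 < T -> (forall z, is_derive z (dir k) h (h' z)) ->
  (forall z, continuous (fun s : R => h' (s *: dir k + z))) -> Defs.periodic h -> bndQ T h' ->
  (forall x, h (x, 0) = h (x, T)) -> intQ T h' = 0.
Proof.
move=> T0; case: k => [a|] hd hc ph [mh' [C _ HC]] h0T; first exact: (int_dx hd hc ph mh' HC).
rewrite /intQ (int_dt T0 hd hc mh' HC) (_ : (fun x => h (x, T) - h (x, 0)) = fun=> 0).
  by rewrite Rintegral_cst ?mul0r//; exact: measurable_cell.
by apply/funext => x; rewrite h0T subrr.
Qed.

Section C11.
Context {I : finType}.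
Implicit Types (lo hi a b : I -> R).

Definition inbox lo hi a := forall i, lo i <= a i <= hi i.

(* K is C^{1,1} on a box, with gradient dK. *)
Definition C11 lo hi (K : (I -> R) -> R) (dK : I -> (I -> R) -> R) (C : R) :=
  [/\ 0 <= C, forall a b, inbox lo hi a -> inbox lo hi b ->
    `|K b - K a - \sum_i dK i a * (b i - a i)| <= C * \sum_i (b i - a i) ^+ 2 &
   forall i a b, inbox lo hi a -> inbox lo hi b -> `|dK i b - dK i a| <= C * \sum_j `|b j - a j|].

(** On a box of total width [W] the gradient differs from its value at [a0] by at most [C W], and
    the quadratic remainder is at most [C W] times the $\ell^1$ distance. *)
Lemma C11_lip lo hi K dK C a0 : C11 lo hi K dK C -> inbox lo hi a0 ->
  exists2 B, 0 <= B & (forall i a, inbox lo hi a -> `|dK i a| <= B) /\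
    (forall a b, inbox lo hi a -> inbox lo hi b -> `|K b - K a| <= B * \sum_i `|b i - a i|).
Proof.
move=> [C0 K2 K1] box0; pose W := \sum_i (hi i - lo i).
have W1 a b i : inbox lo hi a -> inbox lo hi b -> `|b i - a i| <= hi i - lo i.
  by move=> /(_ i)/andP[? ?] /(_ i)/andP[? ?]; rewrite ler_norml; apply/andP; split; lra.
have Wi i : 0 <= hi i - lo i by have /andP[? ?] := box0 i; rewrite subr_ge0 (le_trans _ _ (y := a0 i)).
have W0 : 0 <= W by exact: sumr_ge0.
pose M := \sum_i `|dK i a0| + C * W.
have M0 : 0 <= M by rewrite addr_ge0 ?mulr_ge0// sumr_ge0.
have dKM i a : inbox lo hi a -> `|dK i a| <= M.
  move=> ba; rewrite -[dK i a](subrK (dK i a0)) addrC (le_trans (ler_normD _ _))// lerD//.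
    by rewrite (bigD1 i)//= lerDl sumr_ge0.
  rewrite (le_trans (K1 _ _ _ box0 ba))// ler_wpM2l// ler_sum// => j _; exact: W1.
exists (M + C * W); first by rewrite addr_ge0// mulr_ge0.
split=> [i a ba|a b ba bb]; first by rewrite (le_trans (dKM i a ba))// lerDl mulr_ge0.
have -> : K b - K a = \sum_i dK i a * (b i - a i) + (K b - K a - \sum_i dK i a * (b i - a i)).
  by rewrite [RHS]addrC subrK.
rewrite (le_trans (ler_normD _ _))// mulrDl lerD//.
  rewrite mulr_sumr (le_trans (ler_norm_sum _ _ _))// ler_sum// => i _.
  by rewrite normrM ler_wpM2r// dKM.
rewrite (le_trans (K2 _ _ ba bb))// -mulrA ler_wpM2l// mulr_sumr ler_sum// => i _.
rewrite -[_ ^+ 2]real_normK ?num_real// expr2 ler_wpM2r// (le_trans (W1 _ _ _ ba bb))//.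
by rewrite /W (bigD1 i)//= lerDl sumr_ge0.
Qed.

(** Along a differentiable curve, [K] is its first-order expansion at time [s] plus a remainder
    bounded by squared increments, whose derivative at [s] is 0. No differentiability of [K] on an
    open set enters, so the box may touch the boundary of the domain. *)
Lemma C11_has_deriv lo hi K dK C (G G' : I -> R -> R) : C11 lo hi K dK C ->
  (forall s, inbox lo hi (G^~ s)) -> (forall i, has_deriv (G i) (G' i)) ->
  has_deriv (fun s => K (G^~ s)) (fun s => \sum_i dK i (G^~ s) * G' i s).
Proof.
move=> [C0 K2 _] Gbox dG s.
have dA : has_deriv (fun t => K (G^~ s) + \sum_i dK i (G^~ s) * (G i t - G i s))
    (fun t => 0 + \sum_i dK i (G^~ s) * G' i t).
  apply: has_derivD; first exact: has_deriv_cst.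
  apply: has_deriv_sum => i t.
  apply: is_derive_eq (has_derivM (has_deriv_cst (dK i (G^~ s)))
    (has_derivD (dG i) (has_deriv_cst (- G i s))) t) _.
  by rewrite mulr0 !addr0.
have dq : is_derive s (1 : R) (fun t => \sum_i (G i t - G i s) ^+ 2) 0.
  have H := has_deriv_sum (fun i => has_derivM (has_derivD (dG i) (has_deriv_cst (- G i s)))
    (has_derivD (dG i) (has_deriv_cst (- G i s)))) s.
  have -> : (fun t => \sum_i (G i t - G i s) ^+ 2) = (fun t => \sum_i (G i t - G i s) * (G i t - G i s)).
    by apply/funext => t; apply: eq_bigr => i _; rewrite expr2.
  by apply: is_derive_eq H _; rewrite big1// => i _; rewrite subrr !mul0r addr0.
have dB := is_derive_squeeze C0 dq _ _ (B := fun t => K (G^~ t) - (K (G^~ s) + \sum_i dK i (G^~ s) * (G i t - G i s))).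
have {}dB : is_derive s (1 : R) (fun t => K (G^~ t) - (K (G^~ s) + \sum_i dK i (G^~ s) * (G i t - G i s))) 0.
  apply: dB; first by rewrite big1// => i _; rewrite subrr expr0n.
  by move=> t; rewrite opprD addrA; exact: K2.
have -> : (fun t => K (G^~ t)) = (fun t => (K (G^~ s) + \sum_i dK i (G^~ s) * (G i t - G i s)) +
    (K (G^~ t) - (K (G^~ s) + \sum_i dK i (G^~ s) * (G i t - G i s)))).
  by apply/funext => t; rewrite addrC subrK.
by apply: is_derive_eq (is_deriveD (dA s) dB) _; rewrite add0r addr0.
Qed.

Lemma lipQ_comp T lo hi (K : (I -> R) -> R) (B : R) (u : I -> stime R -> R) : 0 <= B ->
  (forall a b, inbox lo hi a -> inbox lo hi b -> `|K b - K a| <= B * \sum_i `|b i - a i|) ->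
  (forall i, lipQ T (u i)) -> (forall z, 0 <= z.2 <= T -> inbox lo hi (u^~ z)) ->
  lipQ T (fun z => K (u^~ z)).
Proof.
move=> B0 KB lu ubox; split.
  by move=> z a; congr K; apply/funext => i; have [pu _] := lu i; rewrite pu.
have /choice[L HL] i : exists L, 0 <= L /\
    forall z w : stime R, 0 <= z.2 <= T -> 0 <= w.2 <= T -> `|u i z - u i w| <= L * dist4 z w.
  by have [_ [L L0 H]] := lu i; exists L.
exists (B * \sum_i L i) => [|z w zT wT].
  by rewrite mulr_ge0// sumr_ge0// => i _; case: (HL i).
rewrite (le_trans (KB _ _ (ubox w wT) (ubox z zT)))// -mulrA ler_wpM2l// mulr_suml.
by rewrite ler_sum// => i _; have [_ H] := HL i; exact: H.
Qed.

(** The chain rule holds pointwise for smooth approximants of the components, which stay in the box.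
    In the limit the coefficients [dK i] converge uniformly and the derivatives weakly, so their
    products converge. *)
Lemma Lw_comp T lo hi K dK C (u : I -> stime R -> R) (du : I -> option 'I_3 -> stime R -> R) :
  0 < T -> C11 lo hi K dK C -> (forall i, Lw T (u i) (du i)) ->
  (forall z, 0 <= z.2 <= T -> inbox lo hi (u^~ z)) ->
  Lw T (fun z => K (u^~ z)) (fun k z => \sum_i dK i (u^~ z) * du i k z).
Proof.
move=> T0 cK Lu ubox; have T00 : 0 <= (0 : R) <= T by rewrite lexx ltW.
have lu i : lipQ T (u i) by case: (Lu i).
have [B B0 [dKB KB]] := C11_lip cK (ubox (0, 0, 0, 0) T00).
have [C0 K2 K1] := cK.
have ldK i : lipQ T (fun z => dK i (u^~ z)) by apply: (lipQ_comp C0 (K1 i) lu ubox).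
have bdK i := lipQ_bndQ T0 (ldK i).
have bdu i k : bndQ T (du i k) by case: (Lu i).
have lK := lipQ_comp B0 KB lu ubox.
split=> // [k|k psi tpsi].
  by apply: bndQ_sum => i _; exact: bndQM.
have spsi : Sm psi by case: tpsi.
have Lpsi := Sm_L1Q T spsi; have bpsi := Sm_bndQ T spsi.
have LD := Sm_L1Q T (Sm_D (dir k) spsi); have bD := Sm_bndQ T (Sm_D (dir k) spsi).
have /choice[G /choice[M HG]] i := Lw_approx T0 (Lu i).
have sG i n : Sm (G i n) by case: (HG i).
have GM i n j z : `|'D_(dir j) (G i n) z| <= M i by case: (HG i) => _ _ _ + _; apply.
have Gu i n z : 0 <= z.2 <= T -> `|G i n z - u i z| <= hrate n by case: (HG i) => _ _ + _ _; apply.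
have Gbox n z : inbox lo hi (fun i => G i n z).
  move=> i; have [_ _ _ _ [H _]] := HG i; apply: H => w wT; exact: ubox.
have Glim i h : L1Q T h -> intQ T (fun z => 'D_(dir k) (G i n) z * h z) @[n --> \oo] -->
   intQ T (fun z => du i k z * h z) by move=> Lh; have [_ _ _ _ [_ H]] := HG i; exact: H.
have lGK n : lipQ T (fun z => K (fun i => G i n z)).
  by apply: (lipQ_comp B0 KB (fun i => Sm_lip T0 (sG i n))) => z _; exact: Gbox.
have ldGK n i : lipQ T (fun z => dK i (fun j => G j n z)).
  by apply: (lipQ_comp C0 (K1 i) (fun i => Sm_lip T0 (sG i n))) => z _; exact: Gbox.
have bGK n := lipQ_bndQ T0 (lGK n).
have bdGK n i := lipQ_bndQ T0 (ldGK n i).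
have bDG n i : bndQ T ('D_(dir k) (G i n)) by apply: Sm_bndQ; exact: Sm_D.
pose D n z := \sum_i dK i (fun j => G j n z) * 'D_(dir k) (G i n) z.
have bDn n : bndQ T (D n) by apply: bnd_sum => i _; exact: bndQM.
have line n z : has_deriv (fun s => K (fun i => G i n (s *: dir k + z))) (fun s => D n (s *: dir k + z)).
  apply: (C11_has_deriv (G := fun i s => G i n (s *: dir k + z)) cK) => [s|i s]; first exact: Gbox.
  by apply: is_derive_line; exact: Sm_is_derive.
have dK_line n i z : continuous (fun s : R => dK i (fun j => G j n (s *: dir k + z))).
  move=> s; apply/cvgrPdist_le => e e0.
  have cs : \sum_j `|G j n (t *: dir k + z) - G j n (s *: dir k + z)| @[t --> s] --> (0 : R).
    rewrite -[X in _ --> X](_ : \sum_(j : I) `|G j n (s *: dir k + z) - G j n (s *: dir k + z)| = 0); last first.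
      by rewrite big1// => j _; rewrite subrr normr0.
    apply: (@cvg_sumr _ _ _ _ (fun j t => `|G j n (t *: dir k + z) - G j n (s *: dir k + z)|)) => j; apply: cvg_norm; apply: cvgB; last exact: cvg_cst.
    exact: (@Sm_line_continuous _ (dir k) z _ (sG j n)).
  have C1 : 0 < C + 1 by rewrite ltr_pwDr.
  move/cvgrPdist_le : cs => /(_ _ (divr_gt0 e0 C1)); apply: filterS => t.
  rewrite sub0r normrN ger0_norm; last exact: sumr_ge0.
  move=> H; rewrite distrC (le_trans (K1 _ _ _ (Gbox n _) (Gbox n _)))//.
  rewrite (le_trans (ler_wpM2l C0 H))// mulrCA ger_pMr// ler_pdivrMr// mul1r.
  by rewrite lerDl.
have cD n z : continuous (fun s : R => D n (s *: dir k + z)).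
  move=> s; apply: (@cvg_sumr _ _ _ _ (fun i s => dK i (fun j => G j n (s *: dir k + z)) * 'D_(dir k) (G i n) (s *: dir k + z))) => i; apply: cvgM; first exact: dK_line.
  exact: (@Sm_line_continuous _ (dir k) z _ (Sm_D (dir k) (sG i n))).
have ibp n : intQ T (fun z => K (fun i => G i n z) * 'D_(dir k) psi z) = - intQ T (fun z => D n z * psi z).
  pose h z := K (fun i => G i n z) * psi z.
  pose h' z := K (fun i => G i n z) * 'D_(dir k) psi z + D n z * psi z.
  have hline z : has_deriv (fun s => h (s *: dir k + z)) (fun s => h' (s *: dir k + z)).
    move=> s; have dpsi : has_deriv (fun s : R => psi (s *: dir k + z)) (fun s => 'D_(dir k) psi (s *: dir k + z)).
      by move=> t; apply: is_derive_line; exact: Sm_is_derive.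
    by apply: is_derive_eq (has_derivM (line n z) dpsi s) _; rewrite /h' [X in _ + X]mulrC.
  have hd z : is_derive z (dir k) h (h' z).
    by have := hline z 0; rewrite scale0r add0r => H; exact: is_derive_line0 H.
  have hc z : continuous (fun s : R => h' (s *: dir k + z)).
    move=> s; apply: cvgD; apply: cvgM.
    - by apply: (has_deriv_continuous (line n z)).
    - exact: (@Sm_line_continuous _ (dir k) z _ (Sm_D (dir k) spsi)).
    - exact: cD.
    - exact: (@Sm_line_continuous _ (dir k) z _ spsi).
  have bh' : bndQ T h' by apply: bndQD; exact: bndQM.
  have : intQ T h' = 0.
    apply: (intQ_dir_eq0 T0 hd hc) => // [z a'|x]; rewrite /h.
      by have [p1 _] := lGK n; rewrite (Sm_periodic spsi); congr (_ * _); exact: p1.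
    have [_ [[t0 t00 p0] [T' T'T pT]]] := tpsi.
    by rewrite [psi (x, 0)]p0 ?[psi (x, T)]pT ?mulr0//=; exact: ltW.
  rewrite /h' intQD; [move/eqP; rewrite addr_eq0 => /eqP //| |].
    by apply: bndQ_L1Q; exact: bndQM.
  by apply: bndQ_L1Q; exact: bndQM.
have GS n z : QT T z -> \sum_i `|G i n z - u i z| <= #|I|%:R * hrate n.
  move=> [_ zT]; rewrite (le_trans (ler_sum _ (fun i _ => Gu i n z zT)))//.
  by rewrite sumr_const mulr_natl.
have lim1 : intQ T (fun z => K (fun i => G i n z) * 'D_(dir k) psi z) @[n --> \oo] -->
    intQ T (fun z => K (u^~ z) * 'D_(dir k) psi z).
  apply: (@intQ_cvg_unif _ _ _ _ _ (B * #|I|%:R)) => //; first exact: lipQ_bndQ.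
  move=> n z Qz; have zT : 0 <= z.2 <= T by case: Qz.
  by rewrite (le_trans (KB _ _ (ubox z zT) (Gbox n z)))// -mulrA ler_wpM2l// GS.
have lim2 : intQ T (fun z => D n z * psi z) @[n --> \oo] -->
    intQ T (fun z => (\sum_i dK i (u^~ z) * du i k z) * psi z).
  have -> : intQ T (fun z => (\sum_i dK i (u^~ z) * du i k z) * psi z) =
      \sum_i intQ T (fun z => du i k z * (dK i (u^~ z) * psi z)).
    rewrite -intQ_sum => [|i _]; last by apply: bndQ_L1Q; do !apply: bndQM.
    by apply: intQ_ext => z _; rewrite mulr_suml; apply: eq_bigr => i _; ring.
  (* Weak times strong: with the limit coefficient the derivative converges weakly; the change of
     coefficient tends to 0 uniformly while the derivative stays bounded. *)
  have -> : (fun n => intQ T (fun z => D n z * psi z)) = (fun n => \sum_i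
      (intQ T (fun z => 'D_(dir k) (G i n) z * (dK i (u^~ z) * psi z)) +
       intQ T (fun z => (dK i (fun j => G j n z) - dK i (u^~ z)) * 'D_(dir k) (G i n) z * psi z))).
    apply/funext => n; rewrite -[LHS](@intQ_ext _ T (fun z => \sum_i
      ('D_(dir k) (G i n) z * (dK i (u^~ z) * psi z) +
      (dK i (fun j => G j n z) - dK i (u^~ z)) * 'D_(dir k) (G i n) z * psi z))); last first.
      by move=> z _; rewrite mulr_suml; apply: eq_bigr => i _; ring.
    rewrite intQ_sum => [|i _]; last first.
      by apply: bndQ_L1Q; apply: bndQD; do !apply: bndQM => //; exact: bndQB.
    apply: eq_bigr => i _; rewrite intQD//.
      by apply: bndQ_L1Q; do !apply: bndQM.
    by apply: bndQ_L1Q; do !apply: bndQM => //; exact: bndQB.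
  apply: cvg_sumr => i; rewrite -[X in _ --> X]addr0; apply: cvgD.
    by apply: Glim; apply: bndQ_L1Q; exact: bndQM.
  rewrite -[X in _ --> X](_ : intQ T (fun z => 0 * psi z) = 0); last first.
    by rewrite intQZ// mul0r.
  apply: (@intQ_cvg_unif _ _ _ _ _ (C * #|I|%:R * M i)) => // [n||n z Qz].
  - by apply: bndQM => //; exact: bndQB.
  - exact: bndQ_cst.
  have zT : 0 <= z.2 <= T by case: Qz.
  rewrite subr0 normrM mulrAC ler_pM// (le_trans (K1 _ _ _ (ubox z zT) (Gbox n z)))//.
  by rewrite -mulrA ler_wpM2l// GS.
have lim3 : intQ T (fun z => K (fun i => G i n z) * 'D_(dir k) psi z) @[n --> \oo] -->
    - intQ T (fun z => (\sum_i dK i (u^~ z) * du i k z) * psi z).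
  by under eq_fun do rewrite ibp; exact: cvgN.
exact: (cvg_unique _ lim1 lim3).
Qed.

End C11.
End ChainRule.

(** * Products, sums, and balance laws with Lipschitz tests *)

Section WeakCalculus.
Context {R : realType}.
Implicit Types (T : R) (f g h : stime R -> R).
Notation lebT := (measurableTypeR R).

Let mcell : measurable (cell : set (lebT * lebT * lebT)%type).
Proof. exact: measurable_cell. Qed.

Lemma lipQ_strip_bounded T f : 0 < T -> lipQ T f ->
  exists2 C, 0 <= C & forall z, 0 <= z.2 <= T -> `|f z| <= C.
Proof.
move=> T0 lf; have [C _ HC] := approx_exists T0 lf.
have [g [sg gf _ _]] := HC 1 ltr01; have [B B0 gB] := Sm_bounded T sg.
exists (1 + B) => [|z zT]; first by rewrite addr_ge0.
by rewrite -[f z](subrK (g z)) (le_trans (ler_normD _ _))// lerD ?gB// distrC gf.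
Qed.

Lemma Lw_ext T f df df' : Lw T f df -> (forall k z, QT T z -> df k z = df' k z) -> Lw T f df'.
Proof.
move=> [lf bf wf] e; split=> // [k|k psi tpsi]; first by apply: (bndQ_ext (bf k)) => z; exact: e.
by rewrite wf//; congr (- _); apply: intQ_ext => z Qz; rewrite e.
Qed.

Lemma Lw_cst T (c : R) : 0 < T -> Lw T (fun=> c) (fun _ _ => 0).
Proof.
move=> T0; split=> [|k|k psi tpsi].
- by split=> //; exists 0 => // z w _ _; rewrite subrr normr0 mul0r.
- exact: bndQ_cst.
rewrite (Sm_ibp k T0 (Sm_cst c) tpsi); congr (- _); apply: intQ_ext => z _.
by rewrite derive_cst.
Qed.

(** The chain rule for multiplication on a box: it is $C^{1,1}$ with constant 1, its Taylor
    remainder being the product of the two increments. *)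
Lemma LwM T f g df dg : 0 < T -> Lw T f df -> Lw T g dg ->
  Lw T (fun z => f z * g z) (fun k z => g z * df k z + f z * dg k z).
Proof.
move=> T0 Lf Lg; have [lf _ _] := Lf; have [lg _ _] := Lg.
have [B B0 fB] := lipQ_strip_bounded T0 lf; have [B' B'0 gB] := lipQ_strip_bounded T0 lg.
pose u (b : bool) := if b then f else g; pose du (b : bool) := if b then df else dg.
pose S (b : bool) : R := if b then B else B'.
have cK : C11 (fun b => - S b) S (fun a => a true * a false) (fun b a => a (~~ b)) 1.
  split=> // [a b _ _|i a b _ _]; rewrite !big_bool/= mul1r; last first.
    by case: i => /=; rewrite ?lerDl ?lerDr.
  rewrite (_ : _ - _ = (b true - a true) * (b false - a false)); last by ring.
  have := sqr_ge0 (`|b true - a true| - `|b false - a false|).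
  rewrite normrM -[X in _ <= X + _]real_normK ?num_real// -[X in _ <= _ + X]real_normK ?num_real//.
  set x := `|_|; set y := `|_| => H; have : 0 <= x ^+ 2 by exact: sqr_ge0.
  have : 0 <= y ^+ 2 by exact: sqr_ge0.
  move: H; rewrite !expr2; lra.
have := Lw_comp T0 cK (u := u) (du := du).
move=> /(_ _ _)/Lw_ext; apply => [[]//|z zT []|k z _] /=; last by rewrite big_bool.
  by rewrite -ler_norml; exact: fB.
by rewrite -ler_norml; exact: gB.
Qed.

Lemma LwZ T (c : R) f df : 0 < T -> Lw T f df -> Lw T (fun z => c * f z) (fun k z => c * df k z).
Proof.
move=> T0 Lf; apply: (Lw_ext (LwM T0 (Lw_cst c T0) Lf)) => k z _.
by rewrite mulr0 add0r.
Qed.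

Lemma Lw_sum T (I : finType) (u : I -> stime R -> R) du : 0 < T -> (forall i, Lw T (u i) (du i)) ->
  Lw T (fun z => \sum_i u i z) (fun k z => \sum_i du i k z).
Proof.
move=> T0 Lu; have /choice[S HS] i : exists C, forall z, 0 <= z.2 <= T -> `|u i z| <= C.
  by have [lu _ _] := Lu i; have [C _ H] := lipQ_strip_bounded T0 lu; exists C.
have cK : C11 (fun i => - S i) S (fun a => \sum_i a i) (fun _ _ => 1) 0.
  split=> // [a b _ _|i a b _ _]; last by rewrite subrr normr0 mul0r.
  rewrite -sumrB (_ : _ - _ = 0) ?normr0 ?mul0r//.
  by apply/eqP; rewrite subr_eq0; apply/eqP/eq_bigr => i _; rewrite mul1r.
have := Lw_comp T0 cK Lu.
move=> /(_ _)/Lw_ext; apply => [z zT i|k z _]; last by apply: eq_bigr => i _; rewrite mul1r.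
by rewrite -ler_norml; exact: HS.
Qed.

Lemma LwD T f g df dg : 0 < T -> Lw T f df -> Lw T g dg ->
  Lw T (fun z => f z + g z) (fun k z => df k z + dg k z).
Proof.
move=> T0 Lf Lg; have := @Lw_sum T bool (fun b => if b then f else g) (fun b => if b then df else dg) T0.
rewrite (_ : (fun z => \sum_(i : bool) _) = fun z => f z + g z); last by apply/funext => z; rewrite big_bool.
by move=> H; apply: (Lw_ext (H _)) => [[]//|k z _]; rewrite big_bool.
Qed.

Lemma LwN T f df : 0 < T -> Lw T f df -> Lw T (fun z => - f z) (fun k z => - df k z).
Proof.
move=> T0 Lf; have := LwZ (-1) T0 Lf.
rewrite (_ : (fun z => -1 * f z) = fun z => - f z); last by apply/funext => z; rewrite mulN1r.
by move=> H; apply: (Lw_ext H) => k z _; rewrite mulN1r.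
Qed.

Lemma LwB T f g df dg : 0 < T -> Lw T f df -> Lw T g dg ->
  Lw T (fun z => f z - g z) (fun k z => df k z - dg k z).
Proof. by move=> T0 Lf Lg; apply: LwD => //; exact: LwN. Qed.

Lemma Lw_bndQ T f df : 0 < T -> Lw T f df -> bndQ T f.
Proof. by move=> T0 [lf _ _]; exact: lipQ_bndQ. Qed.

Lemma Lw_bndQ_deriv T f df k : Lw T f df -> bndQ T (df k). Proof. by case. Qed.

Lemma lipQ_bndC T f : 0 < T -> lipQ T f -> bndC (fun x => f (x, 0)).
Proof.
move=> T0 lf; have [C C0 HC] := lipQ_strip_bounded T0 lf.
have [C' C'0 app] := approx_exists T0 lf; have T00 : 0 <= (0 : R) <= T by rewrite lexx ltW.
have /choice[g Hg] n := app _ (hrate_gt0 n).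
split; last by exists C => // x _; exact: HC.
apply: (@measurable_fun_cvg _ _ _ _ (fun n x => g n (x, 0))) => [n|x _].
  have [sg _ _ _] := Hg n.
  have mpair : measurable_fun setT (fun x : (lebT * lebT * lebT)%type => (x, 0 : lebT)).
    exact: measurable_pair2.
  exact: (measurable_funS measurableT (@subsetT _ _) (measurableT_comp (Sm_measurable sg) mpair)).
by apply: (@cvg_hrate _ _ _ 1) => n; rewrite mul1r; have [_ H _ _] := Hg n; exact: H.
Qed.

Lemma L1C_bndM (f h : xspace R -> R) : bndC f -> L1C h -> L1C (fun x => f x * h x).
Proof. exact: (@L1_bndM _ _ _ leb3 cell mcell f h). Qed.
Lemma intCB (f h : xspace R -> R) : L1C f -> L1C h -> intC (fun x => f x - h x) = intC f - intC h.
Proof. exact: (@intB _ _ _ leb3 cell mcell f h). Qed.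
Lemma intCZ (k : R) (f : xspace R -> R) : L1C f -> intC (fun x => k * f x) = k * intC f.
Proof. exact: (@intZ _ _ _ leb3 cell mcell k f). Qed.
Lemma intC_bndM_le (f h : xspace R -> R) (C : R) : bndC f -> L1C h ->
  (forall x, cell x -> `|f x| <= C) -> `|intC (fun x => f x * h x)| <= C * intC (fun x => `|h x|).
Proof. exact: (@int_bndM_le _ _ _ leb3 cell mcell f h C). Qed.
Lemma bndCB (f h : xspace R -> R) : bndC f -> bndC h -> bndC (fun x => f x - h x).
Proof. exact: bndB. Qed.

Lemma intC_cvg_unif (F : nat -> xspace R -> R) (f h : xspace R -> R) (C : R) :
  (forall n, bndC (F n)) -> bndC f -> L1C h ->
  (forall n x, cell x -> `|F n x - f x| <= C * hrate n) ->
  intC (fun x => F n x * h x) @[n --> \oo] --> intC (fun x => f x * h x).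
Proof.
move=> bF bf Lh HF; apply: (@cvg_hrate _ _ _ (C * intC (fun x => `|h x|))) => n.
have LF : L1C (fun x => F n x * h x) by exact: L1C_bndM.
have Lf : L1C (fun x => f x * h x) by exact: L1C_bndM.
have -> : intC (fun x => F n x * h x) - intC (fun x => f x * h x) = intC (fun x => (F n x - f x) * h x).
  rewrite -(intCB LF Lf).
  by apply: eq_Rintegral => x _; rewrite mulrBl.
rewrite mulrAC; apply: intC_bndM_le => //; first exact: bndCB.
by move=> x; exact: HF.
Qed.

(** Here [psi] need not vanish at $t=0$, so integration by parts in time leaves the initial trace;
    it passes to the limit because the approximants converge uniformly up to that slice. *)
Lemma Lw_ibp T f df psi k : 0 < T -> Lw T f df -> Sm_init T psi ->
  intQ T (fun z => f z * 'D_(dir k) psi z) =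
  - (if k is None then intC (fun x => f (x, 0) * psi (x, 0)) else 0) - intQ T (fun z => df k z * psi z).
Proof.
move=> T0 Lf ipsi; have [spsi _] := ipsi; have [lf _ _] := Lf.
have [g [C [C0 sg gf Dg [_ Hlim]]]] := Lw_approx T0 Lf.
have T00 : 0 <= (0 : R) <= T by rewrite lexx ltW.
have lim1 : intQ T (fun z => g n z * 'D_(dir k) psi z) @[n --> \oo] --> intQ T (fun z => f z * 'D_(dir k) psi z).
  apply: (@intQ_cvg_unif _ _ _ _ _ 1) => [n|||n z [_ zT]].
  - exact: Sm_bndQ.
  - exact: lipQ_bndQ.
  - by apply: Sm_L1Q; exact: Sm_D.
  - by rewrite mul1r; exact: gf.
have lim2 := Hlim k _ (Sm_L1Q T spsi).
have bC h : Sm h -> bndC (fun x => h (x, 0)) by move=> sh; apply: (@lipQ_bndC T) => //; exact: Sm_lip.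
have lim3 : intC (fun x => g n (x, 0) * psi (x, 0)) @[n --> \oo] --> intC (fun x => f (x, 0) * psi (x, 0)).
  apply: (@intC_cvg_unif _ _ _ 1) => [n|||n x _].
  - exact: bC.
  - exact: lipQ_bndC lf.
  - by apply: bndC_L1C; exact: bC.
  - by rewrite mul1r; exact: gf.
case: k lim1 lim2 => [a|] lim1 lim2.
  apply: (cvg_unique _ lim1) => //; rewrite oppr0 sub0r.
  by rewrite [X in X @ _](_ : _ = fun n => - intQ T (fun z => 'D_(dir (Some a)) (g n) z * psi z)); [exact: cvgN|apply/funext => n; exact: Sm_ibp_x].
apply: (cvg_unique _ lim1) => //; rewrite [X in X @ _](_ : _ = fun n => - intC (fun x => g n (x, 0) * psi (x, 0)) -
    intQ T (fun z => 'D_dt (g n) z * psi z)); last by apply/funext => n; exact: Sm_ibp_t.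
by apply: cvgB => //; exact: cvgN.
Qed.

Definition balance_Sm T (f0 : xspace R -> R) f (g : 'I_3 -> stime R -> R) (s : stime R -> R) :=
  forall psi, Sm_init T psi ->
    intC (fun x => f0 x * psi (x, 0)) +
    intQ T (fun z => f z * 'D_dt psi z - \sum_a g a z * 'D_(dx a) psi z + s z * psi z) = 0.

Lemma balance_law_init_Sm T (f0 : xspace R -> R) f (g : 'I_3 -> stime R -> R) (s : stime R -> R) : balance_law_init T f0 f g s -> balance_Sm T f0 f g s.
Proof. by move=> H psi /Sm_init_test/H. Qed.

(** For smooth approximants [G n] of [w] the function [phi(t) G n] is an admissible test. Every term
    of the law is linear in [G n] or in one of its first derivatives and is paired with an
    integrable function, so uniform convergence and weak convergence of derivatives suffice. *)
Lemma balance_ext T (f0 : xspace R -> R) f (g : 'I_3 -> stime R -> R) (s : stime R -> R) (phi phi' : R -> R) (w : stime R -> R) dw : 0 < T ->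
  L1C f0 -> L1Q T f -> (forall a, L1Q T (g a)) -> L1Q T s -> balance_Sm T f0 f g s ->
  smooth1 phi -> has_deriv phi phi' -> (exists2 T', T' < T & forall t, T' <= t -> phi t = 0) ->
  Lw T w dw ->
  phi 0 * intC (fun x => f0 x * w (x, 0)) +
  intQ T (fun z => f z * (phi' z.2 * w z + phi z.2 * dw None z) -
     \sum_a g a z * (phi z.2 * dw (Some a) z) + s z * (phi z.2 * w z)) = 0.
Proof.
move=> T0 Lf0 Lf Lg Ls bal sphi dphi [T' T'T phi0] Lww; have [lw bdw _] := Lww.
have [G [C [C0 sG Gw DG [_ Glim]]]] := Lw_approx T0 Lww.
have sphi' : smooth1 phi'.
  have [phi1 sphi1 dphi1] := smooth1_deriv sphi.
  by rewrite (_ : phi' = phi1)//; apply/funext => t; exact: is_derive1_unique (dphi t) (dphi1 t).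
have st := Sm_time sphi; have st' := Sm_time sphi'.
have bt := Sm_bndQ T st; have bt' := Sm_bndQ T st'.
have bw := lipQ_bndQ T0 lw.
have T00 : 0 <= (0 : R) <= T by rewrite lexx ltW.
have Dt (z : stime R) : 'D_dt (fun z => phi z.2) z = phi' z.2.
  rewrite -[RHS]mulr1 -[z.2]add0r -(mulr0 1).
  apply: (Sm_derive_line st (G := fun s => phi (1 * s + z.2))
     (G' := fun s => phi' (1 * s + z.2) * 1)) => [u|].
  - by case: z => [[[x0 x1] x2] t]; rewrite smul_dt/= mul1r.
  - exact: has_deriv_affine.
have Dx a (z : stime R) : 'D_(dx a) (fun z => phi z.2) z = 0.
  apply: (Sm_derive_line st (G := fun _ => phi z.2) (G' := fun=> 0)) => [u|].
  - by case: z => [[[x0 x1] x2] t]; rewrite smul_dx.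
  - exact: has_deriv_cst.
have bG n := Sm_bndQ T (sG n).
have bDG n k := Sm_bndQ T (Sm_D (dir k) (sG n)).
have Ltf := L1Q_bndM bt Lf; have Lt'f := L1Q_bndM bt' Lf; have Lts := L1Q_bndM bt Ls.
have Ltg a := L1Q_bndM bt (Lg a).
have spl (u : stime R -> R) (du : option 'I_3 -> stime R -> R) : bndQ T u -> (forall k, bndQ T (du k)) ->
    intQ T (fun z => f z * (phi' z.2 * u z + phi z.2 * du None z) -
     \sum_a g a z * (phi z.2 * du (Some a) z) + s z * (phi z.2 * u z)) =
    intQ T (fun z => u z * (phi' z.2 * f z)) + intQ T (fun z => du None z * (phi z.2 * f z)) -
    \sum_a intQ T (fun z => du (Some a) z * (phi z.2 * g a z)) + intQ T (fun z => u z * (phi z.2 * s z)).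
  move=> bu bdu.
  have L1 := L1Q_bndM bu Lt'f; have L2 := L1Q_bndM (bdu None) Ltf.
  have L3 a := L1Q_bndM (bdu (Some a)) (Ltg a); have L4 := L1Q_bndM bu Lts.
  have LS : L1Q T (fun z => \sum_a du (Some a) z * (phi z.2 * g a z)) by exact: L1Q_sum.
  rewrite -intQ_sum// -intQD// -intQB//; last exact: L1QD.
  rewrite -intQD//; last by apply: L1QB => //; exact: L1QD.
  apply: intQ_ext => z _; rewrite (eq_bigr (fun a => du (Some a) z * (phi z.2 * g a z))).
    by ring.
  by move=> a _; ring.
have H n : phi 0 * intC (fun x => G n (x, 0) * f0 x) +
   (intQ T (fun z => G n z * (phi' z.2 * f z)) + intQ T (fun z => 'D_dt (G n) z * (phi z.2 * f z)) -
    \sum_a intQ T (fun z => 'D_(dx a) (G n) z * (phi z.2 * g a z)) + intQ T (fun z => G n z * (phi z.2 * s z))) = 0.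
  rewrite -(spl (G n) (fun k => 'D_(dir k) (G n)))//.
  rewrite -[RHS](bal (fun z => phi z.2 * G n z)); last first.
    by split; [exact: SmM|exists T' => // z Tz; rewrite phi0// mul0r].
  congr (_ + _).
    rewrite -intCZ; last first.
      apply: L1C_bndM => //; apply: (@lipQ_bndC T) => //; exact: Sm_lip.
    by apply: eq_Rintegral => x _ /=; ring.
  apply: intQ_ext => z _; rewrite (Sm_deriveM _ _ st (sG n)) Dt; congr (_ * _ - _ + _); first by ring.
  by apply: eq_bigr => a _; rewrite (Sm_deriveM _ _ st (sG n)) Dx mulr0 addr0.
rewrite spl// (_ : intC (fun x => f0 x * w (x, 0)) = intC (fun x => w (x, 0) * f0 x)); last first.
  by apply: eq_Rintegral => x _; rewrite mulrC.
have cG h : L1Q T h -> intQ T (fun z => G n z * h z) @[n --> \oo] --> intQ T (fun z => w z * h z).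
  by move=> Lh; apply: (@intQ_cvg_unif _ _ _ _ _ 1) => // n z [_ zT]; rewrite mul1r; exact: Gw.
have cC : intC (fun x => G n (x, 0) * f0 x) @[n --> \oo] --> intC (fun x => w (x, 0) * f0 x).
  apply: (@intC_cvg_unif _ _ _ 1) => // [n||n x _]; [|exact: lipQ_bndC lw|by rewrite mul1r; exact: Gw].
  by apply: (@lipQ_bndC T) => //; exact: Sm_lip.
set L := LHS; suff c0 : (fun=> 0 : R) n @[n --> \oo] --> (L : R).
  by apply: (cvg_unique _ c0) => //; exact: cvg_cst.
rewrite /L {L} (_ : (fun=> 0) = fun n : nat => phi 0 * intC (fun x => G n (x, 0) * f0 x) +
   (intQ T (fun z => G n z * (phi' z.2 * f z)) + intQ T (fun z => 'D_dt (G n) z * (phi z.2 * f z)) -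
    \sum_a intQ T (fun z => 'D_(dx a) (G n) z * (phi z.2 * g a z)) + intQ T (fun z => G n z * (phi z.2 * s z)))); last first.
  by apply/funext => n; rewrite H.
apply: cvgD; first by apply: cvgM => //; exact: cvg_cst.
apply: cvgD; last exact: cG.
apply: cvgB.
  by apply: cvgD; [exact: cG|exact: (Glim None)].
apply: (@cvg_sumr _ _ _ _ _ (fun a n => intQ T (fun z => 'D_(dx a) (G n) z * (phi z.2 * g a z)))) => a.
exact: (Glim (Some a)).
Qed.

End WeakCalculus.

(** * Minors and null Lagrangians *)

Section NullLagrangianAlgebra.
Context {R : realType}.
Implicit Types (F : 'M[R]_3) (B C : xidx) (i j k a b c : 'I_3).

Definition s1 i : 'I_3 := ordS i.
Definition s2 i : 'I_3 := ordS (ordS i).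

(** The Levi-Civita symbol, written with cyclic successors modulo 3. *)
Definition eps i j k : R := ((j == s1 i) && (k == s2 i))%:R - ((j == s2 i) && (k == s1 i))%:R.

Lemma eps_swap23 i j k : eps i j k = - eps i k j.
Proof. by rewrite /eps opprB -!mulnb !natrM; ring. Qed.

Lemma eps_swap12 i j k : eps i j k = - eps j i k.
Proof.
by case: i => [[|[|[|//]]] ?]; case: j => [[|[|[|//]]] ?]; case: k => [[|[|[|//]]] ?];
  rewrite /eps -!val_eqE /= ?subr0 ?sub0r ?opprK ?oppr0.
Qed.

Lemma sum_pick3 (G : 'I_3 -> R) j : \sum_i (i == j)%:R * G i = G j.
Proof.
rewrite (bigD1 j)//= eqxx mul1r big1 ?addr0// => i /negbTE ->.
by rewrite mul0r.
Qed.

Lemma sum_eps3 (G : 'I_3 -> R) i j :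
  \sum_k eps i j k * G k = (j == s1 i)%:R * G (s2 i) - (j == s2 i)%:R * G (s1 i).
Proof.
rewrite -(sum_pick3 G (s2 i)) -(sum_pick3 G (s1 i)) !mulr_sumr -sumrB; apply: eq_bigr => k _.
by rewrite /eps -!mulnb !natrM; ring.
Qed.

(** With cyclic indices the signs of the minors are absorbed in the order of the rows and
    columns. *)
Lemma cofE F i a : cof F i a = F (s1 i) (s1 a) * F (s2 i) (s2 a) - F (s1 i) (s2 a) * F (s2 i) (s1 a).
Proof.
rewrite /cof mxE /cofactor (expand_det_row _ ord0) !big_ord_recl big_ord0 /cofactor !det_mx11 !mxE.
pose G (n m : nat) := F (inord n) (inord m).
have E x y : F x y = G (val x) (val y) by rewrite /G !inord_val.
rewrite !E; clearbody G.
case: i => [[|[|[|//]]] ?]; case: a => [[|[|[|//]]] ?]; rewrite /= /bump/= ?expr0 ?expr1; ring.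
Qed.

Lemma detE F i : \det F = \sum_a F i a * cof F i a.
Proof. by rewrite (expand_det_row _ i); apply: eq_bigr => a _; rewrite /cof mxE. Qed.

(** The derivatives of the minors are affine functions of the minors: [dPhi_k] is the constant part
    and [dPhi_m] the matrix of the linear part. This is what carries averages and balance laws from
    [PhiB] over to [dPhiB]. *)
Definition dPhi_k B i a : R := if B is inl (inl (j, b)) then ((j == i) && (b == a))%:R else 0.

Definition dPhi_m B i a C : R :=
  match B, C with
  | inl (inr (j, b)), inl (inl (k, c)) => eps j i k * eps b a c
  | inr _, inl (inr (j, b)) => ((j == i) && (b == a))%:R
  | _, _ => 0
  end.

Lemma sum_xidx (f : xidx -> R) : \sum_C f C =
  \sum_i \sum_a f (inl (inl (i, a))) + \sum_i \sum_a f (inl (inr (i, a))) + f (inr tt).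
Proof.
rewrite big_sumType big_sumType/= !pair_bigA/=; congr (_ + _ + _).
- by apply: eq_bigr => -[].
- by apply: eq_bigr => -[].
- by rewrite (bigD1 tt)//= big1 ?addr0// => -[].
Qed.

Lemma is_derive_entry F i a j b : is_derive F (delta_mx i a) (fun G => G j b) ((j == i) && (b == a))%:R.
Proof.
have H := @is_derive_proj R _ (fun G : 'M[R]_3 => G j b) id (fun=> 1) F (delta_mx i a).
have -> : ((j == i) && (b == a))%:R = 1 * (delta_mx i a : 'M[R]_3) j b by rewrite mul1r !mxE.
by apply: H => [h|t]; [rewrite !mxE|exact: is_derive_id].
Qed.

Lemma is_derive_cof F i a j b : is_derive F (delta_mx i a) (fun G => cof G j b)
  (\sum_k \sum_c eps j i k * eps b a c * F k c).
Proof.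
under eq_fun do rewrite cofE.
apply: is_derive_eq (is_deriveB (is_deriveM (is_derive_entry F i a _ _) (is_derive_entry F i a _ _))
  (is_deriveM (is_derive_entry F i a _ _) (is_derive_entry F i a _ _))) _.
under eq_bigr => k _ do (under eq_bigr do rewrite -mulrA; rewrite -mulr_sumr sum_eps3).
rewrite sum_eps3 /GRing.scale/= -!mulnb !natrM ![_ == i]eq_sym ![_ == a]eq_sym; ring.
Qed.

Lemma is_derive_det F i a : is_derive F (delta_mx i a) (fun G => \det G) (cof F i a).
Proof.
under eq_fun do rewrite (detE _ i).
rewrite (_ : (fun G => _) = \sum_(b < 3) ((fun G : 'M[R]_3 => G i b) * (fun G => cof G i b))); last first.
  by apply/funext => G; rewrite fct_sumE; apply: eq_bigr.
apply: is_derive_eq (is_derive_sum (fun b => is_deriveM (is_derive_entry F i a i b) (is_derive_cof F i a i b))) _.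
rewrite -[RHS](sum_pick3 (fun b => cof F i b)); apply: eq_bigr => b _.
rewrite /GRing.scale/= [X in _ * X + _]big1 ?mulr0 ?add0r; last first.
  move=> k _; rewrite big1// => c _; rewrite (_ : eps i i k = 0) ?mul0r//.
  by rewrite /eps; case: (i) => [[|[|[|//]]] ?]; rewrite -!val_eqE /= subrr.
by rewrite eqxx mulrC.
Qed.


Lemma sum_dPhi_m B i a (X : xidx -> R) : \sum_C dPhi_m B i a C * X C =
  match B with
  | inl (inl _) => 0
  | inl (inr (j, b)) => \sum_k \sum_c eps j i k * eps b a c * X (inl (inl (k, c)))
  | inr _ => X (inl (inr (i, a)))
  end.
Proof.
have z0 (f : 'I_3 -> 'I_3 -> R) : \sum_k \sum_c 0 * f k c = 0.
  by rewrite big1// => k _; rewrite big1// => c _; rewrite mul0r.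
rewrite sum_xidx; case: B => [[[j b]|[j b]]|[]] /=.
- by rewrite !z0 mul0r !addr0.
- by rewrite z0 mul0r !addr0.
rewrite z0 mul0r addr0 add0r.
under eq_bigr => k _ do (under eq_bigr do rewrite -mulnb natrM -mulrA; rewrite -mulr_sumr (sum_pick3 (fun c => X (inl (inr (k, c)))))).
by rewrite (sum_pick3 (fun k => X (inl (inr (k, a))))).
Qed.

Lemma is_derive_PhiB B i a F : is_derive F (delta_mx i a) (PhiB B) 
  (dPhi_k B i a + \sum_C dPhi_m B i a C * PhiB C F).
Proof.
rewrite sum_dPhi_m; case: B => [[[j b]|[j b]]|[]] /=.
- by rewrite addr0; exact: is_derive_entry.
- by rewrite add0r; exact: is_derive_cof.
- by rewrite add0r; exact: is_derive_det.
Qed.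

Lemma dPhiB_affine B i a F : dPhiB B i a F = dPhi_k B i a + \sum_C dPhi_m B i a C * PhiB C F.
Proof. by have [_ H] := is_derive_PhiB B i a F; exact: H. Qed.

Lemma dPhiB_F j b i a F : dPhiB (inl (inl (j, b))) i a F = ((j == i) && (b == a))%:R.
Proof. by rewrite dPhiB_affine sum_dPhi_m /= addr0. Qed.

Lemma dPhiB_cof j b i a F :
  dPhiB (inl (inr (j, b))) i a F = \sum_k \sum_c eps j i k * eps b a c * F k c.
Proof. by rewrite dPhiB_affine sum_dPhi_m /= add0r. Qed.

Lemma dPhiB_det i a F : dPhiB (inr tt) i a F = cof F i a.
Proof. by rewrite dPhiB_affine sum_dPhi_m /= add0r. Qed.

(* Hence div(dPhiB B i . F) = 0 for gradients F. *)
Lemma dPhi_antisym B i j a b F :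
  \sum_C dPhi_m B i a C * dPhiB C j b F = - \sum_C dPhi_m B i b C * dPhiB C j a F.
Proof.
apply: etrans (sum_dPhi_m B i a (fun C => dPhiB C j b F)) _.
apply: etrans _ (esym (congr1 -%R (sum_dPhi_m B i b (fun C => dPhiB C j a F)))).
case: B => [[[k c]|[k c]]|[]].
- by rewrite oppr0.
- rewrite -sumrN; apply: eq_bigr => m _.
  have E (p q : 'I_3) : \sum_n eps k i m * eps c p n * dPhiB (inl (inl (m, n))) j q F =
      eps k i m * (m == j)%:R * eps c p q.
    rewrite -(sum_pick3 (fun n => eps k i m * (m == j)%:R * eps c p n)); apply: eq_bigr => n _.
    by rewrite dPhiB_F -mulnb natrM; ring.
  by rewrite [LHS]E [in RHS]E (eps_swap23 c a b) mulrN.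
- rewrite !dPhiB_cof -sumrN; apply: eq_bigr => m _; rewrite -sumrN; apply: eq_bigr => n _.
  by rewrite (eps_swap12 a b) mulrN mulNr.
Qed.

Let o1 := s1 ord0.
Let o2 := s2 ord0.

Let sum3 (G : 'I_3 -> R) : \sum_i G i = G ord0 + G o1 + G o2.
Proof.
rewrite !big_ord_recl big_ord0 addr0 addrA; congr (_ + G _ + G _); exact: val_inj.
Qed.
Let s1_1 : s1 o1 = o2. Proof. exact: val_inj. Qed.
Let s1_2 : s1 o2 = ord0. Proof. exact: val_inj. Qed.
Let s2_1 : s2 o1 = ord0. Proof. exact: val_inj. Qed.
Let s2_2 : s2 o2 = o1. Proof. exact: val_inj. Qed.

(** The product rule applied to the explicit minors; the work lies in reading the outcome as a
    contraction of [dPhiB] with the weak gradient. *)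
Lemma Lw_PhiB T (X : 'I_3 -> 'I_3 -> stime R -> R) dX B : 0 < T ->
  (forall i a, Lw T (X i a) (dX i a)) ->
  Lw T (fun z => PhiB B (\matrix_(i, a) X i a z))
    (fun d z => \sum_i \sum_a dPhiB B i a (\matrix_(i, a) X i a z) * dX i a d z).
Proof.
move=> T0 LX.
pose Dcof j b d z := X (s2 j) (s2 b) z * dX (s1 j) (s1 b) d z + X (s1 j) (s1 b) z * dX (s2 j) (s2 b) d z -
   (X (s2 j) (s1 b) z * dX (s1 j) (s2 b) d z + X (s1 j) (s2 b) z * dX (s2 j) (s1 b) d z).
have Lcof0 j b : Lw T (fun z => cof (\matrix_(i, a) X i a z) j b) (Dcof j b).
  have := LwB T0 (LwM T0 (LX (s1 j) (s1 b)) (LX (s2 j) (s2 b))) (LwM T0 (LX (s1 j) (s2 b)) (LX (s2 j) (s1 b))).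
  rewrite (_ : (fun z => _ - _) = (fun z => cof (\matrix_(i, a) X i a z) j b)) //.
  by apply/funext => z; rewrite cofE !mxE.
have Lcof j b : Lw T (fun z => cof (\matrix_(i, a) X i a z) j b) (fun d z =>
    \sum_i \sum_a (\sum_m \sum_c eps j i m * eps b a c * X m c z) * dX i a d z).
  apply: (Lw_ext (Lcof0 j b)) => d z _; rewrite /Dcof.
  have E i a : (\sum_m \sum_c eps j i m * eps b a c * X m c z) * dX i a d z =
     ((i == s1 j)%:R * ((a == s1 b)%:R * (X (s2 j) (s2 b) z * dX i a d z)) - (i == s1 j)%:R * ((a == s2 b)%:R * (X (s2 j) (s1 b) z * dX i a d z)))
     - ((i == s2 j)%:R * ((a == s1 b)%:R * (X (s1 j) (s2 b) z * dX i a d z)) - (i == s2 j)%:R * ((a == s2 b)%:R * (X (s1 j) (s1 b) z * dX i a d z))).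
    under eq_bigr => m _ do (under eq_bigr do rewrite -mulrA; rewrite -mulr_sumr (sum_eps3 (fun c => X m c z))).
    by rewrite (sum_eps3 (fun m => (a == s1 b)%:R * X m (s2 b) z - (a == s2 b)%:R * X m (s1 b) z)); ring.
  under [RHS]eq_bigr => i _ do (under eq_bigr do rewrite E; rewrite !sumrB -!mulr_sumr
    !(sum_pick3 (fun a => _ * dX i a d z))).
  by rewrite !sumrB !(sum_pick3 (fun i => _ * dX i _ d z)); ring.
case: B => [[[j b]|[j b]]|[]].
- rewrite (_ : (fun z => PhiB _ _) = X j b); last by apply/funext => z; rewrite /PhiB/= mxE.
  apply: (Lw_ext (LX j b)) => d z _.
  rewrite -(sum_pick3 (fun i => dX i b d z)); apply: eq_bigr => i _.
  rewrite -(sum_pick3 (fun a => dX i a d z)) mulr_sumr; apply: eq_bigr => a _.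
  by rewrite dPhiB_F -mulnb natrM mulrA (eq_sym i) (eq_sym a).
- apply: (Lw_ext (Lcof j b)) => d z _; apply: eq_bigr => i _; apply: eq_bigr => a _.
  rewrite dPhiB_cof; congr (_ * _); apply: eq_bigr => m _; apply: eq_bigr => c _.
  by rewrite mxE.
- have Lco b : Lw T (fun z => cof (\matrix_(i, a) X i a z) ord0 b) (fun d z => Dcof ord0 b d z).
    by apply: (Lw_ext (Lcof0 ord0 b)).
  have := Lw_sum T0 (fun b => LwM T0 (LX ord0 b) (Lco b)).
  rewrite (_ : (fun z => \sum_b _) = fun z => PhiB (inr tt) (\matrix_(i, a) X i a z)); last first.
    by apply/funext => z; rewrite /PhiB/= (detE _ ord0); apply: eq_bigr => b _; rewrite mxE.
  move=> H; apply: (Lw_ext H) => d z _.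
  under [RHS]eq_bigr do under eq_bigr do rewrite dPhiB_det cofE !mxE.
  under [LHS]eq_bigr => b do rewrite (cofE _ ord0 b) !mxE.
  rewrite !sum3 /Dcof !s1_1 !s1_2 !s2_1 !s2_2 -[s1 ord0]/o1 -[s2 ord0]/o2; ring.
Qed.

End NullLagrangianAlgebra.

(** * Estimates for the internal energy *)

Section CoordinatewiseCalculus.
Context {R : realType} {I : finType}.
Implicit Types (lo hi a b : I -> R).

Definition upd a i (t : R) : I -> R := fun j => if j == i then t else a j.

(** Only coordinate directions are demanded. This is available on boxes that touch $\eta=0$, where
    derivatives are one-sided. *)
Definition coord_mvt lo hi (f : (I -> R) -> R) (df : I -> (I -> R) -> R) :=
  forall a i s t, s <= t -> inbox lo hi (upd a i s) -> inbox lo hi (upd a i t) ->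
  exists2 u, s <= u <= t & f (upd a i t) - f (upd a i s) = df i (upd a i u) * (t - s).

(** The path from [a] to [b] changes one coordinate at a time: [p l] has the coordinates listed in
    [l] already moved. It stays in the box, and each leg is a one-dimensional mean value whose
    intermediate point is coordinatewise no farther from [a] than [b] is. *)
Lemma path_mean lo hi f df a b : coord_mvt lo hi f df -> inbox lo hi a -> inbox lo hi b ->
  exists xi : I -> I -> R, (forall i, inbox lo hi (xi i) /\ forall j, `|xi i j - a j| <= `|b j - a j|) /\
    f b - f a = \sum_i df i (xi i) * (b i - a i).
Proof.
move=> mvt ba bb; pose p (l : seq I) j := if j \in l then b j else a j.
suff H l : uniq l -> exists xi : I -> I -> R,
    (forall i, inbox lo hi (xi i) /\ forall j, `|xi i j - a j| <= `|b j - a j|) /\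
    f (p l) - f a = \sum_(i <- l) df i (xi i) * (b i - a i).
  have [xi [xib E]] := H _ (index_enum_uniq I); exists xi; split=> //; rewrite -E.
  by congr (f _ - _); apply/funext => j; rewrite /p mem_index_enum.
elim: l => [_|i l IH /= /andP[il ul]].
  exists (fun=> a); split; first by move=> i; split=> // j; rewrite subrr normr0.
  by rewrite big_nil (_ : p [::] = a) ?subrr//; apply/funext.
have [xi [xib E]] := IH ul.
have boxp m : inbox lo hi (p m) by move=> j; rewrite /p; case: ifP => _.
have pi : p l = upd (p l) i (a i).
  by apply/funext => j; rewrite /upd; case: eqP => // ->; rewrite /p (negbTE il).
have pil : p (i :: l) = upd (p l) i (b i).
  apply/funext => j; rewrite /upd /p in_cons; case: eqP => [->//|_] /=.
  by [].
have [u uab Eu] : exists2 u, Num.min (a i) (b i) <= u <= Num.max (a i) (b i) &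
    f (p (i :: l)) - f (p l) = df i (upd (p l) i u) * (b i - a i).
  have b1 : inbox lo hi (upd (p l) i (a i)) by rewrite -pi.
  have b2 : inbox lo hi (upd (p l) i (b i)) by rewrite -pil.
  have [ab|/ltW ab] := leP (a i) (b i).
    have [u uab Eu] := mvt (p l) i _ _ ab b1 b2.
    by exists u; rewrite ?min_l ?max_r// pil {2}pi.
  have [u uab Eu] := mvt (p l) i _ _ ab b2 b1.
  by exists u; rewrite ?min_r ?max_l// pil {2}pi -opprB Eu -mulrN opprB.
have ul' : Num.min (a i) (b i) <= u <= Num.max (a i) (b i) := uab.
exists (fun j => if j == i then upd (p l) i u else xi j); split.
  move=> k; case: eqP => [_|_]; last exact: xib.
  split=> j; rewrite /upd; case: eqP => [->|_].
  - have /andP[a1 a2] := ba i; have /andP[b1 b2] := bb i; case/andP: uab => u1 u2; apply/andP; split.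
      by rewrite (le_trans _ u1)// le_min a1.
    by rewrite (le_trans u2)// ge_max a2.
  - exact: boxp.
  - case/andP: uab; rewrite ge_min le_max => /orP u1 /orP u2; rewrite ler_norml.
    have [ab|ab] := leP (a i) (b i).
      by rewrite ger0_norm ?subr_ge0//; apply/andP; split; lra.
    by rewrite ltr0_norm ?subr_lt0//; apply/andP; split; lra.
  - by rewrite /p; case: ifP => // _; rewrite subrr normr0.
rewrite big_cons eqxx -Eu -[LHS](subrKA (f (p l))) E; congr (_ + _).
rewrite !big_seq; apply: eq_bigr => j jl; case: eqP => // ji.
by move: il; rewrite -ji jl.
Qed.

Lemma sqr_sum_le (x : I -> R) : (\sum_i x i) ^+ 2 <= #|I|%:R * \sum_i x i ^+ 2.
Proof.
have -> : (\sum_i x i) ^+ 2 = \sum_i \sum_j x i * x j.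
  by rewrite expr2 mulr_suml; apply: eq_bigr => i _; rewrite mulr_sumr.
have E : \sum_i \sum_j (x i ^+ 2 + x j ^+ 2) / 2 = #|I|%:R * \sum_i x i ^+ 2.
  under eq_bigr do rewrite -mulr_suml big_split /= sumr_const.
  rewrite -mulr_suml big_split /= sumr_const sumrMnl.
  by rewrite -mulr2n -[_ *+ 2]mulr_natr mulfK ?pnatr_eq0// mulr_natl.
rewrite -E; apply: ler_sum => i _; apply: ler_sum => j _.
have := sqr_ge0 (x i - x j); rewrite ler_pdivlMr//; lra.
Qed.

Lemma coord_mvt_lip lo hi f df M a b : coord_mvt lo hi f df ->
  (forall i a, inbox lo hi a -> `|df i a| <= M) -> inbox lo hi a -> inbox lo hi b ->
  `|f b - f a| <= M * \sum_i `|b i - a i|.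
Proof.
move=> mvt dfM ba bb; have [xi [xib ->]] := path_mean mvt ba bb.
rewrite mulr_sumr (le_trans (ler_norm_sum _ _ _))// ler_sum// => i _.
by rewrite normrM ler_wpM2r// dfM//; case: (xib i).
Qed.

(** At the intermediate points of the path the gradient differs from that at [a] by at most [M]
    times the $\ell^1$ distance; the squared $\ell^1$ distance is at most the number of coordinates
    times the sum of squares. *)
Lemma coord_C11 lo hi f df (ddf : I -> I -> (I -> R) -> R) M : 0 <= M ->
  coord_mvt lo hi f df -> (forall i, coord_mvt lo hi (df i) (fun j => ddf j i)) ->
  (forall j i a, inbox lo hi a -> `|ddf j i a| <= M) -> C11 lo hi f df (M * (1 + #|I|%:R)).
Proof.
move=> M0 mf mdf HM.
have L i a b : inbox lo hi a -> inbox lo hi b -> `|df i b - df i a| <= M * \sum_j `|b j - a j|.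
  by move=> ba bb; apply: (coord_mvt_lip (mdf i)) => // j c; exact: HM.
split=> [|a b ba bb|i a b ba bb]; first by rewrite mulr_ge0// addr_ge0.
  have [xi [xib ->]] := path_mean mf ba bb; rewrite -sumrB.
  have S0 : 0 <= \sum_i `|b i - a i| by exact: sumr_ge0.
  apply: (@le_trans _ _ (\sum_i M * (\sum_j `|b j - a j|) * `|b i - a i|)).
    rewrite (le_trans (ler_norm_sum _ _ _))// ler_sum// => i _; rewrite -mulrBl normrM ler_wpM2r//.
    have [bi xij] := xib i; rewrite (le_trans (L i a (xi i) ba bi))// ler_wpM2l//.
    by apply: ler_sum => j _; exact: xij.
  rewrite -mulr_sumr -!mulrA ler_wpM2l// -expr2 (le_trans (sqr_sum_le _))//.
  rewrite (eq_bigr (fun i => (b i - a i) ^+ 2)) => [|i _]; last by rewrite real_normK ?num_real.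
  by rewrite ler_wpM2r ?lerDr// sumr_ge0// => i _; exact: sqr_ge0.
rewrite (le_trans (L i a b ba bb))// ler_wpM2r ?sumr_ge0// ler_peMr// lerDl//.
Qed.

End CoordinatewiseCalculus.

(** * The energy in the coordinates of (xi, eta) *)

Section EnergyCoordinates.
Context {R : realType}.
Notation idx := (option xidx).
Notation V := (xi_space R * R)%type.
Implicit Types (a b : idx -> R) (g : V -> R) (I J K : idx).

Definition vec a : V :=
  (\matrix_(i, j) a (Some (inl (inl (i, j)))), \matrix_(i, j) a (Some (inl (inr (i, j)))),
   a (Some (inr tt)), a None).

Definition xc (z : V) I : R := if I is Some B then xi_coord B z.1 else z.2.

Lemma xcK z : vec (xc z) = z.
Proof. by case: z => [[[F Z] w] t]; congr (_, _, _, _); apply/matrixP => i j; rewrite mxE. Qed.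

Lemma vecK a I : xc (vec a) I = a I.
Proof. by case: I => [[[[i j]|[i j]]|[]]|] //=; rewrite mxE. Qed.

Lemma vec_upd a I s t : vec (upd a I t) = (t - s) *: xe_basis I + vec (upd a I s).
Proof.
suff H J : upd a I t J = (t - s) * xc (xe_basis I) J + upd a I s J.
  rewrite -[RHS]xcK; congr vec; apply/funext => J; rewrite H.
  rewrite [X in _ + X](_ : _ = xc (vec (upd a I s)) J); last by rewrite vecK.
  case: J {H} => [[[[i j]|[i j]]|[]]|] //=; try by rewrite !mxE.
rewrite /upd (_ : xc (xe_basis I) J = (J == I)%:R); last first.
  case: I => [[[[i j]|[i j]]|[]]|]; case: J => [[[[k l]|[k l]]|[]]|] //=; by rewrite ?mxE.
by case: eqP => _; [rewrite mulr1 subrK|rewrite mulr0 add0r].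
Qed.

(** Lower corner of a cube cut at $\eta=0$, the boundary of [edom]; the upper corner is the constant
    [r]. *)
Definition pbox (r : R) I : R := if I is None then 0 else - r.

Lemma inbox_edom r a : inbox (pbox r) (fun=> r) a -> edom (vec a).
Proof. by move=> /(_ None)/andP[]. Qed.

(** Inside a coordinate segment contained in [edom] small increments of both signs stay in [edom],
    so the derivative relative to [edom] is an ordinary one along the segment; at the end points
    continuity is enough. *)
Lemma pbox_mvt r g : {within edom, continuous g} -> (forall I z, edom z -> derivable_in edom g (xe_basis I) z) ->
  coord_mvt (pbox r) (fun=> r) (g \o vec) (fun I a => derive_in edom (xe_basis I) g (vec a)).
Proof.
move=> cg dg a I s t st bs bt.
have dom u : s <= u <= t -> edom (vec (upd a I u)).
  move=> /andP[su ut]; have := bs None; have := bt None; rewrite /edom/= /upd; case: eqP => _ /andP[? _] /andP[? _] //.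
  exact: le_trans su.
have der (u : R) : u \in `]s, t[ -> is_derive u (1 : R) (fun u => g (vec (upd a I u)))
    (derive_in edom (xe_basis I) g (vec (upd a I u))).
  rewrite in_itv/= => /andP[su ut].
  have dq : dquot g (xe_basis I) (vec (upd a I u)) @ within [set h | edom (vec (upd a I u) + h *: xe_basis I)] 0^' -->
      derive_in edom (xe_basis I) g (vec (upd a I u)) by apply: dg; apply: dom; rewrite !ltW.
  have {}dq : h^-1 *: (((fun u => g (vec (upd a I u))) \o shift u) (h *: (1 : R)) - g (vec (upd a I u))) @[h --> 0^'] -->
      derive_in edom (xe_basis I) g (vec (upd a I u)).
    move=> A /dq; rewrite /fmap/= /within/=.
    have : \forall h \near (0 : R)^', s <= h + u <= t.
      have us0 : 0 < u - s by rewrite subr_gt0.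
      have tu0 : 0 < t - u by rewrite subr_gt0.
      apply: (@cvg_within _ (nbhs (0 : R)) _ [set x | x != 0]).
      apply: filterS2 (nbhs0_lt us0) (nbhs0_lt tu0) => h.
      by rewrite !ltr_norml => /andP[? ?] /andP[? ?]; apply/andP; split; lra.
    apply: filterS2 => h hst; rewrite /dquot => Hd.
    have E : vec (upd a I u) + h *: xe_basis I = vec (upd a I (h + u)).
      by rewrite (vec_upd a I u (h + u)) addrK addrC.
    change (A (h^-1 * (g (vec (upd a I (h * 1 + u))) - g (vec (upd a I u))))).
    by rewrite mulr1 -E; apply: Hd; rewrite /= E; exact: dom.
  by apply: DeriveDef; [apply/cvg_ex; eexists; exact: dq | apply/cvg_lim].
have cont : {within `[s, t], continuous (fun u => g (vec (upd a I u)))}.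
  apply/subspace_continuousP => u; rewrite /= in_itv/= => ust.
  have := (subspace_continuousP _ _).1 cg _ (dom u ust).
  move=> H A nA.
  have W : \forall w \near vec (upd a I u), edom w -> A (g w) := H A nA.
  have cv : vec (upd a I x) @[x --> u] --> vec (upd a I u).
    rewrite (_ : (fun x => vec _) = fun x => (x - u) *: xe_basis I + vec (upd a I u)); last first.
      by apply/funext => x; exact: vec_upd.
    rewrite -[X in _ --> X]add0r -(scale0r (xe_basis I)) -(subrr u).
    apply: cvgD; last exact: cvg_cst.
    by apply: cvgZr_tmp; apply: cvgB; [exact: cvg_id|exact: cvg_cst].
  suff : \forall x \near u, x \in `[s, t] -> A (g (vec (upd a I x))) by [].
  have W' : \forall x \near u, edom (vec (upd a I x)) -> A (g (vec (upd a I x))) := cv _ W.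
  apply: filterS W' => x Hx; rewrite in_itv/= => xst; apply: Hx; exact: dom.
have [u + E] := MVT_segment st der cont.
by rewrite in_itv/= => ust; exists u.
Qed.

Lemma compact_pbox r : compact [set vec a | a in inbox (pbox r) (fun=> r)].
Proof.
pose A I : set R := `[pbox r I, r]%classic.
have cA : compact [set f : prod_topology (fun _ : idx => R) | forall I, A I (f I)].
  by apply: tychonoff => I; exact: segment_compact.
have -> : [set vec a | a in inbox (pbox r) (fun=> r)] =
   [set vec f | f in [set f : prod_topology (fun _ : idx => R) | forall I, A I (f I)]].
  by apply/seteqP; split=> _ [a H <-]; exists a => // I; have := H I; rewrite /A/= in_itv.
apply: continuous_compact cA; apply: continuous_subspaceT => a.
have pc I : (f I) @[f --> (a : prod_topology (fun _ : idx => R))] --> a I by exact: proj_continuous.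
have mc (G : 'I_3 * 'I_3 -> idx) : \matrix_(i, j) (f (G (i, j)) : R) @[f --> (a : prod_topology (fun _ : idx => R))] -->
    (\matrix_(i, j) (a (G (i, j)) : R) : 'M[R]_3).
  have FF : Filter (nbhs (a : prod_topology (fun _ : idx => R))) by exact: nbhs_filter.
  apply/cvg_ballP => e e0.
  have : \forall f \near (a : prod_topology (fun _ : idx => R)), forall ij, ball (a (G ij) : R) e (f (G ij)).
    by apply: (@filter_forall _ _ (fun ij f => ball (a (G ij) : R) e (f (G ij))) _ FF) => ij; apply: (cvg_ball (pc (G ij))).
  by apply: filterS => f H; split=> // i j; rewrite !mxE; exact: H.
have m1 := mc (fun ij => Some (inl (inl ij))); have m2 := mc (fun ij => Some (inl (inr ij))).
have FF : Filter (nbhs (a : prod_topology (fun _ : idx => R))) by exact: nbhs_filter.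
exact: (cvg_pair (cvg_pair (cvg_pair m1 m2) (pc (Some (inr tt)))) (pc None)).
Qed.

Lemma pbox_bounded r g : {within edom, continuous g} ->
  exists2 M, 0 <= M & forall a, inbox (pbox r) (fun=> r) a -> `|g (vec a)| <= M.
Proof.
move=> cg; have : compact (g @` [set vec a | a in inbox (pbox r) (fun=> r)]).
  apply: continuous_compact; last exact: compact_pbox.
  by apply: continuous_subspaceW cg => _ [a ba <-]; exact: inbox_edom ba.
move=> /compact_bounded [M [_ HM]]; exists (`|M| + 1) => [|a ba]; first by rewrite addr_ge0.
apply: (HM (`|M| + 1)); last by exists (vec a) => //; exists a.
by rewrite (le_lt_trans (ler_norm M))// ltrDl.
Qed.

End EnergyCoordinates.

(** * Increments bounded below by subdivision *)

Section Subdivision.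
Context {R : realType}.

(* Riemann sums: the quadratic errors of n steps add up to C / n. *)
Lemma increment_ge (f g : R -> R) (C m k : R) : 0 <= C ->
  (forall s t, 0 <= s -> s <= t -> t <= 1 -> g s * (t - s) - C * (t - s) ^+ 2 <= f t - f s) ->
  (forall s, 0 <= s <= 1 -> m + k * s <= g s) -> m + k / 2 <= f 1 - f 0.
Proof.
(* The left Riemann sum of $ks$ with $N$ points falls short of $k/2$ by $k/(2N)$, and $N$ errors of
   size $C/N^2$ add up to $C/N$; [B / N] covers both. *)
move=> C0 fg gm; pose B := `|k| / 2 + C.
have B0 : 0 <= B by rewrite addr_ge0// divr_ge0.
suff H (n : nat) : m + k / 2 - B / n.+1%:R <= f 1 - f 0.
  rewrite leNgt; apply/negP => lt.
  have d0 : 0 < m + k / 2 - (f 1 - f 0) by rewrite subr_gt0.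
  have [n Hn] : exists n : nat, B / n.+1%:R < m + k / 2 - (f 1 - f 0).
    exists (Num.truncn (B / (m + k / 2 - (f 1 - f 0)))).
    by rewrite ltr_pdivrMr// mulrC -ltr_pdivrMr// truncnS_gt.
  by move: (H n) Hn; set x := B / _; move: x => x; lra.
have n0 : 0 < (n.+1%:R : R) by [].
set N : R := n.+1%:R in n0 *.
have -> : f 1 - f 0 = \sum_(i < n.+1) (f (i.+1%:R / N) - f (i%:R / N)).
  rewrite -(big_mkord xpredT (fun i => f (i.+1%:R / N) - f (i%:R / N))).
  by rewrite (telescope_sumr (fun i => f (i%:R / N)))// divff ?gt_eqF// mul0r.
have step (i : 'I_n.+1) : (m + k * (i%:R / N)) / N - C / N ^+ 2 <= f (i.+1%:R / N) - f (i%:R / N).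
  have i1 : (i.+1%:R : R) / N <= 1 by rewrite ler_pdivrMr// mul1r ler_nat.
  have i0 : 0 <= (i%:R : R) / N by rewrite divr_ge0// ltW.
  have d : (i.+1%:R : R) / N - i%:R / N = N^-1 by rewrite -mulrBl -natr1 addrC addKr mul1r.
  have ii : (i%:R : R) / N <= i.+1%:R / N by rewrite -subr_ge0 d invr_ge0 ltW.
  apply: le_trans (fg _ _ i0 ii i1); rewrite d -exprVn lerB// ler_wpM2r ?invr_ge0 ?(ltW n0)//.
  by apply: gm; rewrite i0 (le_trans ii).
apply: le_trans (ler_sum _ (fun i _ => step i)).
have NE : N != 0 by rewrite gt_eqF.
have SE : \sum_(i < n.+1) (i%:R : R) = N * (N - 1) / 2.
  rewrite /N {step NE n0 N}; elim: n => [|n IH]; first by rewrite big_ord1 subrr mulr0 mul0r.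
  by rewrite big_ord_recr/= IH -[n.+2%:R]natr1; field.
rewrite (eq_bigr (fun i : 'I_n.+1 => (m / N - C / N ^+ 2) + k / N ^+ 2 * i%:R)); last by move=> i _; field.
rewrite big_split/= sumr_const card_ord -mulr_sumr SE -[(_ - _) *+ _]mulr_natl -/N.
have -> : N * (m / N - C / N ^+ 2) + k / N ^+ 2 * (N * (N - 1) / 2) = m + k / 2 - (k / 2 + C) / N by field.
rewrite /B.
rewrite lerD2l lerN2 ler_wpM2r ?invr_ge0 ?(ltW n0)// /B lerD2r ler_wpM2r// ?invr_ge0//; exact: ler_norm.
Qed.

End Subdivision.

(** * Symmetry of the Hessian and convexity of the energy *)

Section Energy.
Context {R : realType}.
Notation idx := (option xidx).
Implicit Types (a b : idx -> R) (I J K : idx).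
Variable e : xi_space R * R -> R.
Hypothesis Ce : Ck_in edom 3 e.

Definition Ec a : R := e (vec a).
Definition Dc I a : R := de e I (vec a).
Definition Hc I J a : R := hess e I J (vec a).

Lemma Ec_mvt r : coord_mvt (pbox r) (fun=> r) Ec Dc.
Proof.
have [c d] := Ce (s := [::]) isT; apply: (pbox_mvt c) => I z; exact: (d isT).
Qed.

Lemma Dc_mvt r J : coord_mvt (pbox r) (fun=> r) (Dc J) (fun I => Hc I J).
Proof.
have [c d] := Ce (s := [:: xe_basis J]) isT; apply: (pbox_mvt c) => I z; exact: (d isT).
Qed.

Definition Tc K I J a : R := derive_in edom (xe_basis K) (hess e I J) (vec a).

Lemma Hc_mvt r I J : coord_mvt (pbox r) (fun=> r) (Hc I J) (fun K => Tc K I J).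
Proof.
have [c d] := Ce (s := [:: xe_basis I; xe_basis J]) isT; apply: (pbox_mvt c) => K z; exact: (d isT).
Qed.

Lemma sum_ge1 (L : finType) (F : L -> R) i : (forall j, 0 <= F j) -> F i <= \sum_j F j.
Proof. by move=> F0; rewrite (bigD1 i)//= lerDl sumr_ge0. Qed.

(** The derivatives up to order three are continuous, hence bounded on the compact box; those of
    order two and three give the $C^{1,1}$ constants of the energy and of its gradient. *)
Lemma energy_C11 r : exists C, [/\ C11 (pbox r) (fun=> r) Ec Dc C,
  forall J, C11 (pbox r) (fun=> r) (Dc J) (fun I => Hc I J) C,
  forall I a, inbox (pbox r) (fun=> r) a -> `|Dc I a| <= C &
  forall I J a, inbox (pbox r) (fun=> r) a -> `|Hc I J a| <= C].
Proof.
have /choice[M1 HM1] I : exists M, 0 <= M /\ forall a, inbox (pbox r) (fun=> r) a -> `|Dc I a| <= M.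
  by have [c _] := Ce (s := [:: xe_basis I]) isT; have [M M0 H] := pbox_bounded r c; exists M.
have /choice[M2 HM2] (IJ : idx * idx) : exists M, 0 <= M /\
    forall a, inbox (pbox r) (fun=> r) a -> `|Hc IJ.1 IJ.2 a| <= M.
  have [c _] := Ce (s := [:: xe_basis IJ.1; xe_basis IJ.2]) isT.
  by have [M M0 H] := pbox_bounded r c; exists M.
have /choice[M3 HM3] (IJ : idx * idx * idx) : exists M, 0 <= M /\
    forall a, inbox (pbox r) (fun=> r) a -> `|Tc IJ.1.1 IJ.1.2 IJ.2 a| <= M.
  have [c _] := Ce (s := [:: xe_basis IJ.1.1; xe_basis IJ.1.2; xe_basis IJ.2]) isT.
  by have [M M0 H] := pbox_bounded r c; exists M.
pose M := \sum_I M1 I + \sum_J M2 J + \sum_K M3 K.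
have s1 : 0 <= \sum_I M1 I by apply: sumr_ge0 => I _; case: (HM1 I).
have s2 : 0 <= \sum_I M2 I by apply: sumr_ge0 => I _; case: (HM2 I).
have s3 : 0 <= \sum_I M3 I by apply: sumr_ge0 => I _; case: (HM3 I).
have M0 : 0 <= M by rewrite /M !addr_ge0.
have le1 I : M1 I <= M.
  have := @sum_ge1 _ M1 I (fun i => proj1 (HM1 i)); rewrite /M; move: s1 s2 s3; lra.
have le2 IJ : M2 IJ <= M.
  have := @sum_ge1 _ M2 IJ (fun i => proj1 (HM2 i)); rewrite /M; move: s1 s2 s3; lra.
have le3 IJ : M3 IJ <= M.
  have := @sum_ge1 _ M3 IJ (fun i => proj1 (HM3 i)); rewrite /M; move: s1 s2 s3; lra.
have b2 I J a : inbox (pbox r) (fun=> r) a -> `|Hc I J a| <= M.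
  by move=> ba; rewrite (le_trans _ (le2 (I, J)))//; have [_] := HM2 (I, J); exact.
have MM : M <= M * (1 + #|{: idx}|%:R) by rewrite ler_peMr// lerDl.
exists (M * (1 + #|{: idx}|%:R)); split=> [|J|I a ba|I J a ba].
- exact: (coord_C11 M0 (@Ec_mvt r) (@Dc_mvt r) b2).
- apply: (coord_C11 M0 (@Dc_mvt r J) (fun I => @Hc_mvt r I J)) => K I a ba.
  by rewrite (le_trans _ (le3 (K, I, J)))//; have [_] := HM3 (K, I, J); exact.
- by rewrite (le_trans _ MM)// (le_trans _ (le1 I))//; have [_] := HM1 I; exact.
- by rewrite (le_trans _ MM)// b2.
Qed.

Lemma sum_upd (L : finType) (F : L -> R) (a : L -> R) i t :
  \sum_j F j * (upd a i t j - a j) = F i * (t - a i).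
Proof.
rewrite (bigD1 i)//= {1}/upd eqxx big1 ?addr0// => j /negbTE ji.
by rewrite /upd ji subrr mulr0.
Qed.

Lemma sum_upd_sqr (L : finType) (a : L -> R) i t : \sum_j (upd a i t j - a j) ^+ 2 = (t - a i) ^+ 2.
Proof.
rewrite (bigD1 i)//= {1}/upd eqxx big1 ?addr0// => j /negbTE ji.
by rewrite /upd ji subrr expr0n.
Qed.

Lemma sum_upd_norm (L : finType) (a : L -> R) i t : \sum_j `|upd a i t j - a j| = `|t - a i|.
Proof.
rewrite (bigD1 i)//= {1}/upd eqxx big1 ?addr0// => j /negbTE ji.
by rewrite /upd ji subrr normr0.
Qed.

Lemma inbox_upd r a I t : inbox (pbox r) (fun=> r) a -> pbox r I <= t <= r -> inbox (pbox r) (fun=> r) (upd a I t).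
Proof. by move=> ba bt J; rewrite /upd; case: eqP => [->|_]. Qed.

Definition mixed_diff a I J (t : R) :=
  Ec (upd (upd a I (a I + t)) J (a J + t)) - Ec (upd a I (a I + t)) - Ec (upd a J (a J + t)) + Ec a.

(** The argument of Schwarz: the increment in direction [J] of a difference in direction [I]. As a
    function of one parameter it has approximate derivative [g], within $2Ct^3$ of $t^2$ times the
    Hessian entry, and subdivision bounds it from both sides. Only increments $t>0$ occur, so the
    point may lie on $\eta=0$. *)
Lemma mixed_diff_near r C a I J t : C11 (pbox r) (fun=> r) Ec Dc C ->
  (forall K, C11 (pbox r) (fun=> r) (Dc K) (fun I => Hc I K) C) ->
  (forall I J a b, inbox (pbox r) (fun=> r) a -> inbox (pbox r) (fun=> r) b ->
     `|Hc I J b - Hc I J a| <= C * \sum_j `|b j - a j|) ->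
  I != J -> 0 < t -> (forall K, pbox r K <= a K /\ a K + t <= r) ->
  `|mixed_diff a I J t - t ^+ 2 * Hc I J a| <= 2 * C * t ^+ 3.
Proof.
move=> [C0 E2 E1] cD H1 IJ t0 ba.
pose b (x y : R) := upd (upd a I (a I + x)) J (a J + y).
have bb x y : 0 <= x <= t -> 0 <= y <= t -> inbox (pbox r) (fun=> r) (b x y).
  move=> /andP[x0 xt] /andP[y0 yt]; apply: inbox_upd; first apply: inbox_upd.
  - by move=> K; have [k1 k2] := ba K; rewrite k1 (le_trans _ k2)// lerDl ltW.
  - by have [k1 k2] := ba I; rewrite (le_trans k1) ?lerDl// (le_trans _ k2)// lerD2l.
  - by have [k1 k2] := ba J; rewrite (le_trans k1) ?lerDl// (le_trans _ k2)// lerD2l.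
have JI : (J == I) = false by apply/negbTE; rewrite eq_sym.
have bJ x y : b x y J = a J + y by rewrite /b /upd eqxx.
have bI x y : b x y I = a I + x by rewrite /b /upd (negbTE IJ) eqxx.
have by' x y y' : b x y' = upd (b x y) J (a J + y').
  by apply/funext => K; rewrite /b /upd; case: eqP.
have bx x y x' : b x' y = upd (b x y) I (a I + x').
  apply/funext => K; rewrite /b /upd; have [->|KJ] := eqVneq K J; rewrite ?JI ?eqxx//.
  by case: eqP.
have b00 : b 0 0 = a.
  by apply/funext => K; rewrite /b /upd !addr0; case: eqP => [->//|_]; case: eqP => [->|].
have bx0 : b t 0 = upd a I (a I + t).
  by apply/funext => K; rewrite /b /upd addr0; have [->|KJ] := eqVneq K J; rewrite ?JI.
have b0y : b 0 t = upd a J (a J + t).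
  by apply/funext => K; rewrite /b /upd addr0; case: eqP => [//|_]; case: eqP => [->|].
pose f (s : R) := Ec (b t (t * s)) - Ec (b 0 (t * s)).
pose g (s : R) := t * (Dc J (b t (t * s)) - Dc J (b 0 (t * s))).
have ts s : 0 <= s <= 1 -> 0 <= t * s <= t.
  by move=> /andP[s0 s1]; rewrite mulr_ge0 ?(ltW t0)//= ger_pMr.
have tt : 0 <= t <= t by rewrite lexx ltW.
have z0 : 0 <= (0 : R) <= t by rewrite lexx ltW.
have df s s' : 0 <= s -> s <= s' -> s' <= 1 ->
    `|f s' - f s - g s * (s' - s)| <= 2 * C * t ^+ 2 * (s' - s) ^+ 2.
  move=> s0 ss s1.
  have bs : 0 <= t * s <= t by apply: ts; rewrite s0 (le_trans ss).
  have bs' : 0 <= t * s' <= t by apply: ts; rewrite s1 (le_trans s0).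
  have H x : 0 <= x <= t -> `|Ec (b x (t * s')) - Ec (b x (t * s)) - Dc J (b x (t * s)) * (t * (s' - s))| <= C * (t * (s' - s)) ^+ 2.
    move=> xt; have := E2 _ _ (bb x _ xt bs) (bb x _ xt bs').
    rewrite {2 3}(by' x (t * s) (t * s')) (sum_upd (fun K => Dc K _)) sum_upd_sqr bJ.
    by rewrite (_ : _ - (a J + _) = t * (s' - s))//; ring.
  have := H _ tt; have := H _ z0; rewrite /f /g => h1 h2.
  have -> : Ec (b t (t * s')) - Ec (b 0 (t * s')) - (Ec (b t (t * s)) - Ec (b 0 (t * s))) -
     t * (Dc J (b t (t * s)) - Dc J (b 0 (t * s))) * (s' - s) =
     (Ec (b t (t * s')) - Ec (b t (t * s)) - Dc J (b t (t * s)) * (t * (s' - s))) -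
     (Ec (b 0 (t * s')) - Ec (b 0 (t * s)) - Dc J (b 0 (t * s)) * (t * (s' - s))) by ring.
  rewrite (le_trans (ler_normB _ _))// (le_trans (lerD h2 h1))// exprMn.
  by rewrite le_eqVlt; apply/orP; left; apply/eqP; ring.
have dg s : 0 <= s <= 1 -> `|g s - t ^+ 2 * Hc I J a| <= 2 * C * t ^+ 3.
  move=> s01; have bs := ts _ s01; have [_ D2 _] := cD J.
  have := D2 _ _ (bb 0 _ z0 bs) (bb t _ tt bs).
  rewrite {2 3}(bx 0 (t * s) t) (sum_upd (fun K => Hc K J _)) sum_upd_sqr bI addr0.
  rewrite (_ : a I + t - a I = t); last by rewrite addrC addKr.
  move=> h1.
  have := H1 I J _ _ (bb 0 0 z0 z0) (bb 0 _ z0 bs).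
  rewrite {2}(by' 0 0 (t * s)) sum_upd_norm bJ addr0 b00.
  rewrite (_ : a J + t * s - a J = t * s); last by rewrite addrC addKr.
  move=> h2.
  have {}h2 : `|Hc I J (b 0 (t * s)) - Hc I J a| <= C * t.
    rewrite (le_trans h2)// ler_wpM2l//; case/andP: bs => bs0 bs1; by rewrite ger0_norm.
  rewrite /g; move: h1 h2; move: (Dc J (b t (t * s))) (Dc J (b 0 (t * s))) (Hc I J (b 0 (t * s))) (Hc I J a).
  move=> x y h h' h1 h2.
  have -> : t * (x - y) - t ^+ 2 * h' = t * (x - y - h * t) + t ^+ 2 * (h - h') by ring.
  rewrite (le_trans (ler_normD _ _))// [X in X + _]normrM [X in _ + X]normrM (ger0_norm (ltW t0)) (ger0_norm (exprn_ge0 2 (ltW t0))).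
  have k1 := ler_wpM2l (ltW t0) h1; have k2 := ler_wpM2l (exprn_ge0 2 (ltW t0)) h2.
  rewrite (le_trans (lerD k1 k2))// le_eqVlt; apply/orP; left; apply/eqP; ring.
have K0 : 0 <= 2 * C * t ^+ 2 by rewrite !mulr_ge0// ltW.
have fE : mixed_diff a I J t = f 1 - f 0.
  by rewrite /f !mulr1 !mulr0 b00 bx0 b0y /mixed_diff; ring.
have lo : t ^+ 2 * Hc I J a - 2 * C * t ^+ 3 + 0 / 2 <= f 1 - f 0.
  apply: (increment_ge K0 (g := g)) => [s s' s0 ss s1|s s01].
    by have := df s s' s0 ss s1; rewrite ler_norml => /andP[+ _]; lra.
  by have := dg s s01; rewrite ler_norml => /andP[+ _]; lra.
have hi : - (t ^+ 2 * Hc I J a) - 2 * C * t ^+ 3 + 0 / 2 <= - f 1 - - f 0.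
  apply: (increment_ge K0 (f := fun s => - f s) (g := fun s => - g s)) => [s s' s0 ss s1|s s01].
    by have := df s s' s0 ss s1; rewrite ler_norml => /andP[_ +]; lra.
  by have := dg s s01; rewrite ler_norml => /andP[_ +]; lra.
by rewrite fE ler_norml; apply/andP; split; move: lo hi; set x := f 1; set y := f 0; lra.
Qed.

(** The mixed second difference is symmetric in [I] and [J], and it determines each Hessian entry up
    to $O(t)$ after division by $t^2$. *)
Lemma Hc_sym a I J : 0 <= a None -> Hc I J a = Hc J I a.
Proof.
move=> a0; have [->//|IJ] := eqVneq I J.
pose r := \sum_K `|a K| + 1; have [C [cE cD _ _]] := energy_C11 r; have [C0 _ _] := cE.
have ba t K : 0 < t -> t <= 1 -> pbox r K <= a K /\ a K + t <= r.
  move=> t0 t1; have aS : `|a K| <= \sum_K `|a K| by apply: (@sum_ge1 _ (fun K => `|a K|)).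
  have [a1 a2] : - `|a K| <= a K /\ a K <= `|a K| by split; [rewrite lerNl -normrN ler_norm|exact: ler_norm].
  split; last by rewrite /r; lra.
  by case: K aS a1 a2 => [B|//] /=; rewrite /r; lra.
have H1 K L c b : inbox (pbox r) (fun=> r) c -> inbox (pbox r) (fun=> r) b ->
    `|Hc K L b - Hc K L c| <= C * \sum_j `|b j - c j| by have [_ _ H] := cD L; exact: H.
have near t : 0 < t -> t <= 1 -> `|Hc I J a - Hc J I a| <= 4 * C * t.
  move=> t0 t1; have JI : J != I by rewrite eq_sym.
  have n1 := mixed_diff_near cE cD H1 IJ t0 (fun K => ba t K t0 t1).
  have n2 := mixed_diff_near cE cD H1 JI t0 (fun K => ba t K t0 t1).
  have E : mixed_diff a I J t = mixed_diff a J I t.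
    rewrite /mixed_diff (_ : upd (upd a I _) J _ = upd (upd a J (a J + t)) I (a I + t)); first by ring.
    apply/funext => K; rewrite /upd; have [->|KJ] := eqVneq K J; last by [].
    by rewrite (negbTE JI).
  rewrite -E in n2.
  have t2 : 0 < t ^+ 2 by exact: exprn_gt0.
  rewrite -(ler_pM2l t2) -[X in X * `|_|]gtr0_norm// -normrM.
  have -> : t ^+ 2 * (Hc I J a - Hc J I a) = (mixed_diff a I J t - t ^+ 2 * Hc J I a) -
     (mixed_diff a I J t - t ^+ 2 * Hc I J a) by ring.
  rewrite (le_trans (ler_normB _ _))// (le_trans (lerD n2 n1))//.
  by rewrite le_eqVlt; apply/orP; left; apply/eqP; ring.
apply/eqP; rewrite -subr_eq0 -normr_eq0 eq_le normr_ge0 andbT leNgt; apply/negP => d0.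
set d := `|_| in near d0; have D0 : 0 < d + 4 * C + 1 by rewrite ltr_pwDr// addr_ge0 ?mulr_ge0// ltW.
(* This value of [t] lies between 0 and 1 and makes $4Ct<d$, which contradicts the bound. *)
have := near (d / (d + 4 * C + 1)); rewrite divr_gt0// ler_pdivrMr// mul1r => /(_ isT).
have -> : d <= d + 4 * C + 1 by rewrite -addrA lerDl addr_ge0// mulr_ge0.
move=> /(_ isT); rewrite leNgt => /negP; apply.
rewrite mulrA ltr_pdivrMr// mulrC ltr_pM2l//; lra.
Qed.

(** The Bregman distance of the energy from base point [a] to [b]. *)
Definition relE a b := Ec b - Ec a - \sum_I Dc I a * (b I - a I).
Definition sqd a b := \sum_I (b I - a I) ^+ 2.

Lemma sqd_ge0 a b : 0 <= sqd a b. Proof. by apply: sumr_ge0 => I _; exact: sqr_ge0. Qed.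

(** Convexity is integrated twice along the segment from [a] to [b]: the Hessian bound makes the
    slope grow at least like [c sqd] times the parameter, and a second integration produces the
    factor 1/2. The subdivision estimate replaces differentiation in a direction that is not a
    coordinate direction. *)
Lemma relE_lower (c : R) a b : (forall z, edom z -> forall d : idx -> R,
     c * (\sum_I d I ^+ 2) <= \sum_I \sum_J d I * hess e I J z * d J) ->
  0 <= a None -> 0 <= b None -> c / 2 * sqd a b <= relE a b.
Proof.
move=> conv a0 b0; pose d I := b I - a I; pose p (s : R) I := a I + s * d I.
pose r := \sum_K (`|a K| + `|b K|).
have [C [cE cD _ _]] := energy_C11 r; have [C0 E2 _] := cE.
have S0 := sqd_ge0 a b.
have p_None s : 0 <= s <= 1 -> 0 <= p s None.
  move=> /andP[s0 s1]; rewrite /p /d (_ : _ + _ = (1 - s) * a None + s * b None); last by ring.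
  by rewrite addr_ge0// mulr_ge0// subr_ge0.
have bp s : 0 <= s <= 1 -> inbox (pbox r) (fun=> r) (p s).
  move=> s01 K; have /andP[s0 s1] := s01.
  have kS : `|a K| + `|b K| <= r by apply: (@sum_ge1 _ (fun K => `|a K| + `|b K|)) => j; exact: addr_ge0.
  have pk : `|p s K| <= `|a K| + `|b K|.
    rewrite /p /d (_ : _ + _ = (1 - s) * a K + s * b K); last by ring.
    rewrite (le_trans (ler_normD _ _))// !normrM (ger0_norm s0) ger0_norm ?subr_ge0//.
    by rewrite lerD// ler_piMl//; lra.
  have := le_trans pk kS; rewrite ler_norml => /andP[p1 p2].
  by apply/andP; split=> //; case: (K) p1 => [B|] //= _; exact: p_None.
have pd s t I : p t I - p s I = (t - s) * d I by rewrite /p; ring.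
have dS s t : \sum_I (p t I - p s I) ^+ 2 = sqd a b * (t - s) ^+ 2.
  by rewrite /sqd mulr_suml; apply: eq_bigr => I _; rewrite pd exprMn mulrC.
have p0 : p 0 = a by apply/funext => I; rewrite /p mul0r addr0.
have p1 : p 1 = b by apply/funext => I; rewrite /p /d mul1r addrC subrK.
pose f s := Ec (p s); pose g s := \sum_I Dc I (p s) * d I; pose W := \sum_I `|d I|.
have W0 : 0 <= W by exact: sumr_ge0.
have gs s : 0 <= s <= 1 -> g 0 + c * sqd a b * s <= g s.
  move=> s01; have /andP[s0 s1] := s01.
  (* [G] is the candidate derivative of $u\mapsto g(su)$; the Hessian bound at each point of the
     segment bounds it below by [c sqd s]. *)
  pose G u := s * \sum_I \sum_J d J * Hc J I (p (s * u)) * d I.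
  have CW : 0 <= C * sqd a b * W * s ^+ 2 by rewrite !mulr_ge0// exprn_ge0.
  have su u : 0 <= u -> u <= 1 -> 0 <= s * u <= 1.
    by move=> u0 u1; rewrite mulr_ge0//= mulr_ile1.
  have := increment_ge CW (f := fun u => g (s * u)) (g := G) (m := c * sqd a b * s) (k := 0).
  rewrite mulr1 mulr0 mul0r addr0 lerBrDl addrC; apply=> [u v u0 uv v1|u /andP[u0 u1]]; last first.
    rewrite mul0r addr0 /G mulrC ler_wpM2l// exchange_big/=.
    by apply: conv; apply: p_None; exact: su.
  have bu : 0 <= s * u <= 1 by apply: su => //; exact: le_trans v1.
  have bv : 0 <= s * v <= 1 by apply: su => //; exact: le_trans uv.
  have DI I : `|Dc I (p (s * v)) - Dc I (p (s * u)) - \sum_J Hc J I (p (s * u)) * ((s * v - s * u) * d J)| <=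
      C * (sqd a b * (s * v - s * u) ^+ 2).
    have [_ D2 _] := cD I; have := D2 _ _ (bp _ bu) (bp _ bv); rewrite dS.
    by under eq_bigr do rewrite pd.
  suff : `|g (s * v) - g (s * u) - G u * (v - u)| <= C * sqd a b * W * s ^+ 2 * (v - u) ^+ 2.
    by rewrite ler_norml => /andP[+ _]; lra.
  have -> : g (s * v) - g (s * u) - G u * (v - u) = \sum_I (Dc I (p (s * v)) - Dc I (p (s * u)) -
      \sum_J Hc J I (p (s * u)) * ((s * v - s * u) * d J)) * d I.
    rewrite /g /G mulr_sumr mulr_suml -!sumrB; apply: eq_bigr => I _.
    rewrite !mulrBl; congr (_ - _); rewrite mulr_sumr !mulr_suml; apply: eq_bigr => J _; ring.
  rewrite (le_trans (ler_norm_sum _ _ _))// (_ : C * sqd a b * W * s ^+ 2 * (v - u) ^+ 2 =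
     \sum_I (C * (sqd a b * (s * v - s * u) ^+ 2)) * `|d I|).
    by apply: ler_sum => I _; rewrite normrM ler_wpM2r.
  by rewrite -mulr_sumr -mulrBr exprMn -/W; ring.
have CS : 0 <= C * sqd a b by exact: mulr_ge0.
have := increment_ge CS (f := f) (g := g) (m := g 0) (k := c * sqd a b).
rewrite /f p0 p1 /relE (_ : \sum_I _ = g 0); last by rewrite /g p0.
move=> H; have : g 0 + c * sqd a b / 2 <= Ec b - Ec a; last by lra.
apply: H => // s t s0 st t1.
have bs : 0 <= s <= 1 by rewrite s0 (le_trans st).
have bt : 0 <= t <= 1 by rewrite t1 (le_trans s0).
have := E2 _ _ (bp _ bs) (bp _ bt); rewrite dS (_ : \sum_I _ = g s * (t - s)).
  by rewrite ler_norml => /andP[+ _]; lra.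
by rewrite /g mulr_suml; apply: eq_bigr => I _; rewrite pd; ring.
Qed.

End Energy.

(** * Taylor remainders near and far from the reference state *)

Section EnergyEstimates.
Context {R : realType}.
Notation idx := (option xidx).
Implicit Types (a b : idx -> R) (I J K : idx) (F : 'M[R]_3).
Variable e : xi_space R * R -> R.
Hypothesis Ce : Ck_in edom 3 e.
Notation Ec := (Ec e). Notation Dc := (Dc e). Notation Hc := (Hc e). Notation relE := (relE e).
Notation n := (#|{: idx}|%:R : R).

Definition sad a b := \sum_I `|b I - a I|.

Lemma sad_ge0 a b : 0 <= sad a b. Proof. exact: sumr_ge0. Qed.

Lemma sad_sqr a b : sad a b ^+ 2 <= n * sqd a b.
Proof.
rewrite (le_trans (sqr_sum_le _))// ler_wpM2l//; apply: ler_sum => I _.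
by rewrite real_normK ?num_real.
Qed.

(** The dichotomy behind the remainder estimates: near [a] Taylor expansion applies; far from it
    [sqd] is at least 1 and absorbs constants and linear terms. *)
Lemma near_or_far a b : (forall I, `|b I - a I| <= 1) \/ 1 <= sqd a b.
Proof.
have [H|/existsNP[I /negP]] := pselect (forall I, `|b I - a I| <= 1); first by left.
rewrite -ltNge => H; right; have Fs : (b I - a I) ^+ 2 <= sqd a b.
  by apply: (@sum_ge1 _ _ (fun J => (b J - a J) ^+ 2)) => J; exact: sqr_ge0.
by rewrite (le_trans _ Fs)// -[_ ^+ 2]real_normK ?num_real// expr_ge1// ltW.
Qed.

Lemma sad_far a b : 1 <= sqd a b -> sad a b <= (n + 1) * sqd a b.
Proof.
move=> far; rewrite mulrDl mul1r; have := sad_sqr a b; have := sqr_ge0 (sad a b - 1).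
by rewrite sqrrB1 => h1 h2; have := sad_ge0 a b; move: h1 h2; set x := sad a b; lra.
Qed.

Lemma inbox1 rho a b : inbox (pbox rho) (fun=> rho) a -> 0 <= b None -> (forall I, `|b I - a I| <= 1) ->
  inbox (pbox (rho + 1)) (fun=> rho + 1) b /\ inbox (pbox (rho + 1)) (fun=> rho + 1) a.
Proof.
move=> ba b0 ab; split=> I; have /andP[a1 a2] := ba I.
  have := ab I; rewrite ler_norml => /andP[d1 d2]; apply/andP; split; last by lra.
  by case: I a1 a2 d1 d2 => [B|] //= *; lra.
apply/andP; split; last by lra.
by case: I a1 a2 => [B|] //= *; lra.
Qed.

(** The constants come from the box enlarged by 1, which contains every admissible [b] within
    distance 1 of [a] in each coordinate. *)
Lemma energy_near rho : exists2 C, 0 <= C & forall a, inbox (pbox rho) (fun=> rho) a ->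
  [/\ `|Ec a| <= C, forall I, `|Dc I a| <= C, forall I J, `|Hc I J a| <= C &
   forall b, 0 <= b None -> (forall I, `|b I - a I| <= 1) ->
   forall J, `|Dc J b - Dc J a| <= C * sad a b /\
    `|Dc J b - Dc J a - \sum_I Hc I J a * (b I - a I)| <= C * sqd a b].
Proof.
have [C [cE cD bD bH]] := energy_C11 Ce (rho + 1); have [C0 _ _] := cE.
have [c _] := Ce (s := [::]) isT; have [M M0 HM] := pbox_bounded (rho + 1) c.
have CM : C <= C + M by rewrite lerDl.
exists (C + M) => [|a ba]; first exact: addr_ge0.
have ba1 : inbox (pbox (rho + 1)) (fun=> rho + 1) a.
  move=> I; have /andP[a1 a2] := ba I; apply/andP; split; last by lra.
  by case: I a1 a2 => [B|] //= *; lra.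
split=> [|I|I J|b b0 ab J].
- by rewrite (le_trans (HM _ ba1))// lerDr.
- by rewrite (le_trans (bD _ _ ba1)).
- by rewrite (le_trans (bH _ _ _ ba1)).
have [bb _] := inbox1 ba b0 ab; split.
  rewrite (le_trans (coord_mvt_lip (@Dc_mvt R e Ce (rho + 1) J) (fun I a => bH I J a) ba1 bb))//.
  by rewrite ler_wpM2r// sad_ge0.
have [_ D2 _] := cD J; rewrite (le_trans (D2 _ _ ba1 bb))// ler_wpM2r//; exact: sqd_ge0.
Qed.

(** With $\theta_a,\theta_b$ the temperatures and $h$ the linear increment, the expression equals
    $(\theta_b-\theta_a-h)/\theta_a-(\theta_b-\theta_a)^2/(\theta_a\theta_b)$, which is quadratic
    near [a] (constant [K1]). Far from [a] each term is bounded with the help of the lower bound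
    [delta] (constant [K2]). *)
Lemma source_taylor rho delta : 0 < delta -> (forall a, 0 <= a None -> delta <= Dc None a) ->
  exists2 K, 0 <= K & forall a b, inbox (pbox rho) (fun=> rho) a -> 0 <= b None ->
  `|1 - Dc None a / Dc None b - (\sum_I Hc I None a * (b I - a I)) / Dc None a| <= K * sqd a b.
Proof.
move=> d0 thd; have [C C0 HC] := energy_near rho.
have di0 : 0 <= delta^-1 by rewrite invr_ge0 ltW.
pose K1 := C ^+ 2 * n * delta^-1 ^+ 2 + C * delta^-1; pose K2 := 1 + C * delta^-1 + C * (n + 1) * delta^-1.
have K10 : 0 <= K1 by rewrite addr_ge0 ?mulr_ge0 ?exprn_ge0.
have K20 : 0 <= K2 by rewrite !addr_ge0 ?mulr_ge0 ?addr_ge0.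
exists (K1 + K2) => [|a b ba b0]; first exact: addr_ge0.
have [_ bD bH near] := HC a ba; have a0 : 0 <= a None by have /andP[] := ba None.
have S0 := sqd_ge0 a b; have s0 := sad_ge0 a b.
have ta := thd a a0; have tb := thd b b0.
set ra := Dc None a in ta *; set rb := Dc None b in tb *; set Hs := \sum_I _.
have ra0 : 0 < ra by exact: lt_le_trans ta. have rb0 : 0 < rb by exact: lt_le_trans tb.
have ia : `|ra^-1| <= delta^-1 by rewrite normfV gtr0_norm// lef_pV2// posrE.
have ib : `|rb^-1| <= delta^-1 by rewrite normfV gtr0_norm// lef_pV2// posrE.
have HS : `|Hs| <= C * sad a b.
  rewrite (le_trans (ler_norm_sum _ _ _))// mulr_sumr; apply: ler_sum => I _.
  by rewrite normrM ler_wpM2r// bH.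
set x := delta^-1 in di0 K1 K10 K2 K20 ia ib *.
have [/(near b b0)/(_ None)[]|far] := near_or_far a b.
  rewrite -/ra -/rb -/Hs => h1 h2.
  have -> : 1 - ra / rb - Hs / ra = (rb - ra - Hs) / ra - (rb - ra) ^+ 2 * (ra^-1 * rb^-1).
    by field; rewrite !gt_eqF.
  have t1 : `|(rb - ra) ^+ 2 * (ra^-1 * rb^-1)| <= C ^+ 2 * (n * sqd a b) * (x * x).
    rewrite normrM ler_pM//; last by rewrite normrM ler_pM.
    rewrite normrX (le_trans (lerXn2r 2 _ _ h1)) ?nnegrE ?mulr_ge0// exprMn ler_wpM2l ?exprn_ge0//.
    exact: sad_sqr.
  have t2 : `|(rb - ra - Hs) / ra| <= C * sqd a b * x by rewrite normrM ler_pM.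
  rewrite (le_trans (ler_normB _ _))// (le_trans (lerD t2 t1))// mulrDl.
  apply: (@le_trans _ _ (K1 * sqd a b)); last by rewrite lerDl mulr_ge0.
  by rewrite le_eqVlt; apply/orP; left; apply/eqP; rewrite /K1; ring.
have t1 : `|ra / rb| <= C * x by rewrite normrM ler_pM// bD.
have t2 : `|Hs / ra| <= C * ((n + 1) * sqd a b) * x.
  by rewrite normrM ler_pM// (le_trans HS)// ler_wpM2l// sad_far.
rewrite (le_trans (ler_normB _ _))// (le_trans (lerD (ler_normB _ _) t2))// normr1.
have t3 : 1 + C * x <= (1 + C * x) * sqd a b by rewrite ler_peMr// addr_ge0// mulr_ge0.
apply: (@le_trans _ _ ((1 + C * x) * sqd a b + C * ((n + 1) * sqd a b) * x)).
  by rewrite lerD2r (le_trans _ t3)// lerD2l.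
apply: (@le_trans _ _ (K2 * sqd a b)); last by rewrite [leRHS]mulrDl lerDr mulr_ge0.
by rewrite le_eqVlt; apply/orP; left; apply/eqP; rewrite /K2; ring.
Qed.

Variables (p q rho_ l c c1 c2 : R).
Hypotheses (c0 : 0 < c) (c10 : 0 < c1) (c20 : 0 < c2) (p4 : 4 <= p).
Hypothesis conv : forall z, edom z -> forall d : idx -> R,
     c * (\sum_I d I ^+ 2) <= \sum_I \sum_J d I * hess e I J z * d J.
Hypothesis grow : forall z, edom z -> c1 * growth p q rho_ l z - c2 <= e z.
Hypothesis dgrow : forall z, edom z ->
     enorm (dF_e e z) `^ (p / (p - 1)) + enorm (dzeta_e e z) `^ (p / (p - 2))
       + `|dw_e e z| `^ (p / (p - 3)) <= c2 * growth p q rho_ l z + c2.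

Notation G a := (growth p q rho_ l (vec a)).

Lemma growth_ge0 z : 0 <= growth p q rho_ l z.
Proof. by rewrite !addr_ge0// powR_ge0. Qed.

Lemma sqd_relE a b : 0 <= a None -> 0 <= b None -> sqd a b <= 2 / c * relE a b.
Proof.
move=> a0 b0; have := relE_lower Ce conv a0 b0; rewrite -ler_pdivlMl ?divr_gt0//.
by rewrite invf_div.
Qed.

(** Coercivity bounds the growth function by the energy at [b], which is [relE] plus an affine
    function of [b]. Far from [a] the affine part is at most a multiple of [sqd], and convexity
    bounds [sqd] by [relE]. *)
Lemma growth_far rho : exists2 K, 0 <= K & forall a b, inbox (pbox rho) (fun=> rho) a -> 0 <= b None ->
  1 <= sqd a b -> 1 + G b <= K * relE a b.
Proof.
have [C C0 HC] := energy_near rho.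
pose B := 1 + (c2 + C + C * (n + 1)) / c1.
have B0 : 0 <= B by rewrite addr_ge0// divr_ge0 ?(ltW c10)// !addr_ge0 ?mulr_ge0 ?addr_ge0// ltW.
have ic : 0 <= c1^-1 by rewrite invr_ge0 ltW.
exists (B * (2 / c) + c1^-1) => [|a b ba b0 far].
  by rewrite addr_ge0// mulr_ge0// divr_ge0// ltW.
have a0 : 0 <= a None by have /andP[] := ba None.
have [EC DC _ _] := HC a ba; have SQ := sqd_relE a0 b0.
have gr : c1 * G b <= c2 + Ec b by rewrite addrC -lerBlDr; exact: grow.
have DS : `|\sum_I Dc I a * (b I - a I)| <= C * ((n + 1) * sqd a b).
  apply: (@le_trans _ _ (C * sad a b)); last by rewrite ler_wpM2l// sad_far.
  rewrite (le_trans (ler_norm_sum _ _ _))// mulr_sumr; apply: ler_sum => I _.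
  by rewrite normrM ler_wpM2r.
have gr2 : c1 * G b <= (c2 + C + C * (n + 1)) * sqd a b + relE a b.
  have -> : (c2 + C + C * (n + 1)) * sqd a b + relE a b =
    (c2 + C) * sqd a b + C * ((n + 1) * sqd a b) + relE a b by ring.
  have h1 : c2 + C <= (c2 + C) * sqd a b by rewrite ler_peMr// addr_ge0// ltW.
  have h2 := ler_norm (Ec a); have h3 := ler_norm (\sum_I Dc I a * (b I - a I)).
  have h4 : Ec b = relE a b + Ec a + \sum_I Dc I a * (b I - a I) by rewrite /relE; ring.
  move: gr h1 h2 h3 h4 DS EC; set y := \sum_I _; set u := _ * sqd a b; set v := C * _; lra.
have {}gr2 : G b <= (c2 + C + C * (n + 1)) / c1 * sqd a b + c1^-1 * relE a b.
  by have := ler_wpM2l ic gr2; rewrite mulKf ?gt_eqF// mulrDr (mulrA c1^-1) (mulrC c1^-1 (_ + _)).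
have h1 : 1 + G b <= B * sqd a b + c1^-1 * relE a b by rewrite /B mulrDl mul1r -addrA lerD.
rewrite (le_trans h1)// [leRHS]mulrDl lerD2r -mulrA ler_wpM2l//.
Qed.

Lemma entry_le_enorm m k (A : 'M[R]_(m, k)) i j : `|A i j| <= enorm A.
Proof.
rewrite /enorm -sqrtr_sqr ler_wsqrtr// (bigD1 i)//= (bigD1 j)//= -addrA lerDl addr_ge0//.
  by apply: sumr_ge0 => j' _; exact: sqr_ge0.
by apply: sumr_ge0 => i' _; apply: sumr_ge0 => j' _; exact: sqr_ge0.
Qed.

Let p0 : 0 < p. Proof. exact: lt_le_trans p4. Qed.

(* All the products below have order (p - 1)/p in the growth function. *)
Lemma power_product (x y g : R) (k : nat) : (k <= 2)%N -> 0 <= x -> 0 <= g ->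
  0 <= y -> y `^ p <= g ->
  x `^ (p / (p - k.+1%:R)) <= c2 * g + c2 -> x * y ^+ k <= c2 `^ ((p - k.+1%:R) / p) * (1 + g).
Proof.
move=> k2 x0 g0 y0 yg xg; have pk : 0 < p - k.+1%:R.
  by rewrite subr_gt0 (lt_le_trans _ p4)// ltr_nat.
have g1 : 0 < 1 + g by rewrite ltr_pwDl.
have Y : y <= (1 + g) `^ p^-1.
  have E : y = (y `^ p) `^ p^-1 by rewrite -powRrM mulfV ?powRr1// gt_eqF.
  rewrite E ge0_ler_powR ?nnegrE ?powR_ge0 ?invr_ge0 ?(ltW p0) ?(ltW g1)//.
  by rewrite (le_trans yg)// lerDr.
have X : x <= (c2 * (1 + g)) `^ ((p - k.+1%:R) / p).
  have E : x = (x `^ (p / (p - k.+1%:R))) `^ ((p - k.+1%:R) / p).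
    by rewrite -powRrM -[p / _]invf_div mulVf ?powRr1// gt_eqF// divr_gt0.
  rewrite {1}E ge0_ler_powR ?nnegrE ?powR_ge0 ?mulr_ge0 ?divr_ge0 ?(ltW p0) ?(ltW g1) ?(ltW c20) ?(ltW pk) ?invr_ge0 ?(ltW p0)//.
  by rewrite (le_trans xg)// mulrDr mulr1 addrC.
have Yk : y ^+ k <= (1 + g) `^ (k%:R / p).
  rewrite mulrC powRrM powR_mulrn ?powR_ge0// lerXn2r ?nnegrE ?powR_ge0//.
rewrite (le_trans (ler_pM x0 (exprn_ge0 _ y0) X Yk))// powRM ?(ltW c20) ?(ltW g1)// -mulrA ler_wpM2l ?powR_ge0//.
rewrite -powRD ?(gt_eqF g1) ?implybT// -[leRHS](powRr1 (ltW g1)) ler_powR ?lerDl//.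
rewrite -mulrDl ler_pdivrMr// mul1r -natr1; lra.
Qed.

Lemma le_sum3 (x y z w : R) : 0 <= x -> 0 <= y -> 0 <= z -> x + y + z <= w -> [/\ x <= w, y <= w & z <= w].
Proof. by move=> *; split; lra. Qed.

(** The exponents $p/(p-1)$, $p/(p-2)$, $p/(p-3)$ match the degrees 0, 1, 2 in [F] of the
    derivatives of [F], of its cofactors and of its determinant: each product has order
    $(p-1)/p\le1$ in the growth function. *)
Lemma growth_product : exists2 K, 0 <= K & forall F (eta : R) B i al, 0 <= eta ->
  `|dxi e B (Phi F, eta)| * `|dPhiB B i al F| <= K * (1 + growth p q rho_ l (Phi F, eta)).
Proof.
pose Kk k : R := c2 `^ ((p - k) / p).
have Kk0 k : 0 <= Kk k by exact: powR_ge0.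
(* 9 counts the terms of the double sum in the derivative of a cofactor; the derivatives of the
   other minors have at most two. *)
exists (9 * (Kk 1 + Kk 2 + Kk 3)) => [|F eta B i al eta0]; first by rewrite mulr_ge0// !addr_ge0.
set z := (Phi F, eta); set g := growth p q rho_ l z.
have g0 : 0 <= g by exact: growth_ge0.
have g1 : 0 <= 1 + g by exact: addr_ge0.
have dg := dgrow (z := z) eta0.
have Fy : enorm F `^ p <= g.
  by rewrite /g /growth -!addrA lerDl !addr_ge0// powR_ge0.
have y0 : 0 <= enorm F by exact: sqrtr_ge0.
have Fe j k : `|F j k| <= enorm F by exact: entry_le_enorm.
have pr (k : nat) x : (k <= 2)%N -> 0 <= x -> x `^ (p / (p - k.+1%:R)) <= c2 * g + c2 ->
   x * enorm F ^+ k <= Kk k.+1%:R * (1 + g) by move=> k2 x0 H; exact: power_product.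
have P1 := powR_ge0 (enorm (dF_e e z)) (p / (p - 1)); have P2 := powR_ge0 (enorm (dzeta_e e z)) (p / (p - 2)).
have P3 := powR_ge0 (`|dw_e e z|) (p / (p - 3)).
have [Z1 Z2 Z3] := le_sum3 P1 P2 P3 dg.
have n0 m k (A : 'M[R]_(m, k)) : 0 <= enorm A by exact: sqrtr_ge0.
have H1 := pr 0%N _ isT (n0 _ _ _) Z1; have H2 := pr 1%N _ isT (n0 _ _ _) Z2.
have H3 := pr 2%N _ isT (normr_ge0 _) Z3; rewrite expr0 mulr1 in H1; rewrite expr1 in H2.
have fin k : Kk k <= Kk 1 + Kk 2 + Kk 3 -> 9 * (Kk k * (1 + g)) <= 9 * (Kk 1 + Kk 2 + Kk 3) * (1 + g).
  by move=> H; rewrite -mulrA ler_wpM2l// ler_wpM2r.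
case: B => [[[j b]|[j b]]|[]].
- apply: le_trans (fin 1 _); last by rewrite -addrA lerDl addr_ge0.
  apply: (@le_trans _ _ (enorm (dF_e e z))).
    rewrite dPhiB_F -[leRHS]mulr1 ler_pM//; last by case: (_ && _); rewrite ?normr1 ?normr0.
    by have := entry_le_enorm (dF_e e z) j b; rewrite mxE.
  apply: (le_trans H1).
  by rewrite ler_peMl ?mulr_ge0// ler1n.
- apply: le_trans (fin 2 _); last by rewrite addrAC lerDr addr_ge0.
  apply: (@le_trans _ _ (9 * (enorm (dzeta_e e z) * enorm F))); last by rewrite ler_wpM2l.
  rewrite mulrCA ler_pM//; first by have := entry_le_enorm (dzeta_e e z) j b; rewrite mxE.
  rewrite dPhiB_cof (le_trans (ler_norm_sum _ _ _))//.
  apply: (@le_trans _ _ (\sum_(k < 3) \sum_(cc < 3) enorm F)).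
    apply: ler_sum => k _; rewrite (le_trans (ler_norm_sum _ _ _))//; apply: ler_sum => cc _.
    have eps1 u v w : `|eps u v w : R| <= 1.
      by rewrite /eps; case: (_ && _); case: (_ && _); rewrite ?subrr ?subr0 ?sub0r ?normrN ?normr1 ?normr0.
    by rewrite !normrM -[leRHS]mul1r ler_pM ?mulr_ge0// mulr_ile1.
  by rewrite !sumr_const !card_ord -mulrnA mulr_natl.
- apply: le_trans (fin 3 _); last by rewrite lerDr addr_ge0.
  apply: (@le_trans _ _ (2 * (`|dw_e e z| * enorm F ^+ 2))).
    rewrite mulrCA ler_wpM2l// dPhiB_det cofE (le_trans (ler_normB _ _))// !normrM mulr2n mulrDl mul1r expr2.
    by rewrite lerD// ler_pM.
  by rewrite ler_pM ?mulr_ge0// ?exprn_ge0// ler_nat.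
Qed.

Lemma sum_option (L : finType) (f : option L -> R) : \sum_x f x = f None + \sum_y f (Some y).
Proof.
rewrite (bigD1 None)//=; congr (_ + _).
by rewrite (reindex_omap Some id) => [|[x|]//]; apply: eq_bigl => x; rewrite eqxx.
Qed.

Notation X F eta := (xc (Phi F, eta)).

(** Only the derivatives of the energy are expanded; [dPhiB] is kept at [F'] in the leading term,
    where its average over the Young measure is exact. The remainder is the product of the two
    increments plus the Taylor remainder of the derivatives times [dPhiB] at [F]. Near the base
    point both are quadratic; far from it the growth conditions bound the stress by the relative
    energy. *)
Lemma stress_taylor rho : exists2 K, 0 <= K & forall F F' (eta eta' : R) i al,
  inbox (pbox rho) (fun=> rho) (X F eta) -> 0 <= eta' ->
  `|stress e i al F' eta' - \sum_B Dc (Some B) (X F eta) * dPhiB B i al F' -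
    \sum_B (\sum_I Hc I (Some B) (X F eta) * (X F' eta' I - X F eta I)) * dPhiB B i al F|
   <= K * relE (X F eta) (X F' eta').
Proof.
have [C C0 HC] := energy_near rho; have [Kg Kg0 HKg] := growth_far rho.
have [Kp Kp0 HKp] := growth_product.
pose m : R := \sum_(x : xidx * 'I_3 * 'I_3 * xidx) `|dPhi_m x.1.1.1 x.1.1.2 x.1.2 x.2|.
pose kk : R := \sum_(x : xidx * 'I_3 * 'I_3) `|dPhi_k x.1.1 x.1.2 x.2|.
have m0 : 0 <= m by exact: sumr_ge0.
have kk0 : 0 <= kk by exact: sumr_ge0.
pose N : R := #|{: xidx}|%:R; pose A := kk + m * (N * `|rho|).
have A0 : 0 <= A by rewrite /A addr_ge0// !mulr_ge0.
(* [K1] serves the near case; in the far case [K2] bounds the stress itself and [K3] the two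
   comparison terms. *)
pose K1 := N * (C * m * n + C * A).
pose K2 := N * (Kp * Kg).
pose K3 := N * (C * (A + m * (n + 1)) + C * (n + 1) * A).
have K10 : 0 <= K1 by rewrite !(mulr_ge0, addr_ge0).
have K20 : 0 <= K2 by rewrite !mulr_ge0.
have K30 : 0 <= K3 by rewrite !(mulr_ge0, addr_ge0).
have ic : 0 <= 2 / c by rewrite divr_ge0// ltW.
exists ((K1 + K3) * (2 / c) + K2) => [|F F' eta eta' i al ba b0].
  by rewrite addr_ge0// mulr_ge0// addr_ge0.
set a := X F eta in ba *; set b := X F' eta'; have {}b0 : 0 <= b None by [].
have a0 : 0 <= a None by have /andP[] := ba None.
have [_ DC HCC near] := HC a ba; have SQ := sqd_relE a0 b0.
have S0 := sqd_ge0 a b; have s0 := sad_ge0 a b.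
have mm B j be D : `|dPhi_m B j be D : R| <= m.
  by apply: (@sum_ge1 _ _ (fun x : xidx * 'I_3 * 'I_3 * xidx => `|dPhi_m x.1.1.1 x.1.1.2 x.1.2 x.2|) (B, j, be, D)).
have kkk B j be : `|dPhi_k B j be : R| <= kk.
  by apply: (@sum_ge1 _ _ (fun x : xidx * 'I_3 * 'I_3 => `|dPhi_k x.1.1 x.1.2 x.2|) (B, j, be)).
have PA B : `|dPhiB B i al F| <= A.
  rewrite dPhiB_affine (le_trans (ler_normD _ _))// lerD// (le_trans (ler_norm_sum _ _ _))//.
  apply: (@le_trans _ _ (\sum_(D : xidx) m * `|rho|)).
    apply: ler_sum => D _; rewrite normrM ler_pM//.
    have /andP[d1 d2] := ba (Some D); rewrite (le_trans _ (ler_norm rho))// ler_norml.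
    by apply/andP; split; [exact: d1|exact: d2].
  by rewrite sumr_const -mulrnAr mulr_natl.
have PD B : `|dPhiB B i al F' - dPhiB B i al F| <= m * sad a b.
  rewrite !dPhiB_affine opprD addrACA subrr add0r -sumrB (le_trans (ler_norm_sum _ _ _))//.
  apply: (@le_trans _ _ (\sum_(D : xidx) m * `|b (Some D) - a (Some D)|)).
    by apply: ler_sum => D _; rewrite -mulrBr normrM ler_wpM2r.
  by rewrite -mulr_sumr ler_wpM2l// /sad sum_option lerDr.
set E := `|_|.
have sumN (f : xidx -> R) (k : R) : (forall B, `|f B| <= k) -> `|\sum_B f B| <= N * k.
  move=> fk; rewrite (le_trans (ler_norm_sum _ _ _))// (le_trans (ler_sum _ (fun B _ => fk B)))//.
  by rewrite sumr_const mulr_natl.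
have E1 : E = `|\sum_B ((Dc (Some B) b - Dc (Some B) a) * (dPhiB B i al F' - dPhiB B i al F) +
     (Dc (Some B) b - Dc (Some B) a - \sum_I Hc I (Some B) a * (b I - a I)) * dPhiB B i al F)|.
  rewrite /E /stress -!sumrB; congr `|_|; apply: eq_bigr => B _.
  rewrite -[dxi e B _]/(de e (Some B) (Phi F', eta')) -[(Phi F', eta')]xcK -/b -[de e _ _]/(Dc (Some B) b).
  move: (Dc _ _) (Dc _ _) (dPhiB _ _ _ _) (dPhiB _ _ _ _) (\sum_I _) => x y z w u; ring.
have [nr|far] := near_or_far a b.
  have H := near b b0 nr.
  apply: (@le_trans _ _ (K1 * sqd a b)).
    rewrite E1 -mulrA; apply: sumN => B; have [h1 h2] := H (Some B).
    rewrite (le_trans (ler_normD _ _))// [leRHS]mulrDl lerD//.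
      rewrite normrM (le_trans (ler_pM (normr_ge0 _) (normr_ge0 _) h1 (PD B)))//.
      rewrite mulrACA -expr2 -[leRHS]mulrA ler_wpM2l ?mulr_ge0//; exact: sad_sqr.
    by rewrite normrM mulrAC ler_pM.
  apply: (@le_trans _ _ ((K1 + K3) * (2 / c) * relE a b)).
    by rewrite -mulrA; apply: ler_pM => //; rewrite lerDl.
  have R0 : 0 <= relE a b.
    by rewrite -(pmulr_rge0 _ (divr_gt0 (ltr0n R 2) c0)) (le_trans S0).
  by rewrite [leRHS]mulrDl lerDl mulr_ge0.
have E2 : E = `|\sum_B (dxi e B (Phi F', eta') * dPhiB B i al F') - \sum_B (Dc (Some B) a * dPhiB B i al F' +
     (\sum_I Hc I (Some B) a * (b I - a I)) * dPhiB B i al F)|.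
  by rewrite /E /stress big_split/= opprD addrA.
have A1 : A <= A * sqd a b by rewrite ler_peMr.
rewrite E2 (le_trans (ler_normB _ _))// [leRHS]mulrDl addrC lerD//.
  apply: (@le_trans _ _ (K3 * sqd a b)).
    rewrite -mulrA; apply: sumN => B; rewrite (le_trans (ler_normD _ _))// [leRHS]mulrDl lerD//.
      rewrite normrM -mulrA ler_pM// -[dPhiB _ _ _ F'](subrK (dPhiB B i al F)) (le_trans (ler_normD _ _))// addrC [leRHS]mulrDl lerD//.
        by rewrite (le_trans (PA B)).
      by rewrite (le_trans (PD B))// -mulrA ler_wpM2l// sad_far.
    rewrite normrM -[leRHS]mulrA [A * _]mulrC mulrA ler_pM//.
    rewrite (le_trans (ler_norm_sum _ _ _))//; apply: (@le_trans _ _ (C * sad a b)).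
      by rewrite mulr_sumr; apply: ler_sum => I _; rewrite normrM ler_wpM2r.
    by rewrite -mulrA ler_wpM2l// sad_far.
  rewrite -[leRHS]mulrA; apply: (ler_pM K30 S0 _ SQ).
  by rewrite [K1 + K3]addrC lerDl.
rewrite -mulrA; apply: sumN => B; rewrite normrM (le_trans (HKp F' eta' B i al b0))//.
by rewrite -mulrA ler_wpM2l//; have := HKg a b ba b0 far; rewrite xcK.
Qed.

End EnergyEstimates.

(** * Balance laws in weak form *)

Section NullLagrangian.
Context {R : realType}.
Implicit Types (T : R) (f g h : stime R -> R).

Definition tensor (g0 g1 g2 g3 : R -> R) (z : stime R) : R :=
  g0 z.1.1.1 * g1 z.1.1.2 * g2 z.1.2 * g3 z.2.

Lemma tensor_D0 (g0 g1 g2 g3 g' : R -> R) : Sm (tensor g0 g1 g2 g3) -> has_deriv g0 g' ->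
  'D_(dir (Some (inord 0))) (tensor g0 g1 g2 g3) = tensor g' g1 g2 g3.
Proof.
move=> s d; apply/funext => -[[[x0 x1] x2] t].
have H := has_derivM (has_derivM (has_derivM (has_deriv_affine 1 x0 d) (has_deriv_cst (g1 x1))) (has_deriv_cst (g2 x2))) (has_deriv_cst (g3 t)).
rewrite (Sm_derive_line s (G := fun s => g0 (1 * s + x0) * g1 x1 * g2 x2 * g3 t) _ H).
  by rewrite /tensor /= (mulr0 1) add0r; ring.
by move=> u; rewrite smul_dx /tensor /= !inordK //= !mulr0 !add0r mulr1 mul1r.
Qed.

Lemma tensor_D1 (g0 g1 g2 g3 g' : R -> R) : Sm (tensor g0 g1 g2 g3) -> has_deriv g1 g' ->
  'D_(dir (Some (inord 1))) (tensor g0 g1 g2 g3) = tensor g0 g' g2 g3.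
Proof.
move=> s d; apply/funext => -[[[x0 x1] x2] t].
have H := has_derivM (has_derivM (has_derivM (has_deriv_cst (g0 x0)) (has_deriv_affine 1 x1 d)) (has_deriv_cst (g2 x2))) (has_deriv_cst (g3 t)).
rewrite (Sm_derive_line s (G := fun s => g0 x0 * g1 (1 * s + x1) * g2 x2 * g3 t) _ H).
  by rewrite /tensor /= (mulr0 1) add0r; ring.
by move=> u; rewrite smul_dx /tensor /= !inordK //= !mulr0 !add0r mulr1 mul1r.
Qed.

Lemma tensor_D2 (g0 g1 g2 g3 g' : R -> R) : Sm (tensor g0 g1 g2 g3) -> has_deriv g2 g' ->
  'D_(dir (Some (inord 2))) (tensor g0 g1 g2 g3) = tensor g0 g1 g' g3.
Proof.
move=> s d; apply/funext => -[[[x0 x1] x2] t].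
have H := has_derivM (has_derivM (has_derivM (has_deriv_cst (g0 x0)) (has_deriv_cst (g1 x1))) (has_deriv_affine 1 x2 d)) (has_deriv_cst (g3 t)).
rewrite (Sm_derive_line s (G := fun s => g0 x0 * g1 x1 * g2 (1 * s + x2) * g3 t) _ H).
  by rewrite /tensor /= (mulr0 1) add0r; ring.
by move=> u; rewrite smul_dx /tensor /= !inordK //= !mulr0 !add0r mulr1 mul1r.
Qed.

Lemma tensor_D3 (g0 g1 g2 g3 g' : R -> R) : Sm (tensor g0 g1 g2 g3) -> has_deriv g3 g' ->
  'D_(dir None) (tensor g0 g1 g2 g3) = tensor g0 g1 g2 g'.
Proof.
move=> s d; apply/funext => -[[[x0 x1] x2] t].
have H := has_derivM (has_derivM (has_derivM (has_deriv_cst (g0 x0)) (has_deriv_cst (g1 x1))) (has_deriv_cst (g2 x2))) (has_deriv_affine 1 t d).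
rewrite (Sm_derive_line s (G := fun s => g0 x0 * g1 x1 * g2 x2 * g3 (1 * s + t)) _ H).
  by rewrite /tensor /= (mulr0 1) add0r; ring.
by move=> u; rewrite smul_dt /tensor /= mul1r.
Qed.

Lemma Sm_deriveD (v z : stime R) f g : Sm f -> Sm g ->
  'D_v (fun z => f z + g z) z = 'D_v f z + 'D_v g z.
Proof. by move=> sf sg; have [_ ->] := is_deriveD (Sm_is_derive v z sf) (Sm_is_derive v z sg). Qed.

(** On a tensor, derivatives in different coordinates act on different factors and therefore
    commute; sums follow by linearity. *)
Lemma Sm_schwarz (k l : option 'I_3) f : Sm f ->
  'D_(dir k) ('D_(dir l) f) = 'D_(dir l) ('D_(dir k) f).
Proof.
elim=> {f} [g0 g1 g2 g3 s0 p0 s1 p1 s2 p2 s3|f1 f2 s1 IH1 s2 IH2]; last first.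
  have E d : 'D_(dir d) (fun z => f1 z + f2 z) = fun z => 'D_(dir d) f1 z + 'D_(dir d) f2 z.
    by apply/funext => z; exact: Sm_deriveD.
  have DD d d' z : 'D_(dir d) ('D_(dir d') (fun z => f1 z + f2 z)) z = 'D_(dir d) ('D_(dir d') f1) z + 'D_(dir d) ('D_(dir d') f2) z.
    by rewrite E; exact: Sm_deriveD (Sm_D _ s1) (Sm_D _ s2).
  apply/funext => z; apply: etrans (DD _ _ _) (etrans _ (esym (DD _ _ _))).
  exact: (congr2 +%R (congr1 (@^~ z) IH1) (congr1 (@^~ z) IH2)).
change ('D_(dir k) ('D_(dir l) (tensor g0 g1 g2 g3)) = 'D_(dir l) ('D_(dir k) (tensor g0 g1 g2 g3))).
have [d0 t0 h0] := smooth1_deriv s0; have [d1 t1 h1] := smooth1_deriv s1.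
have [d2 t2 h2] := smooth1_deriv s2; have [d3 t3 h3] := smooth1_deriv s3.
have q0 := per1_deriv p0 h0; have q1 := per1_deriv p1 h1; have q2 := per1_deriv p2 h2.
have S := SmT.
have kk (m : option 'I_3) : [\/ m = Some (inord 0), m = Some (inord 1), m = Some (inord 2) | m = None].
  case: m => [[[|[|[|//]]] a3]|]; last by constructor 4.
  - by constructor 1; congr Some; apply: val_inj; rewrite /= inordK.
  - by constructor 2; congr Some; apply: val_inj; rewrite /= inordK.
  - by constructor 3; congr Some; apply: val_inj; rewrite /= inordK.
have E0 a1 a2 a3 : smooth1 a1 -> per1 a1 -> smooth1 a2 -> per1 a2 -> smooth1 a3 ->
    'D_(dir (Some (inord 0))) (tensor g0 a1 a2 a3) = tensor d0 a1 a2 a3.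
  by move=> *; apply: tensor_D0 => //; exact: SmT.
have E1 a0 a2 a3 : smooth1 a0 -> per1 a0 -> smooth1 a2 -> per1 a2 -> smooth1 a3 ->
    'D_(dir (Some (inord 1))) (tensor a0 g1 a2 a3) = tensor a0 d1 a2 a3.
  by move=> *; apply: tensor_D1 => //; exact: SmT.
have E2 a0 a1 a3 : smooth1 a0 -> per1 a0 -> smooth1 a1 -> per1 a1 -> smooth1 a3 ->
    'D_(dir (Some (inord 2))) (tensor a0 a1 g2 a3) = tensor a0 a1 d2 a3.
  by move=> *; apply: tensor_D2 => //; exact: SmT.
have E3 a0 a1 a2 : smooth1 a0 -> per1 a0 -> smooth1 a1 -> per1 a1 -> smooth1 a2 -> per1 a2 ->
    'D_(dir None) (tensor a0 a1 a2 g3) = tensor a0 a1 a2 d3.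
  by move=> *; apply: tensor_D3 => //; exact: SmT.
have C01 : 'D_(dir (Some (inord 0))) ('D_(dir (Some (inord 1))) (tensor g0 g1 g2 g3)) = 'D_(dir (Some (inord 1))) ('D_(dir (Some (inord 0))) (tensor g0 g1 g2 g3)).
  exact: etrans (etrans (congr1 (fun h : stime R -> R => 'D_(dir (Some (inord 0))) h) (E1 _ _ _ s0 p0 s2 p2 s3)) (E0 _ _ _ t1 q1 s2 p2 s3)) (esym (etrans (congr1 (fun h : stime R -> R => 'D_(dir (Some (inord 1))) h) (E0 _ _ _ s1 p1 s2 p2 s3)) (E1 _ _ _ t0 q0 s2 p2 s3))).
have C02 : 'D_(dir (Some (inord 0))) ('D_(dir (Some (inord 2))) (tensor g0 g1 g2 g3)) = 'D_(dir (Some (inord 2))) ('D_(dir (Some (inord 0))) (tensor g0 g1 g2 g3)).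
  exact: etrans (etrans (congr1 (fun h : stime R -> R => 'D_(dir (Some (inord 0))) h) (E2 _ _ _ s0 p0 s1 p1 s3)) (E0 _ _ _ s1 p1 t2 q2 s3)) (esym (etrans (congr1 (fun h : stime R -> R => 'D_(dir (Some (inord 2))) h) (E0 _ _ _ s1 p1 s2 p2 s3)) (E2 _ _ _ t0 q0 s1 p1 s3))).
have C03 : 'D_(dir (Some (inord 0))) ('D_(dir None) (tensor g0 g1 g2 g3)) = 'D_(dir None) ('D_(dir (Some (inord 0))) (tensor g0 g1 g2 g3)).
  exact: etrans (etrans (congr1 (fun h : stime R -> R => 'D_(dir (Some (inord 0))) h) (E3 _ _ _ s0 p0 s1 p1 s2 p2)) (E0 _ _ _ s1 p1 s2 p2 t3)) (esym (etrans (congr1 (fun h : stime R -> R => 'D_(dir None) h) (E0 _ _ _ s1 p1 s2 p2 s3)) (E3 _ _ _ t0 q0 s1 p1 s2 p2))).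
have C12 : 'D_(dir (Some (inord 1))) ('D_(dir (Some (inord 2))) (tensor g0 g1 g2 g3)) = 'D_(dir (Some (inord 2))) ('D_(dir (Some (inord 1))) (tensor g0 g1 g2 g3)).
  exact: etrans (etrans (congr1 (fun h : stime R -> R => 'D_(dir (Some (inord 1))) h) (E2 _ _ _ s0 p0 s1 p1 s3)) (E1 _ _ _ s0 p0 t2 q2 s3)) (esym (etrans (congr1 (fun h : stime R -> R => 'D_(dir (Some (inord 2))) h) (E1 _ _ _ s0 p0 s2 p2 s3)) (E2 _ _ _ s0 p0 t1 q1 s3))).
have C13 : 'D_(dir (Some (inord 1))) ('D_(dir None) (tensor g0 g1 g2 g3)) = 'D_(dir None) ('D_(dir (Some (inord 1))) (tensor g0 g1 g2 g3)).
  exact: etrans (etrans (congr1 (fun h : stime R -> R => 'D_(dir (Some (inord 1))) h) (E3 _ _ _ s0 p0 s1 p1 s2 p2)) (E1 _ _ _ s0 p0 s2 p2 t3)) (esym (etrans (congr1 (fun h : stime R -> R => 'D_(dir None) h) (E1 _ _ _ s0 p0 s2 p2 s3)) (E3 _ _ _ s0 p0 t1 q1 s2 p2))).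
have C23 : 'D_(dir (Some (inord 2))) ('D_(dir None) (tensor g0 g1 g2 g3)) = 'D_(dir None) ('D_(dir (Some (inord 2))) (tensor g0 g1 g2 g3)).
  exact: etrans (etrans (congr1 (fun h : stime R -> R => 'D_(dir (Some (inord 2))) h) (E3 _ _ _ s0 p0 s1 p1 s2 p2)) (E2 _ _ _ s0 p0 s1 p1 t3)) (esym (etrans (congr1 (fun h : stime R -> R => 'D_(dir None) h) (E2 _ _ _ s0 p0 s1 p1 s3)) (E3 _ _ _ s0 p0 s1 p1 t2 q2))).
case: (kk k) => ->.
- case: (kk l) => ->; [reflexivity | exact: C01 | exact: C02 | exact: C03].
- case: (kk l) => ->; [exact: (esym C01) | reflexivity | exact: C12 | exact: C13].
- case: (kk l) => ->; [exact: (esym C02) | exact: (esym C12) | reflexivity | exact: C23].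
- case: (kk l) => ->; [exact: (esym C03) | exact: (esym C13) | exact: (esym C23) | reflexivity].
Qed.

(** Reflection in time of the primitive that vanishes on the left. *)
Lemma primitive_from_right (f : R -> R) (b : R) : smooth1 f -> (forall t, b <= t -> f t = 0) ->
  exists F, [/\ smooth1 F, has_deriv F f & forall t, b <= t -> F t = 0].
Proof.
move=> sf f0; have sr := smooth1_affine (-1) 0 sf.
have r0 t : t <= - b -> f (-1 * t + 0) = 0 by move=> tb; apply: f0; lra.
have [F dF F0] := continuous_primitive (smooth1_continuous sr) r0.
have d : has_deriv (fun t => - F (-1 * t + 0)) f.
  move=> t; apply: is_derive_eq (has_derivN (has_deriv_affine (-1) 0 dF) t) _.
  by rewrite mulrN1 opprK; congr f; ring.
exists (fun t => - F (-1 * t + 0)); split=> //; first exact: smooth1_near d.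
by move=> t bt; rewrite F0 ?oppr0//; lra.
Qed.

(** It exhibits [phi(t) f] as the time derivative of an admissible test. Only the time factor is
    integrated, from the right, so the primitive vanishes at late times and is unrestricted at
    $t=0$. *)
Lemma time_primitive (b : R) (phi : R -> R) f : smooth1 phi -> (forall t, b <= t -> phi t = 0) -> Sm f ->
  exists Psi, [/\ Sm Psi, forall z, b <= z.2 -> Psi z = 0 &
    forall z, 'D_dt Psi z = phi z.2 * f z].
Proof.
move=> sphi phi0; elim=> {f} [g0 g1 g2 g3 s0 p0 s1 p1 s2 p2 s3|f1 f2 s1 [P1 [sP1 P10 D1]] s2 [P2 [sP2 P20 D2]]].
  have z0 t : b <= t -> phi t * g3 t = 0 by move=> bt; rewrite phi0// mul0r.
  have [F [sF dF F0]] := primitive_from_right (smooth1M sphi s3) z0.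
  have sP : Sm (tensor g0 g1 g2 F) by exact: SmT.
  exists (tensor g0 g1 g2 F); split=> // [z bz|z]; first by rewrite /tensor F0 ?mulr0.
  apply: etrans (congr1 (@^~ z) (tensor_D3 sP dF)) _; rewrite /tensor; ring.
exists (fun z => P1 z + P2 z); split=> [|z bz|z]; first exact: SmD.
  by rewrite P10// P20// addr0.
by rewrite Sm_deriveD// D1 D2 mulrDr.
Qed.

Lemma intQ_law T F (G : 'I_3 -> stime R -> R) S : L1Q T F -> (forall a, L1Q T (G a)) -> L1Q T S ->
  intQ T (fun z => F z - \sum_a G a z + S z) = intQ T F - \sum_a intQ T (G a) + intQ T S.
Proof.
move=> LF LG LS; have LsG : L1Q T (fun z => \sum_a G a z) by exact: L1Q_sum.
by rewrite (intQD (L1QB LF LsG) LS) (intQB LF LsG) intQ_sum.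
Qed.

(* A law with Lipschitz data holding away from t = 0 is a pointwise identity, hence holds up to t = 0. *)
Lemma interior_law T f df (g : 'I_3 -> stime R -> R) dg (s : stime R -> R) : 0 < T ->
  Lw T f df -> (forall a, Lw T (g a) (dg a)) -> bndQ T s ->
  balance_law T f g s ->
  forall h, L1Q T h -> intQ T (fun z => (df None z - \sum_a dg a (Some a) z - s z) * h z) = 0.
Proof.
move=> T0 Lf Lg bs law; pose k z := df None z - \sum_a dg a (Some a) z - s z.
have bdf := Lw_bndQ_deriv None Lf; have bdg a := Lw_bndQ_deriv (Some a) (Lg a).
have bf := Lw_bndQ T0 Lf; have bg a := Lw_bndQ T0 (Lg a).
have bk : bndQ T k by apply: bndQB => //; apply: bndQB => //; exact: bndQ_sum.
have test psi : SmT_int T psi -> intQ T (fun z => k z * psi z) = 0.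
  move=> tpsi; have [spsi _] := tpsi; have bpsi := Sm_bndQ T spsi.
  have bD d := Sm_bndQ T (Sm_D (dir d) spsi).
  have [_ _ wf] := Lf; have wg a : forall psi, SmT_int T psi -> intQ T (fun z => g a z * 'D_(dx a) psi z) = - intQ T (fun z => dg a (Some a) z * psi z).
    by have [_ _ H] := Lg a; exact: (H (Some a)).
  have := law psi (SmT_int_test tpsi); rewrite -[LHS]/(intQ T _).
  have LfD : L1Q T (fun z => f z * 'D_dt psi z) by apply: bndQ_L1Q; apply: bndQM => //; exact: (bD None).
  have LgD a : L1Q T (fun z => g a z * 'D_(dx a) psi z) by apply: bndQ_L1Q; apply: bndQM => //; exact: (bD (Some a)).
  have Lsp : L1Q T (fun z => s z * psi z) by apply: bndQ_L1Q; exact: bndQM.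
  have Ldf : L1Q T (fun z => df None z * psi z) by apply: bndQ_L1Q; exact: bndQM.
  have Ldg a : L1Q T (fun z => dg a (Some a) z * psi z) by apply: bndQ_L1Q; exact: bndQM.
  rewrite (intQ_law LfD LgD Lsp) (wf None psi tpsi); under eq_bigr => a _ do rewrite (wg a psi tpsi).
  move=> H; have -> : intQ T (fun z => k z * psi z) = intQ T (fun z => df None z * psi z) -
      \sum_a intQ T (fun z => dg a (Some a) z * psi z) - intQ T (fun z => s z * psi z).
    rewrite -(intQN Lsp) -(intQ_law Ldf Ldg (L1QN Lsp)).
    by apply: intQ_ext => z _; rewrite /k !mulrBl mulr_suml.
  by rewrite sumrN in H; move: H; set x := intQ _ _; set y := \sum_a _; set w := intQ _ _; lra.
move=> h Lh; have [_ [C C0 kC]] := bk.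
apply/eqP; rewrite -normr_eq0 eq_le normr_ge0 andbT; apply/ler_addgt0Pr => e e0; rewrite add0r.
have C1 : 0 < C + 1 by rewrite ltr_pwDr.
have [psi tpsi hpsi] := L1Q_dense T0 Lh (divr_gt0 e0 C1).
have [spsi _] := tpsi; have Lpsi := Sm_L1Q T spsi.
have -> : intQ T (fun z => k z * h z) = intQ T (fun z => k z * (h z - psi z)).
  rewrite -[LHS]subr0 -(test _ tpsi) -intQB; [|exact: L1Q_bndM|exact: L1Q_bndM].
  by apply: intQ_ext => z _; rewrite mulrBr.
rewrite (le_trans (intQ_bndM_le bk (L1QB Lh Lpsi) kC))// (le_trans (ler_wpM2l C0 hpsi))//.
by rewrite mulrCA ger_pMr// ler_pdivrMr// mul1r lerDl.
Qed.

(** Integrating the pointwise identity back by parts against tests that do not vanish at $t=0$ adds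
    exactly the trace of [f]. *)
Lemma interior_balance_Sm T f df (g : 'I_3 -> stime R -> R) dg (s : stime R -> R) : 0 < T ->
  Lw T f df -> (forall a, Lw T (g a) (dg a)) -> bndQ T s ->
  balance_law T f g s -> balance_Sm T (fun x => f (x, 0)) f g s.
Proof.
move=> T0 Lf Lg bs law psi ipsi; have [spsi _] := ipsi.
have H := interior_law T0 Lf Lg bs law (Sm_L1Q T spsi).
have bpsi := Sm_bndQ T spsi; have bD d := Sm_bndQ T (Sm_D (dir d) spsi).
have bdf := Lw_bndQ_deriv None Lf; have bdg a := Lw_bndQ_deriv (Some a) (Lg a).
have bf := Lw_bndQ T0 Lf; have bg a := Lw_bndQ T0 (Lg a).
have LfD : L1Q T (fun z => f z * 'D_dt psi z) by apply: bndQ_L1Q; apply: bndQM => //; exact: (bD None).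
have LgD a : L1Q T (fun z => g a z * 'D_(dx a) psi z) by apply: bndQ_L1Q; apply: bndQM => //; exact: (bD (Some a)).
have Lsp : L1Q T (fun z => s z * psi z) by apply: bndQ_L1Q; exact: bndQM.
have Ldf : L1Q T (fun z => df None z * psi z) by apply: bndQ_L1Q; exact: bndQM.
have Ldg a : L1Q T (fun z => dg a (Some a) z * psi z) by apply: bndQ_L1Q; exact: bndQM.
rewrite (intQ_law LfD LgD Lsp) (Lw_ibp None T0 Lf ipsi).
under eq_bigr => a _ do rewrite (Lw_ibp (Some a) T0 (Lg a) ipsi) oppr0 sub0r.
have {}H : intQ T (fun z => df None z * psi z) - \sum_a intQ T (fun z => dg a (Some a) z * psi z) -
    intQ T (fun z => s z * psi z) = 0.
  rewrite -[RHS]H -(intQN Lsp) -(intQ_law Ldf Ldg (L1QN Lsp)).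
  by apply: intQ_ext => z _; rewrite !mulrBl mulr_suml.
by rewrite sumrN; move: H; set x := intQ _ _; set y := \sum_a _; set w := intQ _ _; lra.
Qed.

End NullLagrangian.

(** * Vanishing divergence of the derivatives of minors *)

Section NullDivergence.
Context {R : realType}.
Implicit Types (T : R) (f h : stime R -> R).
Notation lebT := (measurableTypeR R).

Let mcell : measurable (cell : set (lebT * lebT * lebT)%type).
Proof. exact: measurable_cell. Qed.

Lemma intCD (f h : xspace R -> R) : L1C f -> L1C h -> intC (fun x => f x + h x) = intC f + intC h.
Proof. exact: (@intD _ _ _ leb3 cell mcell f h). Qed.
Lemma L1C_sum (I : Type) (r : seq I) (P : pred I) (F : I -> xspace R -> R) :
  (forall i, P i -> L1C (F i)) -> L1C (fun x => \sum_(i <- r | P i) F i x).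
Proof. exact: (@L1_sum _ _ _ leb3 cell mcell). Qed.
Lemma intC_sum (I : Type) (r : seq I) (P : pred I) (F : I -> xspace R -> R) :
  (forall i, P i -> L1C (F i)) ->
  intC (fun x => \sum_(i <- r | P i) F i x) = \sum_(i <- r | P i) intC (F i).
Proof. exact: (@int_sum _ _ _ leb3 cell mcell). Qed.
Lemma L1CZ (k : R) (f : xspace R -> R) : L1C f -> L1C (fun x => k * f x).
Proof. exact: (@L1Z _ _ _ leb3 cell mcell k f). Qed.
Lemma L1C_Mbnd (f h : xspace R -> R) : L1C f -> bndC h -> L1C (fun x => f x * h x).
Proof. exact: (@L1_Mbnd _ _ _ leb3 cell mcell f h). Qed.

Lemma Sm_bndC T f : 0 < T -> Sm f -> bndC (fun x => f (x, 0)).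
Proof. by move=> T0 sf; apply: (lipQ_bndC T0); exact: Sm_lip. Qed.

(** Since [dPhiB] is affine in the minors, it obeys a balance law by linearity; the constant part
    contributes its own trace and nothing else. *)
Lemma balance_Sm_lin T (kc : R) (m : xidx -> R) (f0 : xidx -> xspace R -> R) (f : xidx -> stime R -> R)
    (g : xidx -> 'I_3 -> stime R -> R) : 0 < T ->
  (forall C, L1C (f0 C)) -> (forall C, L1Q T (f C)) -> (forall C a, L1Q T (g C a)) ->
  (forall C, balance_Sm T (f0 C) (f C) (g C) (fun=> 0)) ->
  balance_Sm T (fun x => kc + \sum_C m C * f0 C x) (fun z => kc + \sum_C m C * f C z)
    (fun a z => \sum_C m C * g C a z) (fun=> 0).
Proof.
move=> T0 Lf0 Lf Lg bal psi ipsi; have [spsi _] := ipsi.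
have bpsi := Sm_bndQ T spsi; have bD d := Sm_bndQ T (Sm_D (dir d) spsi).
have b0 := Sm_bndC T0 spsi; have Lpsi0 := bndC_L1C b0.
have L0 C : L1C (fun x => m C * (f0 C x * psi (x, 0))) by apply: L1CZ; exact: L1C_Mbnd.
have Lk : L1C (fun x => kc * psi (x, 0)) by exact: L1CZ.
rewrite (_ : intC _ = intC (fun x => kc * psi (x, 0)) + \sum_C m C * intC (fun x => f0 C x * psi (x, 0))); last first.
  rewrite (eq_bigr (fun C => intC (fun x => m C * (f0 C x * psi (x, 0))))); last first.
    by move=> C _; rewrite intCZ//; exact: L1C_Mbnd.
  rewrite -intC_sum// -intCD//; last exact: L1C_sum.
  apply: eq_Rintegral => x _; rewrite mulrDl mulr_suml; congr (_ + _).
  by apply: eq_bigr => C _; rewrite mulrA.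
pose h C z := f C z * 'D_dt psi z - \sum_a g C a z * 'D_(dx a) psi z + 0 * psi z.
have L00 : L1Q T (fun z => 0 * psi z) by apply: L1QZ; exact: bndQ_L1Q.
have Lh C : L1Q T (h C).
  apply: L1QD => //; apply: L1QB; first by apply: L1Q_Mbnd => //; exact: (bD None).
  by apply: L1Q_sum => a _; apply: L1Q_Mbnd => //; exact: (bD (Some a)).
have LkD : L1Q T (fun z => kc * 'D_dt psi z) by apply: L1QZ; apply: bndQ_L1Q; exact: (bD None).
have -> : intQ T (fun z => (kc + \sum_C m C * f C z) * 'D_dt psi z -
    \sum_a (\sum_C m C * g C a z) * 'D_(dx a) psi z + 0 * psi z) =
    intQ T (fun z => kc * 'D_dt psi z) + \sum_C m C * intQ T (h C).
  rewrite (eq_bigr (fun C => intQ T (fun z => m C * h C z))); last by move=> C _; rewrite intQZ.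
  rewrite -intQ_sum => [|C _]; last exact: L1QZ.
  rewrite -intQD//; last by apply: L1Q_sum => C _; exact: L1QZ.
  apply: intQ_ext => z _; rewrite mul0r addr0 mulrDl -addrA; congr (_ + _).
  rewrite mulr_suml (eq_bigr (fun a => \sum_C m C * (g C a z * 'D_(dx a) psi z))); last first.
    by move=> a _; rewrite mulr_suml; apply: eq_bigr => C _; rewrite mulrA.
  rewrite exchange_big/= -sumrB; apply: eq_bigr => C _.
  by rewrite /h mul0r addr0 mulrBr mulr_sumr mulrA.
have := Lw_ibp None T0 (Lw_cst kc T0) ipsi.
rewrite (_ : intQ T (fun z => 0 * psi z) = 0); last by rewrite intQZ ?mul0r//; exact: bndQ_L1Q.
move=> ->; rewrite subr0 addrACA subrr add0r -big_split/= big1// => C _.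
by rewrite -mulrDr (bal C psi ipsi) mulr0.
Qed.

Lemma Sm_init_dx T f a : Sm_init T f -> Sm_init T ('D_(dx a) f).
Proof.
move=> [sf [T' T'T f0]]; split; first exact: Sm_D.
exists T' => // z Tz; apply: (Sm_derive_line sf (G := fun=> 0) (G' := fun=> 0)) => [s|]; last exact: has_deriv_cst.
by rewrite f0// smul_dx.
Qed.

Lemma eq_opp0 (x : R) : x = - x -> x = 0. Proof. lra. Qed.

(** The law for the component [a] is tested with ['D_(dx a) psi] and summed over [a]. The flux,
    antisymmetric in its two indices, meets symmetric second derivatives of [psi] and drops out. *)
Lemma null_div T (X0 : 'I_3 -> xspace R -> R) (X : 'I_3 -> stime R -> R) (N : 'I_3 -> 'I_3 -> stime R -> R) psi :
  0 < T -> (forall a, L1Q T (X a)) -> (forall a b, L1Q T (N a b)) ->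
  (forall a b z, QT T z -> N a b z = - N b a z) ->
  (forall a, balance_Sm T (X0 a) (X a) (N a) (fun=> 0)) -> Sm_init T psi ->
  \sum_a intC (fun x => X0 a x * 'D_(dx a) psi (x, 0)) + \sum_a intQ T (fun z => X a z * 'D_(dx a) ('D_dt psi) z) = 0.
Proof.
move=> T0 LX LN anti bal ipsi; have [spsi _] := ipsi.
have bDD d d' : bndQ T ('D_(dir d) ('D_(dir d') psi)) by apply: Sm_bndQ; do 2 apply: Sm_D.
have LXD a : L1Q T (fun z => X a z * 'D_dt ('D_(dx a) psi) z) by apply: L1Q_Mbnd => //; exact: (bDD None (Some a)).
have LND a b : L1Q T (fun z => N a b z * 'D_(dx b) ('D_(dx a) psi) z).
  by apply: L1Q_Mbnd => //; exact: (bDD (Some b) (Some a)).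
have L0 a : L1Q T (fun z => 0 * 'D_(dx a) psi z).
  by apply: L1QZ; apply: Sm_L1Q; exact: Sm_D.
have I0 a : intQ T (fun z => 0 * 'D_(dx a) psi z) = 0.
  by rewrite intQZ ?mul0r//; apply: Sm_L1Q; exact: Sm_D.
have H a : intC (fun x => X0 a x * 'D_(dx a) psi (x, 0)) + intQ T (fun z => X a z * 'D_(dx a) ('D_dt psi) z) =
    \sum_b intQ T (fun z => N a b z * 'D_(dx b) ('D_(dx a) psi) z).
  have fin (x y y' s : R) : y = y' -> x + (y - s) = 0 -> x + y' = s.
    by move=> <- /eqP; rewrite addrA subr_eq0 => /eqP.
  have E : intQ T (fun z => X a z * 'D_dt ('D_(dx a) psi) z) = intQ T (fun z => X a z * 'D_(dx a) ('D_dt psi) z).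
    apply: intQ_ext => z _.
    exact: (congr1 (fun h => X a z * h z) (Sm_schwarz None (Some a) spsi)).
  apply: (fin _ _ _ _ E); rewrite -[RHS](bal a _ (Sm_init_dx a ipsi)).
  by rewrite (intQ_law (LXD a) (LND a) (L0 a)) I0 addr0.
rewrite -big_split/= (eq_bigr _ (fun a _ => H a)).
set S := \sum_a _; have : S = - S; last exact: eq_opp0.
rewrite {2}/S exchange_big/= -sumrN; apply: eq_bigr => a _; rewrite -sumrN; apply: eq_bigr => b _.
apply: etrans _ (intQN (LND b a)); apply: intQ_ext => z Qz.
apply: etrans (congr1 (fun y => y * 'D_(dx b) ('D_(dx a) psi) z) (anti a b z Qz)) _.
apply: etrans (mulNr _ _) (congr1 -%R _).
exact: (congr1 (fun h => N b a z * h z) (Sm_schwarz (Some b) (Some a) spsi)).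
Qed.

Lemma Lw_dPhiB T (F : 'I_3 -> 'I_3 -> stime R -> R) dF B i a : 0 < T ->
  (forall j b, Lw T (F j b) (dF j b)) ->
  Lw T (fun z => dPhiB B i a (\matrix_(j, b) F j b z)) (fun d z => \sum_C dPhi_m B i a C *
    \sum_j \sum_b dPhiB C j b (\matrix_(j, b) F j b z) * dF j b d z).
Proof.
move=> T0 LF; have H := LwD T0 (Lw_cst (dPhi_k B i a) T0)
  (Lw_sum T0 (fun C => LwZ (dPhi_m B i a C) T0 (Lw_PhiB C T0 LF))).
have -> : (fun z => dPhiB B i a (\matrix_(j, b) F j b z)) = fun z => dPhi_k B i a +
    \sum_C dPhi_m B i a C * PhiB C (\matrix_(j, b) F j b z) by apply/funext => z; exact: dPhiB_affine.
by apply: (Lw_ext H) => d z _; rewrite add0r.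
Qed.

(** The Piola identity: coefficients antisymmetric in [a] and [b] meet a curl-free gradient,
    symmetric in them. *)
Lemma Lw_dPhiB_div (F : 'I_3 -> 'I_3 -> stime R -> R) (dF : 'I_3 -> 'I_3 -> option 'I_3 -> stime R -> R) B i z :
  (forall j a b, dF j b (Some a) z = dF j a (Some b) z) ->
  \sum_a \sum_C dPhi_m B i a C * (\sum_j \sum_b dPhiB C j b (\matrix_(j, b) F j b z) * dF j b (Some a) z) = 0.
Proof.
move=> sym; pose A j a b := \sum_C dPhi_m B i a C * dPhiB C j b (\matrix_(j, b) F j b z).
have -> : \sum_a \sum_C dPhi_m B i a C * (\sum_j \sum_b dPhiB C j b (\matrix_(j, b) F j b z) * dF j b (Some a) z) =
    \sum_j \sum_a \sum_b A j a b * dF j b (Some a) z.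
  rewrite [RHS]exchange_big/=; apply: eq_bigr => a _.
  rewrite (eq_bigr (fun C => \sum_j \sum_b dPhi_m B i a C * dPhiB C j b (\matrix_(j, b) F j b z) * dF j b (Some a) z)).
    rewrite exchange_big/=; apply: eq_bigr => j _; rewrite exchange_big/=; apply: eq_bigr => b _.
    by rewrite mulr_suml.
  move=> C _; rewrite mulr_sumr; apply: eq_bigr => j _; rewrite mulr_sumr; apply: eq_bigr => b _.
  by rewrite mulrA.
rewrite big1// => j _; set S := \sum_a _; have : S = - S; last exact: eq_opp0.
rewrite {2}/S exchange_big/= -sumrN; apply: eq_bigr => a _; rewrite -sumrN; apply: eq_bigr => b _.
rewrite -mulNr (sym j a b).
exact: (congr1 (fun y => y * dF j a (Some b) z) (dPhi_antisym B i j a b _)).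
Qed.

Lemma time_mul_dx (phi : R -> R) f a (z : stime R) : smooth1 phi -> Sm f ->
  'D_(dx a) (fun z => phi z.2 * f z) z = phi z.2 * 'D_(dx a) f z.
Proof.
move=> sphi sf; have st := Sm_time sphi; rewrite (Sm_deriveM _ _ st sf).
rewrite (_ : 'D_(dx a) (fun z => phi z.2) z = 0) ?mulr0 ?addr0//.
by apply: (Sm_derive_line st (G := fun _ => phi z.2) (G' := fun=> 0)) => [s|]; [rewrite smul_dx|exact: has_deriv_cst].
Qed.

(* The potential of a gradient is not needed: the transport equation of Phi(F) keeps
   div dPhi^B(F) constant in time, and it vanishes initially because F0 = Fbar(., 0) is curl free. *)
Lemma null_lagrangian T (FU : stime R -> 'M[R]_3) (V : 'I_3 -> stime R -> R)
    (F : 'I_3 -> 'I_3 -> stime R -> R) (v : 'I_3 -> stime R -> R) dF dv : 0 < T ->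
  (forall j b, Lw T (F j b) (dF j b)) -> (forall j, Lw T (v j) (dv j)) ->
  (forall z, QT T z -> forall j a b, dF j b (Some a) z = dF j a (Some b) z) ->
  (forall C, balance_law T (fun z => PhiB C (\matrix_(j, b) F j b z))
    (fun a z => \sum_j dPhiB C j a (\matrix_(j, b) F j b z) * v j z) (fun=> 0)) ->
  (forall C, L1Q T (fun z => PhiB C (FU z))) ->
  (forall C a, L1Q T (fun z => \sum_j dPhiB C j a (FU z) * V j z)) ->
  (forall C, balance_Sm T (fun x => PhiB C (\matrix_(j, b) F j b (x, 0))) (fun z => PhiB C (FU z))
    (fun a z => \sum_j dPhiB C j a (FU z) * V j z) (fun=> 0)) ->
  forall B i (phi : R -> R) w dw, smooth1 phi -> (exists2 T', T' < T & forall t, T' <= t -> phi t = 0) ->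
    Lw T w dw ->
  \sum_a intQ T (fun z => dw (Some a) z * (phi z.2 * dPhiB B i a (FU z))) = 0.
Proof.
move=> T0 LF Lv sym lawF LP Lflux balU B i phi w dw sphi [T' T'T phi0] Lww.
pose Fm z := \matrix_(j, b) F j b z.
have LPF C := Lw_PhiB C T0 LF.
have LD C j a := Lw_dPhiB C j a T0 LF.
have Lfl C a := Lw_sum T0 (fun j => LwM T0 (LD C j a) (Lv j)).
have balF C : balance_Sm T (fun x => PhiB C (Fm (x, 0))) (fun z => PhiB C (Fm z))
    (fun a z => \sum_j dPhiB C j a (Fm z) * v j z) (fun=> 0).
  exact: (interior_balance_Sm T0 (LPF C) (Lfl C) (bndQ_cst T 0) (lawF C)).
have L0 C : L1C (fun x => PhiB C (Fm (x, 0))).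
  by apply: bndC_L1C; have [lP _ _] := LPF C; exact: (lipQ_bndC T0 lP).
have LPF1 C : L1Q T (fun z => PhiB C (Fm z)) by apply: bndQ_L1Q; exact: (Lw_bndQ T0 (LPF C)).
have Lfl1 C a : L1Q T (fun z => \sum_j dPhiB C j a (Fm z) * v j z).
  by apply: bndQ_L1Q; exact: (Lw_bndQ T0 (Lfl C a)).
have anti (G : stime R -> 'M[R]_3) (u : 'I_3 -> stime R -> R) a b z :
    \sum_C dPhi_m B i a C * (\sum_j dPhiB C j b (G z) * u j z) = - \sum_C dPhi_m B i b C * (\sum_j dPhiB C j a (G z) * u j z).
  have E p q : \sum_C dPhi_m B i p C * (\sum_j dPhiB C j q (G z) * u j z) =
      \sum_j (\sum_C dPhi_m B i p C * dPhiB C j q (G z)) * u j z.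
    rewrite (eq_bigr (fun C => \sum_j dPhi_m B i p C * dPhiB C j q (G z) * u j z)).
      by rewrite exchange_big/=; apply: eq_bigr => j _; rewrite mulr_suml.
    by move=> C _; rewrite mulr_sumr; apply: eq_bigr => j _; rewrite mulrA.
  apply: etrans (E a b) (etrans _ (congr1 -%R (esym (E b a)))).
  rewrite -sumrN; apply: eq_bigr => j _; rewrite -mulNr.
  exact: (congr1 (fun y => y * u j z) (dPhi_antisym B i j a b (G z))).
have bU a := balance_Sm_lin (dPhi_k B i a) (dPhi_m B i a) T0 L0 LP Lflux balU.
have bF a := balance_Sm_lin (dPhi_k B i a) (dPhi_m B i a) T0 L0 LPF1 Lfl1 balF.
have LX (G : stime R -> 'M[R]_3) : (forall C, L1Q T (fun z => PhiB C (G z))) -> forall a,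
    L1Q T (fun z => dPhi_k B i a + \sum_C dPhi_m B i a C * PhiB C (G z)).
  move=> LG a; apply: L1QD; first by apply: bndQ_L1Q; exact: bndQ_cst.
  by apply: L1Q_sum => C _; exact: L1QZ.
have LN (g : xidx -> 'I_3 -> stime R -> R) : (forall C a, L1Q T (g C a)) -> forall a b,
    L1Q T (fun z => \sum_C dPhi_m B i a C * g C b z).
  by move=> Lg a b; apply: L1Q_sum => C _; exact: L1QZ.
have test G : Sm G -> \sum_a intQ T (fun z => 'D_(dx a) G z * (phi z.2 * dPhiB B i a (FU z))) = 0.
  (* [phi(t) G] is the time derivative of [P]. Tested with [P], the laws of [FU] and of the
     Lipschitz field have the same initial term; it is zero because the space-time term of the
     Lipschitz field vanishes by the Piola identity, and so the term of [FU] vanishes too. *)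
  move=> sG; have [P [sP P0 DP]] := time_primitive sphi phi0 sG.
  have iP : Sm_init T P by split=> //; exists T'.
  have iD : Sm_init T ('D_dt P).
    by split; [exact: Sm_D|exists T' => // z Tz; rewrite DP phi0// mul0r].
  have nU := null_div T0 (LX _ LP) (LN _ Lflux) (fun a b z _ => anti FU V a b z) bU iP.
  have nF := null_div T0 (LX _ LPF1) (LN _ Lfl1) (fun a b z _ => anti Fm v a b z) bF iP.
  have vF : \sum_a intQ T (fun z => (dPhi_k B i a + \sum_C dPhi_m B i a C * PhiB C (Fm z)) * 'D_(dx a) ('D_dt P) z) = 0.
    have LDP := Sm_L1Q T (proj1 iD).
    have E a : intQ T (fun z => (dPhi_k B i a + \sum_C dPhi_m B i a C * PhiB C (Fm z)) * 'D_(dx a) ('D_dt P) z) =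
        - intQ T (fun z => (\sum_C dPhi_m B i a C * (\sum_j \sum_b dPhiB C j b (Fm z) * dF j b (Some a) z)) * 'D_dt P z).
      have := Lw_ibp (Some a) T0 (LD B i a) iD; rewrite oppr0 sub0r => <-.
      by apply: intQ_ext => z _; rewrite dPhiB_affine.
    rewrite (eq_bigr _ (fun a _ => E a)) sumrN -intQ_sum; last first.
      move=> a _; apply: L1Q_bndM => //; exact: (Lw_bndQ_deriv (Some a) (LD B i a)).
    rewrite (intQ_ext (g := fun=> 0 * 'D_dt P 0)); last first.
      by move=> z Qz; rewrite -mulr_suml Lw_dPhiB_div ?mul0r// => j a b; exact: sym.
    by rewrite intQZ ?mul0r ?oppr0//; apply: bndQ_L1Q; exact: bndQ_cst.
  have vU : \sum_a intQ T (fun z => (dPhi_k B i a + \sum_C dPhi_m B i a C * PhiB C (FU z)) * 'D_(dx a) ('D_dt P) z) = 0.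
    by move: nU nF; rewrite vF addr0 => + h0; rewrite h0 add0r.
  rewrite -[RHS]vU; apply: eq_bigr => a _; apply: intQ_ext => z _.
  have -> : 'D_(dx a) ('D_dt P) z = phi z.2 * 'D_(dx a) G z.
    rewrite -(time_mul_dx a z sphi sG); congr (derive _ z (dx a)); apply/funext; exact: DP.
  by rewrite dPhiB_affine; ring.
have [G [C [C0 sG _ _ [_ Glim]]]] := Lw_approx T0 Lww.
have Lh a : L1Q T (fun z => phi z.2 * dPhiB B i a (FU z)).
  apply: L1Q_bndM; first by apply: Sm_bndQ; exact: Sm_time.
  by apply: (L1Q_ext (LX _ LP a)) => z _; rewrite dPhiB_affine.
have lim : \sum_a intQ T (fun z => 'D_(dx a) (G n) z * (phi z.2 * dPhiB B i a (FU z))) @[n --> \oo] -->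
    \sum_a intQ T (fun z => dw (Some a) z * (phi z.2 * dPhiB B i a (FU z))).
  apply: (@cvg_sumr _ _ _ _ _ (fun a n => intQ T (fun z => 'D_(dx a) (G n) z * (phi z.2 * dPhiB B i a (FU z))))) => a.
  exact: (Glim (Some a)).
apply: (cvg_unique _ lim) => //; rewrite [X in X @ _](_ : _ = fun=> 0); first exact: cvg_cst.
by apply/funext => n; exact: test.
Qed.

End NullDivergence.

(** * Weak derivatives of the Lipschitz solution *)

Section LipschitzSolution.
Context {R : realType}.
Implicit Types (T : R) (f h : stime R -> R).
Notation lebT := (measurableTypeR R).
Notation idx := (option xidx).

Let mQT T : measurable (QT T : set (lebT * lebT * lebT * lebT)%type).
Proof. exact: measurable_QT. Qed.

Lemma intQ_ae T f g : measurable_fun (QT T) f -> measurable_fun (QT T) g ->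
  {ae leb4, forall z, QT T z -> f z = g z} -> intQ T f = intQ T g.
Proof. exact: (@int_ae _ _ _ leb4 (QT T) (mQT T)). Qed.

(** Truncation at an essential bound changes the function on a null set only. *)
Lemma Linf_rep T f : Linf T f -> exists2 g, bndQ T g & {ae leb4, forall z, QT T z -> g z = f z}.
Proof.
move=> [mf [C aeC]]; exists (fun z => Num.max (- `|C|) (Num.min `|C| (f z))).
  apply: (@bndQP _ _ _ `|C|) => [|z _].
    by apply: measurable_maxr; [exact: measurable_cst|apply: measurable_minr => //; exact: measurable_cst].
  rewrite ler_norml le_max lexx/= ge_max ge_min lexx/= andbT.
  by rewrite (@le_trans _ _ 0) ?oppr_le0.
apply: (@ae_imp _ _ _ leb4 _ _ aeC) => z H Qz; have := le_trans (H Qz) (ler_norm C); rewrite ler_norml => /andP[a b].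
by rewrite (min_idPr b) (max_idPr a).
Qed.

Lemma weak_deriv_Lw T d f g : weak_deriv T d f g -> Linf T g -> exists2 g', bndQ T g' &
  {ae leb4, forall z, QT T z -> g' z = g z} /\
  forall psi, SmT_int T psi -> intQ T (fun z => f z * 'D_d psi z) = - intQ T (fun z => g' z * psi z).
Proof.
move=> wd Lg; have [g' bg' ae] := Linf_rep Lg; exists g' => //; split=> // psi tpsi.
have [spsi _] := tpsi; have mpsi : measurable_fun (QT T) psi by exact: measurable_funS (Sm_measurable spsi).
apply: etrans (wd psi (SmT_int_test tpsi)) _; congr (- _).
have [mg _] := Lg; have [mg' _] := bg'.
apply: intQ_ae; [exact: measurable_funM|exact: measurable_funM|].
by apply: (@ae_imp _ _ _ leb4 _ _ ae) => z H Qz; rewrite H.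
Qed.

Lemma W1inf_Lw T f : lipQ T f -> W1inf T f -> exists df, Lw T f df.
Proof.
move=> lf [_ [g0 Lg0 wg0] wg].
have [h0 bh0 [_ H0]] := weak_deriv_Lw wg0 Lg0.
have /choice[h Hh] a : exists h, bndQ T h /\ forall psi, SmT_int T psi ->
    intQ T (fun z => f z * 'D_(dx a) psi z) = - intQ T (fun z => h z * psi z).
  by have [g Lg wga] := wg a; have [h bh [_ H]] := weak_deriv_Lw wga Lg; exists h.
exists (fun k => if k is Some a then h a else h0); split=> // [[a|]//|[a|]//]; by case: (Hh a).
Qed.

Lemma lipQ_inv T f delta : 0 < delta -> lipQ T f -> (forall z, 0 <= z.2 <= T -> delta <= f z) ->
  lipQ T (fun z => (f z)^-1).
Proof.
move=> d0 [pf [L L0 HL]] df; split; first by move=> z a; rewrite pf.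
exists (delta^-1 * delta^-1 * L) => [|z w zT wT].
  by rewrite !mulr_ge0// invr_ge0 ltW.
have fz := df z zT; have fw := df w wT.
have fz0 : 0 < f z by exact: lt_le_trans fz. have fw0 : 0 < f w by exact: lt_le_trans fw.
have -> : (f z)^-1 - (f w)^-1 = (f w - f z) * ((f z)^-1 * (f w)^-1) by field; rewrite !gt_eqF.
rewrite -[leRHS]mulrA normrM mulrC ler_pM//; last by rewrite distrC; exact: HL.
by rewrite normrM !normfV (gtr0_norm fz0) (gtr0_norm fw0) ler_pM ?invr_ge0 ?(ltW fz0) ?(ltW fw0) ?lef_pV2// posrE.
Qed.

Lemma mx_entry_norm m n (A : 'M[R]_(m.+1, n.+1)) i j : `|A i j| <= `|A|.
Proof.
have -> : `|A| = \big[Num.max/0]_ij `|A ij.1 ij.2| by exact: mx_normrE.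
exact: (@le_bigmax _ _ _ 0 (fun ij : 'I_m.+1 * 'I_n.+1 => `|A ij.1 ij.2|) (i, j)).
Qed.

Lemma dist4_norm (z w : stime R) : `|z - w| <= dist4 z w.
Proof.
rewrite /dist4 !prod_normE /= !ge_max.
have h0 := normr_ge0 (z.1.1.1 - w.1.1.1); have h1 := normr_ge0 (z.1.1.2 - w.1.1.2).
have h2 := normr_ge0 (z.1.2 - w.1.2); have h3 := normr_ge0 (z.2 - w.2).
by repeat (apply/andP; split); lra.
Qed.

Lemma lipQ_proj T (U : stime R -> state R) (pr : state R -> R) :
  Defs.periodic U -> [lipschitz U z | z in [set z : stime R | 0 <= z.2 <= T]] ->
  (forall u u', `|pr u - pr u'| <= `|u - u'|) -> lipQ T (fun z => pr (U z)).
Proof.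
move=> pU [k [_ Hk]] prU; split; first by move=> z a; rewrite pU.
(* The estimate is available for every constant above [k]; this one is also nonnegative. *)
exists (`|k| + 1) => [|z w zT wT]; first by rewrite addr_ge0.
have k1 : k < `|k| + 1 by rewrite (le_lt_trans (ler_norm k))// ltrDl.
have := Hk _ k1 (z, w) (conj zT wT) => /= H.
rewrite (le_trans (prU _ _))// (le_trans H)// ler_wpM2l ?addr_ge0//; exact: dist4_norm.
Qed.

Lemma dPhiB_F_sum i b a (G : 'M[R]_3) (x : 'I_3 -> R) :
  \sum_j dPhiB (inl (inl (i, b))) j a G * x j = (a == b)%:R * x i.
Proof.
rewrite -(sum_pick3 x i) mulr_sumr; apply: eq_bigr => j _.
by rewrite dPhiB_F -mulnb natrM (eq_sym i) (eq_sym b); ring.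
Qed.

Definition ubar (U : stime R -> state R) z : idx -> R := xc (sPhi (U z)).

Definition dub (U : stime R -> state R) (dF : 'I_3 -> 'I_3 -> option 'I_3 -> stime R -> R)
    (deta : option 'I_3 -> stime R -> R) (I : idx) (d : option 'I_3) z : R :=
  if I is Some B then \sum_i \sum_a dPhiB B i a (sF (U z)) * dF i a d z else deta d z.

(* The derivatives of the conjugate variables D_I(ubar). *)
Definition dDb e (U : stime R -> state R) dF deta (I : idx) d z : R :=
  \sum_K Hc e K I (ubar U z) * dub U dF deta K d z.

Definition dPhi_d (U : stime R -> state R) (dF : 'I_3 -> 'I_3 -> option 'I_3 -> stime R -> R) B i a d z : R :=
  \sum_C dPhi_m B i a C * \sum_j \sum_b dPhiB C j b (sF (U z)) * dF j b d z.

Lemma matrix_sF (u : state R) : \matrix_(i, a) sF u i a = sF u.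
Proof. by apply/matrixP => i a; rewrite mxE. Qed.

(** The equations of [U] hold as distributions, so each one says that a certain bounded function is
    a weak derivative. These functions are taken as the representatives: the time derivative of [F]
    is the spatial derivative of [v], that of [eta] is [rr] over the temperature, that of [v] is the
    divergence of the stress. The evolution equations then hold at every point, with no exceptional
    set. *)
Lemma Ubar_weak T (e : xi_space R * R -> R) (r : stime R -> R) (U : stime R -> state R) (U0 : xspace R -> state R) delta :
  0 < T -> Linf T r -> Ck_in edom 3 e -> 0 < delta -> (forall z, edom z -> delta <= theta e z) ->
  lipschitz_solution e T r U U0 ->
  exists rho dF dv deta rr, [/\
    (bndQ T rr /\ {ae leb4, forall z, QT T z -> rr z = r z}) /\
      (forall z, 0 <= z.2 <= T -> inbox (pbox rho) (fun=> rho) (ubar U z)),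
    [/\ forall i a, Lw T (fun z => sF (U z) i a) (dF i a), forall i, Lw T (fun z => sv (U z) ord0 i) (dv i),
      Lw T (fun z => seta (U z)) deta, forall I, Lw T (fun z => ubar U z I) (dub U dF deta I) &
      forall I, Lw T (fun z => Dc e I (ubar U z)) (dDb e U dF deta I)],
    forall B i a, Lw T (fun z => dPhiB B i a (sF (U z))) (dPhi_d U dF B i a),
    (forall i a z, dF i a None z = dv i (Some a) z) /\ (forall i a b z, dF i b (Some a) z = dF i a (Some b) z) &
    (forall z, deta None z = rr z / Dc e None (ubar U z)) /\
    (forall i z, dv i None z = \sum_a \sum_B dPhiB B i a (sF (U z)) * dDb e U dF deta (Some B) (Some a) z)].
Proof.
move=> T0 Lr Ce d0 thd L; have [pU sU LU WF Wv We iU curl PhiE entE momE _] := L.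
have lF i a : lipQ T (fun z => sF (U z) i a).
  apply: (lipQ_proj pU LU (pr := fun u => sF u i a)) => u u'.
  rewrite (_ : _ - _ = (sF u - sF u') i a); last by rewrite !mxE.
  by rewrite (le_trans (mx_entry_norm _ _ _))// !prod_normE/= !le_max lexx.
have lv i : lipQ T (fun z => sv (U z) ord0 i).
  apply: (lipQ_proj pU LU (pr := fun u => sv u ord0 i)) => u u'.
  rewrite (_ : _ - _ = (sv u - sv u') ord0 i); last by rewrite !mxE.
  by rewrite (le_trans (mx_entry_norm _ _ _))// !prod_normE/= !le_max lexx !orbT.
have le_ : lipQ T (fun z => seta (U z)).
  by apply: (lipQ_proj pU LU (pr := seta)) => u u'; rewrite !prod_normE/= le_max lexx orbT.
have /choice[dF0 HdF0] (ia : 'I_3 * 'I_3) : exists df, Lw T (fun z => sF (U z) ia.1 ia.2) df.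
  by apply: W1inf_Lw => //; exact: WF.
have /choice[dv0 Hdv0] i : exists df, Lw T (fun z => sv (U z) ord0 i) df by apply: W1inf_Lw => //; exact: Wv.
have [de0 Hde0] : exists df, Lw T (fun z => seta (U z)) df by exact: W1inf_Lw.
have [rr brr aerr] := Linf_rep Lr.
have bD (psi : stime R -> R) d : Sm psi -> bndQ T ('D_(dir d) psi) by move=> sp; apply: Sm_bndQ; exact: Sm_D.
(* A single representative serves each unordered pair of spatial indices, so curl-freeness holds
   pointwise; the time derivative is borrowed from the gradient of [v]. *)
pose dF (i b : 'I_3) (k : option 'I_3) (z : stime R) : R := if k is Some a then (if (a <= b)%N then dF0 (i, b) (Some a) z else dF0 (i, a) (Some b) z)
  else dv0 i (Some b) z.
have symF i a b z : dF i b (Some a) z = dF i a (Some b) z.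
  by rewrite /dF; case: (ltngtP (val a) (val b)) => [ab|ab|/val_inj ->//].
have LF i b : Lw T (fun z => sF (U z) i b) (dF i b).
  split=> // [[a|]|[a|] psi tpsi].
  - by rewrite /dF; case: (a <= b)%N; [exact: Lw_bndQ_deriv (HdF0 (i, b))|exact: Lw_bndQ_deriv (HdF0 (i, a))].
  - exact: Lw_bndQ_deriv (Hdv0 i).
  - rewrite /dF; case: (a <= b)%N; first by have [_ _ H] := HdF0 (i, b); exact: (H (Some a)).
    have [_ _ H] := HdF0 (i, a); apply: etrans (H (Some b) psi tpsi).
    exact: (curl i a b psi (SmT_int_test tpsi)).
  have [spsi _] := tpsi; have [_ _ H] := Hdv0 i.
  apply: etrans (H (Some b) psi tpsi); have := PhiE (inl (inl (i, b))) psi (SmT_int_test tpsi).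
  rewrite -[LHS]/(intQ T _) (@intQ_ext _ T _ (fun z => sF (U z) i b * 'D_dt psi z - sv (U z) ord0 i * 'D_(dx b) psi z)).
    rewrite intQB; [by move/eqP; rewrite subr_eq0 => /eqP| |].
      by apply: bndQ_L1Q; apply: bndQM; [exact: lipQ_bndQ|exact: (bD psi None)].
    by apply: bndQ_L1Q; apply: bndQM; [exact: lipQ_bndQ|exact: (bD psi (Some b))].
  move=> z _; rewrite mul0r addr0; congr (_ - _).
  rewrite (eq_bigr (fun a => (a == b)%:R * (sv (U z) ord0 i * 'D_(dx a) psi z))); last first.
    by move=> a _; rewrite dPhiB_F_sum mulrA.
  exact: (sum_pick3 (fun a => sv (U z) ord0 i * 'D_(dx a) psi z)).
have LPhi B : Lw T (fun z => PhiB B (sF (U z))) (fun d z => \sum_i \sum_a dPhiB B i a (sF (U z)) * dF i a d z).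
  have := Lw_PhiB B T0 LF; under eq_fun do rewrite matrix_sF.
  by move=> H; apply: (Lw_ext H) => d z _; rewrite matrix_sF.
have LdPhi B i a : Lw T (fun z => dPhiB B i a (sF (U z))) (dPhi_d U dF B i a).
  have := Lw_dPhiB B i a T0 LF; under eq_fun do rewrite matrix_sF.
  by move=> H; apply: (Lw_ext H) => d z _; rewrite matrix_sF.
have lub I : lipQ T (fun z => ubar U z I).
  by case: I => [B|//]; have [H _ _] := LPhi B.
have /choice[S HS] I : exists C, 0 <= C /\ forall z, 0 <= z.2 <= T -> `|ubar U z I| <= C.
  by have [C C0 H] := lipQ_strip_bounded T0 (lub I); exists C.
pose rho := \sum_I S I.
have ubox z : 0 <= z.2 <= T -> inbox (pbox rho) (fun=> rho) (ubar U z).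
  move=> zT I; have SI : S I <= rho by apply: sum_ge1 => J; case: (HS J).
  have [_ /(_ z zT) H] := HS I; have := le_trans H SI; rewrite ler_norml => /andP[u1 u2].
  by apply/andP; split=> //; case: (I) u1 => [B|] //= _; exact: (sU z zT).
have [C [_ cD _ _]] := energy_C11 Ce rho; have [C0 _ _] := cD None.
have T00 : 0 <= ((0, 0, 0, 0) : stime R).2 <= T by rewrite /= lexx ltW.
have lth : lipQ T (fun z => Dc e None (ubar U z)).
  have [B B0 [_ KB]] := C11_lip (cD None) (ubox _ T00).
  exact: (lipQ_comp (u := fun I z => ubar U z I) B0 KB lub ubox).
have thE I z : Dc e I (ubar U z) = de e I (sPhi (U z)) by rewrite /Dc /ubar xcK.
have lith : lipQ T (fun z => (Dc e None (ubar U z))^-1).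
  by apply: (lipQ_inv d0 lth) => z zT; rewrite thE; apply: thd; exact: (sU z zT).
pose deta (k : option 'I_3) (z : stime R) : R := if k is Some a then de0 (Some a) z else rr z / Dc e None (ubar U z).
have Ldeta : Lw T (fun z => seta (U z)) deta.
  have [_ be we] := Hde0.
  have brt : bndQ T (fun z => rr z / Dc e None (ubar U z)) by apply: bndQM => //; exact: lipQ_bndQ.
  split=> // [[a|]|[a|] psi tpsi]; [exact: be|exact: brt|exact: (we (Some a))|].
  have [spsi _] := tpsi; have := entE psi (SmT_int_test tpsi); have [mr _] := Lr; have [mrr _] := brr.
  have mit : measurable_fun (QT T) (fun z => (Dc e None (ubar U z))^-1) by exact: lipQ_measurable.
  have mpsi : measurable_fun (QT T) psi by exact: measurable_funS (Sm_measurable spsi).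
  have bf := lipQ_bndQ T0 le_; have bpsi := Sm_bndQ T spsi.
  have LfD : L1Q T (fun z => seta (U z) * 'D_dt psi z) by apply: bndQ_L1Q; apply: bndQM => //; exact: (bD psi None).
  pose m z := (Dc e None (ubar U z))^-1 * psi z.
  have bm : bndQ T m by apply: bndQM => //; exact: lipQ_bndQ.
  have [mm _] := bm; have mF := L1_measurable LfD.
  have Lrp : L1Q T (fun z => rr z * m z) by apply: bndQ_L1Q; exact: bndQM.
  have mr1 := measurable_funD mF (measurable_funM mr mm).
  have mr2 := measurable_funD mF (measurable_funM mrr mm).
  rewrite -[LHS]/(intQ T _) (@intQ_ext _ T _ (fun z => seta (U z) * 'D_dt psi z + r z * m z)); last first.
    by move=> z _; rewrite big1 ?subr0 /m ?mulrA ?thE// => a _; rewrite mul0r.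
  have E : intQ T (fun z => seta (U z) * 'D_dt psi z + r z * m z) = intQ T (fun z => seta (U z) * 'D_dt psi z + rr z * m z).
    by apply: (intQ_ae mr1 mr2); apply: (@ae_imp _ _ _ leb4 _ _ aerr) => z Hr Qz;
      exact: (congr1 (fun y => seta (U z) * 'D_dt psi z + y * m z) (esym (Hr Qz))).
  rewrite E (intQD LfD Lrp) => /eqP; rewrite addr_eq0 => /eqP ->; congr (- _).
  by apply: intQ_ext => z _; rewrite /m mulrA.
have Lub I : Lw T (fun z => ubar U z I) (dub U dF deta I) by case: I => [B|]; [exact: LPhi|exact: Ldeta].
have LD I : Lw T (fun z => Dc e I (ubar U z)) (dDb e U dF deta I).
  exact: (Lw_comp T0 (cD I) Lub ubox).
(* The divergence of the stress in non-conservative form. The other product-rule term, with the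
   derivatives of [dPhiB], sums to zero over [a] by the Piola identity. *)
pose tv (i : 'I_3) (z : stime R) : R := \sum_a \sum_B dPhiB B i a (sF (U z)) * dDb e U dF deta (Some B) (Some a) z.
pose dv (i : 'I_3) (k : option 'I_3) (z : stime R) : R := if k is Some c then dv0 i (Some c) z else tv i z.
have Ldv i : Lw T (fun z => sv (U z) ord0 i) (dv i).
  have [_ bv wv] := Hdv0 i.
  have btv : bndQ T (tv i).
    by do 2 (apply: bndQ_sum => ? _); apply: bndQM; [exact: Lw_bndQ (LdPhi _ _ _)|exact: Lw_bndQ_deriv (LD _)].
  split=> // [[a|]|[a|] psi tpsi]; [exact: bv|exact: btv|exact: (wv (Some a))|].
  have [spsi _] := tpsi; have bpsi := Sm_bndQ T spsi.
  pose g (a : 'I_3) (z : stime R) := \sum_B Dc e (Some B) (ubar U z) * dPhiB B i a (sF (U z)).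
  have Lg a := Lw_sum T0 (fun B => LwM T0 (LD (Some B)) (LdPhi B i a)).
  have gE a z : stress e i a (sF (U z)) (seta (U z)) = g a z by apply: eq_bigr => B _; rewrite thE.
  have LfD : L1Q T (fun z => sv (U z) ord0 i * 'D_dt psi z).
    by apply: bndQ_L1Q; apply: bndQM; [exact: lipQ_bndQ|exact: (bD psi None)].
  have LgD a : L1Q T (fun z => g a z * 'D_(dx a) psi z).
    by apply: bndQ_L1Q; apply: bndQM; [exact: Lw_bndQ (Lg a)|exact: (bD psi (Some a))].
  have L0 : L1Q T (fun z => 0 * psi z) by apply: L1QZ; exact: bndQ_L1Q.
  pose k (a : 'I_3) (z : stime R) := \sum_B (dPhiB B i a (sF (U z)) * dDb e U dF deta (Some B) (Some a) z +
    Dc e (Some B) (ubar U z) * dPhi_d U dF B i a (Some a) z).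
  have Lk a : L1Q T (fun z => k a z * psi z).
    by apply: bndQ_L1Q; apply: bndQM => //; exact: (Lw_bndQ_deriv (Some a) (Lg a)).
  have := momE i psi (SmT_int_test tpsi); rewrite -[LHS]/(intQ T _).
  rewrite (@intQ_ext _ T _ (fun z => sv (U z) ord0 i * 'D_dt psi z - \sum_a g a z * 'D_(dx a) psi z + 0 * psi z)); last first.
    move=> z _.
    have SE : \sum_a stress e i a (sF (U z)) (seta (U z)) * 'D_(dx a) psi z = \sum_a g a z * 'D_(dx a) psi z.
      by apply: eq_bigr => a _; exact: (congr1 (fun y => y * 'D_(dx a) psi z) (gE a z)).
    exact: (congr1 (fun y => sv (U z) ord0 i * 'D_dt psi z - y + 0 * psi z) SE).
  rewrite (intQ_law LfD LgD L0) (intQZ 0 (bndQ_L1Q bpsi)) mul0r addr0 => /eqP; rewrite subr_eq0 => /eqP ->.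
  rewrite (eq_bigr (fun a => - intQ T (fun z => k a z * psi z))); last first.
    by move=> a _; have [_ _ H] := Lg a; exact: (H (Some a)).
  rewrite sumrN -intQ_sum//; congr (- _); apply: intQ_ext => z _; rewrite -mulr_suml; congr (_ * _).
  rewrite /k /dv /tv; under eq_bigr do rewrite big_split/=; rewrite big_split/= [X in _ + X](_ : _ = 0) ?addr0//.
  rewrite exchange_big/= big1// => B _; rewrite -mulr_sumr /dPhi_d.
  have H := @Lw_dPhiB_div R (fun i a z => sF (U z) i a) dF B i z.
  rewrite matrix_sF in H; rewrite H ?mulr0// => j a b; exact: symF.
exists rho, dF, dv, deta, rr; split=> //; split=> // i a b z; exact: symF.
Qed.

End LipschitzSolution.

(** * Averages and the relative energy *)

Section Averages.
Context {R : realType}.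
Notation BS := (borel_state R).
Notation idx := (option xidx).
Implicit Types (u : state R) (f g : state R -> R) (I J : idx).

Lemma measurable_sdom : measurable (sdom : set BS).
Proof.
rewrite -[sdom]setCK; apply: measurableC; apply: sub_sigma_algebra.
apply: closed_openC; apply: (@closed_comp _ _ (@seta R) [set t | 0 <= t]); last exact: closed_ge.
by move=> u _; exact: cvg_snd.
Qed.

Definition xs u : idx -> R := xc (sPhi u).

Section FixedMeasure.
Variable m : {measure set BS -> \bar R}.
Hypothesis m1 : m (sdom : set BS) = 1%E.

Definition L1S f := L1 m (sdom : set BS) f.

Lemma avg_cst (k : R) : avg m (fun=> k) = k.
Proof. by rewrite /avg (Rintegral_cst _ measurable_sdom) m1 mulr1. Qed.

Lemma L1S_cst (k : R) : L1S (fun=> k).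
Proof.
apply: (L1_bnd measurable_sdom); last exact: bnd_cst.
by rewrite m1 ltry.
Qed.

Lemma avgD f g : L1S f -> L1S g -> avg m (fun u => f u + g u) = avg m f + avg m g.
Proof. exact: (intD measurable_sdom). Qed.
Lemma avgB f g : L1S f -> L1S g -> avg m (fun u => f u - g u) = avg m f - avg m g.
Proof. exact: (intB measurable_sdom). Qed.
Lemma avgZ (k : R) f : L1S f -> avg m (fun u => k * f u) = k * avg m f.
Proof. exact: (intZ measurable_sdom k). Qed.
Lemma avg_sum (T : Type) (r : seq T) (F : T -> state R -> R) : (forall i, L1S (F i)) ->
  avg m (fun u => \sum_(i <- r) F i u) = \sum_(i <- r) avg m (F i).
Proof. by move=> LF; exact: (int_sum measurable_sdom). Qed.
Lemma L1SD f g : L1S f -> L1S g -> L1S (fun u => f u + g u).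
Proof. exact: (L1D measurable_sdom). Qed.
Lemma L1SB f g : L1S f -> L1S g -> L1S (fun u => f u - g u).
Proof. exact: (L1B measurable_sdom). Qed.
Lemma L1SZ (k : R) f : L1S f -> L1S (fun u => k * f u).
Proof. exact: (L1Z measurable_sdom k). Qed.
Lemma L1S_sum (T : Type) (r : seq T) (F : T -> state R -> R) : (forall i, L1S (F i)) ->
  L1S (fun u => \sum_(i <- r) F i u).
Proof. by move=> LF; exact: (L1_sum measurable_sdom). Qed.
Lemma L1S_ext f g : L1S f -> (forall u, sdom u -> f u = g u) -> L1S g.
Proof. exact: (L1_ext measurable_sdom). Qed.
Lemma avg_ext f g : (forall u, sdom u -> f u = g u) -> avg m f = avg m g.
Proof. by move=> fg; apply: eq_Rintegral => u; rewrite inE => /fg. Qed.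
Lemma avg_le f g : L1S f -> L1S g -> (forall u, sdom u -> f u <= g u) -> avg m f <= avg m g.
Proof. exact: (int_le measurable_sdom). Qed.

Lemma avg_abs_le f g : L1S f -> L1S g -> (forall u, sdom u -> `|f u| <= g u) -> `|avg m f| <= avg m g.
Proof.
move=> Lf Lg fg; apply: le_trans (int_abs measurable_sdom Lf) _.
by apply: avg_le => //; exact: L1_abs.
Qed.

(** Jensen's inequality by averaging the tangent bound $2kf-k^2\le f^2\le g$ at [k] the average of
    [f]. *)
Lemma avg_sqr_le f g : L1S f -> L1S g -> (forall u, sdom u -> f u ^+ 2 <= g u) -> avg m f ^+ 2 <= avg m g.
Proof.
move=> Lf Lg fg.
have : avg m (fun u => 2 * avg m f * f u - avg m f ^+ 2) <= avg m g.
  apply: avg_le => // [|u su]; first by apply: L1SB; [exact: L1SZ|exact: L1S_cst].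
  by rewrite (le_trans _ (fg u su))//; have := sqr_ge0 (f u - avg m f); move: (avg m f) => k; lra.
rewrite (avgB (L1SZ (2 * avg m f) Lf) (L1S_cst (avg m f ^+ 2))) (avgZ _ Lf) avg_cst.
by apply: le_trans; move: (avg m f) => k; rewrite expr2; lra.
Qed.

Lemma avg_eq0_ae f : L1S f -> (forall u, sdom u -> 0 <= f u) -> avg m f <= 0 ->
  {ae m, forall u : BS, sdom u -> f u = 0}.
Proof. exact: (int_ge0_eq0 measurable_sdom). Qed.

(** A measurable set that misses [u] lies in the union of the exceptional null set and the
    complement of [sdom], hence is null; complements give the sets that contain [u]. *)
Lemma dirac_of_ae u : m setT = 1%E -> {ae m, forall w : BS, sdom w -> w = u} -> is_dirac m u.
Proof.
move=> mT [N [mN N0 NP]] A mA.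
have compl (B : set BS) : measurable B -> m (~` B) = (1 - m B)%E.
  move=> mB; have mfin : (m [set: BS] < +oo)%E by rewrite mT ltry.
  have := @measureD _ _ _ m setT B measurableT mB mfin; rewrite setTD setTI => ->.
  by congr (_ - _)%E; exact: mT.
have S0 : m (~` (sdom : set BS)) = 0%E by rewrite (compl _ measurable_sdom) m1 subee.
have out (B : set BS) : measurable B -> ~ B u -> m B = 0%E.
  move=> mB Bu; apply/eqP; rewrite eq_le measure_ge0 andbT.
  have sub : B `<=` ~` (sdom : set BS) `|` N.
    move=> w Bw; have [sw|] := pselect (sdom w); last by left.
    by right; apply: NP => /= H; apply: Bu; rewrite -(H sw).
  have mU : measurable (~` (sdom : set BS) `|` N) by apply: measurableU => //; exact: measurableC measurable_sdom.
  apply: (le_trans (le_measure m _ _ sub)); rewrite ?inE//.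
  apply: (le_trans (measureU2 _ _ _)) => //; first exact: measurableC measurable_sdom.
  have E : (m (~` (sdom : set BS)) + m N = 0 + 0)%E by congr (_ + _)%E; [exact: S0|exact: N0].
  by move: E; rewrite adde0 => ->.
rewrite diracE; have [Au|Au] := pselect (A u); last by rewrite out// memNset.
have := out (~` A) (measurableC mA) (fun H => H Au); rewrite -[in m A](setCK A) (compl _ (measurableC mA)) => ->.
by rewrite mem_set// sube0.
Qed.

Variables (e : xi_space R * R -> R) (ub : state R).
Hypothesis Ce : Ck_in edom 3 e.
Notation a := (xs ub).
Notation vb i := (sv ub ord0 i).

Definition RE u := 2^-1 * (\sum_i (sv u ord0 i - vb i) ^+ 2) + relE e a (xs u).

Lemma enorm_sqr (v : 'rV[R]_3) : enorm v ^+ 2 = \sum_i v ord0 i ^+ 2.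
Proof.
rewrite /enorm sqr_sqrtr; first by rewrite big_ord1.
by apply: sumr_ge0 => i _; apply: sumr_ge0 => j _; exact: sqr_ge0.
Qed.

(** Apart from the energy, [RE] is affine in [v] and in the minors and the entropy, so its average
    involves only moments governed by the evolution laws and the energy inequality. *)
Lemma RE_expand u : RE u = energy e u - \sum_i vb i * sv u ord0 i +
  (2^-1 * (\sum_i vb i ^+ 2) - Ec e a + \sum_I Dc e I a * a I) - \sum_I Dc e I a * xs u I.
Proof.
have -> : RE u = 2^-1 * (\sum_i (sv u ord0 i ^+ 2 + (vb i ^+ 2 - 2 * (vb i * sv u ord0 i)))) + relE e a (xs u).
  by congr (_ * _ + _); apply: eq_bigr => i _; ring.
have -> : relE e a (xs u) = e (sPhi u) - Ec e a - (\sum_I Dc e I a * xs u I - \sum_I Dc e I a * a I).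
  rewrite /relE; congr (_ - _ - _); first by rewrite /Ec /xs xcK.
  by rewrite -sumrB; apply: eq_bigr => I _; rewrite mulrBr.
by rewrite /energy enorm_sqr big_split/= sumrB -mulr_sumr; field.
Qed.

Variable c : R.
Hypotheses (c0 : 0 < c) (a0 : sdom ub).
Hypothesis conv : forall z, edom z -> forall d : idx -> R,
     c * (\sum_I d I ^+ 2) <= \sum_I \sum_J d I * hess e I J z * d J.

Hypothesis LP : forall B, L1S (fun u => PhiB B (sF u)).
Hypothesis Lv : forall i, L1S (fun u => sv u ord0 i).
Hypothesis Leta : L1S seta.
Hypothesis Len : L1S (energy e).

Lemma Lxs I : L1S (fun u => xs u I). Proof. by case: I => [B|]; [exact: LP|exact: Leta]. Qed.

Lemma L1S_RE : L1S RE.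
Proof.
apply: (L1S_ext (f := fun u => energy e u - \sum_i vb i * sv u ord0 i +
  (2^-1 * (\sum_i vb i ^+ 2) - Ec e a + \sum_I Dc e I a * a I) - \sum_I Dc e I a * xs u I)) => [|u _].
  apply: L1SB; last by apply: L1S_sum => I; apply: L1SZ; exact: Lxs.
  apply: L1SD; last exact: L1S_cst.
  by apply: L1SB => //; apply: L1S_sum => i; exact: L1SZ.
by rewrite RE_expand.
Qed.

Notation X I := (avg m (fun u => xs u I)).
Notation Va i := (avg m (fun u => sv u ord0 i)).

Lemma avg_RE : avg m RE = avg m (energy e) - \sum_i vb i * Va i +
  (2^-1 * (\sum_i vb i ^+ 2) - Ec e a + \sum_I Dc e I a * a I) - \sum_I Dc e I a * X I.
Proof.
have L1 : L1S (fun u => \sum_i vb i * sv u ord0 i) by apply: L1S_sum => i; exact: L1SZ.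
have L2 : L1S (fun u => \sum_I Dc e I a * xs u I) by apply: L1S_sum => I; apply: L1SZ; exact: Lxs.
rewrite (avg_ext (fun u _ => RE_expand u)).
rewrite (avgB (L1SD (L1SB Len L1) (L1S_cst _)) L2) (avgD (L1SB Len L1) (L1S_cst _)) (avgB Len L1) avg_cst.
rewrite avg_sum => [|i]; last exact: L1SZ.
rewrite avg_sum => [|I]; last by apply: L1SZ; exact: Lxs.
congr (_ - _ + _ - _); apply: eq_bigr => i _; rewrite avgZ//; exact: Lxs.
Qed.

Lemma relE_ge0 u : sdom u -> c / 2 * sqd a (xs u) <= relE e a (xs u).
Proof. by move=> su; exact: relE_lower. Qed.

Lemma kin_ge0 u : 0 <= 2^-1 * (\sum_i (sv u ord0 i - vb i) ^+ 2).
Proof. by rewrite mulr_ge0 ?invr_ge0// sumr_ge0// => i _; exact: sqr_ge0. Qed.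

Lemma relE_RE u : relE e a (xs u) <= RE u. Proof. by rewrite /RE lerDr kin_ge0. Qed.

Lemma sqd_RE u : sdom u -> sqd a (xs u) <= 2 / c * RE u.
Proof.
move=> su; have := le_trans (relE_ge0 su) (relE_RE u).
by rewrite -ler_pdivlMl ?divr_gt0// invf_div.
Qed.

Lemma RE_ge0 u : sdom u -> 0 <= RE u.
Proof.
move=> su; apply: le_trans (relE_RE u); apply: le_trans (relE_ge0 su).
by rewrite mulr_ge0 ?sqd_ge0// divr_ge0// ltW.
Qed.

Lemma avg_RE_ge0 : 0 <= avg m RE.
Proof. by rewrite -(avg_cst 0); apply: avg_le => [||u su]; [exact: L1S_cst|exact: L1S_RE|exact: RE_ge0]. Qed.

Lemma v_sqr_le i : (Va i - vb i) ^+ 2 <= 2 * avg m RE.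
Proof.
rewrite -(avg_cst (vb i)) -(avgB (Lv i) (L1S_cst _)) -(avgZ 2 L1S_RE).
apply: avg_sqr_le => [||u su]; [exact: (L1SB (Lv i) (L1S_cst _))|exact: (L1SZ 2 L1S_RE)|].
have R0 := le_trans _ (relE_ge0 su); have q0 := sqd_ge0 a (xs u).
have r0 : 0 <= relE e a (xs u) by apply: R0; rewrite mulr_ge0// divr_ge0// ltW.
have := @sum_ge1 R _ (fun j => (sv u ord0 j - vb j) ^+ 2) i (fun j => sqr_ge0 _).
by rewrite /RE mulrDr mulrA divff// mul1r => H; rewrite (le_trans H)// lerDl mulr_ge0.
Qed.

Lemma X_sqr_le I : (X I - a I) ^+ 2 <= 2 / c * avg m RE.
Proof.
rewrite -(avg_cst (a I)) -(avgB (Lxs I) (L1S_cst _)) -(avgZ (2 / c) L1S_RE).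
apply: avg_sqr_le => [||u su]; [exact: (L1SB (Lxs I) (L1S_cst _))|exact: (L1SZ _ L1S_RE)|].
rewrite (le_trans _ (sqd_RE su))//.
by apply: (@sum_ge1 R _ (fun J => (xs u J - a J) ^+ 2)) => J; exact: sqr_ge0.
Qed.

Lemma source_le rho K delta rz : 0 <= K ->
  (forall a b, inbox (pbox rho) (fun=> rho) a -> 0 <= b None ->
    `|1 - Dc e None a / Dc e None b - (\sum_I Hc e I None a * (b I - a I)) / Dc e None a| <= K * sqd a b) ->
  inbox (pbox rho) (fun=> rho) a -> 0 < delta -> delta <= Dc e None a ->
  L1S (fun u => rz / theta e (sPhi u)) ->
  `|rz - Dc e None a * avg m (fun u => rz / theta e (sPhi u)) -
    (\sum_I Hc e I None a * (X I - a I)) * (rz / Dc e None a)| <= `|rz| * (K * (2 / c)) * avg m RE.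
Proof.
move=> K0 HK ba d0 da Lsrc; have th0 : Dc e None a != 0 by rewrite gt_eqF// (lt_le_trans d0).
pose f u := rz - Dc e None a * (rz / theta e (sPhi u)) - (\sum_I Hc e I None a * (xs u I - a I)) * (rz / Dc e None a).
have LH : L1S (fun u => \sum_I Hc e I None a * (xs u I - a I)).
  by apply: L1S_sum => I; apply: L1SZ; exact: (L1SB (Lxs I) (L1S_cst _)).
have LHk : L1S (fun u => (\sum_I Hc e I None a * (xs u I - a I)) * (rz / Dc e None a)).
  by apply: (L1S_ext (L1SZ (rz / Dc e None a) LH)) => u _; rewrite mulrC.
have L1 := L1SB (L1S_cst rz) (L1SZ (Dc e None a) Lsrc).
have -> : rz - Dc e None a * avg m (fun u => rz / theta e (sPhi u)) -
    (\sum_I Hc e I None a * (X I - a I)) * (rz / Dc e None a) = avg m f.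
  rewrite /f (avgB L1 LHk) (avgB (L1S_cst rz) (L1SZ (Dc e None a) Lsrc)) avg_cst (avgZ _ Lsrc); congr (_ - _).
  rewrite (avg_ext (g := fun u => (rz / Dc e None a) * (\sum_I Hc e I None a * (xs u I - a I)))); last first.
    by move=> u _; rewrite mulrC.
  rewrite (avgZ _ LH) mulrC; congr (_ * _); rewrite avg_sum => [|I]; last first.
    by apply: L1SZ; exact: (L1SB (Lxs I) (L1S_cst _)).
  apply: eq_bigr => I _; rewrite (avgZ _ (L1SB (Lxs I) (L1S_cst _))).
  by rewrite (avgB (Lxs I) (L1S_cst _)) avg_cst.
rewrite -(avgZ _ L1S_RE); apply: avg_abs_le => [||u su]; [exact: L1SB|exact: (L1SZ _ L1S_RE)|].
have -> : f u = rz * (1 - Dc e None a / Dc e None (xs u) - (\sum_I Hc e I None a * (xs u I - a I)) / Dc e None a).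
  by rewrite /f /Dc -[theta e _]/(de e None _) [vec (xs u)]xcK; ring.
rewrite normrM -!mulrA ler_wpM2l// (le_trans (HK _ _ ba su))// ler_wpM2l//.
by rewrite mulrA; exact: sqd_RE.
Qed.

Variable FU : 'M[R]_3.
Hypothesis HFU : forall C, PhiB C FU = avg m (fun u => PhiB C (sF u)).

Lemma L1S_dPhi B i al : L1S (fun u => dPhiB B i al (sF u)).
Proof.
apply: (L1S_ext (f := fun u => dPhi_k B i al + \sum_C dPhi_m B i al C * PhiB C (sF u))) => [|u _].
  by apply: L1SD; [exact: L1S_cst|apply: L1S_sum => C; exact: L1SZ].
by rewrite dPhiB_affine.
Qed.

(** The average passes through because [dPhiB] is affine in the minors and the minors of [FU] are
    the averaged minors. *)
Lemma avg_dPhi B i al : avg m (fun u => dPhiB B i al (sF u)) = dPhiB B i al FU.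
Proof.
rewrite (avg_ext (g := fun u => dPhi_k B i al + \sum_C dPhi_m B i al C * PhiB C (sF u))); last first.
  by move=> u _; rewrite dPhiB_affine.
have LS : L1S (fun u => \sum_C dPhi_m B i al C * PhiB C (sF u)) by apply: L1S_sum => C; exact: L1SZ.
rewrite (avgD (L1S_cst _) LS) avg_cst avg_sum => [|C]; last exact: L1SZ.
rewrite dPhiB_affine; congr (_ + _); apply: eq_bigr => C _; rewrite avgZ//.
by rewrite HFU.
Qed.

Lemma dPhi_sqr_le B i al : (dPhiB B i al FU - dPhiB B i al (sF ub)) ^+ 2 <=
  #|{: xidx}|%:R * (\sum_C dPhi_m B i al C ^+ 2) * (2 / c) * avg m RE.
Proof.
have -> : dPhiB B i al FU - dPhiB B i al (sF ub) = \sum_C dPhi_m B i al C * (X (Some C) - a (Some C)).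
  rewrite !dPhiB_affine opprD addrACA subrr add0r -sumrB; apply: eq_bigr => C _.
  by rewrite -mulrBr HFU.
rewrite (le_trans (sqr_sum_le _))// -!mulrA ler_wpM2l// mulr_suml; apply: ler_sum => C _.
by rewrite exprMn ler_wpM2l ?sqr_ge0// mulrA X_sqr_le.
Qed.

Lemma stress_le rho K i al : 0 <= K ->
  (forall F F' (eta eta' : R) i al,
    inbox (pbox rho) (fun=> rho) (xc (Phi F, eta)) -> 0 <= eta' ->
    `|stress e i al F' eta' - \sum_B Dc e (Some B) (xc (Phi F, eta)) * dPhiB B i al F' -
      \sum_B (\sum_I Hc e I (Some B) (xc (Phi F, eta)) * (xc (Phi F', eta') I - xc (Phi F, eta) I)) * dPhiB B i al F|
    <= K * relE e (xc (Phi F, eta)) (xc (Phi F', eta'))) ->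
  inbox (pbox rho) (fun=> rho) a -> L1S (fun u => stress e i al (sF u) (seta u)) ->
  `|avg m (fun u => stress e i al (sF u) (seta u)) - \sum_B Dc e (Some B) a * dPhiB B i al FU -
    \sum_B (\sum_I Hc e I (Some B) a * (X I - a I)) * dPhiB B i al (sF ub)| <= K * avg m RE.
Proof.
move=> K0 HK ba Ls.
pose p u := \sum_B Dc e (Some B) a * dPhiB B i al (sF u).
pose q u := \sum_B (\sum_I Hc e I (Some B) a * (xs u I - a I)) * dPhiB B i al (sF ub).
have Lx I k : L1S (fun u => k * (xs u I - a I)) by apply: L1SZ; exact: (L1SB (Lxs I) (L1S_cst _)).
have Lp : L1S p by apply: L1S_sum => B; apply: L1SZ; exact: L1S_dPhi.
have Lh B : L1S (fun u => \sum_I Hc e I (Some B) a * (xs u I - a I)) by exact: L1S_sum.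
have Lq1 B : L1S (fun u => (\sum_I Hc e I (Some B) a * (xs u I - a I)) * dPhiB B i al (sF ub)).
  by apply: (L1S_ext (L1SZ (dPhiB B i al (sF ub)) (Lh B))) => u _; rewrite mulrC.
have Lq : L1S q by exact: L1S_sum.
have Ep : avg m p = \sum_B Dc e (Some B) a * dPhiB B i al FU.
  rewrite avg_sum => [|B]; last by apply: L1SZ; exact: L1S_dPhi.
  by apply: eq_bigr => B _; rewrite avgZ ?avg_dPhi//; exact: L1S_dPhi.
have Eq : avg m q = \sum_B (\sum_I Hc e I (Some B) a * (X I - a I)) * dPhiB B i al (sF ub).
  rewrite avg_sum//; apply: eq_bigr => B _.
  rewrite (avg_ext (g := fun u => dPhiB B i al (sF ub) * (\sum_I Hc e I (Some B) a * (xs u I - a I)))); last first.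
    by move=> u _; rewrite mulrC.
  rewrite (avgZ _ (Lh B)) mulrC; congr (_ * _); rewrite avg_sum//; apply: eq_bigr => I _.
  rewrite (avgZ _ (L1SB (Lxs I) (L1S_cst _))).
  by rewrite (avgB (Lxs I) (L1S_cst _)) avg_cst.
rewrite -Ep -Eq -(avgB Ls Lp) -(avgB (L1SB Ls Lp) Lq) -(avgZ _ L1S_RE).
apply: avg_abs_le => [||u su]; [exact: (L1SB (L1SB Ls Lp) Lq)|exact: (L1SZ _ L1S_RE)|].
apply: le_trans (HK (sF ub) (sF u) (seta ub) (seta u) i al ba su) _.
by rewrite ler_wpM2l// relE_RE.
Qed.

Lemma RE_eq0 u : sdom u -> RE u = 0 -> u = ub.
Proof.
move=> su R0; have k0 := kin_ge0 u; have r0 := relE_ge0 su.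
have q0 := sqd_ge0 a (xs u); have c2 : 0 < c / 2 by exact: divr_gt0.
have qE : sqd a (xs u) = 0.
  apply/eqP; rewrite eq_le q0 andbT -(pmulr_rle0 _ c2) (le_trans r0)//.
  by have := relE_RE u; rewrite R0.
have rE : 0 <= relE e a (xs u) by rewrite (le_trans _ r0)// mulr_ge0// ltW.
have kE : \sum_i (sv u ord0 i - vb i) ^+ 2 = 0.
  have s0 : 0 <= \sum_i (sv u ord0 i - vb i) ^+ 2 by apply: sumr_ge0 => i _; exact: sqr_ge0.
  by move: R0 k0; rewrite /RE; move: s0 rE; set s := \sum_i _; set w := relE _ _ _; lra.
have xE I : xs u I = a I.
  have := psumr_eq0P (fun J _ => sqr_ge0 (xs u J - a J)) qE (i := I) isT.
  by move=> /eqP; rewrite sqrf_eq0 subr_eq0 => /eqP.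
have vE i : sv u ord0 i = vb i.
  have := psumr_eq0P (fun j _ => sqr_ge0 (sv u ord0 j - vb j)) kE (i := i) isT.
  by move=> /eqP; rewrite sqrf_eq0 subr_eq0 => /eqP.
case: u su R0 k0 r0 q0 qE rE kE xE vE => [[F v] eta] _ _ _ _ _ _ _ _ xE vE.
rewrite [ub]surjective_pairing [ub.1]surjective_pairing; congr (_, _, _).
- by apply/matrixP => i j; exact: (xE (Some (inl (inl (i, j))))).
- by apply/matrixP => i j; rewrite (ord1 i); exact: vE.
- exact: (xE None).
Qed.

Lemma dirac_of_avg_RE : m setT = 1%E -> avg m RE <= 0 -> is_dirac m ub.
Proof.
move=> mT H0; apply: dirac_of_ae => //.
apply: (@ae_imp _ _ _ m _ _ (avg_eq0_ae L1S_RE RE_ge0 H0)) => u H su; exact: RE_eq0 (H su).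
Qed.

End FixedMeasure.
End Averages.

(** * Gronwall argument and relative energy inequality *)

Section RelativeEnergy.
Context {R : realType}.
Implicit Types (T : R).
Notation lebT := (measurableTypeR R).

Let mQT T : measurable (QT T : set (lebT * lebT * lebT * lebT)%type).
Proof. exact: measurable_QT. Qed.

Lemma has_deriv_exp (k : R) : has_deriv (fun t => expR (k * t)) (fun t => k * expR (k * t)).
Proof.
move=> t; have H := has_deriv_affine k 0 (@is_derive_expR R) t.
rewrite addr0 mulrC in H; rewrite (_ : (fun t => expR (k * t)) = fun t => expR (k * t + 0))//.
by apply/funext => s; rewrite addr0.
Qed.

Lemma smooth1_exp (k : R) : smooth1 (fun t => expR (k * t)).
Proof.
exists (fun f => exists c, f = fun t => c * expR (k * t)); split.
  by exists 1; apply/funext => t; rewrite mul1r.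
move=> _ [c ->]; exists (fun t => c * k * expR (k * t)); first by exists (c * k).
by move=> t; apply: is_derive_eq (has_derivM (has_deriv_cst c) (has_deriv_exp k) t) _; rewrite mulr0 addr0 mulrA.
Qed.

Lemma cutoff_exists (a b : R) : a < b -> exists chi chi' : R -> R, [/\ smooth1 chi, has_deriv chi chi',
  forall t, 0 <= chi t, forall t, chi' t <= 0 & (forall t, t <= a -> chi t = 1) /\ (forall t, b <= t -> chi t = 0)].
Proof.
move=> ab; have [S [S' [sS dS S0 S1 [S01 S'0 _ _ _]]]] := @step_exists R.
have ba : 0 < b - a by rewrite subr_gt0.
pose k := (b - a)^-1; have k0 : 0 < k by rewrite invr_gt0.
exists (fun t => 1 + - S (k * t + (- (k * a)))), (fun t => 0 + - (S' (k * t + (- (k * a))) * k)); split.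
- by apply: smooth1D; [exact: smooth1_cst|apply: smooth1N; exact: smooth1_affine].
- by apply: has_derivD; [exact: has_deriv_cst|apply: has_derivN; exact: has_deriv_affine].
- by move=> t; rewrite subr_ge0; case/andP: (S01 (k * t + - (k * a))).
- by move=> t; rewrite add0r oppr_le0 mulr_ge0// ltW.
split=> t tt.
- rewrite S0 ?subr0// (@le_trans _ _ 0) ?invr_ge0// -mulrBr pmulr_rle0// subr_le0//.
- rewrite S1 ?subrr// -mulrBr (@le_trans _ _ 1)//; first by rewrite ler_pdivrMr// mul1r ler_nat.
  by rewrite /k mulrC ler_pdivlMr// mul1r lerB.
Qed.

Definition decay T (phi phi' : R -> R) := [/\ smooth1 phi, has_deriv phi phi',
  forall t, 0 <= phi t, forall t, phi' t <= 0 & exists2 T', T' < T & forall t, T' <= t -> phi t = 0].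

(** [H] is only integrable, so no differential inequality is available; the integrated inequality is
    tested with weights that decay faster than [H] can grow. *)
Lemma gronwall_zero T (K : R) H Q : 0 < T -> L1Q T H -> L1Q T Q ->
  {ae leb4, forall z, QT T z -> 0 <= H z} -> {ae leb4, forall z, QT T z -> Q z <= K * H z} ->
  (forall phi phi', decay T phi phi' -> - intQ T (fun z => phi' z.2 * H z) <= intQ T (fun z => phi z.2 * Q z)) ->
  {ae leb4, forall z, QT T z -> H z = 0}.
Proof.
move=> T0 LH LQ H0 QK test.
have key n : {ae leb4, forall z, QT T z -> z.2 <= T - T * hrate n -> H z = 0}.
  have h0 : 0 < T * hrate n by rewrite mulr_gt0// hrate_gt0.
  (* The cutoff equals 1 up to [a] and 0 from [b] on, halfway between [a] and [T]; as [n] grows, the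
     times up to [a] exhaust those before [T]. *)
  pose a := T - T * hrate n; pose b := T - T * hrate n / 2.
  have ab : a < b by rewrite /a /b; move: h0; lra.
  have bT : b < T by rewrite /b; move: h0; lra.
  have [chi [chi' [sc dc c0 c'0 [c1 cb]]]] := cutoff_exists ab.
  (* With this rate the inequality reads $(|K|+1)\int\phi H\le|K|\int\phi H$, hence $\int\phi
     H\le0$, and [phi] is positive where the cutoff is 1. *)
  pose k := `|K| + 1; have k0 : 0 < k by rewrite ltr_wpDl.
  pose ex t : R := expR (- k * t); have e0 t : 0 < ex t by exact: expR_gt0.
  pose phi t := ex t * chi t; pose phi' t := ex t * chi' t + chi t * (- k * ex t).
  have sphi : smooth1 phi by apply: smooth1M => //; exact: smooth1_exp.
  have dphi : has_deriv phi phi' by apply: has_derivM => //; exact: has_deriv_exp.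
  have phi_ge t : 0 <= phi t by rewrite mulr_ge0// ltW.
  have exc t : ex t * chi' t <= 0 by rewrite pmulr_rle0.
  have phi'_le t : phi' t <= - (k * phi t).
    by rewrite /phi' /phi; have := exc t; move: (ex t) (chi t) (chi' t) => x y w; lra.
  have kphi t : 0 <= k * phi t by rewrite mulr_ge0// ltW.
  have dec : decay T phi phi'.
    split=> // [t|]; first by rewrite (le_trans (phi'_le t))// oppr_le0.
    by exists b => // t bt; rewrite /phi cb// mulr0.
  have sphi' : smooth1 phi'.
    have [phi1 sphi1 dphi1] := smooth1_deriv sphi.
    by rewrite (_ : phi' = phi1)//; apply/funext => t; exact: is_derive1_unique (dphi t) (dphi1 t).
  have Lp : L1Q T (fun z => phi z.2 * H z) by apply: L1Q_bndM => //; apply: Sm_bndQ; exact: Sm_time.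
  have Lp' : L1Q T (fun z => phi' z.2 * H z) by apply: L1Q_bndM => //; apply: Sm_bndQ; exact: Sm_time.
  have LpQ : L1Q T (fun z => phi z.2 * Q z) by apply: L1Q_bndM => //; apply: Sm_bndQ; exact: Sm_time.
  have le1 : intQ T (fun z => phi' z.2 * H z) <= intQ T (fun z => - k * (phi z.2 * H z)).
    apply: (@int_ae_le _ _ _ leb4 (QT T) (mQT T)) => //; first exact: (L1QZ (- k) Lp).
    apply: (@ae_imp _ _ _ leb4 _ _ H0) => z Hz Qz; have := ler_wpM2r (Hz Qz) (phi'_le z.2).
    by rewrite (_ : - (k * phi z.2) * H z = - k * (phi z.2 * H z))//; ring.
  have le2 : intQ T (fun z => phi z.2 * Q z) <= intQ T (fun z => `|K| * (phi z.2 * H z)).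
    apply: (@int_ae_le _ _ _ leb4 (QT T) (mQT T)) => //; first exact: (L1QZ `|K| Lp).
    apply: (@ae_imp _ _ _ leb4 _ _ (ae_and H0 QK)) => z [Hz Kz] Qz.
    by rewrite mulrCA ler_wpM2l// (le_trans (Kz Qz))// ler_wpM2r ?Hz// ler_norm.
  have I0 : intQ T (fun z => phi z.2 * H z) <= 0.
    have := test _ _ dec; move: le1 le2; rewrite (intQZ _ Lp) (intQZ _ Lp) /k.
    set x := intQ T _; set y := intQ T _; set w := intQ T _; lra.
  have absE : intQ T (fun z => `|phi z.2 * H z|) = intQ T (fun z => phi z.2 * H z).
    apply: intQ_ae; [exact: L1_measurable (L1Q_abs Lp)|exact: L1_measurable Lp|].
    by apply: (@ae_imp _ _ _ leb4 _ _ H0) => z Hz Qz; rewrite ger0_norm// mulr_ge0// Hz.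
  have := @int_ge0_eq0 _ _ _ leb4 (QT T) (mQT T) _ (L1Q_abs Lp) (fun z _ => normr_ge0 _).
  rewrite -/(intQ T _) absE => /(_ I0) Z.
  apply: (@ae_imp _ _ _ leb4 _ _ Z) => z Hz Qz za; have := Hz Qz.
  by move/eqP; rewrite normr_eq0 /phi c1// mulr1 mulf_eq0 gt_eqF ?e0//= => /eqP.
apply: (@ae_imp _ _ _ leb4 _ _ (ae_and (ae_open_time T) (ae_foralln key))) => z [zT Hz] Qz.
have /andP[_ z2T] := zT Qz.
have [n nT] : exists n, hrate n <= (T - z.2) / T.
  have d0 : 0 < (T - z.2) / T by rewrite divr_gt0// subr_gt0.
  have [n _ Hn] := near_infty_natSinv_lt (PosNum d0).
  by exists n; apply: ltW; apply: (Hn n); exact: leqnn.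
by apply: (Hz n) => //; move: nT; rewrite ler_pdivlMr// mulrC; lra.
Qed.


Lemma decay_deriv_smooth1 T phi phi' : decay T phi phi' -> smooth1 phi'.
Proof.
move=> [sphi dphi _ _ _]; have [phi1 sphi1 dphi1] := smooth1_deriv sphi.
by rewrite (_ : phi' = phi1)//; apply/funext => t; exact: is_derive1_unique (dphi t) (dphi1 t).
Qed.

(* The concentration measure drops out of the energy inequality because phi' <= 0. *)
Lemma energy_decay T (E0 : xspace R -> R) (EE r rr : stime R -> R)
    (gamma : {finite_measure set (stime R) -> \bar R})
    (gamma0 : {finite_measure set (xspace R) -> \bar R}) :
  0 < T -> L1C E0 -> Linf T r -> bndQ T rr -> {ae leb4, forall z, QT T z -> rr z = r z} ->
  gamma0 cell = 0%E ->
  (forall phi : R -> R, test_time T phi -> (forall t, 0 <= t -> 0 <= phi t) ->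
    - (\int[leb3]_(x in cell) (phi 0 * E0 x) + \int[gamma0]_(x in cell) phi 0)
    - (\int[leb4]_(z in QT T) (derive1 phi z.2 * EE z) + \int[gamma]_(z in QT T) derive1 phi z.2)
    <= \int[leb4]_(z in QT T) (r z * phi z.2)) ->
  forall phi phi', decay T phi phi' ->
  - (phi 0 * intC E0) - intQ T (fun z => phi' z.2 * EE z) <= intQ T (fun z => phi z.2 * rr z).
Proof.
move=> T0 LE0 [mr _] brr aerr g0 ineq phi phi' dec; have sphi' := decay_deriv_smooth1 dec.
have [sphi dphi p0 p'0 [T' T'T pT]] := dec.
have dE : derive1 phi = phi'.
  by apply/funext => t; rewrite derive1E; have [_ ->] := dphi t.
have tphi : test_time T phi by split; [exact: smooth1_smooth|exists T'].
have := ineq phi tphi (fun t _ => p0 t); rewrite dE.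
have -> : \int[gamma0]_(x in cell) phi 0 = 0.
  apply: etrans (Rintegral_cst gamma0 (@measurable_cell R) (phi 0)) _.
  exact: etrans (congr1 (fun y => phi 0 * fine y) g0) (mulr0 _).
rewrite addr0.
rewrite -[X in - X - _ <= _ -> _]/(intC (fun x => phi 0 * E0 x)) intCZ//.
rewrite -[X in _ <= X -> _]/(intQ T (fun z => r z * phi z.2)).
rewrite -[X in _ - (X + _) <= _ -> _]/(intQ T (fun z => phi' z.2 * EE z)).
have -> : intQ T (fun z => r z * phi z.2) = intQ T (fun z => phi z.2 * rr z).
  have [mrr _] := brr.
  have mp : measurable_fun (QT T) (fun z : stime R => phi z.2).
    by have [] := Sm_bndQ T (Sm_time sphi).
  apply: intQ_ae; [exact: measurable_funM|exact: measurable_funM|].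
  by apply: (@ae_imp _ _ _ leb4 _ _ aerr) => z Hz Qz; rewrite Hz// mulrC.
have G0 : \int[gamma]_(z in QT T) phi' z.2 <= 0.
  have gfin : (gamma (QT T) < +oo)%E by rewrite ltey_eq fin_num_measure//; exact: measurable_QT.
  have L := L1_bnd (measurable_QT T) gfin (Sm_bndQ T (Sm_time sphi')).
  rewrite -oppr_ge0 -(intN (measurable_QT T) L); apply: int_ge0 => z _; by rewrite oppr_ge0.
set a := phi 0 * _; set b := intQ T _; set g := (X in _ - (_ + X)); move: G0; rewrite -/g; lra.
Qed.

(* Testing the energy inequality with phi(t), the laws d_t f_j = div g_j + s_j with phi(t) w_j,
   and integrating L by parts in time; the initial terms cancel. *)
Lemma relative_energy T (J : finType) (E0 : xspace R -> R) (EE rr : stime R -> R)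
    (f0 : J -> xspace R -> R) (f s w : J -> stime R -> R) (g : J -> 'I_3 -> stime R -> R) dw L dL N phi phi' :
  0 < T -> decay T phi phi' -> L1C E0 -> L1Q T EE -> L1Q T rr ->
  (forall j, L1C (f0 j)) -> (forall j, L1Q T (f j)) -> (forall j a, L1Q T (g j a)) -> (forall j, L1Q T (s j)) ->
  (forall j, balance_Sm T (f0 j) (f j) (g j) (s j)) ->
  (forall j, Lw T (w j) (dw j)) -> Lw T L dL -> L1Q T N ->
  {ae leb3, forall x, cell x -> E0 x = \sum_j f0 j x * w j (x, 0) - L (x, 0)} ->
  - (phi 0 * intC E0) - intQ T (fun z => phi' z.2 * EE z) <= intQ T (fun z => phi z.2 * rr z) ->
  intQ T (fun z => phi z.2 * N z) = 0 ->
  - intQ T (fun z => phi' z.2 * (EE z - \sum_j w j z * f j z + L z)) <=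
  intQ T (fun z => phi z.2 * (rr z + dL None z -
    \sum_j (f j z * dw j None z - \sum_a g j a z * dw j (Some a) z + s j z * w j z) + N z)).
Proof.
move=> T0 dec LE0 LEE Lrr Lf0 Lf Lg Ls bal Lww LwL LN init enineq null; have sphi' := decay_deriv_smooth1 dec.
have [sphi dphi _ _ zphi] := dec.
have bp := Sm_bndQ T (Sm_time sphi); have bp' := Sm_bndQ T (Sm_time sphi').
have bw j := Lw_bndQ T0 (Lww j); have bdw j k := Lw_bndQ_deriv k (Lww j).
have bL := Lw_bndQ T0 LwL; have bdL := Lw_bndQ_deriv None LwL.
pose P j z := f j z * dw j None z - \sum_a g j a z * dw j (Some a) z + s j z * w j z.
have LPj j : L1Q T (P j).
  apply: L1QD; last exact: L1Q_Mbnd.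
  by apply: L1QB; [exact: L1Q_Mbnd|apply: L1Q_sum => a _; exact: L1Q_Mbnd].
have Lwf j : L1Q T (fun z => w j z * f j z) by exact: L1Q_bndM.
have Lp h : L1Q T h -> L1Q T (fun z => phi z.2 * h z) by exact: L1Q_bndM.
have Lp' h : L1Q T h -> L1Q T (fun z => phi' z.2 * h z) by exact: L1Q_bndM.
have LL := bndQ_L1Q bL; have LdL := bndQ_L1Q bdL.
have L0 j : L1C (fun x => f0 j x * w j (x, 0)).
  by apply: L1C_Mbnd => //; apply: (@lipQ_bndC _ T) => //; case: (Lww j).
have bL0 : bndC (fun x => L (x, 0)) by apply: (@lipQ_bndC _ T) => //; case: LwL.
have balj j : intQ T (fun z => phi' z.2 * (w j z * f j z)) =
    - (phi 0 * intC (fun x => f0 j x * w j (x, 0))) - intQ T (fun z => phi z.2 * P j z).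
  have := balance_ext T0 (Lf0 j) (Lf j) (Lg j) (Ls j) (bal j) sphi dphi zphi (Lww j).
  rewrite (@intQ_ext _ T _ (fun z => phi' z.2 * (w j z * f j z) + phi z.2 * P j z)); last first.
    move=> z _; rewrite /P (eq_bigr (fun a => phi z.2 * (g j a z * dw j (Some a) z))) => [|a _]; last by ring.
    by rewrite -mulr_sumr; ring.
  rewrite (intQD (Lp' _ (Lwf j)) (Lp _ (LPj j))).
  set x := phi 0 * _; set y := intQ T _; set u := intQ T _; lra.
have LwE : intQ T (fun z => phi' z.2 * L z) = - (phi 0 * intC (fun x => L (x, 0))) - intQ T (fun z => phi z.2 * dL None z).
  have ipsi : Sm_init T (fun z : stime R => phi z.2).
    by split; [exact: Sm_time|have [T' T'T pT] := zphi; exists T' => // z /pT].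
  have st := Sm_time sphi.
  have Dt (z : stime R) : 'D_dt (fun z => phi z.2) z = phi' z.2.
    rewrite -[RHS]mulr1 -[z.2]add0r -(mulr0 1).
    apply: (Sm_derive_line st (G := fun s => phi (1 * s + z.2))
     (G' := fun s => phi' (1 * s + z.2) * 1)) => [v|].
    - by case: z => [[[x0 x1] x2] t]; rewrite smul_dt/= mul1r.
    - exact: has_deriv_affine.
  have := Lw_ibp None T0 LwL ipsi; rewrite /=.
  rewrite (@intQ_ext _ T _ (fun z => phi' z.2 * L z)); last by move=> z _; rewrite Dt mulrC.
  move=> ->; congr (- _ - _); last by apply: intQ_ext => z _; rewrite mulrC.
  by rewrite -intCZ; [apply: eq_Rintegral => x _; rewrite mulrC|exact: bndC_L1C].
have iE : intC E0 = \sum_j intC (fun x => f0 j x * w j (x, 0)) - intC (fun x => L (x, 0)).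
  have LS : L1C (fun x => \sum_j f0 j x * w j (x, 0)) by exact: L1C_sum.
  have L1L := bndC_L1C bL0.
  rewrite -intC_sum// -intCB//.
  have LB : L1C (fun x => \sum_j f0 j x * w j (x, 0) - L (x, 0)).
    exact: (@L1B _ _ _ leb3 cell (@measurable_cell R)).
  exact: (@int_ae _ _ _ leb3 cell (@measurable_cell R) _ _ (L1_measurable LE0) (L1_measurable LB)).
have LSw : L1Q T (fun z => \sum_j w j z * f j z) by exact: L1Q_sum.
have LSP : L1Q T (fun z => \sum_j P j z) by exact: L1Q_sum.
have e1 : intQ T (fun z => phi' z.2 * (EE z - \sum_j w j z * f j z + L z)) =
    intQ T (fun z => phi' z.2 * EE z) - \sum_j intQ T (fun z => phi' z.2 * (w j z * f j z)) + intQ T (fun z => phi' z.2 * L z).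
  rewrite -intQ_sum => [|j _]; last exact: Lp'.
  have LS : L1Q T (fun z => \sum_j phi' z.2 * (w j z * f j z)) by apply: L1Q_sum => j _; exact: Lp'.
  rewrite -(intQB (Lp' _ LEE) LS) -(intQD (L1QB (Lp' _ LEE) LS) (Lp' _ LL)).
  by apply: intQ_ext => z _; rewrite mulrDr mulrBr mulr_sumr.
have e2 : intQ T (fun z => phi z.2 * (rr z + dL None z - \sum_j P j z + N z)) =
    intQ T (fun z => phi z.2 * rr z) + intQ T (fun z => phi z.2 * dL None z) - \sum_j intQ T (fun z => phi z.2 * P j z) + intQ T (fun z => phi z.2 * N z).
  rewrite -intQ_sum => [|j _]; last exact: Lp.
  have LS : L1Q T (fun z => \sum_j phi z.2 * P j z) by apply: L1Q_sum => j _; exact: Lp.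
  have L1 := L1QD (Lp _ Lrr) (Lp _ LdL); have L2 := L1QB L1 LS.
  rewrite -(intQD (Lp _ Lrr) (Lp _ LdL)) -(intQB L1 LS) -(intQD L2 (Lp _ LN)).
  by apply: intQ_ext => z _; rewrite !mulrDr mulrN mulr_sumr.
rewrite e1 e2 null LwE (eq_bigr _ (fun j _ => balj j)) sumrB sumrN -mulr_sumr.
move: enineq; rewrite iE mulrBr.
set x1 := phi 0 * \sum_j _; set x2 := phi 0 * _; set y1 := intQ T _; set y2 := \sum_j _; set y3 := intQ T _.
set y4 := intQ T _; move: x1 x2 y1 y2 y3 y4 => x1 x2 y1 y2 y3 y4; lra.
Qed.

End RelativeEnergy.

(** * The quadratic remainder *)

Section Remainder.
Context {R : realType}.
Notation idx := (option xidx).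

Let s3 (F : 'I_3 -> 'I_3 -> xidx -> R) : R := \sum_i \sum_a \sum_B F i a B.

Let s3D F G : s3 (fun i a B => F i a B + G i a B) = s3 F + s3 G.
Proof.
rewrite /s3 -big_split; apply: eq_bigr => i _; rewrite -big_split; apply: eq_bigr => a _.
by rewrite -big_split.
Qed.

Let s3N F : s3 (fun i a B => - F i a B) = - s3 F.
Proof.
rewrite /s3 -sumrN; apply: eq_bigr => i _; rewrite -sumrN; apply: eq_bigr => a _.
by rewrite -sumrN.
Qed.

Let s3_ext F G : (forall i a B, F i a B = G i a B) -> s3 F = s3 G.
Proof. by move=> FG; do 3 (apply: eq_bigr => ? _). Qed.

(* The relative energy identity at a point: what remains after all tests is quadratic in the
   differences X - ub, V - vb, P - A and the Taylor remainders of theta and of the stress. *)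
Lemma remainder_split (r s : R) (V vb dvt : 'I_3 -> R) (dvx S : 'I_3 -> 'I_3 -> R)
    (P A : xidx -> 'I_3 -> 'I_3 -> R) (D X ub dDt dut : idx -> R) (dDx : idx -> 'I_3 -> R)
    (h : idx -> idx -> R) :
  (forall i, dvt i = \sum_a \sum_B A B i a * dDx (Some B) a) ->
  (forall I, dDt I = \sum_K h K I * dut K) -> (forall I K, h I K = h K I) ->
  (forall B, dut (Some B) = \sum_i \sum_a A B i a * dvx i a) -> dut None = r / D None ->
  r + (\sum_i vb i * dvt i + \sum_I dDt I * ub I) -
    (\sum_i (V i * dvt i - \sum_a S i a * dvx i a + 0 * vb i) +
     \sum_I (X I * dDt I - \sum_a (if I is Some B then \sum_j P B j a * V j else 0) * dDx I a +
       (if I is Some B then 0 else s) * D I)) +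
    (- \sum_i \sum_a \sum_B P B i a * (vb i * dDx (Some B) a + D (Some B) * dvx i a)) =
  (r - D None * s - (\sum_I h I None * (X I - ub I)) * (r / D None)) +
  \sum_i \sum_a dvx i a * (S i a - \sum_B D (Some B) * P B i a -
     \sum_B (\sum_I h I (Some B) * (X I - ub I)) * A B i a) +
  \sum_i \sum_a \sum_B (P B i a - A B i a) * (V i - vb i) * dDx (Some B) a.
Proof.
move=> Edv EdD hs EdB EdN.
pose G B := \sum_I h I (Some B) * (X I - ub I).
have -> : \sum_i (V i * dvt i - \sum_a S i a * dvx i a + 0 * vb i) =
    \sum_i vb i * dvt i + s3 (fun i a B => (V i - vb i) * (A B i a * dDx (Some B) a)) - \sum_i \sum_a S i a * dvx i a.
  rewrite -big_split -sumrB; apply: eq_bigr => i _ /=; rewrite mul0r addr0; congr (_ - _).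
  have -> : \sum_a \sum_B (V i - vb i) * (A B i a * dDx (Some B) a) = (V i - vb i) * dvt i.
    by rewrite Edv mulr_sumr; apply: eq_bigr => a _; rewrite mulr_sumr.
  by ring.
have -> : \sum_I (X I * dDt I - \sum_a (if I is Some B then \sum_j P B j a * V j else 0) * dDx I a +
       (if I is Some B then 0 else s) * D I) =
    \sum_I dDt I * ub I + \sum_I (X I - ub I) * dDt I -
    s3 (fun i a B => P B i a * V i * dDx (Some B) a) + s * D None.
  have -> : s3 (fun i a B => P B i a * V i * dDx (Some B) a) =
     \sum_I \sum_a (if I is Some B then \sum_j P B j a * V j else 0) * dDx I a.
    rewrite sum_option [X in X + _]big1 ?add0r => [|a _]; last by rewrite mul0r.
    rewrite /s3 exchange_big [RHS]exchange_big; apply: eq_bigr => a _ /=.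
    by rewrite exchange_big; apply: eq_bigr => B _; rewrite mulr_suml.
  have -> : s * D None = \sum_I (if I is Some B then 0 else s) * D I.
    by rewrite sum_option [X in _ + X]big1 ?addr0// => B _; rewrite mul0r.
  by rewrite -big_split -sumrB -big_split; apply: eq_bigr => I _ /=; ring.
have -> : \sum_I (X I - ub I) * dDt I =
    (\sum_I h I None * (X I - ub I)) * (r / D None) + s3 (fun i a B => dvx i a * (G B * A B i a)).
  rewrite -EdN; have -> : s3 (fun i a B => dvx i a * (G B * A B i a)) = \sum_B G B * dut (Some B).
    rewrite /s3; under eq_bigr do rewrite exchange_big; rewrite exchange_big/=.
    apply: eq_bigr => B _; rewrite EdB mulr_sumr; apply: eq_bigr => i _; rewrite mulr_sumr.
    by apply: eq_bigr => a _; ring.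
  rewrite -(sum_option (fun K => (\sum_I h I K * (X I - ub I)) * dut K)).
  under [LHS]eq_bigr => I _ do rewrite EdD mulr_sumr.
  rewrite exchange_big; apply: eq_bigr => K _ /=; rewrite mulr_suml; apply: eq_bigr => I _.
  by rewrite (hs K I); ring.
have -> : \sum_i \sum_a dvx i a * (S i a - \sum_B D (Some B) * P B i a - \sum_B G B * A B i a) =
    \sum_i \sum_a S i a * dvx i a - s3 (fun i a B => dvx i a * (D (Some B) * P B i a)) -
    s3 (fun i a B => dvx i a * (G B * A B i a)).
  rewrite -!sumrB; apply: eq_bigr => i _; rewrite -!sumrB; apply: eq_bigr => a _.
  by rewrite !mulrBr !mulr_sumr (mulrC (S i a)).
have -> : \sum_i \sum_a \sum_B P B i a * (vb i * dDx (Some B) a + D (Some B) * dvx i a) =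
    s3 (fun i a B => P B i a * vb i * dDx (Some B) a) + s3 (fun i a B => dvx i a * (D (Some B) * P B i a)).
  by rewrite -s3D; apply: s3_ext => i a B; ring.
have -> : \sum_i \sum_a \sum_B (P B i a - A B i a) * (V i - vb i) * dDx (Some B) a =
   s3 (fun i a B => P B i a * V i * dDx (Some B) a) - s3 (fun i a B => P B i a * vb i * dDx (Some B) a) -
   s3 (fun i a B => (V i - vb i) * (A B i a * dDx (Some B) a)).
  by rewrite -!s3N -!s3D; apply: s3_ext => i a B; ring.
by ring.
Qed.

(** The products of differences are bounded by $xy\le(x^2+y^2)/2$; with $x^2\le K_3H$ and $y^2\le2H$
    this gives the factor $(K_3+2)/2$. *)
Lemma remainder_le (H K1 K2 K3 Cd src : R) (dvx str : 'I_3 -> 'I_3 -> R)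
    (pa : xidx -> 'I_3 -> 'I_3 -> R) (dV : 'I_3 -> R) (dDx : idx -> 'I_3 -> R) :
  0 <= H -> 0 <= Cd -> `|src| <= K1 * H -> (forall i a, `|dvx i a| <= Cd) -> (forall B a, `|dDx (Some B) a| <= Cd) ->
  (forall i a, `|str i a| <= K2 * H) -> (forall B i a, pa B i a ^+ 2 <= K3 * H) -> (forall i, dV i ^+ 2 <= 2 * H) ->
  src + \sum_i \sum_a dvx i a * str i a + \sum_i \sum_a \sum_B pa B i a * dV i * dDx (Some B) a <=
  (K1 + \sum_(i < 3) \sum_(a < 3) Cd * K2 + \sum_(i < 3) \sum_(a < 3) \sum_(B : xidx) (K3 + 2) / 2 * Cd) * H.
Proof.
move=> H0 C0 h1 hv hD h2 h3 h4.
rewrite [leRHS]mulrDl [X in _ <= X + _]mulrDl; apply: lerD; first apply: lerD.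
- exact: le_trans (ler_norm _) h1.
- rewrite mulr_suml; apply: ler_sum => i _; rewrite mulr_suml; apply: ler_sum => a _.
  by rewrite (le_trans (ler_norm _))// normrM -mulrA ler_pM.
rewrite mulr_suml; apply: ler_sum => i _; rewrite mulr_suml; apply: ler_sum => a _.
rewrite mulr_suml; apply: ler_sum => B _.
rewrite (le_trans (ler_norm _))// normrM (_ : (K3 + 2) / 2 * Cd * H = (K3 + 2) / 2 * H * Cd) ?ler_pM//; last by ring.
have := h3 B i a; have := h4 i; rewrite normrM.
rewrite -[pa B i a ^+ 2]real_normK ?num_real// -[dV i ^+ 2]real_normK ?num_real//.
move: `|pa B i a| `|dV i| => x y h5 h6; have := sqr_ge0 (x - y); rewrite sqrrB => h7.
by move: h5 h6 h7; rewrite -mulr_natr; move: (x ^+ 2) (y ^+ 2) (x * y) => x2 y2 xy; lra.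
Qed.

End Remainder.

(** * Uniqueness *)

Section MeasureValued.
Context {R : realType}.
Notation lebT := (measurableTypeR R).
Notation BS := (borel_state R).
Notation idx := (option xidx).
Implicit Types (z : stime R) (u ub : state R).

Let mQT (T : R) : measurable (QT T : set (lebT * lebT * lebT * lebT)%type).
Proof. exact: measurable_QT. Qed.

Lemma ae_all d (X : measurableType d) (m : {measure set X -> \bar R}) (I : countType) (P : I -> X -> Prop) :
  (forall i, {ae m, forall x, P i x}) -> {ae m, forall x, forall i, P i x}.
Proof.
move=> H; have H' n : {ae m, forall x, forall i, choice.pickle i = n -> P i x}.
  have [[i <-]|no] := pselect (exists i : I, choice.pickle i = n).
    apply: (@ae_imp _ _ _ m _ _ (H i)) => x Px j /(pcan_inj (@choice.pickleK I)) ->; exact: Px.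
  by apply: aeW => x i E; exfalso; apply: no; exists i.
by apply: (@ae_imp _ _ _ m _ _ (ae_foralln H')) => x Hx i; exact: (Hx (choice.pickle i)).
Qed.

Lemma L1_le_ae (T : R) (f g : stime R -> R) : measurable_fun (QT T) f -> L1Q T g ->
  {ae leb4, forall z, QT T z -> `|f z| <= g z} -> L1Q T f.
Proof.
move=> mf Lg fg; pose h z := Num.max (- `|g z|) (Num.min `|g z| (f z)).
have mg : measurable_fun (QT T) (fun z => `|g z|) by exact: L1_measurable (L1Q_abs Lg).
have mh : measurable_fun (QT T) h.
  by apply: measurable_maxr; [exact: measurableT_comp|exact: measurable_minr].
have Lh : L1Q T h.
  apply: (@L1_le _ _ _ leb4 (QT T) (mQT T) _ (fun z => `|g z|)) => //; first exact: L1Q_abs.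
  move=> z _; rewrite ler_norml le_max lexx/= ge_max ge_min lexx/= andbT.
  by rewrite (@le_trans _ _ 0) ?oppr_le0.
apply: (@L1_ae _ _ _ leb4 (QT T) (mQT T) h) => //.
apply: (@ae_imp _ _ _ leb4 _ _ fg) => z H Qz; rewrite /h.
have := le_trans (H Qz) (ler_norm (g z)); rewrite ler_norml => /andP[a b].
by rewrite (min_idPr b) (max_idPr a).
Qed.

Lemma avg_dirac (m : {measure set BS -> \bar R}) u f : is_dirac m u -> sdom u -> L1S m f -> avg m f = f u.
Proof.
move=> mu su Lf; have mf := L1_measurable Lf.
rewrite /avg /Rintegral (@eq_measure_integral _ _ _ _ (\d_(u : BS)) m); last by move=> A mA _; exact: mu.
rewrite (integral_dirac (u : BS) measurable_sdom); last exact/measurable_EFinP.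
by rewrite diracE mem_set// mul1e.
Qed.

(** What almost every point satisfies, gathered in one predicate so that the pointwise estimates
    carry a single exceptional set. *)
Definition good e (r rr : stime R -> R) (m : {measure set BS -> \bar R}) (U : state R) (z : stime R) : Prop :=
  [/\ m (sdom : set BS) = 1%E, (forall B, L1S m (fun u => PhiB B (sF u))) /\ (forall i, L1S m (fun u => sv u ord0 i)),
    L1S m seta /\ L1S m (energy e),
    L1S m (fun u => rr z / theta e (sPhi u)) /\ (forall i a, L1S m (fun u => stress e i a (sF u) (seta u))) &
    [/\ forall B, PhiB B (sF U) = avg m (fun u => PhiB B (sF u)),
      forall i, sv U ord0 i = avg m (fun u => sv u ord0 i), seta U = avg m seta & rr z = r z]].

Variables (e : xi_space R * R -> R) (p q rho l T : R) (r : stime R -> R).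
Variable nu : R.-pker (stime R) ~> (borel_state R).
Variables (gamma : {finite_measure set (stime R) -> \bar R}) (gamma0 : {finite_measure set (xspace R) -> \bar R}).
Variable U : stime R -> state R.
Hypothesis dm : dmv_solution e p q rho l T r nu gamma gamma0 U.

Lemma avg_integrable_L1Q h : avg_integrable T nu h -> L1Q T (fun z => avg (nu z) (h z)).
Proof. by move=> [_ H]; exact: (@L1_ext _ _ _ leb4 (QT T) (mQT T) _ _ H (fun _ _ => erefl)). Qed.

Lemma dmv_good rr : {ae leb4, forall z, QT T z -> rr z = r z} ->
  {ae leb4, forall z, QT T z -> good e r rr (nu z) (U z) z}.
Proof.
move=> aerr.
have hP := ae_all (fun B => (dmv_int_Phi dm B).1).
have hv := ae_all (fun i => (dmv_int_v dm i).1).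
have hS := ae_all (fun ia => (dmv_int_stress dm ia.1 ia.2).1).
have hE := ae_and (dmv_int_eta dm).1 (dmv_int_energy dm).1.
have hU := ae_and (ae_and (dmv_avg_Phi dm) (dmv_avg_v dm)) (ae_and (dmv_avg_eta dm) aerr).
have H := ae_and (ae_and (ae_and (dmv_sdom dm) (ae_and hP hv)) (ae_and hE (ae_and (dmv_int_source dm).1 hS))) hU.
apply: (@ae_imp _ _ _ leb4 _ _ H) => z [[[H1 [H2 H3]] [[H4 H5] [H6 H7]]] [[H8 H9] [H10 H11]]] Qz.
have rE := H11 Qz; split.
- exact: H1.
- by split=> [B|i]; [exact: H2|exact: H3].
- by split; [exact: H4|exact: H5].
- split=> [|i a]; first by rewrite rE; exact: H6.
  exact: (H7 (i, a)).
- by split=> [B|i||]; [exact: H8|exact: H9|exact: H10|].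
Qed.

Lemma dmv_PhiU_L1Q B : L1Q T (fun z => PhiB B (sF (U z))).
Proof.
have [mP _] := dmv_Phi_Lpqr dm B.
apply: (@L1_ae _ _ _ leb4 (QT T) (mQT T) _ _ (dmv_int_Phi dm B).2 mP).
by apply: (@ae_imp _ _ _ leb4 _ _ (dmv_avg_Phi dm)) => z H Qz; rewrite H.
Qed.

Lemma dmv_dPhi_L1Q B i a : L1Q T (fun z => dPhiB B i a (sF (U z))).
Proof.
apply: (L1Q_ext (f := fun z => dPhi_k B i a + \sum_C dPhi_m B i a C * PhiB C (sF (U z)))) => [|z _].
  apply: L1QD; first by apply: bndQ_L1Q; exact: bndQ_cst.
  by apply: L1Q_sum => C _; apply: L1QZ; exact: dmv_PhiU_L1Q.
by rewrite dPhiB_affine.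
Qed.

Lemma dmv_initial (u0 : xspace R -> state R) : (forall x, sdom (u0 x)) ->
  {ae leb3, forall x, cell x -> is_dirac (nu (x, 0)) (u0 x)} ->
  {ae leb3, forall x, cell x -> [/\ forall B, avg (nu (x, 0)) (fun u => PhiB B (sF u)) = PhiB B (sF (u0 x)),
    forall i, avg (nu (x, 0)) (fun u => sv u ord0 i) = sv (u0 x) ord0 i,
    avg (nu (x, 0)) seta = seta (u0 x) & avg (nu (x, 0)) (energy e) = energy e (u0 x)]}.
Proof.
move=> su dir.
have hP := ae_all (fun B => (dmv_int0_Phi dm B).1); have hv := ae_all (fun i => (dmv_int0_v dm i).1).
have H := ae_and (ae_and dir hP) (ae_and hv (ae_and (dmv_int0_eta dm).1 (dmv_int0_energy dm).1)).
apply: (@ae_imp _ _ _ leb3 _ _ H) => x [[d0 H1] [H2 [H3 H4]]] cx; have D := d0 cx.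
by split=> [B|i||]; apply: (avg_dirac D (su x)); [exact: H1|exact: H2|exact: H3|exact: H4].
Qed.

End MeasureValued.

(** * Stability with respect to the Lipschitz solution *)

Section Stability.
Context {R : realType}.
Notation BS := (borel_state R).
Notation idx := (option xidx).

Let abs_mul_le (x y v b K h : R) : (x - y) ^+ 2 <= K * h -> (v - b) ^+ 2 <= 2 * h ->
  `|x| * `|v| <= (2 * K + 4) * h + (2 * y ^+ 2 + 2 * b ^+ 2).
Proof.
move=> h1 h2.
have sq (s t : R) : s ^+ 2 <= 2 * (s - t) ^+ 2 + 2 * t ^+ 2.
  by rewrite -subr_ge0 (_ : _ - _ = (s - 2 * t) ^+ 2) ?sqr_ge0//; ring.
have xv : `|x| * `|v| <= x ^+ 2 + v ^+ 2.
  rewrite -[x ^+ 2]real_normK ?num_real// -[v ^+ 2]real_normK ?num_real//.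
  have n0 : 0 <= `|x| * `|v| by rewrite mulr_ge0.
  rewrite -subr_ge0 (_ : _ - _ = (`|x| - `|v|) ^+ 2 + `|x| * `|v|) ?addr_ge0 ?sqr_ge0//; ring.
apply: le_trans xv _; have := lerD (sq x y) (sq v b); move: h1 h2.
move: (x ^+ 2) (v ^+ 2) (y ^+ 2) (b ^+ 2) ((x - y) ^+ 2) ((v - b) ^+ 2) => q1 q2 q3 q4 q5 q6; lra.
Qed.

Variables (T : R) (r : stime R -> R) (e : xi_space R * R -> R) (c delta p q rho l c1 c2 : R).
Variables (Ubar : stime R -> state R) (Ubar0 : xspace R -> state R).
Variable nu : R.-pker (stime R) ~> (borel_state R).
Variables (gamma : {finite_measure set (stime R) -> \bar R}) (gamma0 : {finite_measure set (xspace R) -> \bar R}).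
Variable U : stime R -> state R.
Hypotheses (T0 : 0 < T) (Lr : Linf T r) (Ce : Ck_in edom 3 e) (c0 : 0 < c).
Hypothesis conv : forall z, edom z -> forall a : idx -> R,
     c * (\sum_I a I ^+ 2) <= \sum_I \sum_J a I * hess e I J z * a J.
Hypotheses (d0 : 0 < delta) (thd : forall z, edom z -> delta <= theta e z) (p4 : 4 <= p) (c10 : 0 < c1) (c20 : 0 < c2).
Hypothesis grow : forall z, edom z -> c1 * growth p q rho l z - c2 <= e z.
Hypothesis dgrow : forall z, edom z ->
     enorm (dF_e e z) `^ (p / (p - 1)) + enorm (dzeta_e e z) `^ (p / (p - 2))
       + `|dw_e e z| `^ (p / (p - 3)) <= c2 * growth p q rho l z + c2.
Hypothesis lip : lipschitz_solution e T r Ubar Ubar0.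
Hypothesis dm : dmv_solution e p q rho l T r nu gamma gamma0 U.
Hypothesis dir : {ae leb3, forall x, cell x -> is_dirac (nu (x, 0)) (Ubar0 x)}.
Hypothesis g0 : gamma0 cell = 0%E.

Section WeakDerivatives.
Variables (sg : R) (dF : 'I_3 -> 'I_3 -> option 'I_3 -> stime R -> R) (dv : 'I_3 -> option 'I_3 -> stime R -> R).
Variables (deta : option 'I_3 -> stime R -> R) (rr : stime R -> R).
Hypotheses (brr : bndQ T rr) (aerr : {ae leb4, forall z, QT T z -> rr z = r z}).
Hypothesis ubox : forall z, 0 <= z.2 <= T -> inbox (pbox sg) (fun=> sg) (ubar Ubar z).
Hypothesis LF : forall i a, Lw T (fun z => sF (Ubar z) i a) (dF i a).
Hypothesis Lv : forall i, Lw T (fun z => sv (Ubar z) ord0 i) (dv i).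
Hypothesis Lub : forall I, Lw T (fun z => ubar Ubar z I) (dub Ubar dF deta I).
Hypothesis LD : forall I, Lw T (fun z => Dc e I (ubar Ubar z)) (dDb e Ubar dF deta I).
Hypothesis LdPhi : forall B i a, Lw T (fun z => dPhiB B i a (sF (Ubar z))) (dPhi_d Ubar dF B i a).
Hypothesis dFt : forall i a z, dF i a None z = dv i (Some a) z.
Hypothesis dFs : forall i a b z, dF i b (Some a) z = dF i a (Some b) z.
Hypothesis detat : forall z, deta None z = rr z / Dc e None (ubar Ubar z).
Hypothesis dvt : forall i z,
  dv i None z = \sum_a \sum_B dPhiB B i a (sF (Ubar z)) * dDb e Ubar dF deta (Some B) (Some a) z.

Notation J := ('I_3 + idx)%type.
Notation dD I d z := (dDb e Ubar dF deta I d z).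
Notation D I z := (Dc e I (ubar Ubar z)).
Notation vb i z := (sv (Ubar z) ord0 i).
Notation V i z := (sv (U z) ord0 i).
Notation P B i a z := (dPhiB B i a (sF (U z))).

(** All tested laws form one family: momentum, with multiplier [vb i], and the laws of the minors
    and of the entropy, with multipliers the derivatives [D I] of the energy. *)
Let f (j : J) z : R := match j with
  | inl i => avg (nu z) (fun u => sv u ord0 i)
  | inr K => if K is Some B then PhiB B (sF (U z)) else avg (nu z) seta end.
Let f0 (j : J) x : R := match j with
  | inl i => avg (nu (x, 0)) (fun u => sv u ord0 i)
  | inr K => if K is Some B then avg (nu (x, 0)) (fun u => PhiB B (sF u)) else avg (nu (x, 0)) seta end.
Let w (j : J) z : R := match j with inl i => vb i z | inr K => D K z end.
Let dw (j : J) k z : R := match j with inl i => dv i k z | inr K => dD K k z end.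
Let g (j : J) a z : R := match j with
  | inl i => avg (nu z) (fun u => stress e i a (sF u) (seta u))
  | inr K => if K is Some B then \sum_i P B i a z * V i z else 0 end.
Let s (j : J) z : R := match j with
  | inl i => 0
  | inr K => if K is Some B then 0 else avg (nu z) (fun u => r z / theta e (sPhi u)) end.
(** The part of the relative energy that depends on [Ubar] alone. *)
Let L z := 2^-1 * (\sum_i vb i z * vb i z) - Ec e (ubar Ubar z) + \sum_I D I z * ubar Ubar z I.
Let dL k z := \sum_i vb i z * dv i k z + \sum_I dD I k z * ubar Ubar z I.
(** Minus the contraction of [dPhiB] at the averaged gradient with the spatial gradient of
    [D_B vb_i]. Its weighted integral is zero, so it may be added to [Q], where it removes what is
    not quadratic. *)
Let N z := - \sum_i \sum_a \sum_B P B i a z * (vb i z * dD (Some B) (Some a) z + D (Some B) z * dv i (Some a) z).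
Let EE z := avg (nu z) (energy e).
Let H z := EE z - \sum_j w j z * f j z + L z.
Let Q z := rr z + dL None z - \sum_j (f j z * dw j None z - \sum_a g j a z * dw j (Some a) z + s j z * w j z) + N z.

Let sdomU z : QT T z -> sdom (Ubar z). Proof. by move=> [_ zT]; exact: (lip_sdom lip). Qed.

(** As in a Legendre transform, the derivative of the energy cancels the sum of [D I] times the
    derivative of [ubar I]; only the terms with a derivative on [D I] remain. *)
Let LwL : Lw T L dL.
Proof.
have [C [cE _ _ _]] := energy_C11 Ce sg.
have L1 := LwZ 2^-1 T0 (Lw_sum T0 (fun i => LwM T0 (Lv i) (Lv i))).
have L2 := Lw_comp T0 cE Lub ubox.
have L3 := Lw_sum T0 (fun I => LwM T0 (LD I) (Lub I)).
apply: (Lw_ext (LwD T0 (LwB T0 L1 L2) L3)) => k z _; rewrite /dL/=.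
have -> : 2^-1 * \sum_i (vb i z * dv i k z + vb i z * dv i k z) = \sum_i vb i z * dv i k z.
  by rewrite mulr_sumr; apply: eq_bigr => i _; field.
by rewrite big_split/=; under [X in _ + (X + _)]eq_bigr do rewrite mulrC; rewrite addrA addrAC subrK addrC.
Qed.

Let Lww j : Lw T (w j) (dw j). Proof. by case: j => [i|I]; [exact: Lv|exact: LD]. Qed.

Let Lf j : L1Q T (f j).
Proof.
case: j => [i|[B|]]; [exact: (avg_integrable_L1Q (dmv_int_v dm i))|exact: (dmv_PhiU_L1Q dm)|exact: (avg_integrable_L1Q (dmv_int_eta dm))].
Qed.

Let LEE : L1Q T EE. Proof. exact: (avg_integrable_L1Q (dmv_int_energy dm)). Qed.

Let LH : L1Q T H.
Proof.
apply: L1QD; last by apply: bndQ_L1Q; exact: Lw_bndQ LwL.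
by apply: L1QB => //; apply: L1Q_sum => j _; apply: L1Q_bndM => //; exact: Lw_bndQ T0 (Lww j).
Qed.

Let LN : L1Q T N.
Proof.
apply: L1QN; do 3 (apply: L1Q_sum => ? _); apply: L1Q_Mbnd; first exact: (dmv_dPhi_L1Q dm).
by apply: bndQD; apply: bndQM; [exact: Lw_bndQ (Lv _)|exact: Lw_bndQ_deriv (LD _)|
  exact: Lw_bndQ (LD _)|exact: Lw_bndQ_deriv (Lv _)].
Qed.

(** [H] is built from the moments occurring in the laws, which makes it integrable at once; at a
    good point it is the averaged relative energy. *)
Let HE z : QT T z -> good e r rr (nu z) (U z) z -> H z = avg (nu z) (RE e (Ubar z)).
Proof.
move=> Qz [m1 [LP Lvm] [Leta Len] _ [EP _ _ _]].
rewrite (avg_RE m1 (Ubar z) LP Lvm Leta Len) /H /L big_sumType/=.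
have -> : \sum_I D I z * (if I is Some B then PhiB B (sF (U z)) else avg (nu z) seta) =
    \sum_I Dc e I (xs (Ubar z)) * avg (nu z) (fun u => xs u I).
  by apply: eq_bigr => -[B|] _ //; rewrite EP.
have -> : \sum_i vb i z * vb i z = \sum_i vb i z ^+ 2 by apply: eq_bigr => i _; rewrite expr2.
rewrite /EE /ubar /xs; ring.
Qed.

Hypothesis aegood : {ae leb4, forall z, QT T z -> good e r rr (nu z) (U z) z}.

Let K3 : R := \sum_(x : xidx * 'I_3 * 'I_3)
  #|{: xidx}|%:R * (\sum_C dPhi_m x.1.1 x.1.2 x.2 C ^+ 2) * (2 / c).

Let P_sqr_le z B i a : QT T z -> good e r rr (nu z) (U z) z ->
  (P B i a z - dPhiB B i a (sF (Ubar z))) ^+ 2 <= K3 * H z.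
Proof.
move=> Qz gz; have [m1 [LP Lvm] [Leta Len] _ [EP _ _ _]] := gz.
have su := sdomU Qz; have H0 := avg_RE_ge0 m1 Ce c0 su conv LP Lvm Leta Len.
rewrite (HE Qz gz); apply: le_trans (dPhi_sqr_le m1 Ce c0 su conv LP Lvm Leta Len EP B i a) _.
apply: (ler_wpM2r H0).
apply: (@sum_ge1 R _ (fun x : xidx * 'I_3 * 'I_3 =>
  #|{: xidx}|%:R * (\sum_C dPhi_m x.1.1 x.1.2 x.2 C ^+ 2) * (2 / c)) (B, i, a)) => x.
rewrite mulr_ge0 ?divr_ge0 ?(ltW c0)// mulr_ge0//.
by apply: sumr_ge0 => C _; exact: sqr_ge0.
Qed.

Let V_sqr_le z i : QT T z -> good e r rr (nu z) (U z) z -> (V i z - vb i z) ^+ 2 <= 2 * H z.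
Proof.
move=> Qz gz; have [m1 [LP Lvm] [Leta Len] _ [_ EV _ _]] := gz.
rewrite (HE Qz gz) EV; exact: (v_sqr_le m1 Ce c0 (sdomU Qz) conv LP Lvm Leta Len).
Qed.

Let H_ge0 z : QT T z -> good e r rr (nu z) (U z) z -> 0 <= H z.
Proof.
move=> Qz gz; have [m1 [LP Lvm] [Leta Len] _ _] := gz.
by rewrite (HE Qz gz); exact: (avg_RE_ge0 m1 Ce c0 (sdomU Qz) conv LP Lvm Leta Len).
Qed.

(** Integrability of the flux is derived here: both factors differ from bounded reference fields by
    quantities whose squares are at most multiples of [H], so their product is dominated by an
    integrable function. *)
Let Lflux B a : L1Q T (fun z => \sum_i P B i a z * V i z).
Proof.
apply: L1Q_sum => i _.
pose G z := (2 * K3 + 4) * H z + (2 * dPhiB B i a (sF (Ubar z)) ^+ 2 + 2 * vb i z ^+ 2).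
have LG : L1Q T G.
  apply: L1QD; first exact: L1QZ.
  have bA := Lw_bndQ T0 (LdPhi B i a); have bv := Lw_bndQ T0 (Lv i).
  by apply: bndQ_L1Q; apply: bndQD; apply: bndQZ; [exact: (bndQM bA bA)|exact: (bndQM bv bv)].
have mP := L1_measurable (dmv_dPhi_L1Q dm B i a); have [mV _] := dmv_v_L2 dm i.
apply: (L1_le_ae (measurable_funM mP mV) LG).
apply: (@ae_imp _ _ _ leb4 _ _ aegood) => z gz Qz.
have h1 := P_sqr_le B i a Qz (gz Qz); have h2 := V_sqr_le i Qz (gz Qz).
by rewrite normrM; exact: abs_mul_le h1 h2.
Qed.

Let Lg j a : L1Q T (g j a).
Proof.
case: j => [i|[B|]]; [exact: (avg_integrable_L1Q (dmv_int_stress dm i a))|exact: Lflux|].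
by apply: bndQ_L1Q; exact: bndQ_cst.
Qed.

Let Ls j : L1Q T (s j).
Proof.
case: j => [i|[B|]]; [by apply: bndQ_L1Q; exact: bndQ_cst|by apply: bndQ_L1Q; exact: bndQ_cst|].
exact: (avg_integrable_L1Q (dmv_int_source dm)).
Qed.

Let avg_integrable0_L1C h : avg_integrable0 nu h -> L1C (fun x => avg (nu (x, 0)) h).
Proof. by move=> [_ h1]; exact: (@L1_ext _ _ _ leb3 cell (@measurable_cell R) _ _ h1 (fun _ _ => erefl)). Qed.

Let Lf0 j : L1C (f0 j).
Proof.
case: j => [i|[B|]]; [exact: (avg_integrable0_L1C (dmv_int0_v dm i))|
  exact: (avg_integrable0_L1C (dmv_int0_Phi dm B))|exact: (avg_integrable0_L1C (dmv_int0_eta dm))].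
Qed.

Let bal j : balance_Sm T (f0 j) (f j) (g j) (s j).
Proof.
apply: balance_law_init_Sm.
case: j => [i|[B|]]; [exact: (dmv_momentum_eq dm)|exact: (dmv_Phi_eq dm)|exact: (dmv_entropy_eq dm)].
Qed.

Let initial := dmv_initial dm (fun x => eq_ind _ sdom (lip_sdom lip (z := (x, 0)) (introT andP (conj (lexx _) (ltW T0)))) _ (lip_init lip x)) dir.

Let init : {ae leb3, forall x, cell x -> avg (nu (x, 0)) (energy e) = \sum_j f0 j x * w j (x, 0) - L (x, 0)}.
Proof.
apply: (@ae_imp _ _ _ leb3 _ _ initial) => x E cx; have [EP EV Eeta ->] := E cx.
rewrite big_sumType/= /L.
rewrite (eq_bigr (fun i => vb i (x, 0) * vb i (x, 0))) => [|i _]; last by rewrite EV (lip_init lip).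
rewrite [X in _ + X - _](eq_bigr (fun I => D I (x, 0) * ubar Ubar (x, 0) I)) => [|I _]; last first.
  by rewrite mulrC /ubar (lip_init lip); congr (_ * _); case: I => [B|].
rewrite /energy enorm_sqr /Ec /ubar xcK (lip_init lip).
have -> : \sum_i sv (Ubar0 x) ord0 i ^+ 2 = \sum_i sv (Ubar0 x) ord0 i * sv (Ubar0 x) ord0 i.
  by apply: eq_bigr => i _; rewrite expr2.
by field.
Qed.

(** For each [B] and [i] the null Lagrangian identity is applied with multiplier [D_B vb_i], a
    product of Lipschitz functions whose spatial gradient is the factor appearing in [N]. The Dirac
    initial data identify the initial minors with those of [Ubar]. *)
Let null phi : smooth1 phi -> (exists2 T', T' < T & forall t, T' <= t -> phi t = 0) ->
  intQ T (fun z => phi z.2 * N z) = 0.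
Proof.
move=> sphi zphi; have bp := Sm_bndQ T (Sm_time sphi).
pose nt B i a z := (vb i z * dD (Some B) (Some a) z + D (Some B) z * dv i (Some a) z) * (phi z.2 * P B i a z).
have Lw_ B i := LwM T0 (LD (Some B)) (Lv i).
have Lnt B i a : L1Q T (nt B i a).
  apply: L1Q_bndM; first exact: (Lw_bndQ_deriv (Some a) (Lw_ B i)).
  by apply: L1Q_bndM => //; exact: (dmv_dPhi_L1Q dm).
have sym z : QT T z -> forall j a b, dF j b (Some a) z = dF j a (Some b) z by move=> _ j a b; exact: dFs.
have law C : balance_law T (fun z => PhiB C (\matrix_(j, b) sF (Ubar z) j b))
    (fun a z => \sum_j dPhiB C j a (\matrix_(j, b) sF (Ubar z) j b) * vb j z) (fun=> 0).
  have e1 : (fun z => PhiB C (\matrix_(j, b) sF (Ubar z) j b)) = (fun z => PhiB C (sF (Ubar z))).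
    by apply/funext => z; rewrite matrix_sF.
  have e2 : (fun (a : 'I_3) z => \sum_j dPhiB C j a (\matrix_(j, b) sF (Ubar z) j b) * vb j z) =
      (fun a z => \sum_j dPhiB C j a (sF (Ubar z)) * vb j z).
    by apply/funext => a; apply/funext => z; rewrite matrix_sF.
  rewrite e1 e2; exact: (lip_Phi_eq lip C).
have bal0 C : balance_Sm T (fun x => PhiB C (\matrix_(j, b) sF (Ubar (x, 0)) j b)) (fun z => PhiB C (sF (U z)))
    (fun a z => \sum_j dPhiB C j a (sF (U z)) * V j z) (fun=> 0).
  move=> psi ipsi; have [spsi _] := ipsi.
  apply: etrans (bal (inr (Some C)) ipsi); congr (_ + _).
  have bpsi := Sm_bndC T0 spsi.
  have bF : bndC (fun x => PhiB C (\matrix_(j, b) sF (Ubar (x, 0)) j b)).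
    have [lC _ _] := Lub (Some C).
    by have := lipQ_bndC T0 lC; congr bndC; apply/funext => x; rewrite matrix_sF.
  apply: (@int_ae _ _ _ leb3 cell (@measurable_cell R)).
  - exact: L1_measurable (L1C_Mbnd (bndC_L1C bF) bpsi).
  - exact: L1_measurable (L1C_Mbnd (Lf0 (inr (Some C))) bpsi).
  apply: (@ae_imp _ _ _ leb3 _ _ initial) => x E cx; have [EP _ _ _] := E cx.
  by rewrite matrix_sF (lip_init lip) /f0 EP.
have nt0 B i : \sum_a intQ T (nt B i a) = 0.
  exact: (null_lagrangian T0 LF Lv sym law (dmv_PhiU_L1Q dm) Lflux bal0 B i sphi zphi (Lw_ B i)).
have -> : intQ T (fun z => phi z.2 * N z) = - \sum_i \sum_B \sum_a intQ T (nt B i a).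
  have LB i B : L1Q T (fun z => \sum_a nt B i a z) by apply: L1Q_sum => a _; exact: Lnt.
  have LI i : L1Q T (fun z => \sum_B \sum_a nt B i a z) by apply: L1Q_sum => B _; exact: LB.
  under eq_bigr => i _ do under eq_bigr => B _ do rewrite -intQ_sum//.
  under eq_bigr => i _ do rewrite -intQ_sum//.
  rewrite -intQ_sum// -intQN; last by apply: L1Q_sum => i _; exact: LI.
  apply: intQ_ext => z _; rewrite /N mulrN; congr (- _); rewrite mulr_sumr; apply: eq_bigr => i _.
  rewrite exchange_big mulr_sumr; apply: eq_bigr => B _; rewrite mulr_sumr; apply: eq_bigr => a _.
  by rewrite /nt; ring.
by rewrite big1 ?oppr0// => i _; rewrite big1.
Qed.

Let LQ : L1Q T Q.
Proof.
apply: L1QD => //; apply: L1QB.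
  by apply: L1QD; apply: bndQ_L1Q => //; exact: Lw_bndQ_deriv LwL.
apply: L1Q_sum => j _; have bdw k := Lw_bndQ_deriv k (Lww j); have bw := Lw_bndQ T0 (Lww j).
apply: L1QD; last exact: L1Q_Mbnd.
by apply: L1QB; [exact: L1Q_Mbnd|apply: L1Q_sum => a _; exact: L1Q_Mbnd].
Qed.

Notation X I z := (avg (nu z) (fun u => xs u I)).
Notation A B i a z := (dPhiB B i a (sF (Ubar z))).
Notation src z := (avg (nu z) (fun u => rr z / theta e (sPhi u))).
Notation Sg i a z := (avg (nu z) (fun u => stress e i a (sF u) (seta u))).

Let Q_split z : QT T z -> good e r rr (nu z) (U z) z ->
  Q z = (rr z - D None z * src z - (\sum_I Hc e I None (ubar Ubar z) * (X I z - ubar Ubar z I)) * (rr z / D None z)) +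
  \sum_i \sum_a dv i (Some a) z * (Sg i a z - \sum_B D (Some B) z * P B i a z -
     \sum_B (\sum_I Hc e I (Some B) (ubar Ubar z) * (X I z - ubar Ubar z I)) * A B i a z) +
  \sum_i \sum_a \sum_B (P B i a z - A B i a z) * (V i z - vb i z) * dD (Some B) (Some a) z.
Proof.
move=> Qz [m1 [LP Lvm] [Leta Len] _ [EP EV Eeta Er]].
have hs I K : Hc e I K (ubar Ubar z) = Hc e K I (ubar Ubar z) by apply: Hc_sym => //; exact: (sdomU Qz).
have EB B : dub Ubar dF deta (Some B) None z = \sum_i \sum_a A B i a z * dv i (Some a) z.
  by do 2 (apply: eq_bigr => ? _); rewrite dFt.
have split := @remainder_split R (rr z) (src z) (fun i => V i z) (fun i => vb i z) (fun i => dv i None z)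
  (fun i a => dv i (Some a) z) (fun i a => Sg i a z) (fun B i a => P B i a z) (fun B i a => A B i a z) (fun I => D I z) (fun I => X I z) (ubar Ubar z)
  (fun I => dD I None z) (fun I => dub Ubar dF deta I None z) (fun I a => dD I (Some a) z)
  (fun I K => Hc e I K (ubar Ubar z)) (fun i => dvt i z) (fun I => erefl) hs EB (detat z).
apply: etrans split; rewrite /Q /dL /N big_sumType/=; congr (_ + _ - (_ + _) + _).
  by apply: eq_bigr => i _; rewrite -EV.
by apply: eq_bigr => -[B|] _; rewrite ?EP ?Er.
Qed.

Let Q_le : exists K, forall z, QT T z -> good e r rr (nu z) (U z) z -> Q z <= K * H z.
Proof.
have thd' (a : idx -> R) : 0 <= a None -> delta <= Dc e None a by move=> a0; apply: thd.
have [K1 K10 HK1] := source_taylor Ce sg d0 thd'.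
have [K2 K20 HK2] := stress_taylor Ce c0 c10 c20 p4 conv grow dgrow sg.
have [_ [Cr Cr0 HCr]] := brr.
have /choice[Cv HCv] (ia : 'I_3 * 'I_3) : exists C, 0 <= C /\ forall z, QT T z -> `|dv ia.1 (Some ia.2) z| <= C.
  by have [_ [C C0' HC]] := Lw_bndQ_deriv (Some ia.2) (Lv ia.1); exists C.
have /choice[CD HCD] (Ba : xidx * 'I_3) : exists C, 0 <= C /\ forall z, QT T z -> `|dD (Some Ba.1) (Some Ba.2) z| <= C.
  by have [_ [C C0' HC]] := Lw_bndQ_deriv (Some Ba.2) (LD (Some Ba.1)); exists C.
pose Cd := \sum_ia Cv ia + \sum_Ba CD Ba.
have sv0 : 0 <= \sum_ia Cv ia by apply: sumr_ge0 => ia _; case: (HCv ia).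
have sD0 : 0 <= \sum_Ba CD Ba by apply: sumr_ge0 => Ba _; case: (HCD Ba).
exists (Cr * (K1 * (2 / c)) + \sum_(i < 3) \sum_(a < 3) Cd * K2 +
  \sum_(i < 3) \sum_(a < 3) \sum_(B : xidx) (K3 + 2) / 2 * Cd) => z Qz gz.
rewrite (Q_split Qz gz); have H0 := H_ge0 Qz gz.
have [m1 [LP Lvm] [Leta Len] [Lsrc LS] [EP EV Eeta Er]] := gz.
have zT : 0 <= z.2 <= T by case: Qz.
have su := sdomU Qz.
apply: (@remainder_le R (H z) (Cr * (K1 * (2 / c))) K2 K3 Cd _ (fun i a => dv i (Some a) z)
  (fun i a => Sg i a z - \sum_B D (Some B) z * P B i a z -
     \sum_B (\sum_I Hc e I (Some B) (ubar Ubar z) * (X I z - ubar Ubar z I)) * A B i a z)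
  (fun B i a => P B i a z - A B i a z) (fun i => V i z - vb i z) (fun I a => dD I (Some a) z) H0).
- by rewrite addr_ge0.
- apply: le_trans (source_le m1 Ce c0 su conv LP Lvm Leta Len K10 HK1 (ubox zT) d0 (thd' _ su) Lsrc) _.
  rewrite -(HE Qz gz) ler_wpM2r// ler_wpM2r ?HCr// mulr_ge0// divr_ge0// ltW//.
- move=> i a; have [_ HC] := HCv (i, a); apply: le_trans (HC z Qz) _.
  rewrite -[leLHS]addr0 lerD//; apply: (@sum_ge1 R _ Cv (i, a)) => ia; by case: (HCv ia).
- move=> B a; have [_ HC] := HCD (B, a); apply: le_trans (HC z Qz) _.
  rewrite -[leLHS]add0r lerD//; apply: (@sum_ge1 R _ CD (B, a)) => Ba; by case: (HCD Ba).
- move=> i a; rewrite (HE Qz gz).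
  exact: (stress_le m1 LP Lvm Leta Len EP K20 HK2 (ubox zT) (LS i a)).
- by move=> B i a; exact: P_sqr_le.
- by move=> i; exact: V_sqr_le.
Qed.

Lemma relative_energy_eq0 : {ae leb4, forall z, QT T z -> avg (nu z) (RE e (Ubar z)) = 0}.
Proof.
have [K HK] := Q_le.
have aeH0 : {ae leb4, forall z, QT T z -> 0 <= H z}.
  by apply: (@ae_imp _ _ _ leb4 _ _ aegood) => z gz Qz; exact: (H_ge0 Qz (gz Qz)).
have aeQ : {ae leb4, forall z, QT T z -> Q z <= K * H z}.
  by apply: (@ae_imp _ _ _ leb4 _ _ aegood) => z gz Qz; exact: (HK z Qz (gz Qz)).
have LE0 := avg_integrable0_L1C (dmv_int0_energy dm).
have test phi phi' : decay T phi phi' -> - intQ T (fun z => phi' z.2 * H z) <= intQ T (fun z => phi z.2 * Q z).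
  move=> dec; have [sphi _ _ _ zphi] := dec.
  exact: (relative_energy T0 dec LE0 LEE (bndQ_L1Q brr) Lf0 Lf Lg Ls bal Lww LwL LN init
    (energy_decay T0 LE0 Lr brr aerr g0 (dmv_energy_ineq dm) dec) (null sphi zphi)).
have Z := gronwall_zero T0 LH LQ aeH0 aeQ test.
apply: (@ae_imp _ _ _ leb4 _ _ (ae_and Z aegood)) => z [Hz gz] Qz.
by rewrite -(HE Qz (gz Qz)) Hz.
Qed.

End WeakDerivatives.
End Stability.

Theorem theorem9 (R : realType) (T : R) (r : stime R -> R)
    (e : xi_space R * R -> R) (c delta p q rho l c1 c2 M : R)
    (Ubar : stime R -> state R) (Ubar0 U0 : xspace R -> state R)
    (nu : R.-pker (stime R) ~> (borel_state R))
    (gamma : {finite_measure set (stime R) -> \bar R})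
    (gamma0 : {finite_measure set (xspace R) -> \bar R})
    (U : stime R -> state R) :
  0 < T ->
  Linf T r ->
  Ck_in edom 3 e ->
  0 < c ->
  (forall z, edom z -> forall a : option xidx -> R,
     c * (\sum_I a I ^+ 2) <= \sum_I \sum_J a I * hess e I J z * a J) ->
  0 < delta ->
  (forall z, edom z -> delta <= theta e z) ->
  4 <= p -> 2 <= q -> 1 < rho -> 1 < l ->
  0 < c1 -> 0 < c2 ->
  (forall z, edom z ->
     c1 * growth p q rho l z - c2 <= e z <= c2 * growth p q rho l z + c2) ->
  (forall eps, 0 < eps -> exists K, forall z, edom z ->
     K < growth p q rho l z -> `|theta e z / growth p q rho l z| < eps) ->
  (forall z, edom z ->
     enorm (dF_e e z) `^ (p / (p - 1)) + enorm (dzeta_e e z) `^ (p / (p - 2))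
       + `|dw_e e z| `^ (p / (p - 3)) <= c2 * growth p q rho l z + c2) ->
  lipschitz_solution e T r Ubar Ubar0 ->
  0 < M ->
  (forall z, QT T z -> [/\ enorm (sF (Ubar z)) <= M,
     enorm (sv (Ubar z)) <= M & `|seta (Ubar z)| <= M]) ->
  dmv_solution e p q rho l T r nu gamma gamma0 U ->
  {ae leb3, forall x, cell x -> is_dirac (nu (x, 0)) (U0 x)} ->
  (forall A, measurable A -> A `<=` cell -> gamma0 A = 0%E) ->
  {ae leb3, forall x, cell x -> U0 x = Ubar0 x} ->
  {ae leb4, forall z, QT T z -> is_dirac (nu z) (Ubar z)} /\
  {ae leb4, forall z, QT T z -> U z = Ubar z}.
Proof.
move=> T0 Lr Ce c0 conv d0 thd p4 q2 rho1 l1 c10 c20 grow _ dgrow lip M0 _ dm dir gam0 initE.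
have grow1 z : edom z -> c1 * growth p q rho l z - c2 <= e z by move=> /grow /andP[].
have [sg [dF [dv [deta [rr [[[brr aerr] ubox] [LF Lv _ Lub LD] LdPhi [dFt dFs] [detat dvt]]]]]]] :=
  Ubar_weak T0 Lr Ce d0 thd lip.
have dir' : {ae leb3, forall x, cell x -> is_dirac (nu (x, 0)) (Ubar0 x)}.
  by apply: (@ae_imp _ _ _ leb3 _ _ (ae_and dir initE)) => x [dx ix] cx; rewrite -(ix cx); exact: dx.
have g0 : gamma0 cell = 0%E by apply: gam0 => //; exact: measurable_cell.
have gd := dmv_good dm aerr.
have Z := relative_energy_eq0 T0 Lr Ce c0 conv d0 thd p4 c10 c20 grow1 dgrow lip dm dir' g0 brr aerr ubox
  LF Lv Lub LD LdPhi dFt dFs detat dvt gd.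
have ZG := ae_and (ae_and Z gd) (ae_and (dmv_avg_F dm) (dmv_avg_v dm)).
split; apply: (@ae_imp _ _ _ leb4 _ _ ZG) => z [[Hz gz] [HF Hv]] Qz;
  have [m1 [LP Lvm] [Leta Len] _ [EP EV Eeta _]] := gz Qz;
  have su : sdom (Ubar z) by case: Qz => _ zT; exact: (lip_sdom lip).
  apply: (dirac_of_avg_RE m1 Ce c0 su conv LP Lvm Leta Len); last by rewrite (Hz Qz).
  exact: prob_kernel.
(* The Jensen estimates, with zero relative energy on the right, identify each averaged component
   with that of [Ubar]. *)
have sq0 (x y K : R) : (x - y) ^+ 2 <= K * 0 -> x = y.
  by rewrite mulr0 => h; apply/eqP; rewrite -subr_eq0 -sqrf_eq0 eq_le h sqr_ge0.
have HX I := X_sqr_le m1 Ce c0 su conv LP Lvm Leta Len I.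
have HV i := v_sqr_le m1 Ce c0 su conv LP Lvm Leta Len i.
rewrite (Hz Qz) in HX HV.
rewrite [U z]surjective_pairing [(U z).1]surjective_pairing [Ubar z]surjective_pairing [(Ubar z).1]surjective_pairing.
congr (_, _, _).
- apply/matrixP => i j; apply: etrans (HF Qz i j) _; exact: (sq0 _ _ _ (HX (Some (inl (inl (i, j)))))).
- apply/matrixP => i j; rewrite (ord1 i); apply: etrans (Hv Qz j) _; exact: (sq0 _ _ _ (HV j)).
- by apply: etrans Eeta _; exact: (sq0 _ _ _ (HX None)).
Qed.
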